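(* Suppose $J_1=J_2>0$. Then for each $\delta>0$ there are constants $c=c(\delta)>0$ and $\beta_0=\beta_0(\delta)<\infty$ such that for each $\beta\ge\beta_0$ and each spin magnitude $\mathcal S\ge c\beta^2$, if the even integer $N$ is sufficiently large then for all $\boldsymbol r,\boldsymbol r'\in\mathbb T_N$: $$\mathcal S^{-4}\bigl\langle[\hat S^\alpha_{\boldsymbol r}]^2[\hat S^\alpha_{\boldsymbol r'}]^2\bigr\rangle_{N,\beta}\ge\tfrac12-\delta,\quad\alpha=x,z,$$ $$\mathcal S^{-4}\bigl\langle[\hat S^y_{\boldsymbol r}]^2[\hat S^y_{\boldsymbol r'}]^2\bigr\rangle_{N,\beta}<\delta,\qquad \mathcal S^{-4}\bigl|\bigl\langle[\hat S^x_{\boldsymbol r}]^2[\hat S^z_{\boldsymbol r'}]^2\bigr\rangle_{N,\beta}\bigr|<\delta.$$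
   Context: Let $\mathcal S\in\{\frac12,1,\frac32,\dots\}$. On each site $\boldsymbol r$ of the torus $\mathbb T_N=(\mathbb Z/N\mathbb Z)^2$ ($N$ even) put a copy of $\mathbb C^{2\mathcal S+1}$ with basis $|M\rangle$, $M=-\mathcal S,\dots,\mathcal S$; the Hilbert space is the tensor product. Single-site operators act by $\hat S^z|M\rangle=M|M\rangle$, $\hat S^{\pm}|M\rangle=\sqrt{\mathcal S(\mathcal S+1)-M(M\pm1)}\,|M\pm1\rangle$, and $\hat S^x=\frac12(\hat S^++\hat S^-)$, $\hat S^y=\frac1{2i}(\hat S^+-\hat S^-)$; $\hat S^\alpha_{\boldsymbol r}$ denotes the operator acting at site $\boldsymbol r$. Edge types: the horizontal edge $\langle \boldsymbol r,\boldsymbol r+\boldsymbol e_1\rangle$ is an $x$-edge if $r_1$ is even and a $z$-edge otherwise; the vertical edge $\langle\boldsymbol r,\boldsymbol r+\boldsymbol e_2\rangle$ is an $x$-edge if $r_2$ is even and a $z$-edge otherwise. The Hamiltonian is $\hat{\mathcal H}_N=-J_1\mathcal S^{-2}\sum_{x\text{-edges}}\hat S^x_{\boldsymbol r}\hat S^x_{\boldsymbol r'}-J_2\mathcal S^{-2}\sum_{z\text{-edges}}\hat S^z_{\boldsymbol r}\hat S^z_{\boldsymbol r'}$, and $\langle\hat A\rangle_{N,\beta}=\mathrm{Tr}(\hat A e^{-\beta\hat{\mathcal H}_N})/\mathrm{Tr}(e^{-\beta\hat{\mathcal H}_N})$. *)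

(* Defs.v *)
From HB Require Import structures.
From mathcomp Require Import all_boot all_order all_algebra.
From mathcomp Require Import all_classical all_reals all_analysis.
Import Order.TTheory GRing.Theory Num.Theory.
Local Open Scope ring_scope.

(* Operators on the finite-dimensional space R^T (basis indexed by T : finType)
   are represented by their matrix elements  A x y = <x|A|y>. *)
Definition opadd {R : nzRingType} {T : finType} (A B : T -> T -> R) : T -> T -> R :=
  fun x y => A x y + B x y.
Definition opscale {R : nzRingType} {T : finType} (a : R) (A : T -> T -> R) : T -> T -> R :=
  fun x y => a * A x y.
Definition opmul {R : nzRingType} {T : finType} (A B : T -> T -> R) : T -> T -> R :=
  fun x y => \sum_(z : T) A x z * B z y.
Definition opid {R : nzRingType} {T : finType} : T -> T -> R :=
  fun x y => (x == y)%:R.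
Definition oppow {R : nzRingType} {T : finType} (A : T -> T -> R) (k : nat) : T -> T -> R :=
  iter k (opmul A) opid.
Definition optr {R : nzRingType} {T : finType} (A : T -> T -> R) : R :=
  \sum_(x : T) A x x.
Definition opexp {R : realType} {T : finType} (A : T -> T -> R) : T -> T -> R :=
  fun x y => limn (fun m : nat => \sum_(k < m) oppow A k x y / (k`!)%:R).

(* Single-site spin operators.  n = 2S, basis |M>, M = a - S for a : 'I_n.+1. *)
Definition spinS (R : realType) (n : nat) : R := n%:R / 2.
Definition Mval (R : realType) {n : nat} (a : 'I_n.+1) : R := a%:R - spinS R n.
Definition Szloc (R : realType) (n : nat) : 'I_n.+1 -> 'I_n.+1 -> R :=
  fun a b => if a == b then Mval R b else 0.
Definition Splusloc (R : realType) (n : nat) : 'I_n.+1 -> 'I_n.+1 -> R :=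
  fun a b => if (a : nat) == b.+1 then
      Num.sqrt (spinS R n * (spinS R n + 1) - Mval R b * (Mval R b + 1)) else 0.
Definition Sminusloc (R : realType) (n : nat) : 'I_n.+1 -> 'I_n.+1 -> R :=
  fun a b => if (b : nat) == a.+1 then
      Num.sqrt (spinS R n * (spinS R n + 1) - Mval R b * (Mval R b - 1)) else 0.
Definition Sxloc (R : realType) (n : nat) : 'I_n.+1 -> 'I_n.+1 -> R :=
  opscale (2^-1) (opadd (Splusloc R n) (Sminusloc R n)).
(* i S^y = (S^+ - S^-)/2  (a real matrix); hence [S^y]^2 = - (i S^y)^2 *)
Definition iSyloc (R : realType) (n : nat) : 'I_n.+1 -> 'I_n.+1 -> R :=
  opscale (2^-1) (opadd (Splusloc R n) (opscale (-1) (Sminusloc R n))).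

(* Torus T_N = (Z/NZ)^2 and the tensor-product basis (spin configurations). *)
Definition site (N : nat) : finType := ('I_N * 'I_N)%type.
Definition conf (n N : nat) : finType := {ffun site N -> 'I_n.+1}.
Definition e1shift {N : nat} (r : site N) : site N := (ordS r.1, r.2).
Definition e2shift {N : nat} (r : site N) : site N := (r.1, ordS r.2).

Definition atsite {R : realType} {n N : nat} (A : 'I_n.+1 -> 'I_n.+1 -> R) (r : site N)
  : conf n N -> conf n N -> R :=
  fun s t => A (s r) (t r) * ([forall q : site N, (q != r) ==> (s q == t q)])%:R.

Definition Sx (R : realType) (n : nat) {N : nat} (r : site N) := atsite (Sxloc R n) r.
Definition Sz (R : realType) (n : nat) {N : nat} (r : site N) := atsite (Szloc R n) r.
Definition iSy (R : realType) (n : nat) {N : nat} (r : site N) := atsite (iSyloc R n) r.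

Definition Sx2 (R : realType) (n : nat) {N : nat} (r : site N) := opmul (Sx R n r) (Sx R n r).
Definition Sz2 (R : realType) (n : nat) {N : nat} (r : site N) := opmul (Sz R n r) (Sz R n r).
Definition Sy2 (R : realType) (n : nat) {N : nat} (r : site N) :=
  opscale (-1) (opmul (iSy R n r) (iSy R n r)).

Definition hamiltonian (R : realType) (n N : nat) (J1 J2 : R) : conf n N -> conf n N -> R :=
  fun s t =>
    - (J1 / spinS R n ^+ 2) *
      \sum_(r : site N)
        ((if ~~ odd r.1 then opmul (Sx R n r) (Sx R n (e1shift r)) s t else 0)
         + (if ~~ odd r.2 then opmul (Sx R n r) (Sx R n (e2shift r)) s t else 0))
    - (J2 / spinS R n ^+ 2) *
      \sum_(r : site N)
        ((if odd r.1 then opmul (Sz R n r) (Sz R n (e1shift r)) s t else 0)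
         + (if odd r.2 then opmul (Sz R n r) (Sz R n (e2shift r)) s t else 0)).

Definition gibbs {R : realType} {n N : nat} (J1 J2 beta : R)
  (A : conf n N -> conf n N -> R) : R :=
  let E := opexp (opscale (- beta) (hamiltonian R n N J1 J2)) in
  optr (opmul A E) / optr E.

(* Main.v *)
(** Write [b = beta J] and work in the [S^z] basis, where [W s = <s|exp (- beta H)|s>] is a positive
    weight; put [m = M / S].  The Hamiltonian is a sum of products over mirror pairs, so [W] is
    reflection positive in every line, and the chessboard estimate reduces the probability of a set of
    defects to that of a full pattern.  Two defects matter: a site with [kappa < |m| < 1 - kappa], and
    an edge joining a site with [|m|] near 0 to one with [|m|] near 1.  Both patterns lose against the
    partition function: the lower bound tests [exp] on product vectors supported in windows of [M]
    (Jensen and Bessel), the upper bound dominates the moments of [S^x] in an eigenstate of [S^z] by those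
    of an arcsine law, which is where [S >= c beta^2] enters.  Split edges cost a factor exponential
    in [b]; a pattern of intermediate sites has the maximal classical energy but loses a power of [b] by
    the smaller number of spin-wave fluctuations around it (order by disorder).  A Peierls contour argument then
    shows that any two sites agree, with probability close to one, on whether [|m|] is near 0 or
    near 1.

    An intertwiner of [S^x] and [S^z], given by Krawtchouk polynomials, followed by the
    translation by [(1, 1)] exchanges the two spin components, and the entropy bound for the
    partition function forces [S^y] to be small; so the mean of [m^2] is close to 1/2 by the Casimir
    identity.  The correlations follow. *)
Require Import Defs.
From HB Require Import structures.
From mathcomp Require Import all_boot all_order all_algebra.
From mathcomp Require Import all_classical all_reals all_analysis.
From mathcomp Require Import ring lra zify.
From mathcomp Require Import finset.
Import Order.TTheory GRing.Theory Num.Theory.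
Import numFieldNormedType.Exports.
Set Implicit Arguments.
Unset Strict Implicit.
Unset Printing Implicit Defensive.
Local Open Scope ring_scope.

(** * Algebra of operators given by their matrix elements *)

Section OperatorAlgebra.
Context {R : realType} {T : finType}.
Implicit Types (A B C : T -> T -> R) (a : R) (k : nat).

(** The obstacle is that intermediate configurations cost no classical energy. The gain from
    fluctuations is made visible by an integer [q] of order [b^(1/4)]. Near [m = 0] every plaquette
    bounded by z-edges can choose its own level of [m] among [q] blocks in [[0, 1/q]]: the terms
    quadratic in [m] cancel between x- and z-edges, the quartic ones change the energy by [O(1)] per
    site, and the partition function keeps a factor [q] per plaquette on top of a factor of order
    [S / b] per site. When all sites are intermediate, no plaquette factor is left. Noncommutativity
    perturbs the energy of a site by [O(b^2 / S)], whence the square in the condition on [S].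
    Nothing is diagonalized: [exp A] is a limit of powers of [1 + A/m + O(1/m^2)], and positivity,
    Jensen, entropy and reflection positivity are proved for well chosen approximants. The
    chessboard estimate comes from maximizing the weight of a set of defects times a constant to the
    power of its cardinality: reflections that lose no event preserve maximality and spread a single
    defect over the torus. *)

Definition optrans A : T -> T -> R := fun x y => A y x.

Lemma opmulA A B C : opmul A (opmul B C) = opmul (opmul A B) C.
Proof.
apply/funext => x; apply/funext => y; rewrite /opmul.
under eq_bigr do rewrite mulr_sumr.
rewrite exchange_big; apply: eq_bigr => z _; rewrite mulr_suml.
by apply: eq_bigr => t _; rewrite mulrA.
Qed.

Lemma sum_delta_l (x : T) (f : T -> R) : \sum_z (x == z)%:R * f z = f x.
Proof.
rewrite (bigD1 x) //= eqxx mul1r big1 ?addr0 // => z /negPf.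
by rewrite eq_sym => ->; rewrite mul0r.
Qed.

Lemma sum_delta_r (x : T) (f : T -> R) : \sum_z f z * (z == x)%:R = f x.
Proof. by rewrite -[RHS]sum_delta_l; apply: eq_bigr => z _; rewrite mulrC eq_sym. Qed.

Lemma opmul1l A : opmul opid A = A.
Proof. by apply/funext => x; apply/funext => y; rewrite /opmul /opid sum_delta_l. Qed.

Lemma opmul1r A : opmul A opid = A.
Proof. by apply/funext => x; apply/funext => y; rewrite /opmul /opid sum_delta_r. Qed.

Lemma opmulDl A B C : opmul (opadd A B) C = opadd (opmul A C) (opmul B C).
Proof.
apply/funext => x; apply/funext => y; rewrite /opmul /opadd -big_split.
by apply: eq_bigr => z _; rewrite mulrDl.
Qed.

Lemma opmulDr A B C : opmul A (opadd B C) = opadd (opmul A B) (opmul A C).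
Proof.
apply/funext => x; apply/funext => y; rewrite /opmul /opadd -big_split.
by apply: eq_bigr => z _; rewrite mulrDr.
Qed.

Lemma opmulZl a A B : opmul (opscale a A) B = opscale a (opmul A B).
Proof.
apply/funext => x; apply/funext => y; rewrite /opmul /opscale mulr_sumr.
by apply: eq_bigr => z _; rewrite mulrA.
Qed.

Lemma opmulZr a A B : opmul A (opscale a B) = opscale a (opmul A B).
Proof.
apply/funext => x; apply/funext => y; rewrite /opmul /opscale mulr_sumr.
by apply: eq_bigr => z _; rewrite mulrCA.
Qed.

Lemma opmul_suml (I : Type) (r : seq I) (P : pred I) (F : I -> T -> T -> R) B :
  opmul (fun x y => \sum_(i <- r | P i) F i x y) B =
  fun x y => \sum_(i <- r | P i) opmul (F i) B x y.
Proof.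
apply/funext => x; apply/funext => y; rewrite /opmul exchange_big /=.
by apply: eq_bigr => z _; rewrite mulr_suml.
Qed.

Lemma opmul_sumr (I : Type) (r : seq I) (P : pred I) (F : I -> T -> T -> R) B :
  opmul B (fun x y => \sum_(i <- r | P i) F i x y) =
  fun x y => \sum_(i <- r | P i) opmul B (F i) x y.
Proof.
apply/funext => x; apply/funext => y; rewrite /opmul exchange_big /=.
by apply: eq_bigr => z _; rewrite mulr_sumr.
Qed.

Lemma oppowS A k : oppow A k.+1 = opmul A (oppow A k).
Proof. by []. Qed.

Lemma oppowD A j k : oppow A (j + k) = opmul (oppow A j) (oppow A k).
Proof.
elim: j => [|j IH]; first by rewrite /= opmul1l.
by rewrite addSn !oppowS IH opmulA.
Qed.

Lemma oppowSr A k : oppow A k.+1 = opmul (oppow A k) A.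
Proof. by rewrite -addn1 oppowD /oppow /= opmul1r. Qed.

Lemma oppowM A j k : oppow A (j * k) = oppow (oppow A j) k.
Proof. by elim: k => [|k IH]; rewrite ?muln0 // mulnS oppowD IH. Qed.

Lemma oppowZ a A k : oppow (opscale a A) k = opscale (a ^+ k) (oppow A k).
Proof.
elim: k => [|k IH].
  by apply/funext => x; apply/funext => y; rewrite /opscale /= expr0 mul1r.
rewrite !oppowS IH opmulZl opmulZr; apply/funext => x; apply/funext => y.
by rewrite /opscale mulrA exprS.
Qed.

Lemma optr_mulC A B : optr (opmul A B) = optr (opmul B A).
Proof.
rewrite /optr /opmul exchange_big; apply: eq_bigr => x _.
by apply: eq_bigr => y _; rewrite mulrC.
Qed.

Lemma optransM A B : optrans (opmul A B) = opmul (optrans B) (optrans A).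
Proof.
apply/funext => x; apply/funext => y; rewrite /optrans /opmul.
by apply: eq_bigr => z _; rewrite mulrC.
Qed.

Lemma optrans_pow A k : optrans (oppow A k) = oppow (optrans A) k.
Proof.
elim: k => [|k IH].
  by apply/funext => x; apply/funext => y; rewrite /optrans /= /opid eq_sym.
by rewrite oppowS optransM IH oppowSr.
Qed.

Lemma oppow_commute A B C k : opmul A B = opmul B C ->
  opmul (oppow A k) B = opmul B (oppow C k).
Proof.
move=> h; elim: k => [|k IH]; first by rewrite /= opmul1l opmul1r.
by rewrite oppowS -opmulA IH opmulA h -opmulA.
Qed.

End OperatorAlgebra.

(** * The exponential of an operator as a limit of powers *)

Section OperatorExponential.
Context {R : realType} {T : finType}.
Implicit Types (A B M : T -> T -> R) (a c t h : R) (k m : nat) (x y z : T).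
Local Open Scope classical_set_scope.

Lemma cvg_bigsum (I : Type) (r : seq I) (P : pred I) (f : I -> nat -> R) (l : I -> R) :
  (forall i, P i -> (f i m @[m --> \oo] --> l i)) ->
  (\sum_(i <- r | P i) f i m) @[m --> \oo] --> \sum_(i <- r | P i) l i.
Proof.
move=> h; elim: r => [|i r IH].
  by under eq_fun do rewrite big_nil; rewrite big_nil; exact: cvg_cst.
rewrite big_cons; under eq_fun do rewrite big_cons.
case: ifP => Pi //.
by apply: (@cvgD _ R) => //; exact: h.
Qed.

Lemma seq_limit_le (u v : nat -> R) (a b : R) :
  u @ \oo --> a -> v @ \oo --> b -> (forall m, u m <= v m) -> a <= b.
Proof.
move=> hu hv h; have -> : a = lim (u @ \oo) by apply/esym/cvg_lim.
have -> : b = lim (v @ \oo) by apply/esym/cvg_lim.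
apply: ler_lim; [exact: (cvgP _ hu)|exact: (cvgP _ hv)|].
by exists 0%N => // m _ /=.
Qed.

Lemma seq_limit_le_cst (u : nat -> R) (a b : R) :
  u @ \oo --> a -> (forall m, u m <= b) -> a <= b.
Proof. by move=> hu h; apply: (seq_limit_le hu (cvg_cst b)). Qed.

Lemma seq_limit_eq (u v : nat -> R) (a b : R) :
  u @ \oo --> a -> v @ \oo --> b -> u =1 v -> a = b.
Proof.
by move=> hu hv h; apply/eqP; rewrite eq_le (seq_limit_le hu hv) ?(seq_limit_le hv hu) // => m; rewrite h.
Qed.

Definition opl1 A : R := \sum_x \sum_y `|A x y|.

Lemma opl1_ge0 A : 0 <= opl1 A.
Proof. by apply: sumr_ge0 => x _; apply: sumr_ge0. Qed.

Lemma row_le_opl1 A x : \sum_y `|A x y| <= opl1 A.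
Proof.
rewrite /opl1 [leRHS](bigD1 x) //= lerDl; apply: sumr_ge0 => z _; exact: sumr_ge0.
Qed.

Lemma abs_opmul_le A B x y c : (forall z, `|B z y| <= c) ->
  `|opmul A B x y| <= (\sum_z `|A x z|) * c.
Proof.
move=> h; rewrite /opmul; apply: le_trans (ler_norm_sum _ _ _) _.
rewrite mulr_suml; apply: ler_sum => z _; rewrite normrM.
by apply: ler_wpM2l.
Qed.

Lemma abs_oppow_le A k x y : `|oppow A k x y| <= opl1 A ^+ k.
Proof.
elim: k x y => [|k IH] x y; first by rewrite expr0 /= /opid; case: eqP; rewrite ?normr1 ?normr0.
rewrite oppowS exprS; apply: le_trans (abs_opmul_le A x (fun z => IH z y)) _.
by apply: ler_wpM2r; rewrite ?exprn_ge0 ?opl1_ge0 ?row_le_opl1.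
Qed.

Lemma exp_partial_le c m : 0 <= c -> \sum_(k < m) c ^+ k / k`!%:R <= expR c.
Proof.
move=> c0.
have -> : \sum_(k < m) c ^+ k / k`!%:R = series (exp_coeff c) m.
  by rewrite /series /= big_mkord.
apply: nondecreasing_cvgn_le; last exact: is_cvg_series_exp_coeff.
move=> p q pq; rewrite /series /= (big_cat_nat (leq0n p) pq) //= lerDl.
by apply: sumr_ge0 => i _; apply: divr_ge0; rewrite ?exprn_ge0 ?ler0n.
Qed.

Lemma expseries_cvg A x y :
  (\sum_(k < m) oppow A k x y / k`!%:R) @[m --> \oo] --> opexp A x y.
Proof.
have cv : cvgn (fun m => \sum_(k < m) oppow A k x y / k`!%:R).
  have -> : (fun m => \sum_(k < m) oppow A k x y / k`!%:R) =
            series (fun k => oppow A k x y / k`!%:R).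
    by apply/funext => m; rewrite /series /= big_mkord.
  apply: normed_cvg.
  apply: (@series_le_cvg _ _ (exp_coeff (opl1 A))) (is_cvg_series_exp_coeff _).
  - by move=> n /=.
  - by move=> n; apply: exp_coeff_ge0; exact: opl1_ge0.
  - move=> n /=; rewrite normrM normfV normr_nat /exp_coeff /=.
    by apply: ler_wpM2r; rewrite ?invr_ge0 ?ler0n ?abs_oppow_le.
exact: cv.
Qed.

Lemma opexp_uniq A x y l :
  (\sum_(k < m) oppow A k x y / k`!%:R) @[m --> \oo] --> l -> opexp A x y = l.
Proof. by move=> h; apply/cvg_lim. Qed.

Lemma abs_opexp_le A x y : `|opexp A x y| <= expR (opl1 A).
Proof.
have h := @expseries_cvg A x y.
have hn : `|\sum_(k < m) oppow A k x y / k`!%:R| @[m --> \oo] --> `|opexp A x y|.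
  exact: cvg_norm h.
apply: (seq_limit_le_cst hn) => m.
apply: le_trans (ler_norm_sum _ _ _) _.
apply: le_trans (exp_partial_le m (opl1_ge0 A)).
apply: ler_sum => k _; rewrite normrM normfV normr_nat.
by apply: ler_wpM2r; rewrite ?invr_ge0 ?ler0n ?abs_oppow_le.
Qed.

Lemma opexp0 x y : opexp (opscale 0 (fun _ _ => 0)) x y = (x == y)%:R :> R.
Proof.
apply: opexp_uniq.
rewrite -(@cvg_shiftS R) (_ : (fun _ => _) = (fun=> (x == y)%:R)); first exact: cvg_cst.
apply/funext => m /=.
rewrite big_ord_recl /= fact0 divr1 big1 ?addr0 // => i _.
by rewrite /= /opmul /opscale big1 ?mul0r // => z _; rewrite !mul0r.
Qed.

Lemma opexp_scale0 A x y : opexp (opscale 0 A) x y = (x == y)%:R.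
Proof.
rewrite -opexp0; congr (opexp _ x y); apply/funext => u; apply/funext => v.
by rewrite /opscale !mul0r.
Qed.

Lemma powD_second_order (n : nat) t h : 0 <= t -> 0 <= h -> t + h <= 1 ->
  `|(t + h) ^+ n.+1 - t ^+ n.+1 - n.+1%:R * h * t ^+ n| <= h ^+ 2 * 2 ^+ n.+1.
Proof.
move=> t0 h0 th1.
have t1 : t <= 1 by lra.
(* The induction runs with the sharper constant [2 ^ (n + 1) - (n + 1) - 1], which leaves room for
   the new cross term [(n + 1) h ^ 2]. *)
suff [H1 H2] : 0 <= (t + h) ^+ n.+1 - t ^+ n.+1 - n.+1%:R * h * t ^+ n /\
  (t + h) ^+ n.+1 - t ^+ n.+1 - n.+1%:R * h * t ^+ n <= h ^+ 2 * (2 ^+ n.+1 - n.+1%:R - 1).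
  rewrite ger0_norm //; apply: le_trans H2 _.
  apply: ler_wpM2l; first exact: sqr_ge0.
  have := ler0n R n.+1; lra.
elim: n => [|n [IH0 IH]].
  by split; rewrite !expr1 expr0; lra.
set d := _ - _ - _ in IH0 IH.
have -> : (t + h) ^+ n.+2 - t ^+ n.+2 - n.+2%:R * h * t ^+ n.+1 =
          (t + h) * d + n.+1%:R * h ^+ 2 * t ^+ n.
  by rewrite /d !exprS -(natr1 n.+1); ring.
have tn : 0 <= t ^+ n <= 1 by rewrite exprn_ge0 //= exprn_ile1.
have n0 := ler0n R n.+1.
split.
  apply: addr_ge0; first by apply: mulr_ge0 => //; lra.
  by rewrite !mulr_ge0 ?sqr_ge0 //; case/andP: tn.
have h1 : (t + h) * d <= d by rewrite -[leRHS]mul1r; apply: ler_wpM2r.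
have h2 : n.+1%:R * h ^+ 2 * t ^+ n <= n.+1%:R * h ^+ 2.
  by rewrite -[leRHS]mulr1; apply: ler_wpM2l; [rewrite mulr_ge0 ?sqr_ge0|case/andP: tn].
have h3 : n.+1%:R <= 2 ^+ n.+1 :> R by rewrite -natrX ler_nat ltnW // ltn_expl.
apply: le_trans (lerD h1 h2) _; apply: le_trans (lerD IH (lexx _)) _.
rewrite [2 ^+ n.+2]exprS -(natr1 n.+1).
have := sqr_ge0 h; nra.
Qed.

(** Termwise remainder from [powD_second_order]; the [2 ^ k] in that bound is what turns [opl1 A]
    into [2 * opl1 A] in the exponent. *)
Lemma opexp_taylor A t h x y : 0 <= t -> 0 <= h -> t + h <= 1 ->
  `|opexp (opscale (t + h) A) x y - opexp (opscale t A) x y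
     - h * opmul A (opexp (opscale t A)) x y| <= h ^+ 2 * expR (2 * opl1 A).
Proof.
move=> t0 h0 th1.
set c := fun k => oppow A k x y / k`!%:R.
have cE s m : \sum_(k < m) oppow (opscale s A) k x y / k`!%:R = \sum_(k < m) c k * s ^+ k.
  by apply: eq_bigr => k _; rewrite oppowZ /opscale /c; ring.
have P s : (\sum_(k < m) c k * s ^+ k) @[m --> \oo] --> opexp (opscale s A) x y.
  by under eq_fun do rewrite -cE; exact: expseries_cvg.
have Q : (\sum_(k < m) k.+1%:R * c k.+1 * t ^+ k) @[m --> \oo] -->
    opmul A (opexp (opscale t A)) x y.
  have -> : (fun m => \sum_(k < m) k.+1%:R * c k.+1 * t ^+ k) =
    (fun m => \sum_z A x z * \sum_(k < m) oppow (opscale t A) k z y / k`!%:R).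
    apply/funext => m; under [RHS]eq_bigr do rewrite mulr_sumr.
    rewrite exchange_big; apply: eq_bigr => k _.
    rewrite /c oppowS /opmul factS natrM invfM.
    rewrite !(mulrA, mulr_suml, mulr_sumr); apply: eq_bigr => z _.
    rewrite oppowZ /opscale.
    have : (k.+1%:R : R) != 0 by rewrite pnatr_eq0.
    have : (k`!%:R : R) != 0 by rewrite pnatr_eq0 -lt0n fact_gt0.
    by move=> *; field; apply/andP.
  apply: cvg_bigsum => z _; apply: cvgM; first exact: cvg_cst.
  exact: expseries_cvg.
have P1 s : (\sum_(k < m.+1) c k * s ^+ k) @[m --> \oo] --> opexp (opscale s A) x y.
  by rewrite (@cvg_shiftS R (fun m => \sum_(k < m) c k * s ^+ k)); exact: P.
have L : `|\sum_(k < m.+1) c k * (t + h) ^+ k - \sum_(k < m.+1) c k * t ^+ k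
    - h * \sum_(k < m) k.+1%:R * c k.+1 * t ^+ k| @[m --> \oo] -->
    `|opexp (opscale (t + h) A) x y - opexp (opscale t A) x y
     - h * opmul A (opexp (opscale t A)) x y|.
  by apply: cvg_norm; apply: cvgB; [apply: cvgB; exact: P1|apply: cvgM => //; exact: cvg_cst].
apply: (seq_limit_le_cst L) => m.
rewrite -[X in X - _]sumrB /= mulr_sumr big_ord_recl /= !expr0 subrr add0r -sumrB.
apply: le_trans (ler_norm_sum _ _ _) _.
have l0 : 0 <= 2 * opl1 A by rewrite mulr_ge0 ?opl1_ge0.
have E := exp_partial_le m.+1 l0.
apply: le_trans (ler_wpM2l (sqr_ge0 h) E).
move: (abs_oppow_le A) l0 {E}; set l := opl1 A => powle l0.
rewrite big_ord_recl mulrDr.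
have -> : h ^+ 2 * \sum_(i < m) (2 * l) ^+ lift ord0 i / (lift ord0 i)`!%:R =
  \sum_(i < m) h ^+ 2 * ((2 * l) ^+ lift ord0 i / (lift ord0 i)`!%:R) by rewrite mulr_sumr.
apply: ler_wpDl; first by rewrite mulr_ge0 ?sqr_ge0 // divr_ge0 ?exprn_ge0 ?ler0n.
apply: ler_sum => k _.
rewrite /bump /= add1n.
have -> : c k.+1 * (t + h) ^+ k.+1 - c k.+1 * t ^+ k.+1 - h * (k.+1%:R * c k.+1 * t ^+ k)
  = c k.+1 * ((t + h) ^+ k.+1 - t ^+ k.+1 - k.+1%:R * h * t ^+ k) by ring.
rewrite normrM.
apply: le_trans (ler_pM _ _ (lexx _) (powD_second_order k t0 h0 th1)) _ => //.
rewrite /c normrM normfV normr_nat exprMn.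
have := powle k.+1 x y.
set u := `| _ |; set f := (k.+1)`!%:R^-1 => hu.
have -> : u * f * (h ^+ 2 * 2 ^+ k.+1) = (h ^+ 2 * (2 ^+ k.+1 * f)) * u by ring.
have -> : h ^+ 2 * (2 ^+ k.+1 * l ^+ k.+1 * f) = (h ^+ 2 * (2 ^+ k.+1 * f)) * l ^+ k.+1 by ring.
apply: ler_wpM2l hu.
by rewrite !mulr_ge0 ?sqr_ge0 ?invr_ge0 ?ler0n ?exprn_ge0.
Qed.

Lemma exp_ge_compound c m : 0 <= c -> (1 + c / m.+1%:R) ^+ m.+1 <= expR c.
Proof.
move=> c0.
have -> : expR c = expR (c / m.+1%:R) ^+ m.+1.
  by rewrite -expRM_natr mulfVK // pnatr_eq0.
apply: lerXn2r; rewrite ?nnegrE ?expR_ge0 ?expR_ge1Dx //.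
by rewrite addr_ge0 // divr_ge0.
Qed.

(** Any approximant [1 + A/m + O(1/m ^ 2)] will do. This freedom is used throughout: the approximant
    can be chosen with a property that survives powers, such as being the square of a symmetric
    matrix or lying in a reflection positive cone. *)
Lemma euler_limit A (M : nat -> T -> T -> R) c : 0 <= c ->
  (forall m x y, `|M m x y - (x == y)%:R - A x y / m.+1%:R| <= c / m.+1%:R ^+ 2) ->
  forall x y, oppow (M m) m.+1 x y @[m --> \oo] --> opexp A x y.
Proof.
move=> c0 hM x y.
set N := #|T|%:R : R.
have N0 : 0 <= N by rewrite ler0n.
set a := opl1 A + N * c.
have a0 : 0 <= a by rewrite addr_ge0 ?opl1_ge0 ?mulr_ge0.
set c3 := N * c * expR (opl1 A) + expR (2 * opl1 A).
have c30 : 0 <= c3 by rewrite addr_ge0 ?mulr_ge0 ?expR_ge0.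
suff key m : `|oppow (M m) m.+1 x y - opexp A x y| <= c3 * expR a / m.+1%:R.
  apply/cvgrPdist_le => e e0.
  have h0 : 0 < c3 * expR a + 1 by rewrite ltr_wpDl ?mulr_ge0 ?expR_ge0.
  exists (Num.truncn ((c3 * expR a + 1) / e)) => // m /= hm.
  rewrite distrC; apply: le_trans (key m) _.
  rewrite ler_pdivrMr ?ltr0n //.
  have : (c3 * expR a + 1) / e < m.+1%:R.
    apply: lt_le_trans (truncnS_gt _) _.
    by rewrite ler_nat ltnS.
  rewrite ltr_pdivrMr // mulrC; lra.
set m' := m.+1%:R : R.
have m'0 : 0 < m' by rewrite ltr0n.
have m'1 : 1 <= m' by rewrite ler1n.
have row z : \sum_w `|M m z w - (z == w)%:R| <= a / m'.
  have hw w : `|M m z w - (z == w)%:R| <= `|A z w| / m' + c / m' ^+ 2.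
    have -> : M m z w - (z == w)%:R = (M m z w - (z == w)%:R - A z w / m') + A z w / m' by ring.
    apply: le_trans (ler_normD _ _) _; rewrite addrC; apply: lerD (hM _ _ _).
    by rewrite normrM normfV (gtr0_norm m'0).
  apply: le_trans (ler_sum _ (fun w _ => hw w)) _.
  rewrite big_split /= -mulr_suml sumr_const -mulr_natl -/N /a mulrDl.
  apply: lerD.
    by apply: ler_wpM2r; [rewrite invr_ge0 ltW | exact: row_le_opl1].
  rewrite -mulrA; apply: ler_wpM2l => //; apply: ler_wpM2l => //.
  by rewrite lef_pV2 ?posrE ?exprn_gt0 // expr2 ler_peMr // ltW.
(* Telescoping: [j] steps of the product are compared with the exponential of [j A / m]. One step
   adds an error of order [c3 / m ^ 2] and multiplies the previous one by at most [1 + a / m]. *)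
suff H j : (j <= m.+1)%N -> forall z,
    `|oppow (M m) j z y - opexp (opscale (j%:R / m') A) z y| <=
    c3 * j%:R / m' ^+ 2 * (1 + a / m') ^+ j.
  have := H m.+1 (leqnn _) x.
  have -> : opscale (m.+1%:R / m') A = A.
    by apply/funext => u; apply/funext => v; rewrite /opscale divff ?mul1r // gt_eqF.
  move=> h; apply: le_trans h _.
  have -> : c3 * m.+1%:R / m' ^+ 2 = c3 / m'.
    by rewrite -/m'; field; rewrite gt_eqF.
  rewrite -[leRHS]mulrAC; apply: ler_wpM2l; first by rewrite divr_ge0 // ltW.
  exact: exp_ge_compound.
elim: j => [|j IH] hj z.
  by rewrite mul0r opexp_scale0 /= /opid subrr normr0 mulr0 !mul0r.
have {}IH := IH (ltnW hj).
set e := c3 * j%:R / m' ^+ 2 * (1 + a / m') ^+ j in IH.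
have e0 : 0 <= e by rewrite !mulr_ge0 ?invr_ge0 ?exprn_ge0 ?addr_ge0 ?mulr_ge0 ?invr_ge0 // ltW.
set E := opexp (opscale (j%:R / m') A) in IH *.
pose D w := oppow (M m) j w y - E w y.
have dec : oppow (M m) j.+1 z y - opexp (opscale (j.+1%:R / m') A) z y =
   (D z + \sum_w (M m z w - (z == w)%:R) * D w) +
   \sum_w (M m z w - (z == w)%:R - A z w / m') * E w y -
   (opexp (opscale (j%:R / m' + m'^-1) A) z y - E z y - m'^-1 * opmul A E z y).
  have -> : j%:R / m' + m'^-1 = j.+1%:R / m' by rewrite -[j.+1%:R]natr1 mulrDl mul1r.
  have -> : \sum_w (M m z w - (z == w)%:R) * D w = opmul (M m) (oppow (M m) j) z y
     - \sum_w M m z w * E w y - D z.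
    rewrite -(sum_delta_l z D) /opmul -sumrB -sumrB; apply: eq_bigr => w _.
    by rewrite /D; ring.
  have -> : \sum_w (M m z w - (z == w)%:R - A z w / m') * E w y =
     \sum_w M m z w * E w y - E z y - m'^-1 * opmul A E z y.
    rewrite -(sum_delta_l z (E^~ y)) /opmul mulr_sumr -sumrB -sumrB.
    by apply: eq_bigr => w _; ring.
  rewrite oppowS; ring.
rewrite dec; apply: le_trans (ler_normB _ _) _.
apply: le_trans (lerD (ler_normD _ _) (lexx _)) _.
have B1 : `|D z + \sum_w (M m z w - (z == w)%:R) * D w| <= (1 + a / m') * e.
  apply: le_trans (ler_normD _ _) _; rewrite mulrDl mul1r; apply: lerD; first exact: IH.
  apply: le_trans (ler_norm_sum _ _ _) _.
  apply: le_trans (ler_wpM2r e0 (row z)); rewrite mulr_suml; apply: ler_sum => w _.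
  by rewrite normrM; apply: ler_wpM2l => //; exact: IH.
have tj : 0 <= j%:R / m' by rewrite divr_ge0 // ltW.
have tj1 : j%:R / m' + m'^-1 <= 1.
  by rewrite -[X in _ + X]mul1r -mulrDl ler_pdivrMr // mul1r /m' natr1 ler_nat.
have B2 : `|\sum_w (M m z w - (z == w)%:R - A z w / m') * E w y| <= N * (c / m' ^+ 2) * expR (opl1 A).
  apply: le_trans (ler_norm_sum _ _ _) _.
  rewrite -mulrA [N * _]mulr_natl -sumr_const; apply: ler_sum => w _; rewrite normrM.
  apply: (ler_pM (normr_ge0 _) (normr_ge0 _) (hM _ _ _)).
  apply: le_trans (abs_opexp_le _ _ _) _; rewrite ler_expR.
  have -> : opl1 (opscale (j%:R / m') A) = (j%:R / m') * opl1 A.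
    rewrite /opl1 mulr_sumr; apply: eq_bigr => u _; rewrite mulr_sumr.
    by apply: eq_bigr => v _; rewrite /opscale normrM ger0_norm.
  rewrite -[leRHS]mul1r; apply: ler_wpM2r; first exact: opl1_ge0.
  by apply: le_trans tj1; rewrite lerDl invr_ge0 ltW.
have m'V : 0 <= m'^-1 by rewrite invr_ge0 ltW.
have B3 := opexp_taylor A z y tj m'V tj1.
apply: le_trans (lerD (lerD B1 B2) B3) _.
have g1 : 1 <= (1 + a / m') ^+ j.+1 by rewrite exprn_ege1 // lerDl divr_ge0 // ltW.
have -> : N * (c / m' ^+ 2) * expR (opl1 A) = (N * c * expR (opl1 A)) * m'^-1 ^+ 2.
  by rewrite exprVn; ring.
rewrite -addrA [_ * expR (2 * _)]mulrC -mulrDl -/c3.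
rewrite /e [(1 + a / m') ^+ j.+1]exprS.
have -> : c3 * j.+1%:R / m' ^+ 2 * ((1 + a / m') * (1 + a / m') ^+ j) =
  (1 + a / m') * (c3 * j%:R / m' ^+ 2 * (1 + a / m') ^+ j) +
  c3 * m'^-1 ^+ 2 * ((1 + a / m') * (1 + a / m') ^+ j).
  by rewrite exprVn -[j.+1%:R]natr1; ring.
rewrite lerD2l -exprS ler_peMr // mulr_ge0 //; exact: exprn_ge0.
Qed.

Lemma euler_limit_shift A (s : nat) x y :
  oppow (fun u v => (u == v)%:R + A u v / (m + s).+1%:R) m.+1 x y @[m --> \oo] --> opexp A x y.
Proof.
apply: (@euler_limit A _ (s%:R * opl1 A)).
  by rewrite mulr_ge0 ?opl1_ge0.
move=> m u v.
set m' := m.+1%:R : R.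
have m'0 : 0 < m' by rewrite ltr0n.
have E : (m + s).+1%:R = m' + s%:R :> R by rewrite -addSn natrD.
have s0 : 0 <= s%:R :> R by [].
have p0 : 0 < m' + s%:R by rewrite ltr_wpDr.
have -> : (u == v)%:R + A u v / (m + s).+1%:R - (u == v)%:R - A u v / m' =
   - (A u v * s%:R / (m' * (m' + s%:R))).
  by rewrite E; field; rewrite !gt_eqF.
rewrite normrN normrM normfV normrM (ger0_norm s0) (gtr0_norm (mulr_gt0 m'0 p0)).
have hA : `|A u v| <= opl1 A.
  apply: le_trans (row_le_opl1 A u); rewrite (bigD1 v) //= lerDl; exact: sumr_ge0.
rewrite [s%:R * opl1 A]mulrC; apply: ler_pM; rewrite ?mulr_ge0 ?invr_ge0 ?(ltW (mulr_gt0 m'0 p0)) //.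
  by apply: ler_wpM2r.
rewrite lef_pV2 ?posrE ?exprn_gt0 ?mulr_gt0 // expr2 ler_wpM2l ?lerDl // ltW.
Qed.

End OperatorExponential.

(** * Relabelling of the basis *)

Section ExponentialTransport.
Context {R : realType} {T U : finType}.
Local Open Scope classical_set_scope.

Lemma oppow_reindex (phi : T -> U) (K : U -> U -> R) k s t : bijective phi ->
  oppow (fun x y => K (phi x) (phi y)) k s t = oppow K k (phi s) (phi t).
Proof.
move=> bij; elim: k s => [|k IH] s.
  by rewrite /= /opid (inj_eq (bij_inj bij)).
rewrite !oppowS /opmul (reindex phi) /=; last exact: onW_bij.
by apply: eq_bigr => z _; rewrite IH.
Qed.

Lemma opexp_reindex (phi : T -> U) (K : U -> U -> R) s t : bijective phi ->
  opexp (fun x y => K (phi x) (phi y)) s t = opexp K (phi s) (phi t).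
Proof.
move=> bij; apply: opexp_uniq.
under eq_fun do under eq_bigr do rewrite oppow_reindex //.
exact: expseries_cvg.
Qed.

End ExponentialTransport.

(** * Positivity, Jensen and entropy inequalities for exponentials of symmetric operators *)

Section ExponentialState.
Context {R : realType} {T : finType}.
Implicit Types (A B C : T -> T -> R) (v : T -> R) (a : R) (k m : nat).
Local Open Scope classical_set_scope.

Lemma seq_limit_le_near (u v : nat -> R) (a b : R) N :
  u @ \oo --> a -> v @ \oo --> b -> (forall m, (N <= m)%N -> u m <= v m) -> a <= b.
Proof.
move=> hu hv h; have -> : a = lim (u @ \oo) by apply/esym/cvg_lim.
have -> : b = lim (v @ \oo) by apply/esym/cvg_lim.
apply: ler_lim; [exact: (cvgP _ hu)|exact: (cvgP _ hv)|].
by exists N => // m /= Nm; exact: h.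
Qed.

(** An intertwiner passes through every power, hence through the series; [A] and [C] may differ, as
    they do when spin components are exchanged. *)
Lemma opexp_commute A B C : opmul A B = opmul B C ->
  opmul (opexp A) B = opmul B (opexp C).
Proof.
move=> h; apply/funext => x; apply/funext => y.
have h1 : (\sum_z (\sum_(k < m) oppow A k x z / k`!%:R) * B z y) @[m --> \oo] -->
    opmul (opexp A) B x y.
  apply: cvg_bigsum => z _; apply: cvgM; last exact: cvg_cst.
  exact: expseries_cvg.
have h2 : (\sum_z B x z * (\sum_(k < m) oppow C k z y / k`!%:R)) @[m --> \oo] -->
    opmul B (opexp C) x y.
  apply: cvg_bigsum => z _; apply: cvgM; first exact: cvg_cst.
  exact: expseries_cvg.
apply: (seq_limit_eq h1 h2) => m.
under eq_bigr do rewrite mulr_suml; rewrite exchange_big /=.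
under [RHS]eq_bigr do rewrite mulr_sumr; rewrite [RHS]exchange_big /=.
apply: eq_bigr => k _.
have /(congr1 (fun f => f x y / k`!%:R)) := oppow_commute k h.
rewrite /opmul !mulr_suml => e.
rewrite (eq_bigr (fun z => oppow A k x z * B z y / k`!%:R)) ?e.
  by apply: eq_bigr => z _; rewrite mulrA.
by move=> z _; rewrite mulrAC.
Qed.

Lemma opexp_trans A : optrans (opexp A) = opexp (optrans A).
Proof.
apply/funext => x; apply/funext => y; apply/esym/opexp_uniq.
under eq_fun do under eq_bigr do rewrite -optrans_pow.
exact: expseries_cvg.
Qed.

(* [halfstep A m] squared is [1 + A/(m+1) + O(1/m^2)], so that the even powers of these
   symmetric matrices approximate [exp A] by Gram matrices. *)
Definition halfstep A m : T -> T -> R := fun x y => (x == y)%:R + A x y / (2 * m.+1%:R).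

Lemma halfstep_sym A m : optrans A = A -> optrans (halfstep A m) = halfstep A m.
Proof.
move=> sA; apply/funext => x; apply/funext => y; rewrite /optrans /halfstep eq_sym.
by rewrite -[in LHS]sA.
Qed.

Lemma halfstep_sq A m x y :
  opmul (halfstep A m) (halfstep A m) x y =
  (x == y)%:R + A x y / m.+1%:R + opmul A A x y / (4 * m.+1%:R ^+ 2).
Proof.
have -> : halfstep A m = opadd opid (opscale (2 * m.+1%:R)^-1 A).
  by apply/funext => u; apply/funext => v; rewrite /halfstep /opadd /opscale /opid; ring.
rewrite opmulDl !opmulDr opmul1l opmul1l opmul1r opmulZl opmulZr /opadd /opscale /opid.
have h : (m.+1%:R : R) != 0 by rewrite pnatr_eq0.
by field.
Qed.

(** The shift [s] lets one matrix be raised to two neighbouring powers: [trace_exp_le] compares the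
    exponents [2 (m + 1)] and [2 (m + 2)] of the same half step. *)
Lemma halfstep_limit A s x y :
  oppow (halfstep A (m + s)) (m.+1).*2 x y @[m --> \oo] --> opexp A x y.
Proof.
have -> : (fun m => oppow (halfstep A (m + s)) (m.+1).*2 x y) =
  (fun m => oppow (opmul (halfstep A (m + s)) (halfstep A (m + s))) m.+1 x y).
  apply/funext => m; rewrite -mul2n oppowM; congr (oppow _ _ x y).
  by rewrite /oppow /= opmul1r.
set c1 := s%:R * opl1 A; set c2 := opl1 (opmul A A).
have c10 : 0 <= c1 by rewrite mulr_ge0 ?opl1_ge0.
have c20 : 0 <= c2 by exact: opl1_ge0.
apply: (@euler_limit _ _ A _ (c1 + c2)); first exact: addr_ge0.
move=> m u v; rewrite halfstep_sq.
set m' := m.+1%:R : R.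
have m'0 : 0 < m' by rewrite ltr0n.
have E : (m + s).+1%:R = m' + s%:R :> R by rewrite -addSn natrD.
have s0 : 0 <= s%:R :> R by [].
have p0 : 0 < m' + s%:R by rewrite ltr_wpDr.
have entry B : `|B u v| <= opl1 B.
  apply: le_trans (row_le_opl1 B u); rewrite (bigD1 v) //= lerDl; exact: sumr_ge0.
rewrite E.
have -> : (u == v)%:R + A u v / (m' + s%:R) + opmul A A u v / (4 * (m' + s%:R) ^+ 2)
    - (u == v)%:R - A u v / m' =
   - (A u v * s%:R / (m' * (m' + s%:R))) + opmul A A u v / (4 * (m' + s%:R) ^+ 2).
  by field; rewrite !gt_eqF.
apply: le_trans (ler_normD _ _) _; rewrite [leRHS]mulrDl; apply: lerD.
  rewrite normrN normrM normfV normrM (ger0_norm s0) (gtr0_norm (mulr_gt0 m'0 p0)).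
  rewrite /c1 [s%:R * opl1 A]mulrC; apply: ler_pM; rewrite ?mulr_ge0 ?invr_ge0 ?(ltW (mulr_gt0 m'0 p0)) //.
    by apply: ler_wpM2r.
  rewrite lef_pV2 ?posrE ?exprn_gt0 ?mulr_gt0 // expr2 ler_wpM2l ?lerDl // ltW.
have q0 : 0 < 4 * (m' + s%:R) ^+ 2 by rewrite mulr_gt0 ?exprn_gt0.
rewrite normrM normfV (gtr0_norm q0); apply: ler_pM => //.
  by rewrite invr_ge0 ltW.
rewrite lef_pV2 ?posrE ?exprn_gt0 //.
have := sqr_ge0 m'; have : m' <= m' + s%:R by rewrite lerDl.
nra.
Qed.

(** An even power of a symmetric matrix is a Gram matrix; this is the source of positivity for the
    exponential. *)
Lemma opexp_gram A x y : optrans A = A ->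
  (\sum_z oppow (halfstep A m) m.+1 z x * oppow (halfstep A m) m.+1 z y) @[m --> \oo]
    --> opexp A x y.
Proof.
move=> sA; have h := @halfstep_limit A 0 x y.
rewrite (_ : (fun m => \sum_z _) = (fun m => oppow (halfstep A (m + 0)) (m.+1).*2 x y)) //.
apply/funext => m; rewrite addn0 -addnn oppowD /opmul; apply: eq_bigr => z _; congr (_ * _).
by rewrite -[in RHS](halfstep_sym m sA) -optrans_pow.
Qed.

Definition quad A v : R := \sum_x \sum_y v x * A x y * v y.

Lemma quad_gram (P : T -> T -> R) v :
  quad (fun x y => \sum_z P z x * P z y) v = \sum_z (\sum_x P z x * v x) ^+ 2.
Proof.
rewrite /quad; under eq_bigr do under eq_bigr do rewrite mulr_sumr mulr_suml.
under eq_bigr do rewrite exchange_big; rewrite exchange_big; apply: eq_bigr => z _.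
rewrite expr2 mulr_suml; apply: eq_bigr => x _; rewrite mulr_sumr; apply: eq_bigr => y _.
by ring.
Qed.

Lemma quad_limit (F : nat -> T -> T -> R) A v :
  (forall x y, F m x y @[m --> \oo] --> A x y) -> quad (F m) v @[m --> \oo] --> quad A v.
Proof.
move=> h; apply: cvg_bigsum => x _; apply: cvg_bigsum => y _.
apply: cvgM; last exact: cvg_cst.
by apply: cvgM; [exact: cvg_cst|exact: h].
Qed.

Lemma quad_exp_ge0 A v : optrans A = A -> 0 <= quad (opexp A) v.
Proof.
move=> sA; have h := @quad_limit (fun m x y => \sum_z oppow (halfstep A m) m.+1 z x * oppow (halfstep A m) m.+1 z y)
  (opexp A) v (fun x y => @opexp_gram A x y sA).
apply: (seq_limit_le (cvg_cst 0) h) => m.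
by rewrite quad_gram; apply: sumr_ge0 => z _; exact: sqr_ge0.
Qed.

Lemma discriminant_le (a b c : R) : 0 <= c ->
  (forall t, 0 <= a + t * (2 * b) + t ^+ 2 * c) -> b ^+ 2 <= a * c.
Proof.
move=> g0 key; have [c0|c0] := eqVneq c 0.
  rewrite c0 mulr0; have [->|b0] := eqVneq b 0; first by rewrite expr0n.
  have := key (- (a + 1) / (2 * b)); rewrite c0 mulr0 addr0.
  have -> : - (a + 1) / (2 * b) * (2 * b) = - (a + 1) by field.
  by move=> h; exfalso; lra.
have := key (- b / c).
have -> : a + - b / c * (2 * b) + (- b / c) ^+ 2 * c = (a * c - b ^+ 2) / c by field.
have cp : 0 < c by rewrite lt_neqAle eq_sym c0.
by rewrite pmulr_lge0 ?invr_gt0 // subr_ge0.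
Qed.

Lemma cauchy_schwarz_sum (I : Type) (r : seq I) (f g : I -> R) :
  (\sum_(i <- r) f i * g i) ^+ 2 <= (\sum_(i <- r) f i ^+ 2) * (\sum_(i <- r) g i ^+ 2).
Proof.
have key t : 0 <= \sum_(i <- r) f i ^+ 2 + t * (2 * \sum_(i <- r) f i * g i) + t ^+ 2 * \sum_(i <- r) g i ^+ 2.
  rewrite !mulr_sumr -!big_split /=; apply: sumr_ge0 => i _.
  have -> : f i ^+ 2 + t * (2 * (f i * g i)) + t ^+ 2 * g i ^+ 2 = (f i + t * g i) ^+ 2 by ring.
  exact: sqr_ge0.
apply: discriminant_le key; apply: sumr_ge0 => i _; exact: sqr_ge0.
Qed.

(** The ratios [p (j + 1) / p j] are non-decreasing, so [p m / p 0], a product of [m] of them, is at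
    most the power [m] of the ratio that follows. Multiplied out, the inequality survives vanishing
    terms. *)
Lemma logconvex_le (p : nat -> R) : (forall j, 0 <= p j) ->
  (forall j, p j.+1 ^+ 2 <= p j * p j.+2) -> forall m, p m ^+ m.+1 <= p 0%N * p m.+1 ^+ m.
Proof.
move=> p0 lc; elim=> [|m IH]; first by rewrite expr0 expr1 mulr1.
have [e|ne] := eqVneq (p m.+1) 0.
  by rewrite e expr0n mulr_ge0 ?exprn_ge0.
have pos : 0 < p m.+1 by rewrite lt_neqAle eq_sym ne p0.
have := lerXn2r m.+1 _ _ (lc m); rewrite !nnegrE sqr_ge0 mulr_ge0 // => /(_ isT isT).
rewrite [in leRHS]exprMn => h.
rewrite -(ler_pM2r (exprn_gt0 m pos)) -exprD.
have -> : (m.+2 + m = 2 * m.+1)%N by lia.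
rewrite exprM; apply: le_trans h _.
apply: le_trans (ler_wpM2r (exprn_ge0 _ (p0 _)) IH) _.
by rewrite mulrAC.
Qed.

Lemma logconvex_ge (p : nat -> R) : (forall j, 0 <= p j) -> p 0%N = 1 ->
  (forall j, p j.+1 ^+ 2 <= p j * p j.+2) -> forall m, p 1%N ^+ m <= p m.
Proof.
move=> p0 p01 lc.
have step : forall j, p 1%N * p j <= p j.+1.
  elim=> [|j IH]; first by rewrite p01 mulr1.
  have [->|ne] := eqVneq (p j.+1) 0; first by rewrite mulr0 p0.
  have pos : 0 < p j.+1 by rewrite lt_neqAle eq_sym ne p0.
  rewrite -(ler_pM2r pos) -mulrA -expr2.
  apply: le_trans (ler_wpM2l (p0 _) (lc j)) _; rewrite mulrA [leRHS]mulrC.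
  by apply: ler_wpM2r.
elim=> [|m IH]; first by rewrite expr0 p01.
by rewrite exprS; apply: le_trans (step m); apply: ler_wpM2l.
Qed.

Definition matvec A v : T -> R := fun x => \sum_y A x y * v y.

Lemma matvec_mul A B v : matvec (opmul A B) v = matvec A (matvec B v).
Proof.
apply/funext => x; rewrite /matvec /opmul.
under eq_bigr do rewrite mulr_suml; rewrite exchange_big; apply: eq_bigr => z _.
by rewrite mulr_sumr; apply: eq_bigr => y _; rewrite mulrA.
Qed.

Lemma dot_matvec_sym A (u v : T -> R) : optrans A = A ->
  \sum_x u x * matvec A v x = \sum_x matvec A u x * v x.
Proof.
move=> sA; rewrite /matvec.
under eq_bigr do rewrite mulr_sumr; under [RHS]eq_bigr do rewrite mulr_suml.
rewrite exchange_big; apply: eq_bigr => x _; apply: eq_bigr => y _.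
by rewrite -[in LHS]sA /optrans; ring.
Qed.

Lemma quad_matvec A v : quad A v = \sum_x v x * matvec A v x.
Proof.
by rewrite /quad /matvec; apply: eq_bigr => x _; rewrite mulr_sumr; apply: eq_bigr => y _; rewrite mulrA.
Qed.

Lemma quad_pow_double (D : T -> T -> R) v j : optrans D = D ->
  quad (oppow D j.*2) v = \sum_x matvec (oppow D j) v x ^+ 2.
Proof.
move=> sD; rewrite -addnn oppowD quad_matvec matvec_mul dot_matvec_sym; last first.
  by rewrite optrans_pow sD.
by apply: eq_bigr => x _; rewrite expr2.
Qed.

(* Log-convexity of the even moments [<v, D^(2j) v>] gives the Jensen (Peierls) inequality. *)
Lemma jensen_exp A v : optrans A = A -> \sum_x v x ^+ 2 = 1 ->
  expR (quad A v) <= quad (opexp A) v.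
Proof.
move=> sA nv; set a := quad A v.
have L : quad (oppow (halfstep A m) (m.+1).*2) v @[m --> \oo] --> quad (opexp A) v.
  apply: (@quad_limit (fun m => oppow (halfstep A m) (m.+1).*2)) => x y.
  by have := @halfstep_limit A 0 x y; under eq_fun do rewrite addn0.
have E : (1 + a / (2 * m.+1%:R)) ^+ (m.+1).*2 @[m --> \oo] --> expR a.
  (* The scalar limit is the case of matrices indexed by [unit]. *)
  have := @euler_limit R unit (fun _ _ => a) (fun m _ _ => (1 + a / (2 * m.+1%:R)) ^+ 2) (a ^+ 2) (sqr_ge0 _).
  have pw (f : R) k : oppow (fun _ _ : unit => f) k tt tt = f ^+ k.
    elim: k => [|k IH]; first by rewrite /= /opid eqxx.
    rewrite oppowS /opmul exprS (bigD1 tt) //= IH big1 ?addr0 // => -[]; by rewrite eqxx.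
  have -> : expR a = opexp (fun _ _ : unit => a) tt tt.
    apply/esym/opexp_uniq; under eq_fun do under eq_bigr do rewrite pw.
    have := @is_cvg_series_exp_coeff R a; rewrite /expR.
    by rewrite (_ : series (exp_coeff a) = (fun m => \sum_(k < m) a ^+ k / k`!%:R)) //; apply/funext => m; rewrite /series /= big_mkord.
  move=> /(_ _ tt tt) h.
  have -> : (fun m => (1 + a / (2 * m.+1%:R)) ^+ (m.+1).*2) =
     (fun m => oppow (fun _ _ : unit => (1 + a / (2 * m.+1%:R)) ^+ 2) m.+1 tt tt).
    by apply/funext => m; rewrite pw -exprM mul2n.
  apply: h => m [] []; rewrite eqxx.
  have m0 : (0 : R) < m.+1%:R by rewrite ltr0n.
  have -> : (1 + a / (2 * m.+1%:R)) ^+ 2 - 1 - a / m.+1%:R = a ^+ 2 / m.+1%:R ^+ 2 / 4.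
    by field; rewrite gt_eqF.
  rewrite ger0_norm; last by rewrite !divr_ge0 ?sqr_ge0.
  have : 0 <= a ^+ 2 / m.+1%:R ^+ 2 by rewrite divr_ge0 ?sqr_ge0.
  by set q := _ / _ ^+ 2 => q0; lra.
apply: (seq_limit_le E L) => m.
set D := halfstep A m; have sD : optrans D = D by exact: halfstep_sym.
pose p j := quad (oppow D j.*2) v.
have p0 j : 0 <= p j by rewrite /p quad_pow_double //; apply: sumr_ge0 => x _; exact: sqr_ge0.
have p01 : p 0%N = 1 by rewrite /p quad_pow_double // -nv; apply: eq_bigr => x _; rewrite /matvec /= sum_delta_l.
have lc j : p j.+1 ^+ 2 <= p j * p j.+2.
  rewrite /p [in leRHS]quad_pow_double // [X in _ * X]quad_pow_double //.
  have -> : quad (oppow D j.+1.*2) v = \sum_x matvec (oppow D j) v x * matvec (oppow D j.+2) v x.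
    have -> : (j.+1.*2 = j + j.+2)%N by lia.
    by rewrite oppowD quad_matvec matvec_mul dot_matvec_sym ?optrans_pow ?sD.
  exact: cauchy_schwarz_sum.
apply: le_trans (logconvex_ge p0 p01 lc m.+1).
rewrite -mul2n exprM; apply: lerXn2r; rewrite ?nnegrE ?sqr_ge0 //.
have -> : 1 + a / (2 * m.+1%:R) = \sum_x v x * matvec D v x.
  transitivity (\sum_x v x ^+ 2 + a / (2 * m.+1%:R)); first by rewrite nv.
  rewrite /matvec /D /halfstep /a /quad mulr_suml -big_split; apply: eq_bigr => x _ /=.
  under [in RHS]eq_bigr do rewrite mulrDl.
  rewrite big_split /= sum_delta_l mulrDr -expr2; congr (_ + _).
  by rewrite mulr_suml mulr_sumr; apply: eq_bigr => y _; ring.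
apply: le_trans (cauchy_schwarz_sum _ _ _) _.
by rewrite nv mul1r /p quad_pow_double // /oppow /= opmul1r.
Qed.

Lemma exp_diag_gt0 A x : optrans A = A -> 0 < opexp A x x.
Proof.
move=> sA; pose v y : R := (x == y)%:R.
have qv B : quad B v = B x x.
  rewrite /quad /v; under eq_bigr do under eq_bigr do rewrite -mulrA [B _ _ * _]mulrC mulrCA.
  under eq_bigr do rewrite sum_delta_l; exact: sum_delta_l.
have nv : \sum_y v y ^+ 2 = 1.
  by under eq_bigr do rewrite expr2; rewrite /v sum_delta_l eqxx.
have := jensen_exp sA nv; rewrite !qv; apply: lt_le_trans; exact: expR_gt0.
Qed.

Lemma optr_exp_gt0 A (x : T) : optrans A = A -> 0 < optr (opexp A).
Proof.
move=> sA; rewrite /optr (bigD1 x) //=; apply: ltr_wpDr; last exact: exp_diag_gt0.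
by apply: sumr_ge0 => y _; apply: ltW; apply: exp_diag_gt0.
Qed.

(* Jensen's inequality for each unit vector [V i], then Bessel's inequality for this orthonormal family. *)
Lemma trace_exp_ge A (I : finType) (V : I -> T -> R) (lab : T -> option I) :
  optrans A = A -> (forall i, \sum_x V i x ^+ 2 = 1) ->
  (forall i x, V i x != 0 -> lab x = Some i) ->
  \sum_i expR (quad A (V i)) <= optr (opexp A).
Proof.
move=> sA nV dV; apply: le_trans (ler_sum _ (fun i _ => jensen_exp sA (nV i))) _.
have h1 : (\sum_i quad (fun x y => \sum_z oppow (halfstep A m) m.+1 z x * oppow (halfstep A m) m.+1 z y) (V i)) @[m --> \oo] --> \sum_i quad (opexp A) (V i).
  apply: cvg_bigsum => i _.
  apply: (@quad_limit (fun m x y => \sum_z oppow (halfstep A m) m.+1 z x * oppow (halfstep A m) m.+1 z y)) => x y; exact: opexp_gram.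
have h2 : (\sum_x \sum_z oppow (halfstep A m) m.+1 z x * oppow (halfstep A m) m.+1 z x) @[m --> \oo] --> optr (opexp A).
  by apply: cvg_bigsum => x _; exact: opexp_gram.
apply: (seq_limit_le h1 h2) => m.
set P := oppow _ _; under eq_bigr do rewrite quad_gram.
rewrite exchange_big [leRHS]exchange_big; apply: ler_sum => z _ /=.
have b i : (\sum_x P z x * V i x) ^+ 2 <= \sum_(x | lab x == Some i) P z x * P z x.
  have -> : \sum_x P z x * V i x = \sum_x (P z x * (lab x == Some i)%:R) * V i x.
    apply: eq_bigr => x _; have [->|/dV ->] := eqVneq (V i x) 0; first by rewrite !mulr0.
    by rewrite eqxx mulr1.
  apply: le_trans (cauchy_schwarz_sum _ _ _) _; rewrite nV mulr1 [leRHS]big_mkcond /=.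
  by apply: ler_sum => x _; case: eqP => _; rewrite ?mulr1 ?mulr0 ?expr0n -?expr2 ?expr0n.
apply: le_trans (ler_sum _ (fun i _ => b i)) _.
rewrite (exchange_big_dep predT) //=; apply: ler_sum => x _.
case lx : (lab x) => [j|]; last first.
  by rewrite big1 -?expr2 ?sqr_ge0.
by rewrite (big_pred1 j) // => i /=; rewrite eq_sym.
Qed.

Lemma weight_gram_ge0 A B : optrans A = A ->
  0 <= optr (opmul (opmul (optrans B) B) (opexp A)).
Proof.
move=> sA; rewrite optr_mulC.
have -> : optr (opmul (opexp A) (opmul (optrans B) B)) = \sum_z quad (opexp A) (B z).
  rewrite /optr /quad /opmul /optrans exchange_big /=.
  under eq_bigr do under eq_bigr do rewrite mulr_sumr.
  rewrite exchange_big /=; under eq_bigr do rewrite exchange_big /=.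
  rewrite [RHS]exchange_big; under [RHS]eq_bigr do rewrite exchange_big /=.
  apply: eq_bigr => x _; rewrite exchange_big.
  by apply: eq_bigr => y _; apply: eq_bigr => z _; ring.
by apply: sumr_ge0 => z _; exact: quad_exp_ge0.
Qed.

(** [Tr (B^T C exp A)] is a symmetric positive semidefinite form in [B] and [C]: symmetric because
    [exp A] is, positive by [weight_gram_ge0]. *)
Lemma weight_cs A B C : optrans A = A ->
  optr (opmul (opmul (optrans B) C) (opexp A)) ^+ 2 <=
  optr (opmul (opmul (optrans B) B) (opexp A)) * optr (opmul (opmul (optrans C) C) (opexp A)).
Proof.
move=> sA.
pose w X Y := optr (opmul (opmul (optrans X) Y) (opexp A)).
have wsym X Y : w X Y = w Y X.
  rewrite /w; transitivity (optr (optrans (opmul (opmul (optrans X) Y) (opexp A)))) => //.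
  by rewrite !optransM opexp_trans sA optr_mulC; congr (optr (opmul (opmul _ _) _)).
have wD X Y t : w (opadd X (opscale t Y)) (opadd X (opscale t Y)) =
   w X X + t * (2 * w X Y) + t ^+ 2 * w Y Y.
  have -> : w (opadd X (opscale t Y)) (opadd X (opscale t Y)) =
    w X X + t * w X Y + t * w Y X + t ^+ 2 * w Y Y.
    rewrite /w /optr !mulr_sumr -!big_split; apply: eq_bigr => x _ /=.
    rewrite /opmul !mulr_sumr -!big_split; apply: eq_bigr => y _ /=.
    rewrite !mulr_suml !mulr_sumr -!big_split; apply: eq_bigr => z _ /=.
    by rewrite /optrans /opadd /opscale; ring.
  by rewrite (wsym Y X); ring.
have key t : 0 <= w B B + t * (2 * w B C) + t ^+ 2 * w C C.
  by rewrite -wD; exact: weight_gram_ge0.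
exact: discriminant_le (weight_gram_ge0 _ sA) key.
Qed.

(* The entropy of a Gibbs state is at most [ln #|T|]. *)
Lemma trace_exp_le A : optrans A = A -> (0 < #|T|)%N ->
  optr (opexp A) <= #|T|%:R * expR (optr (opmul A (opexp A)) / optr (opexp A)).
Proof.
move=> sA /card_gt0P[x0 _]; set Z := optr (opexp A).
have Z0 : 0 < Z by exact: optr_exp_gt0.
pose D m := halfstep A m.+1.
have sD m : optrans (D m) = D m by exact: halfstep_sym.
pose p m j := optr (oppow (D m) j.*2).
have pE m j k : optr (oppow (D m) (j + k)) = \sum_xy oppow (D m) j xy.1 xy.2 * oppow (D m) k xy.1 xy.2.
  rewrite oppowD /optr /opmul pair_bigA; apply: eq_bigr => -[x y] _ /=; congr (_ * _).
  by rewrite -[in RHS](sD m) -optrans_pow.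
have p0 m j : 0 <= p m j.
  by rewrite /p -addnn pE; apply: sumr_ge0 => xy _; rewrite -expr2 sqr_ge0.
have lc m j : p m j.+1 ^+ 2 <= p m j * p m j.+2.
  rewrite /p (_ : j.+1.*2 = j + j.+2)%N; last by lia.
  rewrite -!addnn !pE; apply: le_trans (cauchy_schwarz_sum _ _ _) _.
  by rewrite le_eqVlt; apply/orP; left; apply/eqP; congr (_ * _); apply: eq_bigr => xy _; rewrite expr2.
have card m : p m 0%N = #|T|%:R.
  by rewrite /p /optr /= /opid; under eq_bigr do rewrite eqxx; rewrite sumr_const.
have lim1 : p m m.+1 @[m --> \oo] --> Z.
  apply: cvg_bigsum => x _; have := @halfstep_limit A 1 x x.
  by under eq_fun do rewrite addn1.
have lim2 : p m m.+2 @[m --> \oo] --> Z.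
  apply: cvg_bigsum => x _; have := @halfstep_limit A 0 x x.
  rewrite -(@cvg_shiftS R) /=; by under eq_fun do rewrite addn0.
have limB (B : T -> T -> R) : optr (opmul B (oppow (D m) m.+1.*2)) @[m --> \oo] --> optr (opmul B (opexp A)).
  apply: cvg_bigsum => x _; apply: cvg_bigsum => z _; apply: cvgM; first exact: cvg_cst.
  by have := @halfstep_limit A 1 z x; under eq_fun do rewrite addn1.
(* [th m] is chosen so that [p m m.+2 = p m m.+1 * (1 + th m / m.+2)] holds exactly; it tends to the
   Gibbs mean of [A]. *)
pose th m := (optr (opmul A (oppow (D m) m.+1.*2)) +
  optr (opmul (opmul A A) (oppow (D m) m.+1.*2)) * (4 * m.+2%:R)^-1) / p m m.+1.
have lim3 : th m @[m --> \oo] --> optr (opmul A (opexp A)) / Z.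
  apply: cvgM; last by apply: cvgV => //; rewrite gt_eqF.
  rewrite -[optr (opmul A (opexp A))]addr0; apply: cvgD; first exact: limB.
  rewrite -(mulr0 (optr (opmul (opmul A A) (opexp A)))); apply: cvgM; first exact: limB.
  have -> : (fun m => (4 * m.+2%:R)^-1) = (fun m => 4^-1 * harmonic m.+1) :> (nat -> R).
    by apply/funext => m; rewrite /harmonic /= invfM.
  rewrite -(mulr0 (4^-1 : R)); apply: cvgM; first exact: cvg_cst.
  by rewrite (@cvg_shiftS R); exact: cvg_harmonic.
have lim4 : #|T|%:R * expR (th m) @[m --> \oo] --> #|T|%:R * expR (optr (opmul A (opexp A)) / Z).
  apply: cvgM; first exact: cvg_cst.
  by apply: continuous_cvg lim3; exact: continuous_expR.
have [N _ hN] : \forall m \near \oo, 0 < p m m.+1 by exact: (cvgr_gt _ lim1 _ Z0).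
apply: (seq_limit_le_near (N := N) lim2 lim4) => m /hN pm.
set M := m.+2%:R : R.
have M0 : 0 < M by rewrite ltr0n.
have diff : p m m.+2 = p m m.+1 * (1 + th m / M).
  have -> : p m m.+1 * (1 + th m / M) = p m m.+1 + optr (opmul A (oppow (D m) m.+1.*2)) / M +
     optr (opmul (opmul A A) (oppow (D m) m.+1.*2)) / (4 * M ^+ 2).
    by rewrite /th -/M; field; rewrite !gt_eqF.
  have -> : p m m.+2 = optr (opmul (opmul (D m) (D m)) (oppow (D m) m.+1.*2)).
    by rewrite /p doubleS !oppowS opmulA.
  rewrite /p; set Q := oppow (D m) _.
  have -> : opmul (D m) (D m) = opadd opid (opadd (opscale M^-1 A) (opscale (4 * M ^+ 2)^-1 (opmul A A))).
    by apply/funext => x; apply/funext => y; rewrite halfstep_sq /opadd /opscale /opid -/M; ring.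
  rewrite !opmulDl opmul1l !opmulZl /optr /opadd /opscale !big_split /= -!mulr_sumr.
  by field; rewrite gt_eqF.
(* Log-convexity gives [p m m.+2 <= #|T| * (p m m.+2 / p m m.+1) ^ m.+2], and the ratio is
   [1 + th m / m.+2], so that the right side is at most [#|T| * exp (th m)]. *)
have := logconvex_le (p0 m) (lc m) m.+1; rewrite card => h.
have h2 : p m m.+2 <= #|T|%:R * (1 + th m / M) ^+ m.+2.
  have pp : 0 < p m m.+1 ^+ m.+2 by rewrite exprn_gt0.
  rewrite -(ler_pM2r pp) -mulrA -exprMn [(1 + _) * _]mulrC -diff [p m m.+2 ^+ _]exprS [leRHS]mulrCA.
  by apply: ler_wpM2l.
apply: le_trans h2 _; apply: ler_wpM2l => //.
have -> : expR (th m) = expR (th m / M) ^+ m.+2.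
  by rewrite -expRM_natr mulfVK // gt_eqF.
apply: lerXn2r; rewrite ?nnegrE ?expR_ge0 ?expR_ge1Dx //.
by rewrite -(pmulr_rge0 _ pm) -diff.
Qed.

End ExponentialState.

(** * Reflection positivity on two mirror copies of a system *)

Section ReflectionCone.
Context {R : realType} {X : finType}.
Implicit Types (a b c d : X -> X -> R) (f g : X -> R) (K : X * X -> X * X -> R).
Local Open Scope classical_set_scope.

Definition tens a b : X * X -> X * X -> R := fun s t => a s.1 t.1 * b s.2 t.2.

Lemma opmul_tens a b c d : opmul (tens a b) (tens c d) = tens (opmul a c) (opmul b d).
Proof.
apply/funext => s; apply/funext => t; rewrite /opmul /tens mulr_suml.
rewrite -(pair_bigA _ (fun x y => a s.1 x * b s.2 y * (c x t.1 * d y t.2))) /=.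
apply: eq_bigr => x _; rewrite mulr_sumr; apply: eq_bigr => y _; ring.
Qed.

Lemma opid_tens : tens opid opid = opid :> (X * X -> X * X -> R).
Proof.
by apply/funext => -[s1 s2]; apply/funext => -[t1 t2]; rewrite /tens /opid xpair_eqE -natrM mulnb.
Qed.

(** All matrices are real, so the reflection of [a] is [a] itself, without conjugation. The class is
    stable under products, and on it Cauchy-Schwarz over the summation index separates the two
    halves. *)
Definition reflcone K := exists l : seq (X -> X -> R),
  K = fun s t => \sum_(a <- l) tens a a s t.

Lemma reflcone_id : reflcone opid.
Proof.
by exists [:: opid]; apply/funext => s; apply/funext => t; rewrite big_seq1 opid_tens.
Qed.

Lemma reflcone_mul K K' : reflcone K -> reflcone K' -> reflcone (opmul K K').
Proof.
move=> [l ->] [l' ->]; exists [seq opmul a b | a <- l, b <- l'].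
rewrite opmul_suml; apply/funext => s; apply/funext => t.
rewrite big_allpairs_dep; apply: eq_bigr => a _.
by rewrite opmul_sumr; apply: eq_bigr => b _; rewrite opmul_tens.
Qed.

Lemma reflcone_pow K k : reflcone K -> reflcone (oppow K k).
Proof.
move=> cK; elim: k => [|k IH]; first exact: reflcone_id.
by rewrite oppowS; exact: reflcone_mul.
Qed.

Definition mirror f g K : R := \sum_s f s.1 * g s.2 * K s s.

Lemma mirror_cone f g (l : seq (X -> X -> R)) :
  mirror f g (fun s t => \sum_(a <- l) tens a a s t) =
  \sum_(a <- l) (\sum_x f x * a x x) * (\sum_x g x * a x x).
Proof.
rewrite /mirror; under eq_bigr do rewrite mulr_sumr; rewrite exchange_big /=.
apply: eq_bigr => a _; rewrite mulr_suml.
rewrite -(pair_bigA _ (fun x y => f x * g y * (a x x * a y y))) /=.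
by apply: eq_bigr => x _; rewrite mulr_sumr; apply: eq_bigr => y _; rewrite /tens /=; ring.
Qed.

Lemma mirror_cone_cs f g K : reflcone K ->
  mirror f g K ^+ 2 <= mirror f f K * mirror g g K.
Proof.
move=> [l ->]; rewrite !mirror_cone.
apply: le_trans (cauchy_schwarz_sum _ _ _) _.
by under eq_bigr do rewrite expr2; under [X in _ * X <= _]eq_bigr do rewrite expr2.
Qed.

(* [1 + A/m] agrees to order [1/m^2] with [(1 + L/m) (x) (1 + L/m) + (1/m) sum c (x) c]. *)
Theorem reflection_cs (A : X * X -> X * X -> R) (L : X -> X -> R) (cs : seq (X -> X -> R)) f g :
  (forall s t, A s t = tens L opid s t + tens opid L s t + \sum_(c <- cs) tens c c s t) ->
  mirror f g (opexp A) ^+ 2 <= mirror f f (opexp A) * mirror g g (opexp A).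
Proof.
move=> hA.
pose M m : X * X -> X * X -> R := fun s t =>
  \sum_(a <- opadd opid (opscale m.+1%:R^-1 L) :: [seq opscale (Num.sqrt m.+1%:R^-1) c | c <- cs]) tens a a s t.
have cM m : reflcone (M m) by eexists; reflexivity.
have lim : forall s t, oppow (M m) m.+1 s t @[m --> \oo] --> opexp A s t.
  apply: (@euler_limit _ _ A M (opl1 (tens L L))); first exact: opl1_ge0.
  move=> m s t; rewrite hA /M big_cons big_map.
  set m' := m.+1%:R : R.
  have m'0 : 0 < m' by rewrite ltr0n.
  have -> : \sum_(c <- cs) tens (opscale (Num.sqrt m'^-1) c) (opscale (Num.sqrt m'^-1) c) s t
     = m'^-1 * \sum_(c <- cs) tens c c s t.
    rewrite mulr_sumr; apply: eq_bigr => c _; rewrite /tens /opscale mulrACA -expr2 sqr_sqrtr //.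
    by rewrite invr_ge0 ltW.
  have idt : (s == t)%:R = tens opid opid s t by rewrite opid_tens.
  rewrite idt.
  have -> : tens (opadd opid (opscale m'^-1 L)) (opadd opid (opscale m'^-1 L)) s t +
    m'^-1 * \sum_(c <- cs) tens c c s t - tens opid opid s t -
    (tens L opid s t + tens opid L s t + \sum_(c <- cs) tens c c s t) / m' = tens L L s t / m' ^+ 2.
    by rewrite /tens /opadd /opscale; field; rewrite gt_eqF.
  have m2 : 0 <= m' ^+ 2 by rewrite exprn_ge0 // ltW.
  rewrite normrM normfV (ger0_norm m2).
  apply: ler_wpM2r; first by rewrite invr_ge0 exprn_ge0 // ltW.
  apply: le_trans (row_le_opl1 (tens L L) s).
  by rewrite [leRHS](bigD1 t) //= lerDl sumr_ge0.
have limm (f1 g1 : X -> R) : mirror f1 g1 (oppow (M m) m.+1) @[m --> \oo] --> mirror f1 g1 (opexp A).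
  by apply: cvg_bigsum => s _; apply: cvgM; [exact: cvg_cst|exact: lim].
have l1 : mirror f g (oppow (M m) m.+1) ^+ 2 @[m --> \oo] --> mirror f g (opexp A) ^+ 2.
  by rewrite expr2; under eq_fun do rewrite expr2; apply: cvgM; exact: limm.
have l2 : mirror f f (oppow (M m) m.+1) * mirror g g (oppow (M m) m.+1) @[m --> \oo] -->
  mirror f f (opexp A) * mirror g g (opexp A) by apply: cvgM; exact: limm.
apply: (seq_limit_le l1 l2) => m.
exact: mirror_cone_cs (reflcone_pow _ (cM m)).
Qed.

End ReflectionCone.

(** * Operators acting at a single point *)

Section LocalOperators.
Context {R : realType} {n : nat} {T : finType}.
Implicit Types (A B : 'I_n.+1 -> 'I_n.+1 -> R) (r : T) (s t : {ffun T -> 'I_n.+1}).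

(** [atsite] over an arbitrary finite set of points, so that it also applies to half of the torus;
    on the sites of the torus the two are convertible. *)
Definition atpoint A r : {ffun T -> 'I_n.+1} -> {ffun T -> 'I_n.+1} -> R :=
  fun s t => A (s r) (t r) * ([forall q, (q != r) ==> (s q == t q)])%:R.

Definition setat s r (a : 'I_n.+1) : {ffun T -> 'I_n.+1} :=
  [ffun q => if q == r then a else s q].

Lemma setat_same s r a : setat s r a r = a.
Proof. by rewrite ffunE eqxx. Qed.

Lemma setat_other s r a q : q != r -> setat s r a q = s q.
Proof. by rewrite ffunE => /negPf ->. Qed.

Lemma agree_setat s t r : [forall q, (q != r) ==> (s q == t q)] = (t == setat s r (t r)).
Proof.
apply/forallP/eqP => [h|-> q]; last first.
  by apply/implyP => qr; rewrite setat_other.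
apply/ffunP => q; rewrite ffunE; case: eqVneq => [->//|qr].
by have /implyP/(_ qr)/eqP := h q.
Qed.

Lemma atpoint_setat A r s a : atpoint A r s (setat s r a) = A (s r) a.
Proof. by rewrite /atpoint agree_setat setat_same eqxx mulr1. Qed.

Lemma opmul_atpoint A r (K : {ffun T -> 'I_n.+1} -> {ffun T -> 'I_n.+1} -> R) s t :
  opmul (atpoint A r) K s t = \sum_a A (s r) a * K (setat s r a) t.
Proof.
rewrite /opmul (partition_big (fun z : {ffun T -> 'I_n.+1} => z r) predT) //=.
apply: eq_bigr => a _; rewrite (bigD1 (setat s r a)) ?setat_same //=.
rewrite atpoint_setat big1 ?addr0 // => z /andP[/eqP zr zn].
by rewrite /atpoint agree_setat zr (negPf zn) mulr0 mul0r.
Qed.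

Lemma atpoint_mul A B r : opmul (atpoint A r) (atpoint B r) = atpoint (opmul A B) r.
Proof.
apply/funext => s; apply/funext => t; rewrite opmul_atpoint /atpoint [in RHS]/opmul mulr_suml.
apply: eq_bigr => a _; rewrite setat_same -mulrA; congr (_ * (_ * _%:R)).
congr (nat_of_bool _); apply: eq_forallb => q; case: eqVneq => //= qr.
by rewrite setat_other.
Qed.

Lemma atpoint_id r : atpoint opid r = opid :> (_ -> _ -> R).
Proof.
apply/funext => s; apply/funext => t; rewrite /atpoint /opid -natrM mulnb; congr (_%:R).
congr (nat_of_bool _); apply/andP/eqP => [[/eqP e /forallP h]|->]; last by rewrite eqxx; split=> //; apply/forallP => q; rewrite eqxx implybT.
by apply/ffunP => q; case: (eqVneq q r) => [->//|qr]; have /implyP/(_ qr)/eqP := h q.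
Qed.

Lemma atpointD A B r : atpoint (opadd A B) r = opadd (atpoint A r) (atpoint B r).
Proof. by apply/funext => s; apply/funext => t; rewrite /atpoint /opadd mulrDl. Qed.

Lemma atpointZ (a : R) A r : atpoint (opscale a A) r = opscale a (atpoint A r).
Proof. by apply/funext => s; apply/funext => t; rewrite /atpoint /opscale mulrA. Qed.

Lemma atpoint_trans A r : optrans (atpoint A r) = atpoint (optrans A) r.
Proof.
apply/funext => s; apply/funext => t; rewrite /atpoint /optrans; congr (_ * _%:R).
by congr (nat_of_bool _); apply: eq_forallb => q; rewrite [s q == _]eq_sym.
Qed.

Lemma atpoint_comm A B r r' : r != r' ->
  opmul (atpoint A r) (atpoint B r') = opmul (atpoint B r') (atpoint A r).
Proof.
move=> rr'; have r'r : r' != r by rewrite eq_sym.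
apply/funext => s; apply/funext => t; rewrite !opmul_atpoint.
have e a : atpoint B r' (setat s r a) t =
   B (s r') (t r') * (a == t r)%:R * [forall q, (q != r) && (q != r') ==> (s q == t q)]%:R.
  rewrite /atpoint setat_other // -mulrA; congr (_ * _).
  rewrite -natrM mulnb; congr (_%:R); congr (nat_of_bool _).
  apply/forallP/andP => [h|[/eqP-> /forallP h] q].
    split; first by have := h r; rewrite rr' setat_same.
    apply/forallP => q; apply/implyP => /andP[qr qr']; have := h q.
    by rewrite qr' setat_other.
  apply/implyP => qr'; rewrite ffunE; case: (eqVneq q r) => [->//|qr].
  by have := h q; rewrite qr qr'.
have e' a : atpoint A r (setat s r' a) t =
   A (s r) (t r) * (a == t r')%:R * [forall q, (q != r) && (q != r') ==> (s q == t q)]%:R.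
  rewrite /atpoint setat_other // -mulrA; congr (_ * _).
  rewrite -natrM mulnb; congr (_%:R); congr (nat_of_bool _).
  apply/forallP/andP => [h|[/eqP-> /forallP h] q].
    split; first by have := h r'; rewrite r'r setat_same.
    apply/forallP => q; apply/implyP => /andP[qr qr']; have := h q.
    by rewrite qr setat_other.
  apply/implyP => qr; rewrite ffunE; case: (eqVneq q r') => [->//|qr'].
  by have := h q; rewrite qr qr'.
under eq_bigr do rewrite e.
under [RHS]eq_bigr do rewrite e'.
rewrite (bigD1 (t r)) //= [RHS](bigD1 (t r')) //= !eqxx.
rewrite big1 ?[X in _ + X = _]addr0; last by move=> a /negPf ->; rewrite !(mul0r,mulr0).
rewrite [X in _ = _ + X]big1; last by move=> a /negPf ->; rewrite !(mul0r,mulr0).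
by ring.
Qed.

End LocalOperators.

(** * Reflection positivity of pair interactions *)

Section ReflectionPositivity.
Context {R : realType} {n : nat} {T H : finType}.
Variables (l r : H -> T).
Hypothesis lr_bij : bijective (fun x : H + H => match x with inl h => l h | inr h => r h end).
Variables (I : finType) (loc : I -> 'I_n.+1 -> 'I_n.+1 -> R) (iota : I -> T -> T)
  (part : I -> H -> option H).
Hypothesis iota_l : forall i h, iota i (l h) = if part i h is Some h' then l h' else r h.
Hypothesis iota_r : forall i h, iota i (r h) = if part i h is Some h' then r h' else l h.

Notation cf T := {ffun T -> 'I_n.+1}.

Definition split_conf (s : cf T) : cf H * cf H := ([ffun h => s (l h)], [ffun h => s (r h)]).

Lemma split_conf_bij : bijective split_conf.
Proof.
case: lr_bij => g gK Kg.
exists (fun uv : cf H * cf H => [ffun t => match g t with inl h => uv.1 h | inr h => uv.2 h end]).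
  move=> s; apply/ffunP => t; rewrite ffunE -{2}(Kg t); case: (g t) => h; by rewrite ffunE.
move=> [u v]; congr (_, _); apply/ffunP => h; rewrite !ffunE.
  by rewrite (gK (inl h)).
by rewrite (gK (inr h)).
Qed.

Lemma lr_forall (P : pred T) : [forall q, P q] = [forall h, P (l h)] && [forall h, P (r h)].
Proof.
case: lr_bij => g gK Kg.
apply/forallP/andP => [h|[/forallP h1 /forallP h2] q]; first by split; apply/forallP => x.
by rewrite -(Kg q); case: (g q) => h; [exact: h1|exact: h2].
Qed.

Lemma l_inj : injective l.
Proof. by move=> h h' e; have := bij_inj lr_bij; move=> /(_ (inl h) (inl h') e) []. Qed.

Lemma r_inj : injective r.
Proof. by move=> h h' e; have := bij_inj lr_bij; move=> /(_ (inr h) (inr h') e) []. Qed.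

Lemma lr_neq h h' : l h != r h'.
Proof. by apply/eqP => e; have := bij_inj lr_bij; move=> /(_ (inl h) (inr h') e). Qed.

Lemma sum_lr (F : T -> R) : \sum_t F t = \sum_h F (l h) + \sum_h F (r h).
Proof.
by rewrite (reindex (fun x : H + H => match x with inl h => l h | inr h => r h end)) ?big_sumType //=; exact: onW_bij.
Qed.

Lemma atpoint_l (A : 'I_n.+1 -> 'I_n.+1 -> R) h (s t : cf T) :
  atpoint A (l h) s t = tens (atpoint A h) opid (split_conf s) (split_conf t).
Proof.
rewrite /atpoint /tens /= !ffunE -mulrA; congr (_ * _).
rewrite /opid -natrM mulnb lr_forall; congr (nat_of_bool (_ && _))%:R.
  by apply: eq_forallb => q; rewrite !ffunE (inj_eq l_inj).
apply/forallP/eqP => [e|e q]; last first.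
  by apply/implyP => _; move/ffunP: e => /(_ q); rewrite !ffunE => ->.
apply/ffunP => q; rewrite !ffunE; have := e q.
by rewrite eq_sym lr_neq => /eqP.
Qed.

Lemma atpoint_r (A : 'I_n.+1 -> 'I_n.+1 -> R) h (s t : cf T) :
  atpoint A (r h) s t = tens opid (atpoint A h) (split_conf s) (split_conf t).
Proof.
rewrite /atpoint /tens /= !ffunE mulrCA; congr (_ * _).
rewrite /opid -natrM mulnb lr_forall; congr (nat_of_bool (_ && _))%:R.
  apply/forallP/eqP => [e|e q]; last first.
    by apply/implyP => _; move/ffunP: e => /(_ q); rewrite !ffunE => ->.
  by apply/ffunP => q; rewrite !ffunE; have := e q; rewrite lr_neq => /eqP.
by apply: eq_forallb => q; rewrite !ffunE (inj_eq r_inj).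
Qed.

Lemma opmul_split (K K' : cf H * cf H -> cf H * cf H -> R) (B B' : cf T -> cf T -> R) s t :
  (forall s t, B s t = K (split_conf s) (split_conf t)) ->
  (forall s t, B' s t = K' (split_conf s) (split_conf t)) ->
  opmul B B' s t = opmul K K' (split_conf s) (split_conf t).
Proof.
move=> hB hB'; rewrite /opmul [RHS](reindex split_conf) /=; last exact/onW_bij/split_conf_bij.
by apply: eq_bigr => z _; rewrite hB hB'.
Qed.

(** [iota i q] is the partner of [q] under the interaction [i]. A value [part i h = None] marks a
    pair cut by the axis: by [iota_l] and [iota_r] its ends are then mirror images, and its term is
    the product of one operator with its reflection. *)
Definition pair_energy (kappa : R) : cf T -> cf T -> R := fun s t =>
  kappa * \sum_q \sum_i opmul (atpoint (loc i) q) (atpoint (loc i) (iota i q)) s t.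

Theorem reflection_positivity (kappa : R) (f g : cf H -> R) : 0 <= kappa ->
  (\sum_s f (split_conf s).1 * g (split_conf s).2 * opexp (pair_energy kappa) s s) ^+ 2 <=
  (\sum_s f (split_conf s).1 * f (split_conf s).2 * opexp (pair_energy kappa) s s) *
  (\sum_s g (split_conf s).1 * g (split_conf s).2 * opexp (pair_energy kappa) s s).
Proof.
move=> k0.
pose L : cf H -> cf H -> R := fun u v => kappa *
  \sum_h \sum_i (if part i h is Some h' then opmul (atpoint (loc i) h) (atpoint (loc i) h') u v else 0).
(* Pairs inside one half went into [L]. A cut pair is met once from either side, whence [2 * kappa]
   under the root; the sign of [kappa] makes the root legitimate. *)
pose cs : seq (cf H -> cf H -> R) :=
  [seq opscale (Num.sqrt (2 * kappa)) (atpoint (loc x.2) x.1) |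
     x <- enum {: H * I} & part x.2 x.1 == None].
pose K : cf H * cf H -> cf H * cf H -> R := fun s t =>
  tens L opid s t + tens opid L s t + \sum_(c <- cs) tens c c s t.
have AK s t : pair_energy kappa s t = K (split_conf s) (split_conf t).
  rewrite /pair_energy sum_lr /K.
  set s' := split_conf s; set t' := split_conf t.
  have el h i : opmul (atpoint (loc i) (l h)) (atpoint (loc i) (iota i (l h))) s t =
     (if part i h is Some h' then opmul (atpoint (loc i) h) (atpoint (loc i) h') s'.1 t'.1 else 0) * opid s'.2 t'.2
     + (if part i h == None then tens (atpoint (loc i) h) (atpoint (loc i) h) s' t' else 0).
    rewrite iota_l; case: (part i h) => [h'|] /=.
      rewrite (opmul_split _ _ (atpoint_l _ h) (atpoint_l _ h')) opmul_tens opmul1l /tens.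
      by rewrite addr0.
    by rewrite (opmul_split _ _ (atpoint_l _ h) (atpoint_r _ h)) opmul_tens opmul1l opmul1r mul0r add0r.
  have er h i : opmul (atpoint (loc i) (r h)) (atpoint (loc i) (iota i (r h))) s t =
     opid s'.1 t'.1 * (if part i h is Some h' then opmul (atpoint (loc i) h) (atpoint (loc i) h') s'.2 t'.2 else 0)
     + (if part i h == None then tens (atpoint (loc i) h) (atpoint (loc i) h) s' t' else 0).
    rewrite iota_r; case: (part i h) => [h'|] /=.
      rewrite (opmul_split _ _ (atpoint_r _ h) (atpoint_r _ h')) opmul_tens opmul1l /tens.
      by rewrite addr0.
    by rewrite (opmul_split _ _ (atpoint_r _ h) (atpoint_l _ h)) opmul_tens opmul1l opmul1r mulr0 add0r.
  under eq_bigr do under eq_bigr do rewrite el.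
  under [X in _ + X]eq_bigr do under eq_bigr do rewrite er.
  under eq_bigr do rewrite big_split /= -mulr_suml.
  under [X in _ + X]eq_bigr do rewrite big_split /= -mulr_sumr.
  rewrite !big_split /= -mulr_suml -mulr_sumr.
  have -> : \sum_(c <- cs) tens c c s' t' =
     2 * kappa * \sum_h \sum_i (if part i h == None then tens (atpoint (loc i) h) (atpoint (loc i) h) s' t' else 0).
    rewrite /cs big_map big_filter big_enum_cond /= big_mkcond /=.
    rewrite pair_bigA /= mulr_sumr; apply: eq_bigr => -[h i] _ /=.
    case: ifP => _; last by rewrite mulr0.
    rewrite /tens /opscale mulrACA -expr2 sqr_sqrtr //.
    by rewrite mulr_ge0.
  have tl : tens L opid s' t' = L s'.1 t'.1 * opid s'.2 t'.2 by [].
  have tr : tens opid L s' t' = opid s'.1 t'.1 * L s'.2 t'.2 by [].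
  by rewrite tl tr /L; ring.
have -> : pair_energy kappa = (fun s t => K (split_conf s) (split_conf t)).
  by apply/funext => s; apply/funext => t; exact: AK.
have E (f1 g1 : cf H -> R) :
   \sum_s f1 (split_conf s).1 * g1 (split_conf s).2 * opexp (fun s t => K (split_conf s) (split_conf t)) s s
   = mirror f1 g1 (opexp K).
  rewrite /mirror [RHS](reindex split_conf) /=; last exact/onW_bij/split_conf_bij.
  by apply: eq_bigr => s _; rewrite opexp_reindex //; exact: split_conf_bij.
by rewrite !E; apply: (@reflection_cs _ _ K L cs).
Qed.

(* Events [E (s q) (s (tau q))] for [q] in a set of points, where [tau] is compatible with the
   reflection; pairs [{q, tau q}] cut by the reflection axis are discarded. *)
Variables (tau : T -> T) (tpart : H -> option H) (E : rel 'I_n.+1).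
Hypothesis tau_l : forall h, tpart h -> tau (l h) = if tpart h is Some h' then l h' else l h.
Hypothesis tau_r : forall h, tpart h -> tau (r h) = if tpart h is Some h' then r h' else r h.

Definition pair_event (J : {set T}) (s : cf T) := [forall q in J, E (s q) (s (tau q))].

Definition event_weight (A : cf T -> cf T -> R) (J : {set T}) : R :=
  \sum_(s | pair_event J s) opexp A s s.

Definition keep_left (J : {set T}) : {set T} :=
  [set t | [exists h, ((t == l h) || (t == r h)) && (l h \in J) && tpart h]].
Definition keep_right (J : {set T}) : {set T} :=
  [set t | [exists h, ((t == l h) || (t == r h)) && (r h \in J) && tpart h]].

Lemma event_weight_cs (kappa : R) (J : {set T}) : 0 <= kappa ->
  optrans (pair_energy kappa) = pair_energy kappa ->
  event_weight (pair_energy kappa) J ^+ 2 <=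
  event_weight (pair_energy kappa) (keep_left J) * event_weight (pair_energy kappa) (keep_right J).
Proof.
move=> k0 sA; set A := pair_energy kappa.
have W0 s : 0 <= opexp A s s by apply: ltW; exact: exp_diag_gt0.
pose ev (m : H -> T) (u : cf H) : bool :=
  [forall h, (m h \in J) ==> (if tpart h is Some h' then E (u h) (u h') else true)].
pose f u : R := (ev l u)%:R; pose g u : R := (ev r u)%:R.
(* Dropping the cut pairs only enlarges the event; what remains is a product of a condition on the
   left half and one on the right half. *)
have le1 : event_weight A J <=
    \sum_s f (split_conf s).1 * g (split_conf s).2 * opexp A s s.
  rewrite /event_weight big_mkcond /=; apply: ler_sum => s _.
  case: ifP => [/forall_inP h|_]; last by rewrite !mulr_ge0.
  have e1 : ev l (split_conf s).1.
    apply/forallP => x; apply/implyP => /h; case tx : (tpart x) => [x'|] //.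
    by rewrite !ffunE tau_l ?tx.
  have e2 : ev r (split_conf s).2.
    apply/forallP => x; apply/implyP => /h; case tx : (tpart x) => [x'|] //.
    by rewrite !ffunE tau_r ?tx.
  by rewrite /f /g e1 e2 !mul1r.
have ge (m : H -> T) (K : {set T}) :
    (forall t, t \in K -> exists h, [/\ (t == l h) || (t == r h), m h \in J & tpart h]) ->
    \sum_s (ev m (split_conf s).1)%:R * (ev m (split_conf s).2)%:R * opexp A s s <= event_weight A K.
  move=> hK; rewrite /event_weight [leRHS]big_mkcond /=; apply: ler_sum => s _.
  case e1 : (ev m (split_conf s).1); last by rewrite !mul0r; case: ifP.
  case e2 : (ev m (split_conf s).2); last by rewrite mulr0 mul0r; case: ifP.
  suff -> : pair_event K s by rewrite !mul1r.
  apply/forall_inP => t /hK [h [/orP[]/eqP-> mh th]].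
    have /forallP/(_ h) := e1; rewrite mh /=; case tx : (tpart h) th => [x'|] //.
    by rewrite !ffunE tau_l ?tx.
  have /forallP/(_ h) := e2; rewrite mh /=; case tx : (tpart h) th => [x'|] //.
  by rewrite !ffunE tau_r ?tx.
have K1 t : t \in keep_left J -> exists h, [/\ (t == l h) || (t == r h), l h \in J & tpart h].
  by rewrite inE => /existsP[h /andP[/andP[h1 h2] h3]]; exists h.
have K2 t : t \in keep_right J -> exists h, [/\ (t == l h) || (t == r h), r h \in J & tpart h].
  by rewrite inE => /existsP[h /andP[/andP[h1 h2] h3]]; exists h.
apply: le_trans (_ : (\sum_s f (split_conf s).1 * g (split_conf s).2 * opexp A s s) ^+ 2 <= _).
  apply: lerXn2r; rewrite ?nnegrE //.
    by apply: sumr_ge0 => s _.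
  by apply: sumr_ge0 => s _; rewrite !mulr_ge0.
apply: le_trans (reflection_positivity f g k0) _.
apply: ler_pM (ge l _ K1) (ge r _ K2); apply: sumr_ge0 => s _; by rewrite !mulr_ge0.
Qed.

End ReflectionPositivity.

(** * Edges and reflections of the torus *)

Section TorusGeometry.
Variable N : nat.
Hypothesis evN : ~~ odd N.

(* Directions are booleans ([false] = e1, [true] = e2); [mk d x y] has coordinate [x] in
   direction [d] and [y] in the other one. *)
Definition cd (d : bool) (r : site N) : 'I_N := if d then r.2 else r.1.
Definition mk (d : bool) (x y : 'I_N) : site N := if d then (y, x) else (x, y).

Lemma mk_cd d r : mk d (cd d r) (cd (~~ d) r) = r.
Proof. by case: d; case: r. Qed.
Lemma cd_mk d x y : cd d (mk d x y) = x. Proof. by case: d. Qed.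
Lemma cdN_mk d x y : cd (~~ d) (mk d x y) = y. Proof. by case: d. Qed.

(* [nbr p] pairs [x] with [x + 1] for [x] of parity [p]: [p = false] gives the x-edges of a line
   of the torus, [p = true] its z-edges. *)
Definition nbr (p : bool) (x : 'I_N) : 'I_N := if odd x == p then ordS x else ord_pred x.

Lemma val_ordS (x : 'I_N) : ordS x = (x.+1 %% N)%N :> nat. Proof. by []. Qed.
Lemma val_ord_pred (x : 'I_N) : ord_pred x = ((x + N).-1 %% N)%N :> nat. Proof. by []. Qed.

Lemma odd_modN a : odd (a %% N) = odd a.
Proof. by rewrite odd_mod // (negPf evN). Qed.

Lemma odd_nbr p x : odd (nbr p x) = ~~ odd x.
Proof.
have N0 : (0 < N)%N by exact: leq_ltn_trans (leq0n _) (ltn_ord x).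
rewrite /nbr; case: ifP => _; first by rewrite val_ordS odd_modN.
by rewrite val_ord_pred odd_modN; move: evN; lia.
Qed.

Lemma nbrK p : involutive (nbr p).
Proof.
move=> x; rewrite {1}/nbr odd_nbr; rewrite /nbr; case: ifP => /eqP e1.
  by case: eqP => [e2|_]; [move: e1; rewrite e2; case: (p)|rewrite ord_predK].
case: eqP => [_|]; first by rewrite ordSK.
by move: e1; case: (odd x); case: p.
Qed.

(** The index is a direction together with an edge type. The four involutions lead to the four
    neighbours of a site, and each exchanges the ends of all edges of its direction and type. *)
Definition edge_inv (i : bool * bool) (r : site N) : site N :=
  mk i.1 (nbr i.2 (cd i.1 r)) (cd (~~ i.1) r).

Lemma invK i : involutive (edge_inv i).
Proof. by move=> r; rewrite /edge_inv cd_mk cdN_mk nbrK mk_cd. Qed.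

Lemma inv_neq i r : edge_inv i r != r.
Proof.
apply/eqP => /(congr1 (fun t => odd (cd i.1 t))); rewrite /edge_inv cd_mk odd_nbr.
by case: odd.
Qed.

Definition omod (x : 'I_N) (k : nat) : 'I_N :=
  Ordinal (ltn_pmod k (leq_ltn_trans (leq0n _) (ltn_ord x))).

Definition halftorus : finType := ('I_(N./2) * 'I_N)%type.
(** The axis separates the coordinates [c - 1] and [c] in direction [d] and cuts the torus once more
    on the opposite side. The mirror image of [c + k] is [c - 1 - k]; the added [N] keeps the
    natural subtraction exact. *)
Definition lhalf (d : bool) (c : 'I_N) (h : halftorus) : site N := mk d (omod c (c + h.1)) h.2.
Definition rhalf (d : bool) (c : 'I_N) (h : halftorus) : site N := mk d (omod c (c + N - 1 - h.1)) h.2.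

Definition hup (k : 'I_(N./2)) : option 'I_(N./2) := insub k.+1.
Definition hdown (k : 'I_(N./2)) : option 'I_(N./2) := if (k : nat) is k'.+1 then insub k' else None.

(** [None] occurs only in the reflected direction, at the ends [k = 0] and [k = N/2 - 1] of a
    half. *)
Definition hpart (d : bool) (c : 'I_N) (i : bool * bool) (h : halftorus) : option halftorus :=
  if i.1 == d then
    omap (fun k => (k, h.2)) (if odd (c + h.1) == i.2 then hup h.1 else hdown h.1)
  else Some (h.1, nbr i.2 h.2).

Lemma mk_inj d x y x' y' : mk d x y = mk d x' y' -> x = x' /\ y = y'.
Proof. by case: d => -[-> ->]. Qed.

Lemma half_bij d c :
  bijective (fun x : halftorus + halftorus => match x with inl h => lhalf d c h | inr h => rhalf d c h end).
Proof.
have N0 : (0 < N)%N by exact: leq_ltn_trans (leq0n _) (ltn_ord c).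
have N2 : (N = N./2 + N./2)%N by rewrite addnn even_halfK.
apply: inj_card_bij; last first.
  by rewrite card_sum !card_prod !card_ord -mulnDl -N2.
have ll (k k' : 'I_(N./2)) : ((c + k) %% N = (c + k') %% N)%N -> k = k'.
  move/eqP; rewrite eqn_modDl !modn_small => [/eqP/val_inj //||]; have := ltn_ord k; have := ltn_ord k'; lia.
have rr (k k' : 'I_(N./2)) : ((c + N - 1 - k) %% N = (c + N - 1 - k') %% N)%N -> k = k'.
  have h1 := ltn_ord k; have h2 := ltn_ord k'.
  have -> : (c + N - 1 - k = c + (N - 1 - k))%N by lia.
  have -> : (c + N - 1 - k' = c + (N - 1 - k'))%N by lia.
  move/eqP; rewrite eqn_modDl !modn_small => [/eqP e||]; try lia.
  by apply: val_inj => /=; lia.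
have lr (k k' : 'I_(N./2)) : ((c + k) %% N = (c + N - 1 - k') %% N)%N -> False.
  have h1 := ltn_ord k; have h2 := ltn_ord k'.
  have -> : (c + N - 1 - k' = c + (N - 1 - k'))%N by lia.
  move/eqP; rewrite eqn_modDl !modn_small; try lia.
move=> [[k y]|[k y]] [[k' y']|[k' y']] /mk_inj [/(congr1 val) /= e ->].
- by rewrite (ll _ _ e).
- by case: (lr _ _ e).
- by case: (lr _ _ (esym e)).
- by rewrite (rr _ _ e).
Qed.

Lemma hupE k k' : hup k = Some k' -> k' = k.+1 :> nat.
Proof. by rewrite /hup; case: insubP => // u _ e [<-]. Qed.
Lemma hupN (k : 'I_(N./2)) : hup k = None -> k.+1 = N./2.
Proof. by clear evN; rewrite /hup; case: insubP => // h _; have := ltn_ord k; move: h; lia. Qed.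
Lemma hdownE (k k' : 'I_(N./2)) : hdown k = Some k' -> k = k'.+1 :> nat.
Proof.
rewrite /hdown; case e : (k : nat) => [|j] //.
by case: insubP => // u _ e' [<-]; rewrite e'.
Qed.
Lemma hdownN (k : 'I_(N./2)) : hdown k = None -> k = 0%N :> nat.
Proof.
clear evN.
rewrite /hdown; case e : (k : nat) => [|j] //.
by case: insubP => // h _; have := ltn_ord k; move: h; rewrite e; lia.
Qed.

Lemma nbr_omod p c a : nbr p (omod c a) = omod c (if odd a == p then a.+1 else (a + N.-1)%N).
Proof.
have N0 : (0 < N)%N by exact: leq_ltn_trans (leq0n _) (ltn_ord c).
rewrite /nbr /= odd_modN; case: ifP => _; apply: val_inj => /=.
  by rewrite -addn1 modnDml addn1.
have -> : ((a %% N + N).-1 = a %% N + N.-1)%N by lia.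
by rewrite modnDml.
Qed.

Lemma omodDN c a : omod c (a + N)%N = omod c a.
Proof. by apply: val_inj => /=; rewrite modnDr. Qed.
Arguments omodDN : clear implicits.

Lemma inv_lhalf d c i h :
  edge_inv i (lhalf d c h) = if hpart d c i h is Some h' then lhalf d c h' else rhalf d c h.
Proof.
have N0 : (0 < N)%N by exact: leq_ltn_trans (leq0n _) (ltn_ord c).
have N2 : (N = N./2 + N./2)%N by rewrite addnn even_halfK.
case: h => k y; case: i => d' p; rewrite /edge_inv /hpart /=; case: (eqVneq d' d) => [->|nd].
  rewrite /lhalf cd_mk cdN_mk nbr_omod /=; have hk := ltn_ord k.
  case: ifP => _.
    case e : (hup k) => [k'|] /=.
      by rewrite (hupE e) addnS.
    rewrite /rhalf /=; have e' := hupN e.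
    by have -> : ((c + k).+1 = c + N - 1 - k)%N by lia.
  case e : (hdown k) => [k'|] /=.
    have e' := hdownE e; rewrite -(omodDN c (c + k')).
    by have -> : (c + k + N.-1 = c + k' + N)%N by lia.
  rewrite /rhalf /=; have e' := hdownN e.
  by have -> : (c + k + N.-1 = c + N - 1 - k)%N by lia.
have -> : d' = ~~ d by move: nd; case: d; case: d'.
by rewrite /lhalf cdN_mk negbK cd_mk; case: (d).
Qed.

(** The mirror exchanges successor and predecessor and also flips the parity of the coordinate, [N]
    being even, so it preserves the type of every edge. *)
Lemma inv_rhalf d c i h :
  edge_inv i (rhalf d c h) = if hpart d c i h is Some h' then rhalf d c h' else lhalf d c h.
Proof.
have N0 : (0 < N)%N by exact: leq_ltn_trans (leq0n _) (ltn_ord c).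
have N2 : (N = N./2 + N./2)%N by rewrite addnn even_halfK.
case: h => k y; case: i => d' p; rewrite /edge_inv /hpart /=; case: (eqVneq d' d) => [->|nd].
  rewrite /rhalf cd_mk cdN_mk nbr_omod /=; have hk := ltn_ord k.
  have -> : odd (c + N - 1 - k) = ~~ odd (c + k) by move: evN; lia.
  have -> : (~~ odd (c + k) == p) = ~~ (odd (c + k) == p) by case: odd; case: p.
  case: (odd (c + k) == p) => /=.
    case e : (hup k) => [k'|] /=.
      have e' := hupE e; rewrite -(omodDN c (c + N - 1 - k')).
      have hk' := ltn_ord k'.
      by have -> : (c + N - 1 - k + N.-1 = c + N - 1 - k' + N)%N by lia.
    rewrite /lhalf /= -(omodDN c (c + k)); have e' := hupN e.
    by have -> : (c + N - 1 - k + N.-1 = c + k + N)%N by lia.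
  case e : (hdown k) => [k'|] /=.
    have e' := hdownE e.
    by have -> : ((c + N - 1 - k).+1 = c + N - 1 - k')%N by lia.
  rewrite /lhalf /= -(omodDN c (c + k)); have e' := hdownN e.
  by have -> : ((c + N - 1 - k).+1 = c + k + N)%N by lia.
have -> : d' = ~~ d by move: nd; case: d; case: d'.
by rewrite /rhalf cdN_mk negbK cd_mk; case: (d).
Qed.

End TorusGeometry.

(** * The Hamiltonian as a sum over pairs *)

Section Model.
Context {R : realType}.
Variables (n N : nat).
Hypothesis evN : ~~ odd N.
Notation cf := {ffun site N -> 'I_n.+1}.

Definition spinloc (i : bool * bool) : 'I_n.+1 -> 'I_n.+1 -> R :=
  if i.2 then Szloc R n else Sxloc R n.

(* [energy b] is [- beta H] with [b = beta J]; every edge is counted from both of its ends. *)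
Definition energy (b : R) : cf -> cf -> R :=
  pair_energy spinloc (@edge_inv N) (b / (2 * spinS R n ^+ 2)).

Lemma Sxloc_sym : optrans (Sxloc R n) = Sxloc R n.
Proof.
apply/funext => a; apply/funext => c.
rewrite /optrans /Sxloc /opscale /opadd /Splusloc /Sminusloc addrC; congr (_ * (_ + _)).
  case: eqP => // e; congr Num.sqrt; rewrite /Mval e -natr1; ring.
case: eqP => // e; congr Num.sqrt; rewrite /Mval e -natr1; ring.
Qed.

Lemma Szloc_sym : optrans (Szloc R n) = Szloc R n.
Proof.
by apply/funext => a; apply/funext => c; rewrite /optrans /Szloc eq_sym; case: eqP => // ->.
Qed.

Lemma spinloc_sym i : optrans (spinloc i) = spinloc i.
Proof. by rewrite /spinloc; case: i.2; rewrite ?Szloc_sym ?Sxloc_sym. Qed.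

Lemma pair_term_sym i (r : site N) :
  optrans (opmul (atpoint (spinloc i) r) (atpoint (spinloc i) (edge_inv i r))) =
  opmul (atpoint (spinloc i) r) (atpoint (spinloc i) (edge_inv i r)).
Proof.
rewrite optransM !atpoint_trans spinloc_sym; apply: atpoint_comm; exact: inv_neq.
Qed.

Lemma energy_sym b : optrans (energy b) = energy b.
Proof.
apply/funext => s; apply/funext => t; rewrite /energy /pair_energy /optrans.
congr (_ * _); apply: eq_bigr => r _; apply: eq_bigr => i _.
by rewrite -[in LHS]pair_term_sym.
Qed.

Lemma sum_inv_halves (i : bool * bool) (q : bool) (F : site N -> site N -> R) :
  (forall r r', r != r' -> F r r' = F r' r) ->
  \sum_r F r (edge_inv i r) = 2 * \sum_(r | odd (cd i.1 r) == q) F r (edge_inv i r).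
Proof.
move=> Fs; rewrite (bigID (fun r => odd (cd i.1 r) == q)) /=.
rewrite [X in _ + X](reindex_inj (inv_inj (invK evN i))) /=.
have -> : \sum_(j | odd (cd i.1 (edge_inv i j)) != q) F (edge_inv i j) (edge_inv i (edge_inv i j)) =
   \sum_(r | odd (cd i.1 r) == q) F r (edge_inv i r).
  apply: eq_big => [r|r _]; first by rewrite /edge_inv cd_mk odd_nbr //; case: odd; case: q.
  by rewrite invK // Fs // inv_neq.
by rewrite -mulr2n mulr_natl.
Qed.

(** The Hamiltonian lists an edge from one end only, [pair_energy] from both, whence the factor 1/2.
    The symmetry of [X] and [Z] stands for the commutation of operators at distinct sites. *)
Lemma edge_sumE (X Z : site N -> site N -> R) (a c : R) :
  (forall r r', r != r' -> X r r' = X r' r) -> (forall r r', r != r' -> Z r r' = Z r' r) ->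
  a * (- c * \sum_(r : site N) ((if ~~ odd r.1 then X r (e1shift r) else 0) +
                      (if ~~ odd r.2 then X r (e2shift r) else 0))
       - c * \sum_(r : site N) ((if odd r.1 then Z r (e1shift r) else 0) +
                      (if odd r.2 then Z r (e2shift r) else 0))) =
  - (a * c / 2) * \sum_r \sum_(i : bool * bool) (if i.2 then Z else X) r (edge_inv i r).
Proof.
move=> Xs Zs; rewrite [in RHS]exchange_big /=.
have term (i : bool * bool) : \sum_r (if i.2 then Z else X) r (edge_inv i r) =
   2 * \sum_r (if odd (cd i.1 r) == i.2 then
       (if i.2 then Z else X) r (mk i.1 (ordS (cd i.1 r)) (cd (~~ i.1) r)) else 0).
  rewrite (@sum_inv_halves i i.2 (if i.2 then Z else X)); last by case: i.2.
  rewrite big_mkcond; congr (_ * _); apply: eq_bigr => r _; case: ifP => // e.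
  by rewrite /edge_inv /nbr e.
rewrite (eq_bigr _ (fun i _ => term i)).
rewrite -(pair_bigA _ (fun d p : bool => 2 * \sum_r (if odd (cd d r) == p then
       (if p then Z else X) r (mk d (ordS (cd d r)) (cd (~~ d) r)) else 0))).
have e1 (q : bool) (F : site N -> R) (d : bool) : \sum_r (if odd (cd d r) == q then F r else 0) = \sum_r (if (if q then odd (cd d r) else ~~ odd (cd d r)) then F r else 0).
  by apply: eq_bigr => r _; case: q; case: odd.
rewrite !big_bool !e1 /= !big_split /= /e1shift /e2shift.
by field.
Qed.

Lemma hamiltonianE (beta J : R) :
  opscale (- beta) (hamiltonian R n N J J) = energy (beta * J).
Proof.
apply/funext => s; apply/funext => t.
pose X r r' := opmul (Sx R n r) (Sx R n r') s t.
pose Z r r' := opmul (Sz R n r) (Sz R n r') s t.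
transitivity (- (- beta * (J / spinS R n ^+ 2) / 2) *
   \sum_r \sum_(i : bool * bool) (if i.2 then Z else X) r (edge_inv i r)).
  apply: edge_sumE => r r' rr'; rewrite /X /Z.
    by rewrite -[Sx R n r]/(atpoint (Sxloc R n) r) -[Sx R n r']/(atpoint (Sxloc R n) r') atpoint_comm.
  by rewrite -[Sz R n r]/(atpoint (Szloc R n) r) -[Sz R n r']/(atpoint (Szloc R n) r') atpoint_comm.
rewrite /energy /pair_energy; congr (_ * _).
  by rewrite [in RHS](invfM 2); ring.
by apply: eq_bigr => r _; apply: eq_bigr => -[d []] _.
Qed.

End Model.

(** * Weights of defect sets under reflections *)

Section Chessboard.
Context {R : realType}.
Variables (n N : nat) (b : R) (E : rel 'I_n.+1) (o : option (bool * bool)).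
Hypothesis evN : ~~ odd N.
Hypothesis b0 : 0 <= b.

(** [None] encodes single-site events and [Some i] events on the pairs joined by an [i]-edge, so one
    development serves both kinds of defects. *)
Definition tau_of (r : site N) : site N := if o is Some i then edge_inv i r else r.
Definition tpart_of (d : bool) (c : 'I_N) (h : halftorus N) : option (halftorus N) :=
  if o is Some i then hpart d c i h else Some h.

Definition torus_weight (J : {set site N}) : R := event_weight tau_of E (energy (n := n) (N := N) b) J.
Definition keepl d c J := keep_left (lhalf d c) (rhalf d c) (tpart_of d c) J.
Definition keepr d c J := keep_right (lhalf d c) (rhalf d c) (tpart_of d c) J.

Lemma torus_weight_cs d c J :
  torus_weight J ^+ 2 <= torus_weight (keepl d c J) * torus_weight (keepr d c J).
Proof.
apply: (@event_weight_cs R n (site N) (halftorus N) (lhalf d c) (rhalf d c) (half_bij evN d c)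
  _ (@spinloc R n) (@edge_inv N) (hpart d c) (inv_lhalf evN d c) (inv_rhalf evN d c)).
- move=> h; rewrite /tau_of /tpart_of; case: o => [i|] //; rewrite inv_lhalf //.
  by case: hpart.
- move=> h; rewrite /tau_of /tpart_of; case: o => [i|] //; rewrite inv_rhalf //.
  by case: hpart.
- by rewrite divr_ge0 // mulr_ge0 // sqr_ge0.
- exact: energy_sym.
Qed.

Lemma exp_energy_gt0 s : 0 < opexp (energy (n := n) (N := N) b) s s.
Proof. by apply: exp_diag_gt0; exact: energy_sym. Qed.

Lemma torus_weight_ge0 J : 0 <= torus_weight J.
Proof. by apply: sumr_ge0 => s _; apply: ltW; exact: exp_energy_gt0. Qed.

Lemma torus_weight0 : torus_weight set0 = optr (opexp (energy (n := n) (N := N) b)).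
Proof.
rewrite /torus_weight /event_weight /optr; apply: eq_bigl => s.
by apply/forall_inP => q; rewrite inE.
Qed.

Lemma torus_weight0_gt0 : 0 < torus_weight set0.
Proof.
by rewrite torus_weight0; apply: optr_exp_gt0; [exact: [ffun=> ord0]|exact: energy_sym].
Qed.

Definition lost_half d c (m : halftorus N -> site N) (J : {set site N}) : nat :=
  #|[set h | (m h \in J) && ~~ tpart_of d c h]|.

(** A retained event of one half appears twice in the reflected set, so an exponential tilt in the
    cardinality pays only for the lost events. *)
Lemma card_keep d c J :
  (#|keepl d c J| + #|keepr d c J| + 2 * (lost_half d c (lhalf d c) J + lost_half d c (rhalf d c) J)
   = 2 * #|J|)%N.
Proof.
have bij := half_bij evN d c.
have li := l_inj bij; have ri := r_inj bij.
have nlr h h' := lr_neq bij h h'.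
have card2 (K : {set site N}) (S : {set halftorus N}) :
    (forall t, (t \in K) = [exists h, ((t == lhalf d c h) || (t == rhalf d c h)) && (h \in S)]) ->
    #|K| = (2 * #|S|)%N.
  move=> hK.
  have -> : K = (lhalf d c @: S) :|: (rhalf d c @: S).
    apply/setP => t; rewrite hK in_setU; apply/existsP/orP.
      by move=> [h /andP[/orP[]/eqP-> hS]]; [left|right]; apply: imset_f.
    by move=> [] /imsetP[h hS ->]; exists h; rewrite eqxx ?orbT hS.
  rewrite cardsU (_ : _ :&: _ = set0) ?cards0 ?subn0.
    by rewrite !card_imset // addnn mul2n.
  apply/setP => t; rewrite !inE; apply/negP => /andP[/imsetP[h _ ->] /imsetP[h' _ e]].
  by have := nlr h h'; rewrite e eqxx.
rewrite (card2 _ [set h | (lhalf d c h \in J) && tpart_of d c h]); last first.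
  by move=> t; rewrite inE; apply: eq_existsb => h; rewrite inE andbA.
rewrite (card2 (keepr d c J) [set h | (rhalf d c h \in J) && tpart_of d c h]); last first.
  by move=> t; rewrite inE; apply: eq_existsb => h; rewrite inE andbA.
have split (m : halftorus N -> site N) : (#|[set h | (m h \in J) && tpart_of d c h]| + lost_half d c m J =
   #|[set h | m h \in J]|)%N.
  rewrite /lost_half -!sum1dep_card (bigID (fun h => isSome (tpart_of d c h)) (fun h => m h \in J)) /=.
  by [].
have -> : #|J| = (#|[set h | lhalf d c h \in J]| + #|[set h | rhalf d c h \in J]|)%N.
  rewrite -!sum1dep_card -sum1_card.
  rewrite (reindex (fun x : halftorus N + halftorus N => match x with inl h => lhalf d c h | inr h => rhalf d c h end)) /=; last exact: onW_bij.
  by rewrite big_sumType.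
by have := split (lhalf d c); have := split (rhalf d c); lia.
Qed.

Lemma keepl_in d c (J : {set site N}) h : lhalf d c h \in J -> tpart_of d c h ->
  (lhalf d c h \in keepl d c J) /\ (rhalf d c h \in keepl d c J).
Proof.
by move=> hJ th; split; rewrite inE; apply/existsP; exists h; rewrite eqxx ?orbT hJ th.
Qed.

Definition run (d : bool) (Y : pred 'I_N) (c : 'I_N) (K : nat) (J : {set site N}) :=
  forall k y, (k < K)%N -> Y y -> mk d (omod c (c + k)) y \in J.

(** Reflecting [K] columns on one side of the axis adds their [K] mirror columns on the other: the
    run doubles and its start moves back by [K]. *)
Lemma keepl_run d Y (c : 'I_N) K J : (K <= N./2)%N -> run d Y c K J ->
  (forall h : halftorus N, (h.1 < K)%N -> tpart_of d c h) ->
  run d Y (omod c (c + N - K)) (2 * K) (keepl d c J).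
Proof.
move=> K2 rJ tp k y k2 Yy.
have N2 : (N = N./2 + N./2)%N by rewrite addnn even_halfK.
have [kK|Kk] := ltnP k K.
  have hlt : (K - 1 - k < N./2)%N by lia.
  pose h : halftorus N := (Ordinal hlt, y).
  have hK : (h.1 < K)%N by rewrite /=; lia.
  have [|_] := @keepl_in d c J h _ (tp h hK); first exact: rJ.
  suff -> : rhalf d c h = mk d (omod (omod c (c + N - K)) (omod c (c + N - K) + k)) y by [].
  rewrite /rhalf; congr (mk d _ _); apply: val_inj => /=.
  rewrite modnDml; congr (modn _ N); have := ltn_ord c; lia.
have hlt : (k - K < N./2)%N by lia.
pose h : halftorus N := (Ordinal hlt, y).
have hK : (h.1 < K)%N by rewrite /=; lia.
have [|+ _] := @keepl_in d c J h _ (tp h hK); first exact: rJ.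
suff -> : lhalf d c h = mk d (omod (omod c (c + N - K)) (omod c (c + N - K) + k)) y by [].
rewrite /lhalf; congr (mk d _ _); apply: val_inj => /=.
rewrite modnDml -[in LHS](modnDr (c + (k - K))); congr (modn _ N); lia.
Qed.

Variables (e : R).
Hypothesis e1 : 1 <= e.

(** The estimate for all sets is reduced to locating a maximizer, [e] being the inverse of the
    target factor per event: if the maximum does not exceed the value at the empty set, every [J]
    has weight at most [e ^- #|J|] times the partition function. *)
Definition tilted (J : {set site N}) : R := torus_weight J * e ^+ #|J|.

Lemma tilted_ge0 J : 0 <= tilted J.
Proof. by rewrite mulr_ge0 ?torus_weight_ge0 // exprn_ge0 // (le_trans ler01). Qed.

Lemma tilted_cs d c J :
  tilted J ^+ 2 <= tilted (keepl d c J) * tilted (keepr d c J) *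
   e ^+ (2 * (lost_half d c (lhalf d c) J + lost_half d c (rhalf d c) J)).
Proof.
rewrite /tilted exprMn -exprM mulnC -(card_keep d c J).
set ls := (2 * _)%N; rewrite exprD [e ^+ (#|_| + _)]exprD.
have -> : torus_weight (keepl d c J) * e ^+ #|keepl d c J| * (torus_weight (keepr d c J) * e ^+ #|keepr d c J|) * e ^+ ls
  = torus_weight (keepl d c J) * torus_weight (keepr d c J) * (e ^+ #|keepl d c J| * e ^+ #|keepr d c J| * e ^+ ls).
  by move: (torus_weight _) (torus_weight _) (e ^+ _) (e ^+ _) (e ^+ _) => *; ring.
apply: ler_wpM2r (torus_weight_cs d c J).
by rewrite !mulr_ge0 // exprn_ge0 // (le_trans ler01).
Qed.

Definition maximal_tilt (J : {set site N}) := forall J', tilted J' <= tilted J.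

Lemma exists_maximal_tilt : exists J, maximal_tilt J.
Proof.
have [J _ hJ] := @arg_maxP _ _ _ set0 predT tilted isT.
by exists J => J'; exact: hJ.
Qed.

Lemma maximal_tilt_gt0 J : maximal_tilt J -> 0 < tilted J.
Proof.
move=> mJ; apply: lt_le_trans (mJ set0).
by rewrite /tilted cards0 expr0 mulr1 torus_weight0_gt0.
Qed.

(** Without lost events the square of the value at [J] is at most the product of the values at the
    two reflected sets; neither exceeds the maximum, so the left one attains it. *)
Lemma maximal_keepl d c J : (forall h, tpart_of d c h) -> maximal_tilt J -> maximal_tilt (keepl d c J).
Proof.
move=> tp mJ J'; apply: le_trans (mJ J') _.
have lost0 m : lost_half d c m J = 0%N.
  by apply/eqP; rewrite cards_eq0; apply/eqP/setP => h; rewrite !inE tp andbF.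
have := tilted_cs d c J; rewrite !lost0 /= expr0 mulr1 => h.
have M0 := maximal_tilt_gt0 mJ.
rewrite -(ler_pM2r M0) -expr2; apply: le_trans h _.
by apply: ler_wpM2l (mJ _); exact: tilted_ge0.
Qed.

Lemma run_sub d Y c K K' J : (K' <= K)%N -> run d Y c K J -> run d Y c K' J.
Proof. by move=> h r k y kK; apply: r; exact: leq_trans kK h. Qed.

(* Doubling: a maximal set containing one line contains, after reflections, all parallel lines. *)
Lemma maximal_spread d (Y : pred 'I_N) (x0 : 'I_N) J :
  (forall c h, tpart_of d c h) -> maximal_tilt J ->
  (forall y, Y y -> mk d x0 y \in J) ->
  exists2 J', maximal_tilt J' & forall x y, Y y -> mk d x y \in J'.
Proof.
move=> tp mJ hJ.
(* A run longer than half the torus would not fit on one side of the axis. The cap makes the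
   doubling work for every even [N]. *)
have claim t : exists2 J', maximal_tilt J' & exists c, run d Y c (minn (2 ^ t) N./2) J'.
  elim: t => [|t [J' mJ' [c rJ']]].
    exists J => //; exists x0; apply: (@run_sub _ _ _ 1%N); first by rewrite expn0 geq_minl.
    move=> k y; rewrite ltnS leqn0 => /eqP -> /hJ; rewrite addn0.
    by suff -> : omod x0 x0 = x0 by []; apply: val_inj; rewrite /= modn_small.
  exists (keepl d c J'); first exact: maximal_keepl.
  exists (omod c (c + N - minn (2 ^ t) N./2)).
  apply: run_sub (keepl_run _ rJ' _) => //; last exact: geq_minr.
  by rewrite expnS; lia.
have [J' mJ' [c rJ']] := claim N.
have minE : minn (2 ^ N) N./2 = N./2.
  by apply/minn_idPr; by apply: leq_trans (ltnW (ltn_expl N _)) => //; rewrite -[leqRHS]even_halfK // -addnn leq_addr.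
rewrite minE in rJ'.
(* A run that fills one half is reflected onto the whole torus. *)
exists (keepl d c J'); first exact: maximal_keepl.
move=> x y Yy; have [g gK Kg] := half_bij evN d c.
have all (k : 'I_(N./2)) y' : Y y' -> (lhalf d c (k, y') \in keepl d c J') /\ (rhalf d c (k, y') \in keepl d c J').
  by move=> Yy'; apply: keepl_in => //; exact: rJ'.
rewrite -(Kg (mk d x y)); case eg : (g (mk d x y)) => [[k y']|[k y']];
  have := Kg (mk d x y); rewrite eg /= => ek;
  have -> : y' = y by move: ek => /(congr1 (cd (~~ d))); rewrite !cdN_mk.
  by have [] := all k y Yy.
by have [] := all k y Yy.
Qed.

End Chessboard.

(** * Chessboard estimate for single-site events *)

Section SingleSiteChessboard.
Context {R : realType}.
Variables (n N : nat) (b : R) (E : rel 'I_n.+1).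
Hypothesis evN : ~~ odd N.
Hypothesis b0 : 0 <= b.

(** A non-empty maximizer spreads along a line and then over the torus, so the full pattern is a
    maximizer too, and the hypothesis bounds it by the empty one. *)
Theorem chessboard_site (eps : R) : 0 < eps -> eps <= 1 ->
  torus_weight b E None [set: site N] <= eps ^+ (N ^ 2) * torus_weight (N := N) b E None set0 ->
  forall J : {set site N}, torus_weight b E None J <= eps ^+ #|J| * torus_weight (N := N) b E None set0.
Proof.
move=> e0 e1 full.
have ei : 1 <= eps^-1 by rewrite invf_ge1.
have [J mJ] := @exists_maximal_tilt R n N b E None eps^-1.
suff hJ : tilted (N := N) b E None eps^-1 J <= torus_weight (N := N) b E None set0.
  move=> J'; have := le_trans (mJ J') hJ; rewrite /tilted.
  by rewrite exprVn ler_pdivrMr ?exprn_gt0 // mulrC.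
have [->|[r0 r0J]] := set_0Vmem J; first by rewrite /tilted cards0 expr0 mulr1.
have tp d (c : 'I_N) h : tpart_of None d c h by [].
have [|J1 mJ1 h1] := maximal_spread (d := false) (Y := pred1 (cd true r0)) (x0 := cd false r0) evN b0 ei (tp false) mJ.
  by move=> y /eqP ->; rewrite (mk_cd false).
have [|J2 mJ2 h2] := maximal_spread (d := true) (Y := predT) (x0 := cd true r0) evN b0 ei (tp true) mJ1.
  by move=> y _; exact: (h1 y (cd true r0) (eqxx _)).
have J2T : J2 = setT by apply/setP => r; rewrite inE -(mk_cd true r) h2.
apply: le_trans (mJ2 J) _; rewrite J2T /tilted cardsT card_prod !card_ord mulnn.
by rewrite exprVn ler_pdivrMr ?exprn_gt0 // mulrC.
Qed.

End SingleSiteChessboard.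

(** * Chessboard estimate for pair events *)

Lemma double_loss_exponent (N q : nat) : (0 < q)%N ->
  (4 * N * (2 * q - 1) = 4 * N * (q - 1) * 2 + 4 * N)%N.
Proof.
move=> q0; have -> : (2 * q - 1 = (q - 1) * 2 + 1)%N by lia.
by rewrite mulnDr muln1 mulnA.
Qed.

Lemma final_exponent_le (N q : nat) : (N < 2 * (2 * q))%N ->
  (N ^ 2 + 4 * N * (q - 1) <= 5 * (2 * q * N))%N.
Proof.
move=> hq; rewrite -mulnn.
have h1 : (N * N <= N * (4 * q))%N by rewrite leq_mul2l; apply/orP; right; lia.
have h2 : (4 * N * (q - 1) <= 4 * N * q)%N by rewrite leq_mul2l leq_subr orbT.
by lia.
Qed.

Section PairChessboard.
Context {R : realType}.
Variables (n N : nat) (b : R) (E : rel 'I_n.+1) (i : bool * bool).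
Hypothesis evN : ~~ odd N.
Hypothesis N4 : (4 <= N)%N.
Hypothesis b0 : 0 <= b.
Hypothesis Esym : symmetric E.

Notation W := (torus_weight (N := N) b E (Some i)).

Lemma torus_weight_closure J : W (J :|: edge_inv i @: J) = W J.
Proof.
rewrite /torus_weight /event_weight; apply: eq_bigl => s.
apply/forall_inP/forall_inP => h q qJ; first by apply: h; rewrite inE qJ.
move: qJ; rewrite inE => /orP[/h //|/imsetP[q' q'J ->]].
by rewrite /tau_of invK // Esym; exact: h.
Qed.

Lemma hpart_same (c : 'I_N) K (h : halftorus N) : (K <= N./2)%N -> ~~ odd K -> odd c = i.2 ->
  (h.1 < K)%N -> hpart i.1 c i h.
Proof.
case: h => k y K2 oK oc /= hK; rewrite /hpart eqxx /=.
case: ifP => /eqP oh.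
  have ek : ~~ odd k by move: oh; rewrite oddD oc; case: (i.2); case: odd.
  by case e : (hup k) => [k'|] //; have := hupN e; lia.
case e : (hdown k) => [k'|] //; have := hdownN e => e'.
by exfalso; apply: oh; rewrite e' addn0.
Qed.

(** An axis with [odd c = i.2] cuts no [i]-pair on its near side, so events are lost only in the
    last column of each half, next to the opposite cut. *)
Lemma lost_le (c : 'I_N) (m : halftorus N -> site N) J : odd c = i.2 ->
  (lost_half (Some i) i.1 c m J <= N)%N.
Proof.
move=> oc; have N0 : (0 < N)%N by exact: leq_ltn_trans (leq0n _) (ltn_ord c).
have N2 : (0 < N./2)%N by move: N4; lia.
have lt : (N./2.-1 < N./2)%N by lia.
rewrite /lost_half -[X in (_ <= X)%N](card_ord N) -(cardsT 'I_N).
rewrite -(card_imset [set: 'I_N] (f := fun y => (Ordinal lt, y) : halftorus N)); last by move=> y y' [].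
apply: subset_leq_card; apply/fintype.subsetP => -[k y]; rewrite inE => /andP[_].
rewrite /tpart_of /hpart eqxx; case: ifP => /eqP oh.
  case e : (hup (k, y).1) => [k'|] // _; apply/imsetP; exists y => //; congr (_, _).
  by apply: val_inj => /=; have /= := hupN e; lia.
case e : (hdown (k, y).1) => [k'|] // _; have /= e' := hdownN e.
by exfalso; apply: oh; rewrite /= e' addn0.
Qed.

(** Perpendicular to the pairs, reflections lose nothing, and a maximizer contains two full adjacent
    columns. Along the pairs a doubling may lose events at the opposite cut, up to [4 * N] in the
    exponent, so maximality is not preserved: after [t] doublings the value is still at least
    [M * eps ^ (4 * N * (2 ^ t - 1))]. In [eps ^ (6 * #|J|)] one power per event is spent on the
    tilt, the other five pay for these losses and for [D ^ (N ^ 2)]. *)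
Theorem chessboard_pair (eps D : R) : 0 < eps -> eps <= 1 -> 0 <= D -> D * eps <= 1 ->
  (forall J, W J <= D ^+ (N ^ 2) * eps ^+ (6 * #|J|) * W set0) ->
  forall J, W J <= eps ^+ #|J| * W set0.
Proof.
move=> e0 e1 D0 De direct.
have ei : 1 <= eps^-1 by rewrite invf_ge1.
pose F := tilted (N := N) b E (Some i) eps^-1.
have [J0 mJ0] := @exists_maximal_tilt R n N b E (Some i) eps^-1.
set M := F J0.
have M0 : 0 < M by exact: maximal_tilt_gt0.
have FM J : F J <= M by exact: mJ0.
have F0 J : 0 <= F J by exact: tilted_ge0.
suff hM : M <= W set0.
  move=> J; have := le_trans (FM J) hM; rewrite /F /tilted.
  by rewrite exprVn ler_pdivrMr ?exprn_gt0 // mulrC.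
have [e|[r0 r0J]] := set_0Vmem J0; first by rewrite /M /F e /tilted cards0 expr0 mulr1.
have tp (c : 'I_N) h : tpart_of (Some i) (~~ i.1) c h.
  by rewrite /tpart_of /hpart; case: (i.1).
have [|J1 mJ1 h1] := maximal_spread (d := ~~ i.1) (Y := pred1 (cd i.1 r0)) (x0 := cd (~~ i.1) r0) evN b0 ei tp mJ0.
  by move=> y /eqP ->; rewrite (_ : mk _ _ _ = r0) //; case: (i.1); case: (r0).
pose J2 := J1 :|: edge_inv i @: J1.
have FJ2 : M <= F J2.
  apply: le_trans (mJ1 J0) _; rewrite /F /tilted torus_weight_closure.
  apply: ler_wpM2l; first exact: torus_weight_ge0.
  by apply: ler_weXn2l => //; apply: subset_leq_card; exact: subsetUl.
set x0 := cd i.1 r0.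
have col x y : x = x0 \/ x = nbr i.2 x0 -> mk i.1 x y \in J2.
  have hx0 : mk i.1 x0 y \in J1.
    have -> : mk i.1 x0 y = mk (~~ i.1) y x0 by case: (i.1).
    by apply: h1; exact: eqxx.
  case=> ->; rewrite inE; first by rewrite hx0.
  apply/orP; right; apply/imsetP; exists (mk i.1 x0 y) => //.
  by rewrite /edge_inv cd_mk cdN_mk.
have start : exists2 c : 'I_N, odd c = i.2 & run i.1 predT c 2 J2.
  have [oc|oc] := eqVneq (odd x0) i.2.
    exists x0 => // -[|[|k]] // y _ _; apply: col.
      by left; apply: val_inj; rewrite /= addn0 modn_small.
    by right; rewrite /nbr oc eqxx; apply: val_inj; rewrite /= addn1.
  exists (nbr i.2 x0); first by rewrite odd_nbr //; move: oc; case: odd; case: (i.2).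
  move=> -[|[|k]] // y _ _; apply: col.
    by right; apply: val_inj; rewrite /= addn0 modn_small.
  left; rewrite /nbr (negPf oc); apply: val_inj => /=.
  rewrite addn1 -[in RHS](modn_small (ltn_ord x0)).
  by have := congr1 val (ord_predK x0) => /= ->; rewrite modn_small.
have claim t : (2 ^ t.+1 <= N)%N -> exists2 c : 'I_N, odd c = i.2 &
    exists2 J, run i.1 predT c (2 ^ t.+1) J & M * eps ^+ (4 * N * (2 ^ t - 1)) <= F J.
  elim: t => [|t IH] ht.
    by have [c oc rc] := start; exists c => //; exists J2 => //; rewrite expn0 subnn muln0 expr0 mulr1.
  have pt : (0 < 2 ^ t)%N by rewrite expn_gt0.
  have ht2 : (2 ^ t.+1 <= N./2)%N by have := half_leq ht; rewrite [(2 ^ t.+2)%N]expnS mul2n doubleK.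
  have ht3 : (2 ^ t.+1 <= N)%N by apply: leq_trans ht; rewrite leq_pexp2l.
  have [c oc [J rJ FJ]] := IH ht3.
  exists (omod c (c + N - 2 ^ t.+1)).
    rewrite /= odd_modN // oddB; last exact: leq_trans ht3 (leq_addl _ _).
    by rewrite oddD (negPf evN) oddX /= !addbF.
  exists (keepl (Some i) i.1 c J).
    rewrite [(2 ^ t.+2)%N]expnS; apply: (keepl_run evN b0 ht2 rJ) => h hK.
    by apply: (@hpart_same _ (2 ^ t.+1)) => //; rewrite oddX.
  have := tilted_cs (N := N) (b := b) E (Some i) evN b0 ei i.1 c J.
  rewrite -/F; set FL := F (keepl _ _ _ _) ; set FR := F (keepr _ _ _ _); set ls := (2 * _)%N => cs.
  have lsN : (ls <= 4 * N)%N.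
    by rewrite /ls -[4%N]/(2 * 2)%N -mulnA leq_mul2l /= mul2n -addnn leq_add ?lost_le.
  have cs2 : F J ^+ 2 <= FL * M * eps^-1 ^+ (4 * N).
    apply: le_trans cs _; apply: ler_pM; first exact: mulr_ge0 (F0 _) (F0 _).
    - by rewrite exprn_ge0 // invr_ge0 ltW.
    - by apply: ler_wpM2l; [exact: F0|exact: FM].
    - by apply: ler_weXn2l.
  have cs3 : (M * eps ^+ (4 * N * (2 ^ t - 1))) ^+ 2 <= FL * M * eps^-1 ^+ (4 * N).
    apply: le_trans cs2; apply: lerXn2r; rewrite ?nnegrE ?F0 // mulr_ge0 ?exprn_ge0 // ltW //.
  have ep : 0 < eps ^+ (4 * N) by rewrite exprn_gt0.
  move: cs3; rewrite exprVn ler_pdivlMr // exprMn -exprM.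
  have -> : M ^+ 2 * eps ^+ (4 * N * (2 ^ t - 1) * 2) * eps ^+ (4 * N) =
     M * eps ^+ (4 * N * (2 ^ t.+1 - 1)) * M.
    have -> : (4 * N * (2 ^ t.+1 - 1) = 4 * N * (2 ^ t - 1) * 2 + 4 * N)%N.
      by rewrite expnS double_loss_exponent.
    by rewrite exprD; ring.
  by rewrite ler_pM2r.
(* Doubling stops at the largest power of two not exceeding [N]: the run then covers more than half
   of the columns, enough for the a priori bound [direct]. *)
have [t ht1 ht2] : exists2 t, (2 ^ t.+1 <= N)%N & (N < 2 ^ t.+2)%N.
  have := trunc_log_bounds (p := 2) (n := N) isT (leq_trans _ N4) => /(_ isT).
  case el : (trunc_log 2 N) => [|t] /andP[h1' h2']; last by exists t.
  by have := leq_trans h2' (leq_trans (_ : 2 <= 4)%N N4); rewrite ltnn => /(_ isT).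
have [c oc [J rJ FJ]] := claim t ht1.
have cJ : (2 ^ t.+1 * N <= #|J|)%N.
  pose f (ky : 'I_(2 ^ t.+1) * 'I_N) := mk i.1 (omod c (c + ky.1)) ky.2.
  rewrite -[X in (X * _)%N]card_ord -[X in (_ * X)%N]card_ord -card_prod -cardsT.
  rewrite -(card_in_imset (f := f)).
    apply: subset_leq_card; apply/fintype.subsetP => r /imsetP[[k y] _ ->]; exact: rJ.
  move=> [k y] [k' y'] _ _; rewrite /f /= => /mk_inj [/(congr1 val) /= /eqP + ->].
  rewrite eqn_modDl !modn_small ?(leq_trans (ltn_ord _) ht1) // => /eqP e.
  by congr (_, _); apply: val_inj.
have W0 := torus_weight0_gt0 (n := n) (N := N) b E (Some i) evN.
have FJ2' : F J <= D ^+ (N ^ 2) * eps ^+ (5 * #|J|) * W set0.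
  rewrite /F /tilted exprVn ler_pdivrMr ?exprn_gt0 //; apply: le_trans (direct J) _.
  have -> : (6 * #|J| = 5 * #|J| + #|J|)%N by rewrite -[X in (_ = _ + X)%N]mul1n -mulnDl.
  by rewrite exprD mulrA [leRHS]mulrAC.
have h5 : M * eps ^+ (4 * N * (2 ^ t - 1)) <= D ^+ (N ^ 2) * eps ^+ (5 * (2 ^ t.+1 * N)) * W set0.
  apply: le_trans FJ (le_trans FJ2' _); apply: ler_wpM2r; first exact: ltW.
  apply: ler_wpM2l; first exact: exprn_ge0.
  by apply: ler_wiXn2l; rewrite ?(ltW e0) // leq_mul2l cJ orbT.
have ep : 0 < eps ^+ (4 * N * (2 ^ t - 1)) by rewrite exprn_gt0.
rewrite -(ler_pM2r ep); apply: le_trans h5 _; rewrite mulrC; apply: ler_wpM2l; first exact: ltW.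
have exq : (N ^ 2 + 4 * N * (2 ^ t - 1) <= 5 * (2 ^ t.+1 * N))%N.
  by rewrite [(2 ^ t.+1)%N]expnS; apply: final_exponent_le; rewrite -!expnS.
apply: le_trans (_ : D ^+ (N ^ 2) * eps ^+ (N ^ 2 + 4 * N * (2 ^ t - 1)) <= _).
  apply: ler_wpM2l; first exact: exprn_ge0.
  by apply: ler_wiXn2l; rewrite ?(ltW e0).
rewrite exprD mulrA -exprMn -[leRHS]mul1r; apply: ler_wpM2r; first exact: ltW.
by apply: exprn_ile1 => //; rewrite mulr_ge0 // ltW.
Qed.

End PairChessboard.

(** * Moments of the arcsine law *)

Section Arcsine.
Context {R : realType}.

(** The moment of order [2 k] of the arcsine law on [[-1, 1]], that is the mean of [cos ^ (2 k)]
    over a circle. *)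
Definition arcsine (k : nat) : R := 'C(2 * k, k)%:R / 4 ^+ k.

Lemma arcsine_ge0 k : 0 <= arcsine k.
Proof. by rewrite divr_ge0 // exprn_ge0. Qed.

Lemma arcsineS k : arcsine k.+1 = arcsine k * ((2 * k%:R + 1) / (2 * k%:R + 2)).
Proof.
have e : ('C(2 * k.+1, k.+1) * k.+1 = 2 * (2 * k + 1) * 'C(2 * k, k))%N.
  have h1 := mul_bin_diag (2 * k).+2 k.
  have h2 := mul_bin_down (2 * k).+1 k.
  rewrite /= in h1 h2.
  have -> : (2 * k.+1 = (2 * k).+2)%N by lia.
  have e1 : ((2 * k).+1 - k = k.+1)%N by lia.
  rewrite e1 in h2.
  have k0 : (0 < k.+1)%N by [].
  apply/eqP; rewrite -(eqn_pmul2r k0); apply/eqP.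
  rewrite [('C(_, _) * k.+1)%N]mulnC -h1.
  have -> : ((2 * k).+2 * 'C((2 * k).+1, k) * k.+1 = (2 * k).+2 * (k.+1 * 'C((2 * k).+1, k)))%N by ring.
  rewrite -h2; ring.
have eR : 'C(2 * k.+1, k.+1)%:R * (k%:R + 1) = 2 * (2 * k%:R + 1) * 'C(2 * k, k)%:R :> R.
  by have := congr1 (fun x => x%:R : R) e; rewrite !natrM natrD natrM -natr1.
have k0 : (k%:R + 1 : R) != 0 by rewrite natr1 pnatr_eq0.
have -> : arcsine k.+1 = 'C(2 * k.+1, k.+1)%:R * (k%:R + 1) / (k%:R + 1) / 4 ^+ k.+1.
  by rewrite mulfK.
rewrite eR /arcsine exprS; field.
rewrite expf_neq0 //= k0 andbT (_ : 2 * k%:R + 2 = 2 * (k%:R + 1)) ?mulf_neq0 //; ring.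
Qed.

(** By [arcsineS] the left side is non-increasing. This is the decay [k ^ (-1/2)] that
    [arcsine_atoms] reproduces. *)
Lemma arcsine_sq_le k : arcsine k ^+ 2 * (2 * k%:R + 1) <= 1.
Proof.
elim: k => [|k IH].
  by rewrite /arcsine muln0 bin0 expr0 mulr0 add0r divr1 expr1n mulr1.
rewrite arcsineS; set x := k%:R : R; have x0 : 0 <= x by [].
have -> : (k.+1%:R : R) = x + 1 by rewrite natr1.
have -> : (arcsine k * ((2 * x + 1) / (2 * x + 2))) ^+ 2 * (2 * (x + 1) + 1) =
   (arcsine k ^+ 2 * (2 * x + 1)) * ((2 * x + 1) * (2 * x + 3) / (2 * x + 2) ^+ 2).
  by field; rewrite gt_eqF //; lra.
rewrite -[leRHS]mulr1; apply: ler_pM => //.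
  by rewrite mulr_ge0 ?sqr_ge0 //; lra.
  by rewrite divr_ge0 ?sqr_ge0 // mulr_ge0 //; lra.
rewrite ler_pdivrMr ?mul1r; last by rewrite exprn_gt0 //; lra.
nra.
Qed.

End Arcsine.

(** * Moments of [S^x] in an eigenstate of [S^z] *)

Section LocalMoments.
Context {R : realType}.
Variable n : nat.
Hypothesis n0 : (0 < n)%N.
Notation S := (spinS R n).
Notation X := (Sxloc R n).
Notation I := ('I_n.+1).

Lemma S_gt0 : 0 < S.
Proof. by rewrite /spinS divr_gt0 // ltr0n. Qed.

Lemma S_double : 2 * S = n%:R.
Proof. by rewrite /spinS; field. Qed.

Lemma Mval_bound (a : I) : - S <= Mval R a <= S.
Proof.
have h : (a : nat)%:R <= n%:R :> R by rewrite ler_nat -ltnS.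
have h0 : (0 : R) <= (a : nat)%:R by [].
by rewrite /Mval -S_double in h *; apply/andP; split; lra.
Qed.

Lemma SxlocE (a c : I) : X a c =
  (if (a : nat) == c.+1 then Num.sqrt ((n%:R - c%:R) * c.+1%:R) / 2 else 0) +
  (if (c : nat) == a.+1 then Num.sqrt ((n%:R - a%:R) * a.+1%:R) / 2 else 0).
Proof.
rewrite /Sxloc /opscale /opadd /Splusloc /Sminusloc mulrDr; congr (_ + _).
  case: eqP => [e|_]; last by rewrite mulr0.
  rewrite mulrC; congr (Num.sqrt _ / 2); rewrite /Mval -S_double -natr1; ring.
case: eqP => [e|_]; last by rewrite mulr0.
rewrite mulrC; congr (Num.sqrt _ / 2); rewrite /Mval e -S_double -natr1; ring.
Qed.

Lemma Sxloc_ge0 a c : 0 <= X a c.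
Proof. by rewrite SxlocE addr_ge0 //; case: ifP => // _; rewrite divr_ge0 // sqrtr_ge0. Qed.

Lemma Sxpow_ge0 j a c : 0 <= oppow X j a c.
Proof.
elim: j a c => [|j IH] a c; first by rewrite /= /opid ler0n.
by rewrite oppowS; apply: sumr_ge0 => z _; rewrite mulr_ge0 ?Sxloc_ge0.
Qed.

Lemma Sxloc_step a c : X a c != 0 -> `|Mval R a - Mval R c| = 1.
Proof.
rewrite SxlocE; have [e|ne] := eqVneq (a : nat) c.+1; last first.
  have [e _|ne'] := eqVneq (c : nat) a.+1; last by rewrite addr0 eqxx.
  by rewrite /Mval e -natr1 (_ : _ - _ = -1) ?normrN1 //; ring.
by move=> _; rewrite /Mval e -natr1 (_ : _ - _ = 1) ?normr1 //; ring.
Qed.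

Lemma Sxpow_reach j a c : oppow X j a c != 0 -> `|Mval R a - Mval R c| <= j%:R.
Proof.
elim: j a c => [|j IH] a c.
  by rewrite /= /opid; have [->|_] := eqVneq a c; rewrite ?subrr ?normr0 ?eqxx.
rewrite oppowS => h.
have [z hz] : exists z, X a z * oppow X j z c != 0.
  apply/existsP; apply: contraNT h => /existsPn h; rewrite /opmul big1 // => z _.
  by have := h z; rewrite negbK => /eqP.
move: hz; rewrite mulf_eq0 negb_or => /andP[/Sxloc_step h1 /IH h2].
apply: le_trans (ler_distD (Mval R z) _ _) _.
by rewrite h1 -[j.+1%:R]natr1 addrC lerD2r.
Qed.

(* [walk j a c] counts the [+-1]-walks of length [j] from [a] to [c] on the integers. *)
Definition walk (j a c : nat) : R := ((1 + 'X^2) ^+ j * 'X^a : {poly R})`_(c + j).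

Lemma walk_polyS j a : (1 + 'X^2) ^+ j.+1 * 'X^a =
  (1 + 'X^2) ^+ j * 'X^a + ((1 + 'X^2) ^+ j * 'X^a) * 'X^2 :> {poly R}.
Proof. by rewrite exprS; ring. Qed.

Lemma walk_coef_ge0 j a k : 0 <= ((1 + 'X^2) ^+ j * 'X^a : {poly R})`_k.
Proof.
elim: j k => [|j IH] k; first by rewrite expr0 mul1r coefXn ler0n.
rewrite walk_polyS coefD; apply: addr_ge0 => //.
by rewrite coefMXn; case: (k < 2)%N.
Qed.

Lemma walk_ge0 j a c : 0 <= walk j a c.
Proof. exact: walk_coef_ge0. Qed.

Lemma walkS_ge j a c : walk j a c.+1 + (if c is c'.+1 then walk j a c' else 0) <= walk j.+1 a c.
Proof.
rewrite /walk walk_polyS coefD addnS -addSn lerD2l; case: c => [|c].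
  by rewrite coefMXn; case: (_ < 2)%N => //; exact: walk_coef_ge0.
by rewrite [leRHS]coefMXn !addSn /= subn2.
Qed.

Lemma walk_diag j (a : nat) : walk j a a = if odd j then 0 else 'C(j, j./2)%:R.
Proof.
rewrite /walk coefMXn ltnNge leq_addr /= addKn addrC exprDn coef_sum.
have t (i : 'I_j.+1) : ('X^2 ^+ (j - i) * 1 ^+ i *+ 'C(j, i) : {poly R})`_j = (j == 2 * (j - i))%N%:R *+ 'C(j, i).
  by rewrite expr1n mulr1 -exprM coefMn coefXn.
rewrite (eq_bigr _ (fun i _ => t i)).
case: ifP => oj.
  rewrite big1 // => i _; case: eqP => [e|_]; last by rewrite mul0rn.
  by have := congr1 odd e; rewrite oj oddM.
have hj : (j./2 < j.+1)%N by rewrite ltnS -[leqRHS]half_double half_leq // -addnn leq_addr.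
rewrite (bigD1 (Ordinal hj)) //= big1 => [|i /eqP ni].
  rewrite addr0 (_ : (j == _) = true) //; apply/eqP.
  by rewrite -{1 2}(even_halfK (negbT oj)) -addnn addnK mul2n addnn.
case: eqP => [e|_]; last by rewrite mul0rn.
exfalso; apply: ni; apply: val_inj => /=.
have := ltn_ord i; have := even_halfK (negbT oj); move: (j./2) (nat_of_ord i) e => x y; lia.
Qed.

(** With [M] the value at [c], the left side is [S(S+1) - M(M+1)], four times a squared matrix
    element of [S^x]. Moving [M] by at most [J] changes its square by at most [2 J S], and
    [S - M <= 2 S]. *)
Lemma amp_le (a c : I) (J : R) : 0 <= J -> `|Mval R a - Mval R c| <= J ->
  (n%:R - c%:R) * c.+1%:R <= S ^+ 2 - Mval R a ^+ 2 + (2 * J + 2) * S.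
Proof.
move=> J0 h.
have -> : (n%:R - c%:R) * c.+1%:R = S ^+ 2 - Mval R c ^+ 2 + (S - Mval R c).
  by rewrite /Mval -S_double -natr1; ring.
have := Mval_bound a; have := Mval_bound c; have := S_gt0.
move: h; rewrite ler_norml; move: (Mval R a) (Mval R c) S => x y s.
move=> /andP[h1 h2] s0 /andP[y1 y2] /andP[x1 x2]; nra.
Qed.

(** Expansion over paths: along at most [J] steps from [a] every amplitude obeys [amp_le], and the
    paths inside the multiplet are among all walks on the integers. *)
Lemma Sxpow_le_walk (J : nat) (a c : I) j : (j <= J)%N ->
  oppow X j a c <= (Num.sqrt (S ^+ 2 - Mval R a ^+ 2 + (2 * J%:R + 2) * S) / 2) ^+ j * walk j a c.
Proof.
set B := Num.sqrt _; have B0 : 0 <= B by exact: sqrtr_ge0.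
elim: j c => [|j IH] c jJ.
  rewrite expr0 mul1r /walk expr0 mul1r addn0 coefXn /= /opid.
  by rewrite eq_sym -(inj_eq val_inj).
have {}IH c' := IH c' (ltnW jJ).
have amp (z : I) (k : I) : oppow X j a z != 0 -> `|Mval R z - Mval R k| <= 1 ->
    Num.sqrt ((n%:R - k%:R) * k.+1%:R) <= B.
  move=> hz hk; apply: ler_wsqrtr; apply: amp_le => //.
  apply: le_trans (ler_distD (Mval R z) _ _) _.
  by apply: le_trans (lerD (Sxpow_reach hz) hk) _; rewrite natr1 ler_nat.
rewrite oppowSr /opmul.
have term (z : I) : oppow X j a z * X z c <=
   (B / 2) ^+ j.+1 * (((z : nat) == c.+1)%:R * walk j a z + ((c : nat) == z.+1)%:R * walk j a z).
  have w0 := walk_ge0 j a z.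
  have [->|hz] := eqVneq (oppow X j a z) 0.
    by rewrite mul0r mulr_ge0 ?exprn_ge0 ?divr_ge0 // addr_ge0 // mulr_ge0.
  rewrite SxlocE mulrDr mulrDr; apply: lerD.
    case: eqP => [e|_]; last by rewrite mulr0 mul0r mulr0.
    rewrite mul1r exprSr -[leRHS]mulrA [B / 2 * _]mulrC [leRHS]mulrA.
    apply: ler_pM; rewrite ?Sxpow_ge0 ?divr_ge0 ?sqrtr_ge0 ?IH //.
    apply: ler_wpM2r => //; apply: (amp z) => //.
    by rewrite /Mval e -natr1 (_ : _ - _ = 1) ?normr1 //; ring.
  case: eqP => [e|_]; last by rewrite mulr0 mul0r mulr0.
  rewrite mul1r exprSr -[leRHS]mulrA [B / 2 * _]mulrC [leRHS]mulrA.
  apply: ler_pM; rewrite ?Sxpow_ge0 ?divr_ge0 ?sqrtr_ge0 ?IH //.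
  apply: ler_wpM2r => //; apply: (amp z) => //.
  by rewrite subrr normr0.
apply: le_trans (ler_sum _ (fun z _ => term z)) _.
rewrite -mulr_sumr; apply: ler_wpM2l; first by rewrite exprn_ge0 // divr_ge0.
apply: le_trans (walkS_ge j a c); rewrite big_split /=; apply: lerD.
  have [hc|hc] := ltnP c.+1 n.+1.
    rewrite (bigD1 (Ordinal hc)) //= eqxx mul1r big1 ?addr0 // => z /eqP nz.
    by case: eqP => [e|_]; rewrite ?mul0r //; exfalso; apply: nz; apply: val_inj.
  rewrite big1 ?walk_ge0 // => z _; case: eqP => [e|_]; rewrite ?mul0r //.
  by have := ltn_ord z; rewrite e ltnNge hc.
case ec : (c : nat) => [|c']; first by rewrite big1 // => z _; rewrite mul0r.
have hc : (c' < n.+1)%N by have := ltn_ord c; rewrite ec; exact: ltnW.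
rewrite (bigD1 (Ordinal hc)) //= eqxx mul1r big1 ?addr0 // => z /eqP nz.
by case: eqP => [[e]|_]; rewrite ?mul0r //; exfalso; apply: nz; apply: val_inj.
Qed.

Lemma Sxpow_even_le k (a : I) :
  oppow X (2 * k) a a <= arcsine k * (S ^+ 2 - Mval R a ^+ 2 + (4 * k%:R + 2) * S) ^+ k.
Proof.
apply: le_trans (Sxpow_le_walk a a (leqnn (2 * k))) _.
rewrite walk_diag oddM /= mul2n doubleK -mul2n exprM.
set Y := S ^+ 2 - _ + _.
have Y0 : 0 <= Y.
  have := Mval_bound a; have := S_gt0; have : 0 <= k%:R :> R by [].
  rewrite /Y natrM; move: (Mval R a) S (k%:R : R) => x s z z0 s0 /andP[x1 x2]; nra.
rewrite [(_ / 2) ^+ 2]exprMn sqr_sqrtr // exprVn.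
have -> : S ^+ 2 - Mval R a ^+ 2 + (4 * k%:R + 2) * S = Y by rewrite /Y natrM; ring.
rewrite exprMn /arcsine.
have -> : ((2 ^+ 2)^-1 : R) ^+ k = (4 ^+ k)^-1 by rewrite exprVn (_ : 2 ^+ 2 = 4 :> R) //; ring.
rewrite le_eqVlt; apply/orP; left; apply/eqP; ring.
Qed.

Lemma Sxpow_odd_le k (a : I) : odd k -> oppow X k a a <= 0.
Proof. by move=> ok; have := Sxpow_le_walk a a (leqnn k); rewrite walk_diag ok mulr0. Qed.

Lemma Sx_rowsum_le (a : I) : \sum_z X a z <= 2 * S.
Proof.
have half_le (c : nat) : (c <= n)%N -> Num.sqrt ((n%:R - c%:R) * c.+1%:R) / 2 <= S.
  move=> cn; have s1 : 1 <= 2 * S by rewrite S_double ler1n.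
  have c0 : 0 <= c%:R :> R by [].
  have cn' : c%:R <= 2 * S by rewrite S_double ler_nat.
  rewrite ler_pdivrMr // -(ger0_norm (_ : 0 <= S * 2)) ?mulr_ge0 ?(ltW S_gt0) // -sqrtr_sqr.
  apply: ler_wsqrtr; rewrite -S_double -[c.+1%:R]natr1; move: (c%:R) S c0 cn' s1 => x s x0 xs s1.
  have := sqr_ge0 (2 * s - x - (x + 1)); nra.
under eq_bigr do rewrite SxlocE; rewrite big_split /= mulr_natl mulr2n; apply: lerD.
  case ea : (a : nat) => [|a']; first by rewrite big1 // ltW // S_gt0.
  have ha : (a' < n.+1)%N by have := ltn_ord a; rewrite ea; exact: ltnW.
  rewrite (bigD1 (Ordinal ha)) //= eqxx big1 ?addr0; first exact: half_le.
  by move=> z /eqP nz; case: eqP => [[e]|//]; exfalso; apply: nz; apply: val_inj.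
have [hc|hc] := ltnP a.+1 n.+1.
  rewrite (bigD1 (Ordinal hc)) //= eqxx big1 ?addr0; first by apply: half_le; rewrite -ltnS.
  by move=> z /eqP nz; case: eqP => [e|//]; exfalso; apply: nz; apply: val_inj.
rewrite big1 ?(ltW S_gt0) // => z _; case: eqP => [e|//].
by have := ltn_ord z; rewrite e ltnNge hc.
Qed.

Lemma Sxpow_crude j a c : oppow X j a c <= (2 * S) ^+ j.
Proof.
elim: j a c => [|j IH] a c; first by rewrite /= /opid expr0; case: eqP.
rewrite oppowS exprS; apply: le_trans (_ : \sum_z X a z * (2 * S) ^+ j <= _).
  by apply: ler_sum => z _; apply: ler_wpM2l (IH _ _); exact: Sxloc_ge0.
rewrite -mulr_suml; apply: ler_wpM2r (Sx_rowsum_le a).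
by rewrite exprn_ge0 // mulr_ge0 // ltW // S_gt0.
Qed.

End LocalMoments.

(** * Exponential of a diagonal operator plus a non-negative one *)

Section ExponentialBounds.
Context {R : realType} {T : finType}.
Local Open Scope classical_set_scope.

Lemma opexp_shift (A : T -> T -> R) (c : R) x y :
  opexp (fun u v => A u v + c * (u == v)%:R) x y = expR c * opexp A x y.
Proof.
pose M m : T -> T -> R := opscale (1 + c / m.+1%:R) (fun u v => (u == v)%:R + A u v / m.+1%:R).
have h1 : oppow (M m) m.+1 x y @[m --> \oo] --> opexp (fun u v => A u v + c * (u == v)%:R) x y.
  apply: (@euler_limit _ _ _ M (`|c| * opl1 A)); first by rewrite mulr_ge0 ?opl1_ge0.
  move=> m u v; set m' := m.+1%:R : R.
  have m0 : 0 < m' by rewrite ltr0n.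
  have -> : M m u v - (u == v)%:R - (A u v + c * (u == v)%:R) / m' = c * A u v / m' ^+ 2.
    by rewrite /M /opscale -/m'; field; rewrite gt_eqF.
  have m2 : 0 <= m' ^+ 2 by rewrite exprn_ge0 // ltW.
  rewrite normrM normfV (ger0_norm m2) normrM; apply: ler_wpM2r; first by rewrite invr_ge0.
  apply: ler_wpM2l => //; apply: le_trans (row_le_opl1 A u).
  by rewrite [leRHS](bigD1 v) //= lerDl sumr_ge0.
have h2 : (1 + c / m.+1%:R) ^+ m.+1 @[m --> \oo] --> expR c.
  have := @euler_limit R unit (fun _ _ => c) (fun m _ _ => 1 + c / m.+1%:R) 0 (lexx _).
  have pw (f : R) k : oppow (fun _ _ : unit => f) k tt tt = f ^+ k.
    elim: k => [|k IH]; first by rewrite /= /opid eqxx.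
    rewrite oppowS /opmul exprS (bigD1 tt) //= IH big1 ?addr0 // => -[]; by rewrite eqxx.
  have -> : expR c = opexp (fun _ _ : unit => c) tt tt.
    apply/esym/opexp_uniq; under eq_fun do under eq_bigr do rewrite pw.
    have := @is_cvg_series_exp_coeff R c; rewrite /expR.
    by rewrite (_ : series (exp_coeff c) = (fun m => \sum_(k < m) c ^+ k / k`!%:R)) //; apply/funext => m; rewrite /series /= big_mkord.
  move=> /(_ _ tt tt) h.
  have -> : (fun m => (1 + c / m.+1%:R) ^+ m.+1) =
     (fun m => oppow (fun _ _ : unit => 1 + c / m.+1%:R) m.+1 tt tt).
    by apply/funext => m; rewrite pw.
  have z0 (z : R) : 1 + z - 1 - z = 0 by ring.
  by apply: h => m [] []; rewrite eqxx mul0r z0 normr0.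
have h3 : oppow (M m) m.+1 x y @[m --> \oo] --> expR c * opexp A x y.
  have -> : (fun m => oppow (M m) m.+1 x y) = (fun m => (1 + c / m.+1%:R) ^+ m.+1 *
      oppow (fun u v => (u == v)%:R + A u v / m.+1%:R) m.+1 x y).
    by apply/funext => m; rewrite /M oppowZ.
  apply: cvgM => //.
  by have := @euler_limit_shift _ _ A 0 x y; under eq_fun do rewrite addn0.
exact: (seq_limit_eq h1 h3).
Qed.

Variables (D : T -> R) (B : T -> T -> R) (x0 : T) (a eps : R).
Hypothesis B0 : forall x y, 0 <= B x y.
Hypothesis eps0 : 0 <= eps.
Hypothesis reach : forall k y, oppow B k x0 y != 0 -> D y <= a + eps * k%:R.

Lemma oppow_ge0 k x y : 0 <= oppow B k x y.
Proof.
elim: k x y => [|k IH] x y; first by rewrite /= /opid ler0n.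
by rewrite oppowS; apply: sumr_ge0 => z _; rewrite mulr_ge0.
Qed.

Definition diagplus : T -> T -> R := fun x y => D x * (x == y)%:R + B x y.

(** A word with [k] factors [B] visits only points reached by at most [k] hops, where [D] is at most
    [a + eps * k]; the binomial coefficient counts the positions of these factors. *)
Lemma diagplus_pow_le n y : (forall x, 0 <= D x) -> 0 <= a ->
  0 <= oppow diagplus n x0 y <=
  \sum_(k < n.+1) 'C(n, k)%:R * ((a + eps * k%:R) ^+ (n - k) * oppow B k x0 y).
Proof.
move=> D0 a0; have ak k : 0 <= a + eps * k%:R by rewrite addr_ge0 // mulr_ge0.
elim: n y => [|n IH] y.
  by rewrite big_ord_recl big_ord0 addr0 bin0 subn0 expr0 !mul1r /= lexx /opid ler0n.
have -> : oppow diagplus n.+1 x0 y = oppow diagplus n x0 y * D y + \sum_z oppow diagplus n x0 z * B z y.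
  rewrite oppowSr /opmul -(sum_delta_r y (fun z => oppow diagplus n x0 z * D z)) -big_split /=.
  by apply: eq_bigr => z _; rewrite /diagplus; ring.
apply/andP; split.
  apply: addr_ge0; first by rewrite mulr_ge0 //; case/andP: (IH y).
  by apply: sumr_ge0 => z _; rewrite mulr_ge0 //; case/andP: (IH z).
pose g k := (a + eps * k%:R) ^+ (n.+1 - k) * oppow B k x0 y.
have pascal : \sum_(k < n.+2) 'C(n.+1, k)%:R * g k =
   \sum_(k < n.+1) 'C(n, k)%:R * g k + \sum_(k < n.+1) 'C(n, k)%:R * g k.+1.
  have -> : \sum_(k < n.+1) 'C(n, k)%:R * g k = \sum_(k < n.+2) 'C(n, k)%:R * g k.
    by rewrite [RHS]big_ord_recr /= bin_small // mul0r addr0.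
  rewrite [LHS]big_ord_recl [X in _ = X + _]big_ord_recl /= !bin0 -addrA; congr (_ + _); rewrite -big_split /=.
  by apply: eq_bigr => k _; rewrite /bump /= !add1n binS natrD mulrDl.
rewrite -/g pascal; apply: lerD.
  have /andP[_ h] := IH y.
  apply: le_trans (ler_wpM2r (D0 y) h) _; rewrite mulr_suml; apply: ler_sum => k _.
  rewrite -mulrA; apply: ler_wpM2l => //; rewrite /g.
  have [->|nz] := eqVneq (oppow B k x0 y) 0; first by rewrite mulr0 mul0r mulr0.
  rewrite subSn; last by rewrite -ltnS.
  have -> : (a + eps * k%:R) ^+ (n - k) * oppow B k x0 y * D y = D y * ((a + eps * k%:R) ^+ (n - k) * oppow B k x0 y) by ring.
  rewrite exprS -mulrA; apply: ler_wpM2r; last exact: reach nz.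
  by rewrite mulr_ge0 ?oppow_ge0 ?exprn_ge0.
apply: le_trans (_ : \sum_z (\sum_(k < n.+1) 'C(n, k)%:R * ((a + eps * k%:R) ^+ (n - k) * oppow B k x0 z)) * B z y <= _).
  by apply: ler_sum => z _; apply: ler_wpM2r => //; case/andP: (IH z).
under eq_bigr do rewrite mulr_suml; rewrite exchange_big /=; apply: ler_sum => k _.
rewrite /g oppowSr /opmul subSS !mulr_sumr; apply: ler_sum => z _.
rewrite -!mulrA; apply: ler_wpM2l => //; apply: ler_wpM2r; first by rewrite mulr_ge0 ?oppow_ge0.
apply: lerXn2r; rewrite ?nnegrE // lerD2l; apply: ler_wpM2l => //.
by rewrite ler_nat.
Qed.

Lemma sum_exp_tail_le (c : R) k m : 0 <= c ->
  \sum_(n < m | (k <= n)%N) c ^+ (n - k) / (n - k)`!%:R <= expR c.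
Proof.
move=> c0; rewrite -(big_mkord (fun n => k <= n)%N (fun n => c ^+ (n - k) / (n - k)`!%:R)).
have [km|mk] := leqP k m; last first.
  rewrite big1_seq ?expR_ge0 // => n /andP[kn]; rewrite mem_index_iota => /andP[_ nm].
  by have := leq_trans mk (leq_trans kn (ltnW nm)); rewrite ltnn.
rewrite (big_cat_nat (leq0n k) km) /= big1_seq ?add0r; last first.
  by move=> n /andP[kn]; rewrite mem_index_iota ltnNge kn andbF.
rewrite -{1}[k]add0n big_addn big_mkord; apply: le_trans (exp_partial_le (m - k) c0).
rewrite big_mkcond /=; apply: ler_sum => i _; rewrite addnK leq_addl; exact: lexx.
Qed.

Lemma exp_diagplus_le_nonneg (U : R) : (forall x, 0 <= D x) -> 0 <= a ->
  (forall m, \sum_(k < m) expR eps ^+ k * oppow B k x0 x0 / k`!%:R <= U) ->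
  opexp diagplus x0 x0 <= expR a * U.
Proof.
move=> D0 a0 hU; have ak k : 0 <= a + eps * k%:R by rewrite addr_ge0 // mulr_ge0.
apply: (seq_limit_le_cst (@expseries_cvg _ _ diagplus x0 x0)) => m.
apply: le_trans (_ : \sum_(n < m) \sum_(k < m | (k <= n)%N)
    (oppow B k x0 x0 / k`!%:R) * ((a + eps * k%:R) ^+ (n - k) / (n - k)`!%:R) <= _).
  apply: ler_sum => n _; have /andP[_ h] := diagplus_pow_le n x0 D0 a0.
  apply: le_trans (ler_wpM2r _ h) _; first by rewrite invr_ge0.
  rewrite mulr_suml (big_ord_widen m (fun k => 'C(n, k)%:R * ((a + eps * k%:R) ^+ (n - k) * oppow B k x0 x0) / n`!%:R)) //.
  rewrite le_eqVlt; apply/orP; left; apply/eqP; apply: eq_bigr => k; rewrite ltnS => kn.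
  have f0 j : (j`!%:R : R) != 0 by rewrite pnatr_eq0 -lt0n fact_gt0.
  have -> : (n`!%:R : R) = 'C(n, k)%:R * k`!%:R * (n - k)`!%:R by rewrite -(bin_fact kn) !natrM mulrA.
  have c0 : ('C(n, k)%:R : R) != 0 by rewrite pnatr_eq0 -lt0n bin_gt0.
  by field; rewrite !f0 c0.
rewrite (exchange_big_dep predT) //=.
apply: le_trans (_ : \sum_(k < m) expR a * (expR eps ^+ k * oppow B k x0 x0 / k`!%:R) <= _); last first.
  by rewrite -mulr_sumr; apply: ler_wpM2l; [exact: expR_ge0|exact: hU].
apply: ler_sum => k _; rewrite -mulr_sumr.
apply: le_trans (ler_wpM2l _ (sum_exp_tail_le k m (ak k))) _.
  by rewrite divr_ge0 ?oppow_ge0.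
by rewrite expRD expRM_natr le_eqVlt; apply/orP; left; apply/eqP; ring.
Qed.

End ExponentialBounds.

Section ExponentialBoundShifted.
Context {R : realType} {T : finType}.

(** The diagonal part is frozen at the bound [a], and its variation along the path is paid by a
    factor [expR eps] per hop. *)
Lemma exp_diagplus_le (D : T -> R) (B : T -> T -> R) (x0 : T) (a eps U : R) :
  (forall x y, 0 <= B x y) -> 0 <= eps ->
  (forall k y, oppow B k x0 y != 0 -> D y <= a + eps * k%:R) ->
  (forall m, \sum_(k < m) expR eps ^+ k * oppow B k x0 x0 / k`!%:R <= U) ->
  opexp (diagplus D B) x0 x0 <= expR a * U.
Proof.
(* A constant added to [D] factors out by [opexp_shift], so the diagonal may be taken
   non-negative. *)
move=> B0 e0 reach hU; pose c := \sum_x `|D x|.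
have Dc x : 0 <= D x + c.
  have h1 : `|D x| <= c by rewrite /c (bigD1 x) //= lerDl sumr_ge0.
  by have := ler_norm (- D x); rewrite normrN; lra.
have ac : 0 <= a + c.
  have := reach 0%N x0; rewrite /= /opid eqxx oner_neq0 mulr0 addr0 => /(_ isT) h.
  by have := Dc x0; lra.
have r' k y : oppow B k x0 y != 0 -> D y + c <= (a + c) + eps * k%:R.
  by move=> /reach; lra.
have := exp_diagplus_le_nonneg B0 e0 r' Dc ac hU.
have -> : diagplus (fun x => D x + c) B = (fun u v => diagplus D B u v + c * (u == v)%:R).
  by apply/funext => u; apply/funext => v; rewrite /diagplus; ring.
rewrite opexp_shift expRD -mulrA [expR a * _]mulrCA; rewrite ler_pM2l ?expR_gt0 //.
Qed.

End ExponentialBoundShifted.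

(** * A discrete measure dominating the moments of [S^x] *)

Lemma sum_option (R : nmodType) (I : finType) (F : option I -> R) :
  \sum_x F x = F None + \sum_i F (Some i).
Proof.
rewrite (bigD1 None) //=; congr (_ + _).
rewrite (reindex_omap (fun i => Some i) id) => [|[i|] _] //.
by apply: eq_bigl => i; rewrite eqxx.
Qed.

Section Domination.
Context {R : realType}.
Variables (n q : nat).
Hypothesis n0 : (0 < n)%N.
Hypothesis q0 : (0 < q)%N.
Notation S := (spinS R n).
Notation X := (Sxloc R n).
Notation I := ('I_n.+1).
Notation Q := ((q ^ 4)%:R : R).

Definition mz (a : I) : R := Mval R a / S.
(** The squared radius [1 - m ^ 2] of the arcsine law, enlarged by the correction [(4 k + 2) / S] of
    [Sxpow_even_le] at the largest order it serves, [k = 36 Q]. *)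
Definition rho2 (a : I) : R := 1 - mz a ^+ 2 + (144 * Q + 2) / S.

(* A discrete measure dominating the moments of [S^x / S] in an eigenstate of [S^z]: the atoms
   [Some i] mimic the arcsine law of radius [sqrt (rho2 a)] at resolution [1 / q^2], the atom
   [None] takes care of the moments of order beyond [72 q^4]. *)
Definition atom : finType := option 'I_(q ^ 2).+1.
Definition watom (al : atom) : R :=
  if al is Some i then expR 1 / (q ^ 2)%:R else expR (- (36 * Q)).
Definition yatom (a : I) (al : atom) : R :=
  if al is Some i then Num.sqrt (rho2 a) * expR (- (i%:R ^+ 2 / (2 * Q))) else 2 * expR (2^-1).

Lemma watom_ge0 al : 0 <= watom al.
Proof. by case: al => [i|] /=; rewrite ?divr_ge0 ?expR_ge0. Qed.

Lemma yatom_ge0 a al : 0 <= yatom a al.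
Proof. by case: al => [i|] /=; rewrite mulr_ge0 ?sqrtr_ge0 ?expR_ge0. Qed.

Lemma mz_sq_le1 a : mz a ^+ 2 <= 1.
Proof.
have s0 := S_gt0 (R := R) n0; have /andP[h1 h2] := @Mval_bound R n a.
have h3 : `|mz a| <= 1 by rewrite /mz normrM normfV (gtr0_norm s0) ler_pdivrMr // mul1r ler_norml h1.
by rewrite -real_normK ?num_real // exprn_ile1.
Qed.

Lemma rho2_ge a : 1 - mz a ^+ 2 <= rho2 a.
Proof. by rewrite /rho2 lerDl divr_ge0 ?(ltW (S_gt0 n0)) // addr_ge0 // mulr_ge0. Qed.

Lemma rho2_ge0 a : 0 <= rho2 a.
Proof. by apply: le_trans (rho2_ge a); rewrite subr_ge0 mz_sq_le1. Qed.

(** [arcsine k] is at most 1 and of order [k ^ (-1/2)], like the Riemann sum of a Gaussian. Only the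
    terms with [i ^ 2 * k <= q ^ 4] are needed; each is at least [exp (-1)], which explains the
    factor [expR 1]. *)
Lemma arcsine_atoms k : arcsine k <= expR 1 / (q ^ 2)%:R *
  \sum_(i < (q ^ 2).+1) expR (- (i%:R ^+ 2 * k%:R / Q)).
Proof.
have Q0 : 0 < Q by rewrite ltr0n expn_gt0 q0.
have q20 : (0 : R) < (q ^ 2)%:R by rewrite ltr0n expn_gt0 q0.
have QE : Q = (q ^ 2)%:R ^+ 2 by rewrite -natrX -expnM.
have [t [tq tk ct]] : exists t, [/\ (t <= q ^ 2)%N, (t ^ 2 * k <= q ^ 4)%N &
     arcsine k * (q ^ 2)%:R <= t.+1%:R :> R].
  have [->|k0] := posnP k.
    exists (q ^ 2)%N; split; rewrite ?muln0 //.
    by rewrite /arcsine muln0 bin0 expr0 divr1 mul1r ler_nat.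
  have ex : exists t, (t ^ 2 * k <= q ^ 4)%N by exists 0%N.
  have bd t : (t ^ 2 * k <= q ^ 4)%N -> (t <= q ^ 2)%N.
    move=> h; rewrite -leq_sqr -expnM; apply: leq_trans h; exact: leq_pmulr.
  have [t ht hmax] := ex_maxnP ex bd.
  exists t; split=> //; first exact: bd.
  have ht1 : (q ^ 4 < t.+1 ^ 2 * k)%N.
    by rewrite ltnNge; apply/negP => /hmax; rewrite ltnn.
  have c1 : arcsine k ^+ 2 * k%:R <= 1 :> R.
    have := @arcsine_sq_le R k; have := sqr_ge0 (arcsine k : R); have : (0 : R) <= k%:R by [].
    nra.
  rewrite -(ler_pXn2r (n := 2)) ?nnegrE ?mulr_ge0 ?arcsine_ge0 // exprMn -QE.
  have h2 : Q <= t.+1%:R ^+ 2 * k%:R by rewrite -natrX -natrM ler_nat ltnW.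
  apply: le_trans (ler_wpM2l (sqr_ge0 _) h2) _; rewrite mulrCA.
  by rewrite -[leRHS]mulr1; apply: ler_wpM2l; rewrite ?sqr_ge0.
apply: le_trans (_ : t.+1%:R / (q ^ 2)%:R <= _); first by rewrite ler_pdivlMr.
rewrite [leRHS]mulrAC; apply: ler_wpM2r; first by rewrite invr_ge0 ltW.
have tq1 : (t.+1 <= (q ^ 2).+1)%N by [].
apply: le_trans (_ : expR 1 * \sum_(i < (q ^ 2).+1 | (i < t.+1)%N) expR (- (i%:R ^+ 2 * k%:R / Q)) <= _); last first.
  apply: ler_wpM2l; first exact: expR_ge0.
  by rewrite big_mkcond /=; apply: ler_sum => i _; case: ifP => // _; exact: expR_ge0.
rewrite -(big_ord_widen _ (fun i => expR (- (i%:R ^+ 2 * k%:R / Q))) tq1) mulr_sumr.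
rewrite -[leLHS]mulr1 mulr_natl -[in leLHS](card_ord t.+1) -sumr_const; apply: ler_sum => i _.
rewrite -expRD -[leLHS]expR0 ler_expR subr_ge0 ler_pdivrMr // mul1r.
rewrite -natrX -natrM ler_nat; apply: leq_trans tk; rewrite leq_mul2r leq_sqr.
by rewrite -ltnS ltn_ord orbT.
Qed.

(** Up to order [72 q ^ 4] the walk bound and [arcsine_atoms] apply. Beyond it the crude bound
    [(2 S) ^ j] is enough: the extra [expR 2^-1] per power outweighs the small mass of the atom
    [None]. *)
Lemma Sxpow_dominated j a : oppow X j a a <= \sum_al watom al * (S * yatom a al) ^+ j.
Proof.
have s0 := S_gt0 (R := R) n0.
have all0 al : 0 <= watom al * (S * yatom a al) ^+ j.
  by rewrite mulr_ge0 ?watom_ge0 // exprn_ge0 // mulr_ge0 ?yatom_ge0 // ltW.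
case oj : (odd j).
  by apply: le_trans (Sxpow_odd_le n0 a oj) _; apply: sumr_ge0 => al _.
have [k jk] : exists k, j = (2 * k)%N by exists j./2; rewrite mul2n even_halfK ?oj.
rewrite sum_option /= jk; have [kQ|Qk] := leqP k (36 * q ^ 4).
  apply: le_trans (Sxpow_even_le n0 k a) _.
  apply: ler_wpDl; first by have := all0 None; rewrite jk.
  have base : S ^+ 2 - Mval R a ^+ 2 + (4 * k%:R + 2) * S <= S ^+ 2 * rho2 a.
    have kR : k%:R <= 36 * Q by rewrite -natrM ler_nat.
    have -> : S ^+ 2 * rho2 a = S ^+ 2 - Mval R a ^+ 2 + (144 * Q + 2) * S.
      by rewrite /rho2 /mz; field; rewrite gt_eqF.
    by rewrite lerD2l; apply: ler_wpM2r; rewrite ?(ltW s0) //; lra.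
  have base0 : 0 <= S ^+ 2 - Mval R a ^+ 2 + (4 * k%:R + 2) * S.
    have := @Mval_bound R n a; have : 0 <= k%:R :> R by [].
    move: (Mval R a) S s0 (k%:R : R) => x s s0 z z0 /andP[x1 x2]; nra.
  apply: le_trans (ler_pM (arcsine_ge0 k) (exprn_ge0 k base0) (arcsine_atoms k) (lerXn2r k _ _ base)) _;
    rewrite ?nnegrE // ?(mulr_ge0 (sqr_ge0 _) (rho2_ge0 _)) //.
  rewrite le_eqVlt; apply/orP; left; apply/eqP.
  rewrite mulr_sumr mulr_suml; apply: eq_bigr => i _.
  have sq : (S * (Num.sqrt (rho2 a) * expR (- (i%:R ^+ 2 / (2 * Q))))) ^+ 2 =
     S ^+ 2 * rho2 a * expR (- (i%:R ^+ 2 / Q)).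
    rewrite [LHS]exprMn [(Num.sqrt _ * _) ^+ 2]exprMn sqr_sqrtr ?rho2_ge0 // -expRM_natr mulrA.
    have : Q != 0 by rewrite pnatr_eq0 -lt0n expn_gt0 q0.
    by move=> Qn; congr (_ * expR _); move: Qn; move: Q => z z0; field.
  rewrite exprM sq [(_ * expR _) ^+ k]exprMn -[expR _ ^+ k]expRM_natr.
  have -> : - (i%:R ^+ 2 / Q) * k%:R = - (i%:R ^+ 2 * k%:R / Q) by ring.
  by rewrite -!mulrA; congr (_ * (_ * _)); rewrite mulrC.
apply: le_trans (Sxpow_crude n0 _ a a) _.
apply: ler_wpDr.
  by apply: sumr_ge0 => i _; have := all0 (Some i); rewrite jk.
have -> : S * (2 * expR 2^-1) = (2 * S) * expR 2^-1 by ring.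
rewrite [leRHS](_ : _ = (2 * S) ^+ (2 * k) * (expR (- (36 * Q)) * expR 2^-1 ^+ (2 * k))); last first.
  by rewrite exprMn; ring.
rewrite -[leLHS]mulr1; apply: ler_wpM2l; first by rewrite exprn_ge0 // mulr_ge0 // ltW.
rewrite -expRM_natr -expRD -[leLHS]expR0 ler_expR natrM mulrA mulVf // mul1r.
by rewrite addrC subr_ge0 -natrM ler_nat ltnW.
Qed.

End Domination.

(** * Upper bound on the diagonal of the Gibbs weight by classical variables *)

Section SpectralUpperBound.
Context {R : realType}.
Variables (n N q : nat) (b : R).
Hypothesis n0 : (0 < n)%N.
Hypothesis q0 : (0 < q)%N.
Hypothesis evN : ~~ odd N.
Hypothesis b0 : 0 <= b.
Notation S := (spinS R n).
Notation X := (Sxloc R n).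
Notation cf := {ffun site N -> 'I_n.+1}.

Definition zenergy (s : cf) : R :=
  b / 2 * \sum_r \sum_(d : bool) mz (s r) * mz (s (edge_inv (d, true) r)).

Definition xhop : cf -> cf -> R := fun s t => b / (2 * S ^+ 2) *
  \sum_r \sum_(d : bool) opmul (atpoint X r) (atpoint X (edge_inv (d, false) r)) s t.

Lemma atpoint_Sz r (s t : cf) : atpoint (Szloc R n) r s t = Mval R (s r) * (s == t)%:R.
Proof.
rewrite /atpoint /Szloc; have [->|ne] := eqVneq s t.
  rewrite eqxx; congr (_ * _%:R); apply/eqP; rewrite eqb1; apply/forallP => x.
  by rewrite eqxx implybT.
rewrite mulr0; case: eqP => [e|_]; last by rewrite mul0r.
suff -> : [forall x, (x != r) ==> (s x == t x)] = false by rewrite mulr0.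
apply: contraNF ne => /forallP h; apply/eqP/ffunP => x.
by have [->//|xr] := eqVneq x r; have /implyP/(_ xr)/eqP := h x.
Qed.

Lemma energy_split : energy (n := n) (N := N) b = diagplus zenergy xhop.
Proof.
have s0 := S_gt0 (R := R) n0.
apply/funext => s; apply/funext => t; rewrite /energy /pair_energy /diagplus /xhop /zenergy.
have e r : \sum_(i : bool * bool) opmul (atpoint (spinloc i) r) (atpoint (spinloc i) (edge_inv i r)) s t =
   \sum_(d : bool) (S ^+ 2 * (mz (s r) * mz (s (edge_inv (d, true) r))) * (s == t)%:R) +
   \sum_(d : bool) opmul (atpoint X r) (atpoint X (edge_inv (d, false) r)) s t.
  rewrite -(pair_bigA _ (fun d p : bool => opmul (atpoint (spinloc (d, p)) r) (atpoint (spinloc (d, p)) (edge_inv (d, p) r)) s t)) /=.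
  rewrite -big_split; apply: eq_bigr => d _ /=; rewrite big_bool /=; congr (_ + _).
  rewrite /spinloc /= /opmul; under eq_bigr do rewrite !atpoint_Sz.
  rewrite (eq_bigr (fun z => (s == z)%:R * (Mval R (s r) * (Mval R (z (edge_inv (d, true) r)) * (z == t)%:R)))); last first.
    by move=> z _; ring.
  by rewrite sum_delta_l /mz; field; rewrite gt_eqF.
rewrite (eq_bigr _ (fun r _ => e r)) big_split /= mulrDr; congr (_ + _).
under eq_bigr do rewrite -mulr_suml -mulr_sumr.
rewrite -mulr_suml -mulr_sumr; field; rewrite gt_eqF //.
Qed.

Lemma atpoint_X_ge0 r (s t : cf) : 0 <= atpoint X r s t.
Proof. by rewrite /atpoint mulr_ge0 ?Sxloc_ge0. Qed.

Lemma xhop_ge0 s t : 0 <= xhop s t.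
Proof.
rewrite /xhop mulr_ge0 ?divr_ge0 ?mulr_ge0 ?sqr_ge0 //.
apply: sumr_ge0 => r _; apply: sumr_ge0 => d _; apply: sumr_ge0 => z _.
by rewrite mulr_ge0 ?atpoint_X_ge0.
Qed.

Definition sdist (s t : cf) : R := \sum_r `|Mval R (s r) - Mval R (t r)|.

Lemma sdist_tri u s t : sdist s t <= sdist s u + sdist u t.
Proof. by rewrite /sdist -big_split /=; apply: ler_sum => r _; exact: ler_distD. Qed.

Lemma sum_neq0 (I : finType) (F : I -> R) : \sum_i F i != 0 -> exists i, F i != 0.
Proof.
move=> h; apply/existsP; apply: contraNT h => /existsPn h; rewrite big1 // => i _.
by have := h i; rewrite negbK => /eqP.
Qed.

Lemma atpoint_X_dist r s t : atpoint X r s t != 0 -> sdist s t <= 1.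
Proof.
rewrite /atpoint agree_setat; have [e|ne] := eqVneq t (setat s r (t r)); last by rewrite mulr0 eqxx.
rewrite mulr1 => /(Sxloc_step) h; rewrite /sdist (bigD1 r) //= h big1 ?addr0 // => x xr.
by rewrite e setat_other // subrr normr0.
Qed.

Lemma xhop_dist s t : xhop s t != 0 -> sdist s t <= 2.
Proof.
rewrite /xhop mulf_eq0 negb_or => /andP[_ /sum_neq0[r /sum_neq0[d /sum_neq0[u]]]].
rewrite mulf_eq0 negb_or => /andP[/atpoint_X_dist h1 /atpoint_X_dist h2].
apply: le_trans (sdist_tri u s t) _; lra.
Qed.

Lemma xhop_pow_dist k s t : oppow xhop k s t != 0 -> sdist s t <= 2 * k%:R.
Proof.
elim: k s => [|k IH] s.
  rewrite /= /opid; have [->|ne] := eqVneq s t; last by rewrite eqxx.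
  by move=> _; rewrite mulr0 /sdist big1 // => r _; rewrite subrr normr0.
rewrite oppowS => /sum_neq0[u]; rewrite mulf_eq0 negb_or => /andP[/xhop_dist h1 /IH h2].
apply: le_trans (sdist_tri u s t) _; rewrite -[k.+1%:R]natr1; lra.
Qed.

Lemma mz_abs_le1 (a : 'I_n.+1) : `|mz a : R| <= 1.
Proof.
have s0 := S_gt0 (R := R) n0; have /andP[h1 h2] := @Mval_bound R n a.
by rewrite /mz normrM normfV (gtr0_norm s0) ler_pdivrMr // mul1r ler_norml h1.
Qed.

Lemma prod_lip (x y x' y' : R) : `|x| <= 1 -> `|y'| <= 1 ->
  x' * y' - x * y <= `|x - x'| + `|y - y'|.
Proof.
move=> h1 h2; have -> : x' * y' - x * y = (x' - x) * y' + x * (y' - y) by ring.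
apply: le_trans (ler_norm _) _; apply: le_trans (ler_normD _ _) _.
rewrite !normrM (distrC x' x) (distrC y' y).
have := normr_ge0 (x - x'); have := normr_ge0 (y - y').
move: `|x - x'| `|y - y'| `|x| `|y'| h1 h2 => p1 p2 p3 p4; nra.
Qed.

(** A hop moves the configuration by at most 2 in [sdist], so it raises the z-energy by at most
    [4 b / S]; this is the [eps] of [exp_diagplus_le]. *)
Lemma zenergy_lip s t : zenergy t <= zenergy s + 2 * b / S * sdist s t.
Proof.
have s0 := S_gt0 (R := R) n0.
rewrite -lerBlDl /zenergy -mulrBr -sumrB.
have hb : 0 <= b / 2 by rewrite divr_ge0.
apply: le_trans (_ : b / 2 * \sum_r \sum_(d : bool)
   (`|mz (s r) - mz (t r)| + `|mz (s (edge_inv (d, true) r)) - mz (t (edge_inv (d, true) r))|) <= _).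
  apply: ler_wpM2l => //; apply: ler_sum => r _; rewrite -sumrB; apply: ler_sum => d _.
  exact: prod_lip (mz_abs_le1 _) (mz_abs_le1 _).
under eq_bigr do rewrite big_split /=; rewrite big_split /=.
have e1 : \sum_r \sum_(d : bool) `|mz (s r) - mz (t r)| = 2 * (sdist s t / S).
  under eq_bigr do rewrite sumr_const card_bool -mulr_natl.
  rewrite -mulr_sumr /sdist mulr_suml; congr (_ * _); apply: eq_bigr => r _.
  by rewrite /mz -mulrBl normrM normfV (gtr0_norm s0).
have e2 : \sum_r \sum_(d : bool) `|mz (s (edge_inv (d, true) r)) - mz (t (edge_inv (d, true) r))| = 2 * (sdist s t / S).
  rewrite -e1 exchange_big [RHS]exchange_big; apply: eq_bigr => d _ /=.
  by rewrite [RHS](reindex_inj (inv_inj (invK evN (d, true)))).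
rewrite e1 e2 le_eqVlt; apply/orP; left; apply/eqP; field; rewrite gt_eqF //.
Qed.

Definition monop (d : site N -> nat) : cf -> cf -> R :=
  fun s t => \prod_r oppow X (d r) (s r) (t r).

Lemma Sx_monop r d : opmul (atpoint X r) (monop d) = monop (fun x => d x + (x == r))%N.
Proof.
apply/funext => s; apply/funext => t; rewrite opmul_atpoint /monop.
rewrite [RHS](bigD1 r) //= eqxx addn1 oppowS /opmul mulr_suml; apply: eq_bigr => a _.
rewrite (bigD1 r) //= setat_same mulrA; congr (_ * _); apply: eq_bigr => x xr.
by rewrite setat_other // (negPf xr) addn0.
Qed.

(** [B] is a polynomial with non-negative coefficients in the commuting operators [S^x] of the
    sites, [p] the same polynomial in real variables. In this form diagonal elements factor over the
    sites, monomial by monomial. *)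
Definition represents (B : cf -> cf -> R) (p : (site N -> R) -> R) :=
  exists l : seq (R * (site N -> nat)), [/\ all (fun x => 0 <= x.1) l,
    (forall s t, B s t = \sum_(x <- l) x.1 * monop x.2 s t) &
    (forall y, p y = \sum_(x <- l) x.1 * \prod_r y r ^+ x.2 r)].

Lemma represents_id : represents opid (fun=> 1).
Proof.
exists [:: (1, fun=> 0%N)]; split=> [|s t|y]; rewrite ?big_seq1 /= ?ler01 //.
  rewrite mul1r /monop /= /opid; have [->|ne] := eqVneq s t.
    by rewrite big1 // => r _; rewrite eqxx.
  have [r nr] : exists r, s r != t r.
    apply/existsP; apply: contraNT ne => /existsPn h; apply/eqP/ffunP => r.
    by have := h r; rewrite negbK => /eqP.
  by rewrite (bigD1 r) //= (negPf nr) mul0r.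
by rewrite big1 ?mulr1 // => r _; rewrite expr0.
Qed.

Lemma represents_Sx B p r : represents B p ->
  represents (opmul (atpoint X r) B) (fun y => y r * p y).
Proof.
move=> [l [l0 hB hp]]; exists [seq (x.1, fun z => (x.2 z + (z == r))%N) | x <- l]; split.
- by rewrite all_map.
- move=> s t; rewrite big_map.
  have -> : B = (fun s t => \sum_(x <- l) opscale x.1 (monop x.2) s t).
    by apply/funext => u; apply/funext => v; rewrite hB.
  by rewrite opmul_sumr; apply: eq_bigr => x _; rewrite opmulZr Sx_monop.
- move=> y; rewrite big_map hp mulr_sumr; apply: eq_bigr => x _ /=.
  rewrite mulrCA; congr (_ * _); rewrite (bigD1 r) //= [RHS](bigD1 r) //= eqxx addn1 exprS mulrA.
  by congr (_ * _); apply: eq_bigr => z zr; rewrite (negPf zr) addn0.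
Qed.

Lemma represents_sum (I : Type) (rs : seq I) (Bi : I -> cf -> cf -> R) (pi : I -> (site N -> R) -> R) :
  (forall i, represents (Bi i) (pi i)) ->
  represents (fun s t => \sum_(i <- rs) Bi i s t) (fun y => \sum_(i <- rs) pi i y).
Proof.
move=> h; elim: rs => [|i rs [l [l0 hB hp]]].
  by exists [::]; split=> // [s t|y]; rewrite !big_nil.
have [l' [l0' hB' hp']] := h i; exists (l' ++ l); split.
- by rewrite all_cat l0' l0.
- by move=> s t; rewrite big_cons big_cat /= hB' hB.
- by move=> y; rewrite big_cons big_cat /= hp' hp.
Qed.

Lemma represents_scale (c : R) B p : 0 <= c -> represents B p ->
  represents (opscale c B) (fun y => c * p y).
Proof.
move=> c0 [l [l0 hB hp]]; exists [seq (c * x.1, x.2) | x <- l]; split.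
- by rewrite all_map; apply: sub_all l0 => x /= x0; rewrite mulr_ge0.
- by move=> s t; rewrite big_map /opscale hB mulr_sumr; apply: eq_bigr => x _; rewrite mulrA.
- by move=> y; rewrite big_map hp mulr_sumr; apply: eq_bigr => x _; rewrite mulrA.
Qed.

Definition bilinx (y : site N -> R) : R :=
  \sum_r \sum_(d : bool) y r * y (edge_inv (d, false) r).

Lemma bilinxZ c y : bilinx (fun r => c * y r) = c ^+ 2 * bilinx y.
Proof.
rewrite /bilinx mulr_sumr; apply: eq_bigr => r _; rewrite mulr_sumr; apply: eq_bigr => d _; ring.
Qed.

Lemma represents_xhop k : represents (oppow xhop k) (fun y => (b / (2 * S ^+ 2) * bilinx y) ^+ k).
Proof.
elim: k => [|k IH]; first exact: represents_id.
have -> : (fun y => (b / (2 * S ^+ 2) * bilinx y) ^+ k.+1) = (fun y => b / (2 * S ^+ 2) *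
   \sum_r \sum_(d : bool) (y r * (y (edge_inv (d, false) r) * (b / (2 * S ^+ 2) * bilinx y) ^+ k))).
  apply/funext => y; rewrite exprS -mulrA; congr (_ * _); rewrite /bilinx !mulr_suml.
  by apply: eq_bigr => r _; rewrite mulr_suml; apply: eq_bigr => d _; rewrite mulrA.
have -> : oppow xhop k.+1 = opscale (b / (2 * S ^+ 2)) (fun s t => \sum_r \sum_(d : bool)
   opmul (atpoint X r) (opmul (atpoint X (edge_inv (d, false) r)) (oppow xhop k)) s t).
  rewrite oppowS.
  have -> : xhop = opscale (b / (2 * S ^+ 2)) (fun s t => \sum_r \sum_(d : bool) opmul (atpoint X r) (atpoint X (edge_inv (d, false) r)) s t) by [].
  rewrite opmulZl; congr (opscale _ _).
  rewrite opmul_suml; apply/funext => s; apply/funext => t; apply: eq_bigr => r _.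
  by rewrite opmul_suml; apply: eq_bigr => d _; rewrite -opmulA.
apply: represents_scale; first by rewrite divr_ge0 // mulr_ge0 // sqr_ge0.
apply: represents_sum => r; apply: represents_sum => d.
exact/represents_Sx/represents_Sx.
Qed.

Notation atoms := {ffun site N -> atom q}.
Definition yconf (s : cf) (al : atoms) : site N -> R := fun r => (yatom (s r) (al r) : R).
Definition wconf (al : atoms) : R := \prod_r (watom (al r) : R).

Lemma represents_diag_le B p s : represents B p ->
  B s s <= \sum_al wconf al * p (fun r => S * yconf s al r).
Proof.
have s0 := S_gt0 (R := R) n0.
move=> [l [/allP l0 hB hp]]; rewrite hB; under [leRHS]eq_bigr do rewrite hp mulr_sumr.
rewrite exchange_big /= big_seq [leRHS]big_seq; apply: ler_sum => x /l0 x0.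
have -> : \sum_al wconf al * (x.1 * \prod_r (S * yconf s al r) ^+ x.2 r) =
   x.1 * \sum_(al : atoms) \prod_r ((watom (al r) : R) * (S * (yatom (s r) (al r) : R)) ^+ x.2 r).
  rewrite mulr_sumr; apply: eq_bigr => al _; rewrite mulrCA; congr (_ * _).
  by rewrite /wconf -big_split.
apply: ler_wpM2l => //.
rewrite -(bigA_distr_bigA (fun r al => (watom al : R) * (S * yatom (s r) al) ^+ x.2 r)).
rewrite /monop; apply: ler_prod => r _; rewrite Sxpow_ge0 /=; exact: Sxpow_dominated.
Qed.

(** Moment domination applied to the powers of [xhop] replaces each [S^x] by a classical variable;
    noncommutativity with the z-part leaves only the factor [expR (4 * b / S)] in the coupling. *)
Theorem exp_energy_diag_le s :
  opexp (energy (n := n) (N := N) b) s s <= expR (zenergy s) *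
   \sum_al wconf al * expR (expR (4 * b / S) * (b / 2) * bilinx (yconf s al)).
Proof.
have s0 := S_gt0 (R := R) n0.
rewrite energy_split; apply: (@exp_diagplus_le _ _ _ _ _ _ (4 * b / S)).
- exact: xhop_ge0.
- by rewrite divr_ge0 ?mulr_ge0 // ltW.
- move=> k t /xhop_pow_dist h; apply: le_trans (zenergy_lip s t) _; rewrite lerD2l.
  have c0 : 0 <= 2 * b / S by rewrite divr_ge0 ?mulr_ge0 // ltW.
  apply: le_trans (ler_wpM2l c0 h) _; rewrite le_eqVlt; apply/orP; left; apply/eqP; ring.
move=> m.
apply: le_trans (_ : \sum_(k < m) \sum_al wconf al * ((expR (4 * b / S) * (b / 2) * bilinx (yconf s al)) ^+ k / k`!%:R) <= _).
  apply: ler_sum => k _.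
  have h := represents_diag_le s (represents_xhop k).
  apply: le_trans (_ : expR (4 * b / S) ^+ k / k`!%:R * oppow xhop k s s <= _).
    by rewrite le_eqVlt; apply/orP; left; apply/eqP; ring.
  have c0 : 0 <= expR (4 * b / S) ^+ k / k`!%:R by rewrite divr_ge0 // exprn_ge0 // expR_ge0.
  apply: le_trans (ler_wpM2l c0 h) _.
  rewrite mulr_sumr le_eqVlt; apply/orP; left; apply/eqP; apply: eq_bigr => al _.
  have -> : b / (2 * S ^+ 2) * bilinx (fun r => S * yconf s al r) = b / 2 * bilinx (yconf s al).
    rewrite bilinxZ; move: (bilinx _) S s0 => z s' s0; by field; rewrite gt_eqF.
  rewrite -[expR (4 * b / S) * (b / 2) * _]mulrA.
  move: (b / 2 * bilinx _) => z; rewrite [(_ * z) ^+ k]exprMn; ring.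
rewrite exchange_big; apply: ler_sum => al _; rewrite -mulr_sumr; apply: ler_wpM2l.
  by apply: prodr_ge0 => r _; exact: watom_ge0.
apply: exp_partial_le; rewrite !mulr_ge0 ?expR_ge0 ?invr_ge0 //.
by apply: sumr_ge0 => r _; apply: sumr_ge0 => d _; rewrite mulr_ge0 ?yatom_ge0.
Qed.

End SpectralUpperBound.

(** * Exponential and Gaussian sums over separated points *)

Section SummationTools.
Context {R : realType}.

Lemma geometric_sum_le (x : R) K : 0 <= x -> x < 1 -> \sum_(k < K) x ^+ k <= (1 - x)^-1.
Proof.
move=> x0 x1; have h : 0 < 1 - x by rewrite subr_gt0.
rewrite -[leRHS]mul1r ler_pdivlMr //.
have := subrX1 x K => e.
have -> : (\sum_(k < K) x ^+ k) * (1 - x) = 1 - x ^+ K.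
  by rewrite -[RHS]opprB e; ring.
by rewrite lerBlDr lerDl exprn_ge0.
Qed.

Lemma inj_geometric_le (I : finType) (P : pred I) (k : I -> nat) (x : R) :
  0 <= x -> x < 1 -> {in P &, injective k} -> \sum_(i | P i) x ^+ k i <= (1 - x)^-1.
Proof.
move=> x0 x1 kinj.
pose K := (\max_(i | P i) k i).+1.
apply: le_trans (_ : \sum_(j < K) x ^+ j <= _); last exact: geometric_sum_le.
pose ko i : 'I_K := inord (k i).
have kK i : P i -> (k i < K)%N by move=> Pi; rewrite ltnS; exact: (leq_bigmax_cond _ Pi).
have koE i : P i -> ko i = k i :> nat by move=> Pi; rewrite inordK // kK.
rewrite (partition_big ko predT) //=; apply: ler_sum => j _.
case: (pickP (fun i => P i && (ko i == j))) => [i0 /andP[P0 /eqP e0]|none]; last first.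
  by rewrite big_pred0 ?exprn_ge0.
rewrite (big_pred1 i0) => [|i]; first by rewrite -(koE _ P0) e0.
apply/andP/eqP => [[Pi /eqP ei]|->]; last by rewrite P0 e0 eqxx.
by apply: kinj => //; rewrite -(koE _ Pi) -(koE _ P0) ei e0.
Qed.

Lemma expR1_le4 : expR 1 <= 4 :> R.
Proof.
have h : (2^-1 : R) <= expR (- 2^-1).
  by apply: le_trans (expR_ge1Dx _); lra.
have e : expR 1 * expR (- 2^-1) ^+ 2 = 1 :> R.
  by rewrite -expRM_natr -expRD (_ : _ + _ = 0) ?expR0 //; lra.
have := expR_gt0 (1 : R); move: (expR 1 : R) (expR (- 2^-1) : R) h e => x y h e x0.
have : 4^-1 <= y ^+ 2 by nra.
nra.
Qed.

Lemma one_sub_exp_ge (s : R) : 0 <= s -> s / (1 + s) <= 1 - expR (- s).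
Proof.
move=> s0; have h := expR_ge1Dx s; have s1 : 0 < 1 + s by lra.
have -> : s / (1 + s) = 1 - (1 + s)^-1 by field; rewrite gt_eqF.
rewrite lerD2l lerN2 expRN lef_pV2 ?posrE ?expR_gt0 //.
Qed.

Lemma exp_geometric_inv_le (s : R) : 0 < s -> s <= 1 -> (1 - expR (- s))^-1 <= 2 / s.
Proof.
move=> s0 s1; have h := one_sub_exp_ge (ltW s0).
have h1 : 0 < s / (1 + s) by rewrite divr_gt0 //; lra.
have h2 := lt_le_trans h1 h.
apply: le_trans (_ : (s / (1 + s))^-1 <= _); first by rewrite lef_pV2 ?posrE.
by rewrite invf_div; apply: ler_wpM2r; [rewrite invr_ge0 ltW|lra].
Qed.

(** Points at mutual distance [s] have distinct values of [floor (f / s)], so the sum is compared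
    with two geometric series, one for each sign. *)
Lemma separated_exp_sum_le (I : finType) (P : pred I) (f : I -> R) (s : R) : 0 < s -> s <= 1 ->
  (forall i j, P i -> P j -> i != j -> s <= `|f i - f j|) ->
  \sum_(i | P i) expR (- `|f i|) <= 16 / s.
Proof.
move=> s0 s1 sep; pose z i := Num.floor (f i / s).
have zb i : (z i)%:~R <= f i / s < (z i)%:~R + 1.
  by rewrite /z floor_le_tmp -[1]/(1%:~R) -intrD floorD1_gt.
have zinj i j : P i -> P j -> z i = z j -> i = j.
  move=> Pi Pj e; apply/eqP; apply: contraT => ne; have := sep i j Pi Pj ne.
  have := zb i; have := zb j; rewrite e.
  rewrite !ler_pdivlMr // !ltr_pdivrMr // => /andP[a1 a2] /andP[a3 a4].
  rewrite leNgt ltr_norml => /negP; case; apply/andP; split; nra.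
have term i : expR (- `|f i|) <= 4 * expR (- s) ^+ `|z i|%N.
  have e4 := expR1_le4; apply: le_trans (_ : expR 1 * expR (- s) ^+ `|z i|%N <= _); last first.
    by apply: ler_wpM2r; rewrite // exprn_ge0 // expR_ge0.
  rewrite -expRM_natr -expRD ler_expR -lerBlDl.
  have -> : (`|z i|%N%:R : R) = `|(z i)%:~R| by rewrite -intr_norm natr_absz.
  have := zb i; rewrite ler_pdivlMr // ltr_pdivrMr //; move: ((z i)%:~R : R) (f i) => u v /andP[a1 a2].
  have -> : - s * `|u| = - `|u * s| by rewrite normrM (gtr0_norm s0); ring.
  rewrite mulrDl mul1r in a2; move: (u * s) a1 a2 => w a1 a2.
  case: (ger0P w) => u0; case: (ger0P v) => v0; lra.
apply: le_trans (ler_sum _ (fun i _ => term i)) _; rewrite -mulr_sumr.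
have x0 : 0 <= expR (- s) by exact: expR_ge0.
have x1 : expR (- s) < 1 by rewrite -[ltRHS]expR0 ltr_expR; lra.
have g := exp_geometric_inv_le s0 s1.
suff h : \sum_(i | P i) expR (- s) ^+ `|z i|%N <= 2 * (1 - expR (- s))^-1.
  apply: le_trans (ler_wpM2l _ h) _ => //; lra.
rewrite (bigID (fun i => 0 <= z i)) /= [leRHS]mulr_natl mulr2n; apply: lerD.
  apply: inj_geometric_le => // i j /andP[Pi zi] /andP[Pj zj] e; apply: zinj => //.
  by rewrite -(gez0_abs zi) -(gez0_abs zj) e.
apply: inj_geometric_le => // i j /andP[Pi]; rewrite -ltNge => zi /andP[Pj]; rewrite -ltNge => zj e.
by apply: zinj => //; apply: oppr_inj; rewrite -(ltz0_abs zi) -(ltz0_abs zj) e.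
Qed.

Lemma exp_sq_le (t : R) : expR (- t ^+ 2) <= 2 * expR (- `|t|).
Proof.
have h : expR (4^-1) <= 2 :> R.
  have e : expR 1 = expR (4^-1) ^+ 4 :> R by rewrite -expRM_natr; congr expR; lra.
  have := expR1_le4; have := expR_gt0 (4^-1 : R); rewrite e; move: (expR _ : R) => x x0 h.
  rewrite leNgt; apply/negP => x2.
  have : 4 < x ^+ 2 by nra.
  by rewrite (_ : x ^+ 4 = x ^+ 2 * x ^+ 2) in h; [nra|ring].
apply: le_trans (_ : expR (4^-1) * expR (- `|t|) <= _); last by apply: ler_wpM2r; rewrite ?expR_ge0.
rewrite -expRD ler_expR -[t ^+ 2]real_normK ?num_real //; have := normr_ge0 t; move: `|t| => x x0.
have := sqr_ge0 (x - 2^-1); rewrite sqrrB; lra.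
Qed.

Lemma separated_gauss_sum_le (I : finType) (P : pred I) (f : I -> R) (s : R) : 0 < s -> s <= 1 ->
  (forall i j, P i -> P j -> i != j -> s <= `|f i - f j|) ->
  \sum_(i | P i) expR (- f i ^+ 2) <= 32 / s.
Proof.
move=> s0 s1 sep; apply: le_trans (ler_sum _ (fun i _ => exp_sq_le (f i))) _.
by rewrite -mulr_sumr; have := separated_exp_sum_le s0 s1 sep; lra.
Qed.

End SummationTools.

(** * Summing out variables one at a time *)

Section Elimination.
Context {R : realType} {I L : finType}.

Definition relabel (l : {ffun I -> L}) r a : {ffun I -> L} := [ffun x => if x == r then a else l x].

Lemma relabel_same l r a : relabel l r a r = a.
Proof. by rewrite ffunE eqxx. Qed.

Lemma relabel_other l r a x : x != r -> relabel l r a x = l x.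
Proof. by rewrite ffunE => /negPf ->. Qed.

Lemma relabel_sum r (F : {ffun I -> L} -> R) :
  \sum_l \sum_a F (relabel l r a) = #|L|%:R * \sum_l F l.
Proof.
have -> : #|L|%:R * \sum_l F l = \sum_(a : L) \sum_l F l by rewrite sumr_const mulr_natl.
rewrite pair_bigA [RHS]pair_bigA /=.
pose f (p : {ffun I -> L} * L) := (p.1 r, relabel p.1 r p.2).
pose g (p : L * {ffun I -> L}) := (relabel p.2 r p.1, p.2 r).
rewrite [RHS](reindex f) //=; exists g => -[u v] _; rewrite /f /g /= relabel_same; congr (_, _).
  by apply/ffunP => x; rewrite !ffunE; case: eqP => [->|].
by apply/ffunP => x; rewrite !ffunE; case: eqP => [->|].
Qed.

(* Summing out the variables in the order of decreasing rank. *)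
Lemma sum_prod_eliminate (h : I -> {ffun I -> L} -> R) (rk : I -> nat) (tau : I -> R) :
  (0 < #|L|)%N -> (forall r l, 0 <= h r l) ->
  (forall r r' l a, r' != r -> (rk r' <= rk r)%N -> h r' (relabel l r a) = h r' l) ->
  (forall r l, \sum_a h r (relabel l r a) <= tau r) ->
  \sum_l \prod_r h r l <= \prod_r tau r.
Proof.
move=> L0 h0 hloc htau.
have tau0 r : 0 <= tau r.
  have [a _] := card_gt0P L0.
  by apply: le_trans (htau r [ffun=> a]); apply: sumr_ge0.
have LR : 0 < #|L|%:R :> R by rewrite ltr0n.
(* Variables outside [J] are never removed: they stay free and count for a factor [#|L|] each,
   whence the powers on both sides. *)
have key m (J : {set I}) : #|J| = m ->
   #|L|%:R ^+ m * (\sum_l \prod_(r in J) h r l) <= #|L|%:R ^+ #|I| * \prod_(r in J) tau r.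
  elim: m J => [|m IH] J cJ.
    have -> : J = set0 by apply/eqP; rewrite -cards_eq0 cJ.
    rewrite expr0 mul1r big_set0 mulr1.
    by under eq_bigr do rewrite big_set0; rewrite sumr_const card_ffun natrX.
  have [r0 r0J] : exists r, r \in J by apply/card_gt0P; rewrite cJ.
  have [r /= rJ rmax] := arg_maxnP rk r0J; have {}rJ : r \in J by [].
  have cJr : #|J :\ r| = m by move: cJ; rewrite (cardsD1 r) rJ add1n => -[].
  rewrite (big_setD1 r rJ) /= exprS.
  have -> : #|L|%:R * #|L|%:R ^+ m * (\sum_l \prod_(r' in J) h r' l) =
     #|L|%:R ^+ m * \sum_l (\sum_a h r (relabel l r a)) * \prod_(r' in J :\ r) h r' l.
    rewrite -mulrA mulrCA; congr (_ * _).
    rewrite -(relabel_sum r); apply: eq_bigr => l _; rewrite mulr_suml; apply: eq_bigr => a _.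
    rewrite (big_setD1 r rJ) /=; congr (_ * _); apply: eq_bigr => r'; rewrite !inE => /andP[ne r'J].
    by apply: hloc => //; exact: rmax.
  apply: le_trans (_ : #|L|%:R ^+ m * \sum_l tau r * \prod_(r' in J :\ r) h r' l <= _).
    apply: ler_wpM2l; first by rewrite exprn_ge0 // ltW.
    apply: ler_sum => l _; apply: ler_wpM2r (htau r l); exact: prodr_ge0.
  rewrite -mulr_sumr mulrCA [leRHS]mulrCA; apply: ler_wpM2l => //; exact: IH.
have := key #|I| setT (cardsT I); rewrite ler_pM2l ?exprn_gt0 //.
have eT (F : I -> R) : \prod_(r in [set: I]) F r = \prod_r F r by apply: eq_bigl => r; rewrite inE.
have eS : \sum_l \prod_(r in [set: I]) h r l = \sum_l \prod_r h r l by apply: eq_bigr => l _; exact: eT.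
by rewrite eT eS.
Qed.

Lemma sum_ffun_pair (A B : finType) (F : {ffun I -> A} -> {ffun I -> B} -> R) :
  \sum_s \sum_t F s t = \sum_(l : {ffun I -> A * B}) F [ffun r => (l r).1] [ffun r => (l r).2].
Proof.
rewrite pair_bigA /=.
pose f (l : {ffun I -> A * B}) := ([ffun r => (l r).1] : {ffun I -> A}, [ffun r => (l r).2] : {ffun I -> B}).
pose g (p : {ffun I -> A} * {ffun I -> B}) : {ffun I -> A * B} := [ffun r => (p.1 r, p.2 r)].
rewrite (reindex f) //=; exists g => [l _|[s t] _]; rewrite /f /g.
  by apply/ffunP => r; rewrite !ffunE; case: (l r).
by congr (_, _); apply/ffunP => r; rewrite !ffunE.
Qed.

End Elimination.

(** * Upper bounds on the weights of defect patterns *)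

Section RealLemmas.
Context {R : realType}.

Lemma radius_gap_cost (y y' d d' : R) : y' <= 37 / 100 -> 70 / 100 <= y -> d <= 0 -> d' <= 0 ->
  2^-1 * (d + d') - 4^-1 * (y - y') ^+ 2 <= - 50^-1.
Proof.
by move=> h1 h2 h3 h4; have : 1089 / 10000 <= (y - y') ^+ 2; [nra|lra].
Qed.

Lemma norm_add_same_sign (x y : R) : 0 <= x * y -> `|x + y| = `|x| + `|y|.
Proof.
move=> xy; case: (ltgtP 0 x) xy => [x0|x0|<-] xy.
- have y0 : 0 <= y by rewrite -(pmulr_rge0 _ x0).
  by rewrite !ger0_norm // ?addr_ge0 // ltW.
- have y0 : y <= 0 by rewrite -(nmulr_rge0 _ x0).
  by rewrite !ler0_norm ?(ltW x0) // ?opprD //; lra.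
- by rewrite normr0 !add0r.
Qed.

Lemma mul_sq_ge (x y : R) : 1 <= x -> 0 <= y -> y <= x * x * y /\ x * y <= x * x * y.
Proof.
move=> x1 y0; have h : x <= x * x by nra.
split; last exact: ler_wpM2r.
by rewrite -[leLHS]mul1r; apply: ler_wpM2r => //; lra.
Qed.

End RealLemmas.

Section UpperSums.
Context {R : realType}.
Variables (n N q : nat) (b : R).
Hypothesis n0 : (0 < n)%N.
Hypothesis evN : ~~ odd N.
Hypothesis b100 : 100 <= b.
Hypothesis bQ : b <= (q ^ 4)%:R.
Hypothesis Qb : (q ^ 4)%:R <= 16 * b.
Hypothesis bS : 10000 * b ^+ 2 <= spinS R n.
Notation S := (spinS R n).
Notation cf := {ffun site N -> 'I_n.+1}.
Notation Q := ((q ^ 4)%:R : R).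
Notation q2 := ((q ^ 2)%:R : R).

Lemma b_ge0 : 0 <= b.
Proof. by move: b100; lra. Qed.

Lemma q_gt0 : (0 < q)%N.
Proof.
rewrite lt0n; apply/eqP => q0; move: bQ b100; rewrite q0 exp0n //=; lra.
Qed.

Lemma q2_sq : q2 ^+ 2 = Q.
Proof. by rewrite -natrX -expnM. Qed.

Lemma q2_ge1 : 1 <= q2.
Proof. by rewrite ler1n expn_gt0 q_gt0. Qed.

Definition slack : R := (144 * Q + 2) / S.

Lemma slack_ge0 : 0 <= slack.
Proof. by rewrite divr_ge0 ?(ltW (S_gt0 n0)) // addr_ge0 // mulr_ge0. Qed.

Lemma b_slack_le : b * slack <= 1.
Proof.
rewrite /slack mulrA ler_pdivrMr ?(S_gt0 n0) // mul1r; apply: le_trans bS.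
move: Qb b100; move: Q => z; nra.
Qed.

Lemma slack_le : slack <= 100^-1.
Proof. have := b_slack_le; have := slack_ge0; move: slack b100 => z; nra. Qed.

Lemma rho2E (a : 'I_n.+1) : rho2 q a = 1 - mz a ^+ 2 + slack.
Proof. by []. Qed.

(** Noncommutativity enters through [b * (4 b / S)], and [S >= 10000 b ^ 2] makes it a small
    constant. *)
Lemma coupling_bounds : b <= expR (4 * b / S) * b <= b + 1.
Proof.
have s0 := S_gt0 (R := R) n0; set t := 4 * b / S.
have t0 : 0 <= t by rewrite divr_ge0 ?(ltW s0) // mulr_ge0 // b_ge0.
have B := b100; have bt : b * t <= 1000^-1.
  rewrite /t mulrA ler_pdivrMr //; move: bS; move: (spinS R n) => z; nra.
have h1 := expR_ge1Dx t; have h2 := expR_ge1Dx (- t); have h3 := expR_gt0 t.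
have h4 : expR t * expR (- t) = 1 by rewrite -expRD subrr expR0.
have h5 : t <= 1000^-1 by nra.
have h6 : expR t * (1 - t) <= 1 by nra.
apply/andP; split; first by nra.
have h7 : expR t <= 2 by nra.
have h8 : expR t * b - expR t * (b * t) <= b by nra.
by nra.
Qed.

(** By [x y = (x ^ 2 + y ^ 2) / 2 - (x - y) ^ 2 / 2] the energy splits into site potentials and edge
    penalties; every site lies in one pair per direction. *)
Lemma sum_edge_sq (p : bool) (f : site N -> R) :
  \sum_r \sum_(d : bool) f r * f (edge_inv (d, p) r) =
  2 * \sum_r f r ^+ 2 - 2^-1 * \sum_r \sum_(d : bool) (f r - f (edge_inv (d, p) r)) ^+ 2.
Proof.
have e (d : bool) : \sum_r f (edge_inv (d, p) r) ^+ 2 = \sum_r f r ^+ 2.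
  by rewrite [RHS](reindex_inj (inv_inj (invK evN (d, p)))).
have -> : 2 * \sum_r f r ^+ 2 = \sum_r \sum_(d : bool) (f r ^+ 2 + f (edge_inv (d, p) r) ^+ 2) / 2.
  rewrite exchange_big /=; under [RHS]eq_bigr do rewrite -mulr_suml big_split /= e.
  by rewrite sumr_const card_bool -mulr_natl; lra.
rewrite mulr_sumr -sumrB; apply: eq_bigr => r _; rewrite mulr_sumr -sumrB; apply: eq_bigr => d _.
by field.
Qed.

Notation label := ('I_n.+1 * atom q)%type.

Definition lweight (l : label) : R := if l.2 is Some _ then expR 1 / q2 else 1.
(* The deficit, in units of [b], of the diagonal energy of a label with respect to the maximum [b]. *)
Definition deficit (l : label) : R :=
  if l.2 is Some i then - ((1 - mz l.1 ^+ 2) * (1 - expR (- (i%:R ^+ 2 / Q)))) else - 4.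

(** For [Some i], the sum of [m ^ 2] and [y ^ 2] differs from 1 by [deficit], up to errors of order
    [1 / b] that the 3 absorbs. For [None] the energy is about [17 b], and the mass [exp (- 36 Q)]
    with [Q >= b] compensates it with at least [4 b] to spare. *)
Lemma site_potential_le (a : 'I_n.+1) (al : atom q) :
  (watom al : R) * expR (b * mz a ^+ 2 + expR (4 * b / S) * b * yatom a al ^+ 2) <=
  lweight (a, al) * expR (b + 3) * expR (b * deficit (a, al)).
Proof.
have /andP[hb1 hb2] := coupling_bounds; set b1 := expR _ * b in hb1 hb2 *.
have m1 := mz_sq_le1 (R := R) n0 a; have m0 := sqr_ge0 (mz a : R); have B := b100.
case: al => [i|] /=; rewrite /lweight /deficit /=.
  rewrite -[leRHS]mulrA; apply: ler_wpM2l; first by rewrite divr_ge0 ?expR_ge0.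
  rewrite -expRD ler_expR [(Num.sqrt _ * _) ^+ 2]exprMn sqr_sqrtr ?rho2_ge0 // -expRM_natr.
  have -> : - (i%:R ^+ 2 / (2 * Q)) * 2 = - (i%:R ^+ 2 / Q).
    have : Q != 0 by rewrite pnatr_eq0 -lt0n expn_gt0 q_gt0.
    by move: Q => z z0; field.
  set x := expR _.
  have x1 : x <= 1 by rewrite /x -[leRHS]expR0 ler_expR oppr_le0 divr_ge0 ?sqr_ge0.
  have x0 : 0 <= x by exact: expR_ge0.
  have := b_slack_le; have := slack_le; have := slack_ge0; rewrite rho2E.
  move: slack (mz a ^+ 2) m1 m0 => e m m1 m0 e0 e1 be.
  have h1 : b1 * ((1 - m + e) * x) <= b * ((1 - m + e) * x) + (1 - m + e) * x.
    have : 0 <= (1 - m + e) * x by rewrite mulr_ge0 //; lra.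
    by move: ((1 - m + e) * x) => z; nra.
  have h2 : (1 - m + e) * x <= 2 by nra.
  have h3 : b * ((1 - m + e) * x) = b * (1 - m) * x + b * e * x by ring.
  have h4 : b * e * x <= 1 by have := mulr_ge0 (_ : 0 <= b) e0; nra.
  have -> : b * - ((1 - m) * (1 - x)) = b * (1 - m) * x - b * (1 - m) by ring.
  have -> : b * (1 - m) = b - b * m by ring.
  lra.
rewrite mul1r -!expRD ler_expR.
have y2 : (2 * expR 2^-1) ^+ 2 <= 16 :> R.
  rewrite exprMn -expRM_natr mulVf //; have := expR1_le4 (R := R); lra.
move: (_ ^+ 2) y2 (sqr_ge0 (2 * expR 2^-1 : R)) => y y16 y0.
have : b1 * y <= 16 * (b + 1) by nra.
have : b * mz a ^+ 2 <= b by nra.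
move: bQ b100; lra.
Qed.

Lemma deficit_le0 l : deficit l <= 0.
Proof.
rewrite /deficit; case: l.2 => [i|]; last by lra.
have h : expR (- (i%:R ^+ 2 / Q)) <= 1 by rewrite -[leRHS]expR0 ler_expR oppr_le0 divr_ge0 ?sqr_ge0.
by rewrite oppr_le0 mulr_ge0 // subr_ge0 ?mz_sq_le1.
Qed.

Lemma lweight_ge0 l : 0 <= lweight l.
Proof. by rewrite /lweight; case: l.2 => // i; rewrite divr_ge0 ?expR_ge0. Qed.

Definition edge_cost (s : cf) (al : {ffun site N -> atom q}) (r : site N) (d : bool) : R :=
  (mz (s r) - mz (s (edge_inv (d, true) r))) ^+ 2 +
  (yconf s al r - yconf s al (edge_inv (d, false) r)) ^+ 2.

(** The potentials keep the enlarged coupling, controlled by [coupling_bounds]; in the penalties it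
    is lowered back to [b]. *)
Lemma exp_energy_diag_labels s : opexp (energy (n := n) (N := N) b) s s <=
  \sum_(al : {ffun site N -> atom q})
    (\prod_r (lweight (s r, al r) * expR (b + 3) * expR (b * deficit (s r, al r)))) *
    expR (- (b / 4 * \sum_r \sum_(d : bool) edge_cost s al r d)).
Proof.
have b0 := b_ge0.
apply: le_trans (exp_energy_diag_le n0 q_gt0 evN b0 s) _.
rewrite mulr_sumr; apply: ler_sum => al _.
have /andP[hb1 hb2] := coupling_bounds; set b1 := expR (4 * b / S) in hb1 hb2 *.
have -> : zenergy b s = b * \sum_r mz (s r) ^+ 2 -
     b / 4 * \sum_r \sum_(d : bool) (mz (s r) - mz (s (edge_inv (d, true) r))) ^+ 2.
  by rewrite /zenergy (sum_edge_sq true (fun r => mz (s r))); field.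
have -> : b1 * (b / 2) * bilinx (yconf s al) = b1 * b * \sum_r yconf s al r ^+ 2 -
     b1 * b / 4 * \sum_r \sum_(d : bool) (yconf s al r - yconf s al (edge_inv (d, false) r)) ^+ 2.
  by rewrite /bilinx (sum_edge_sq false (yconf s al)); field.
set M2 := \sum_r mz (s r) ^+ 2; set Y2 := \sum_r yconf s al r ^+ 2.
set DM := \sum_r \sum_(d : bool) _; set DY := \sum_r \sum_(d : bool) _.
have -> : \sum_r \sum_(d : bool) edge_cost s al r d = DM + DY.
  by rewrite -big_split; apply: eq_bigr => r _; rewrite -big_split.
have DY0 : 0 <= DY by apply: sumr_ge0 => r _; apply: sumr_ge0 => d _; rewrite sqr_ge0.
rewrite mulrCA -expRD.
apply: le_trans (_ : wconf al * (expR (b * M2 + b1 * b * Y2) * expR (- (b / 4 * (DM + DY)))) <= _).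
  apply: ler_wpM2l; first by apply: prodr_ge0 => r _; exact: watom_ge0.
  rewrite -expRD ler_expR; move: DY DY0 (b1 * b) hb1 => D D0 c hc; nra.
rewrite mulrA; apply: ler_wpM2r; first exact: expR_ge0.
have -> : b * M2 + b1 * b * Y2 = \sum_r (b * mz (s r) ^+ 2 + b1 * b * yconf s al r ^+ 2).
  by rewrite big_split /= !mulr_sumr.
rewrite expR_sum /wconf -big_split /=; apply: ler_prod => r _; apply/andP; split.
  by rewrite mulr_ge0 ?watom_ge0 ?expR_ge0.
exact: site_potential_le.
Qed.

Definition far_apart (kappa : R) : rel 'I_n.+1 := fun a c =>
  (`|mz a : R| <= kappa) && (1 - kappa <= `|mz c : R|).
Definition split_pair (kappa : R) : rel 'I_n.+1 := fun a c =>
  far_apart kappa a c || far_apart kappa c a.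

Lemma split_pair_sym kappa : symmetric (split_pair kappa).
Proof. by move=> a c; rewrite /split_pair orbC. Qed.

Lemma sq_norm_sub (x y : R) : (`|x| - `|y|) ^+ 2 <= (x - y) ^+ 2.
Proof.
rewrite -[leRHS]real_normK ?num_real // -[leLHS]real_normK ?num_real //.
by apply: lerXn2r; rewrite ?nnegrE ?ler_dist_dist.
Qed.

Lemma split_pair_z (kappa : R) a c : kappa <= 16^-1 -> split_pair kappa a c ->
  50^-1 <= 4^-1 * (mz a - mz c : R) ^+ 2.
Proof.
move=> k16 h; have := sq_norm_sub (mz a) (mz c); move: h.
rewrite /split_pair /far_apart; move: `|mz a| `|mz c| ((mz a - mz c) ^+ 2) => x y z.
by move=> /orP[]/andP[h1 h2]; nra.
Qed.

(** At the site with small [|m|] either the atom has lost half of its squared radius, which shows in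
    the deficit, or [y >= 0.7]. At the other end [y <= 0.37], and a quarter of the squared gap
    exceeds [1/50]. *)
Lemma far_apart_x (kappa : R) a c (al al' : atom q) : 0 <= kappa -> kappa <= 16^-1 -> far_apart kappa a c ->
  2^-1 * (deficit (a, al) + deficit (c, al')) - 4^-1 * (yatom a al - yatom c al' : R) ^+ 2 <= - 50^-1.
Proof.
move=> k0 k16 /andP[h1 h2].
have d1 := deficit_le0 (a, al); have d2 := deficit_le0 (c, al').
have sq := sqr_ge0 (yatom a al - yatom c al' : R).
have dN x : deficit (x, None) = - 4 by [].
case: al d1 sq => [i|] d1 sq; last by rewrite dN; lra.
case: al' d2 sq => [j|] d2 sq; last by rewrite dN; lra.
have ma : mz a ^+ 2 <= 256^-1 :> R.
  rewrite -[mz a ^+ 2]real_normK ?num_real //; move: `|mz a| (normr_ge0 (mz a : R)) h1 => x x0 h1; nra.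
have mc : 225 / 256 <= mz c ^+ 2 :> R.
  rewrite -[mz c ^+ 2]real_normK ?num_real //; move: `|mz c| h2 => x h2; nra.
have ya0 := @yatom_ge0 R n q a (Some i); have yc0 := @yatom_ge0 R n q c (Some j).
have yE (a' : 'I_n.+1) (k : 'I_(q ^ 2).+1) : (yatom a' (Some k) : R) ^+ 2 = rho2 q a' * expR (- (k%:R ^+ 2 / Q)).
  rewrite /= [(Num.sqrt _ * _) ^+ 2]exprMn sqr_sqrtr ?rho2_ge0 // -expRM_natr; congr (_ * expR _).
  have : Q != 0 by rewrite pnatr_eq0 -lt0n expn_gt0 q_gt0.
  by move: Q => z z0; field.
have ea := yE a i; have ec := yE c j.
have x1 (k : 'I_(q ^ 2).+1) : expR (- (k%:R ^+ 2 / Q)) <= 1.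
  by rewrite -[leRHS]expR0 ler_expR oppr_le0 divr_ge0 ?sqr_ge0.
have xi1 := x1 i; have xj1 := x1 j; have xi0 := expR_ge0 (- (i%:R ^+ 2 / Q)).
have xj0 := expR_ge0 (- (j%:R ^+ 2 / Q)).
have sl := slack_le; have sl0 := slack_ge0.
have ra := @rho2_ge0 R n q n0 a.
have da : deficit (a, Some i) = - ((1 - mz a ^+ 2) * (1 - expR (- (i%:R ^+ 2 / Q)))) by [].
move: ea ec d1 d2 sq da ra ya0 yc0; rewrite !rho2E.
move: (yatom a (Some i)) (yatom c (Some j)) (expR (- (i%:R ^+ 2 / Q))) (expR (- (j%:R ^+ 2 / Q)))
  (mz a ^+ 2) (mz c ^+ 2) slack (deficit (a, Some i)) (deficit (c, Some j)) ma mc sl sl0 xi1 xj1 xi0 xj0.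
move=> y y' x x' m m' e d d' ma mc e1 e0 x1' x1'' x0 x0' ea ec d0 d0' sq da r0 y0 y0'.
have c1 : y' <= 37 / 100.
  have h : y' ^+ 2 <= 135 / 1000 by rewrite ec; nra.
  by nra.
case: (lerP x (2^-1)) => hx; first by rewrite da; nra.
have c2 : 70 / 100 <= y.
  have h : 49 / 100 <= y ^+ 2 by rewrite ea; nra.
  by nra.
exact: radius_gap_cost.
Qed.

Lemma split_pair_x (kappa : R) a c (al al' : atom q) : 0 <= kappa -> kappa <= 16^-1 -> split_pair kappa a c ->
  2^-1 * (deficit (a, al) + deficit (c, al')) - 4^-1 * (yatom a al - yatom c al' : R) ^+ 2 <= - 50^-1.
Proof.
move=> k0 k16 /orP[h|h]; first exact: far_apart_x h.
have := far_apart_x al' al k0 k16 h; rewrite [X in _ * X - _]addrC.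
have -> : (yatom c al' - yatom a al : R) ^+ 2 = (yatom a al - yatom c al') ^+ 2 by rewrite -[LHS]sqrrN opprB.
by [].
Qed.

Lemma sum_lweight_le : \sum_(l : label) lweight l <= 36 * S.
Proof.
have e4 := expR1_le4 (R := R); have q1 := q2_ge1.
have -> : \sum_(l : label) lweight l = \sum_(a : 'I_n.+1) \sum_(al : atom q) lweight (a, al).
  by rewrite pair_bigA; apply: eq_bigr => -[].
under eq_bigr do rewrite sum_option /lweight /= sumr_const card_ord.
rewrite sumr_const card_ord -[_ *+ (q ^ 2).+1]mulr_natr -[_ *+ n.+1]mulr_natr.
have -> : (n.+1%:R : R) = 2 * S + 1 by rewrite S_double natr1.
have S1 : 1 <= 2 * S by rewrite S_double ler1n.
have -> : ((q ^ 2).+1%:R : R) = q2 + 1 by rewrite natr1.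
have h : expR 1 / q2 * (q2 + 1) <= 8.
  rewrite mulrAC ler_pdivrMr; last by lra.
  by have := expR_gt0 (1 : R); move: (expR 1 : R) e4 q2 q1 => e e4 z z1 e0; nra.
move: (expR 1 / q2 * _) h (spinS R n) S1 => x h s S1; nra.
Qed.

Theorem split_pairs_upper (kappa : R) i (J : {set site N}) : 0 <= kappa -> kappa <= 16^-1 ->
  torus_weight b (split_pair kappa) (Some i) J <=
  (expR (b + 3) * (36 * S)) ^+ (N ^ 2) * expR (- (b / 50)) ^+ #|J|.
Proof.
move=> k0 k16; have b0 := b_ge0.
have site_ge0 l : 0 <= lweight l * expR (b + 3) by rewrite mulr_ge0 ?lweight_ge0 ?expR_ge0.
apply: le_trans (_ : \sum_(s : cf) \sum_(al : {ffun site N -> atom q})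
    (\prod_r (lweight (s r, al r) * expR (b + 3))) * expR (- (b / 50)) ^+ #|J| <= _); last first.
  under eq_bigr do rewrite -mulr_suml; rewrite -mulr_suml.
  apply: ler_wpM2r; first by rewrite exprn_ge0 // expR_ge0.
  rewrite (sum_ffun_pair (fun s al => \prod_r (lweight (s r, al r) * expR (b + 3)))).
  rewrite (eq_bigr (fun l : {ffun site N -> label} => \prod_r (lweight (l r) * expR (b + 3)))); last first.
    by move=> l _; apply: eq_bigr => r _; rewrite !ffunE; case: (l r).
  rewrite -(bigA_distr_bigA (fun (r : site N) l => lweight l * expR (b + 3))).
  rewrite prodr_const card_prod !card_ord mulnn; apply: lerXn2r; rewrite ?nnegrE.
  - by apply: sumr_ge0.
  - by rewrite !mulr_ge0 ?expR_ge0 // ltW // S_gt0.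
  - by rewrite -mulr_suml mulrC; apply: ler_wpM2l; [exact: expR_ge0|exact: sum_lweight_le].
rewrite /torus_weight /event_weight.
apply: le_trans (_ : \sum_(s | pair_event (tau_of (Some i)) (split_pair kappa) J s)
    \sum_(al : {ffun site N -> atom q})
    (\prod_r (lweight (s r, al r) * expR (b + 3))) * expR (- (b / 50)) ^+ #|J| <= _); last first.
  rewrite big_mkcond; apply: ler_sum => s _; case: ifP => // _.
  by apply: sumr_ge0 => al _; rewrite mulr_ge0 ?prodr_ge0 // exprn_ge0 // expR_ge0.
apply: ler_sum => s /forall_inP ev; apply: le_trans (exp_energy_diag_labels s) _.
apply: ler_sum => al _; rewrite [X in X * _ <= _]big_split /= -[leLHS]mulrA; apply: ler_wpM2l; first by apply: prodr_ge0.
rewrite -expR_sum -expRD -expRM_natr ler_expR -mulr_sumr.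
pose tau := @edge_inv N i.
(* Each deficit is shared equally between the ends of the pair, so that a site of [J] sees half the
   deficits of both ends together with its own penalty. *)
have def2 : \sum_r deficit (s r, al r) =
    \sum_r 2^-1 * (deficit (s r, al r) + deficit (s (tau r), al (tau r))).
  have e : \sum_r deficit (s (tau r), al (tau r)) = \sum_r deficit (s r, al r).
    by rewrite [RHS](reindex_inj (inv_inj (invK evN i))).
  by rewrite -mulr_sumr big_split /= e; field.
have cost1 : \sum_r edge_cost s al r i.1 <= \sum_r \sum_(d : bool) edge_cost s al r d.
  by apply: ler_sum => r _; rewrite (bigD1 i.1) //= lerDl; apply: sumr_ge0 => d _; rewrite addr_ge0 ?sqr_ge0.
have main : \sum_r deficit (s r, al r) - 4^-1 * \sum_r edge_cost s al r i.1 <= - 50^-1 * #|J|%:R.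
  rewrite def2 mulr_sumr -sumrB -sum1_card natr_sum mulr_sumr [leRHS]big_mkcond; apply: ler_sum => r _.
  have c1 := sqr_ge0 (mz (s r) - mz (s (edge_inv (i.1, true) r)) : R).
  have c2 := sqr_ge0 (yconf s al r - yconf s al (edge_inv (i.1, false) r) : R).
  have d1 := deficit_le0 (s r, al r); have d2 := deficit_le0 (s (tau r), al (tau r)).
  case: ifP => [rJ|_]; last by rewrite /edge_cost; lra.
  rewrite mulr1; have := ev r rJ; rewrite /tau_of -/(tau r) /edge_cost.
  have ei : i = (i.1, i.2) by case: (i).
  case e2 : i.2 => h.
    have := split_pair_z k16 h; rewrite /tau {1}ei e2; lra.
  have := split_pair_x (al r) (al (tau r)) k0 k16 h.
  rewrite -[yatom (s r) _]/(yconf s al r) -[yatom (s (tau r)) _]/(yconf s al (tau r)).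
  have -> : tau r = edge_inv (i.1, false) r by rewrite /tau {1}ei e2.
  lra.
have := ler_wpM2l b0 main; have := ler_wpM2l b0 cost1; lra.
Qed.

Definition intermediate (kappa : R) (a : 'I_n.+1) : bool := kappa < `|mz a : R| < 1 - kappa.

Section Intermediate.
Variable kappa : R.
Hypothesis k0 : 0 < kappa.
Hypothesis k16 : kappa <= 16^-1.

(** Here [1 - m ^ 2 >= kappa], and [Q <= 16 b] turns the cost of the atom [i] into at least
    [kappa * i / 32]. Only [O(1 / kappa)] of the [q ^ 2] atoms count, so their total mass keeps a
    factor [1 / q ^ 2]. *)
Lemma intermediate_deficit a (i : 'I_(q ^ 2).+1) : intermediate kappa a ->
  expR (b * deficit (a, Some i)) <= expR (- (kappa / 32)) ^+ i.
Proof.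
move=> /andP[h1 h2]; rewrite -expRM_natr ler_expR /deficit /=.
have m1 : kappa <= 1 - mz a ^+ 2.
  rewrite -[mz a ^+ 2]real_normK ?num_real //; move: `|mz a| h1 h2 k0 => x; nra.
have Q0 : 0 < Q by move: bQ b100; lra.
set t := i%:R ^+ 2 / Q.
have iq : i%:R <= q2 by rewrite ler_nat -ltnS.
have t0 : 0 <= t by rewrite divr_ge0 ?sqr_ge0.
have t1 : t <= 1.
  by rewrite /t ler_pdivrMr // mul1r -q2_sq; apply: lerXn2r; rewrite ?nnegrE.
have tb : i%:R <= 16 * (b * t).
  have -> : 16 * (b * t) = 16 * b * i%:R ^+ 2 / Q by rewrite /t; ring.
  rewrite ler_pdivlMr //.
  have i2 : i%:R <= i%:R ^+ 2 :> R by rewrite -natrX ler_nat; case: (i : nat) => // k; rewrite leq_pmulr.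
  by rewrite [leRHS]mulrC; apply: ler_pM.
have e1 : t / 2 <= 1 - expR (- t).
  apply: le_trans (one_sub_exp_ge t0); rewrite ler_pdivlMr; last by lra.
  nra.
have b0 := b_ge0.
have h : kappa * (t / 2) <= (1 - mz a ^+ 2) * (1 - expR (- t)).
  by apply: ler_pM => //; [exact: ltW|rewrite divr_ge0].
move: (_ * (1 - expR _)) h (i%:R : R) tb k0 => u h v tb kk.
have := ler_wpM2l b0 h; have : kappa * v <= kappa * (16 * (b * t)) by rewrite ler_pM2l.
lra.
Qed.

Lemma exp_junk_le : expR (b * - 4) <= 4 / Q.
Proof.
have Q0 : 0 < Q by move: bQ b100; lra.
have h := expR_ge1Dx (4 * b); have e := expRN (4 * b).
have -> : b * - 4 = - (4 * b) by ring.
rewrite e -[4 / Q]invf_div lef_pV2 ?posrE ?expR_gt0 ?divr_gt0 //.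
by move: Qb b100 h; lra.
Qed.

Lemma sum_decay_le : \sum_(i < (q ^ 2).+1) expR (- (kappa / 32)) ^+ i <= 64 / kappa.
Proof.
have k32 : 0 < kappa / 32 by move: k0; lra.
apply: le_trans (geometric_sum_le _ _ _) _; rewrite ?expR_ge0 //.
  by rewrite -[ltRHS]expR0 ltr_expR oppr_lt0.
apply: le_trans (exp_geometric_inv_le k32 _) _; first by move: k16; lra.
by rewrite invf_div mulrA; move: (kappa^-1) => z; lra.
Qed.

Notation pot l := (lweight l * expR (b + 3) * expR (b * deficit l)).

Lemma pot_ge0 l : 0 <= pot l.
Proof. by rewrite !mulr_ge0 ?lweight_ge0 ?expR_ge0. Qed.

(** [F] is the link to a neighbour that is kept fixed, and [G] bounds its sum over [M]. The sum over
    radii contributes [1 / (kappa q ^ 2)], the atom [None] the remainder [16 S / Q]. *)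
Lemma sum_pot_le (F : 'I_n.+1 -> atom q -> R) (G : R) : (forall a al, 0 <= F a al <= 1) ->
  (forall i, \sum_(a | intermediate kappa a) F a (Some i) <= G) ->
  \sum_(l : label | intermediate kappa l.1) pot l * F l.1 l.2 <=
  expR (b + 3) * (256 / (kappa * q2) * G + 16 * S / Q).
Proof.
move=> F01 hG; have F0 a al : 0 <= F a al by case/andP: (F01 a al).
have F1 a al : F a al <= 1 by case/andP: (F01 a al).
have G0 : 0 <= G by apply: le_trans (hG ord0); apply: sumr_ge0.
have -> : \sum_(l : label | intermediate kappa l.1) pot l * F l.1 l.2 =
   \sum_(al : atom q) \sum_(a | intermediate kappa a) pot (a, al) * F a al.
  rewrite exchange_big /= pair_big_dep /=.
  by apply: eq_big => [[a al]|[a al] _] /=; rewrite ?andbT.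
rewrite sum_option addrC mulrDr; apply: lerD.
  apply: le_trans (_ : \sum_(i < (q ^ 2).+1) (expR (b + 3) * (expR 1 / q2) * G) * expR (- (kappa / 32)) ^+ i <= _).
    apply: ler_sum => i _.
    apply: le_trans (_ : \sum_(a | intermediate kappa a) (expR (b + 3) * (expR 1 / q2) * expR (- (kappa / 32)) ^+ i) * F a (Some i) <= _).
      apply: ler_sum => a ha; apply: ler_wpM2r => //; rewrite /lweight /= [expR 1 / q2 * _]mulrC.
      by apply: ler_wpM2l; [rewrite mulr_ge0 ?divr_ge0 ?expR_ge0|exact: intermediate_deficit].
    rewrite -mulr_sumr mulrAC; apply: ler_wpM2r; first by rewrite exprn_ge0 // expR_ge0.
    by apply: ler_wpM2l => //; rewrite mulr_ge0 ?divr_ge0 ?expR_ge0.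
  rewrite -mulr_sumr.
  have c0 : 0 <= expR (b + 3) * (expR 1 / q2) * G by rewrite !mulr_ge0 ?invr_ge0 ?expR_ge0.
  apply: le_trans (ler_wpM2l c0 sum_decay_le) _.
  rewrite -!mulrA; apply: ler_wpM2l; first exact: expR_ge0.
  have -> : 256 * ((kappa * q2)^-1 * G) = 4 * (q2^-1 * (G * (64 / kappa))) by rewrite invfM; ring.
  apply: ler_wpM2r; last exact: expR1_le4.
  by rewrite !mulr_ge0 ?invr_ge0 // ltW.
apply: le_trans (_ : \sum_(a : 'I_n.+1) expR (b + 3) * (4 / Q) <= _).
  rewrite big_mkcond; apply: ler_sum => a _; case: ifP => _; last by rewrite mulr_ge0 ?expR_ge0 // divr_ge0.
  have -> : pot (a, None) = expR (b + 3) * expR (b * - 4) by rewrite /lweight /= mul1r.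
  apply: le_trans (_ : expR (b + 3) * expR (b * - 4) * 1 <= _).
    by apply: ler_wpM2l; rewrite ?mulr_ge0 ?expR_ge0.
  by rewrite mulr1; apply: ler_wpM2l; [exact: expR_ge0|exact: exp_junk_le].
rewrite sumr_const card_ord -[_ *+ n.+1]mulr_natr -mulrA; apply: ler_wpM2l; first exact: expR_ge0.
have -> : (n.+1%:R : R) = 2 * S + 1 by rewrite S_double natr1.
have S1 : 1 <= 2 * S by rewrite S_double ler1n.
rewrite [4 / Q * _]mulrAC; apply: ler_wpM2r; first by rewrite invr_ge0.
lra.
Qed.

Lemma mz_sep (a c : 'I_n.+1) : a != c -> S^-1 <= `|mz a - mz c : R|.
Proof.
move=> ac; have s0 := S_gt0 (R := R) n0.
rewrite /mz -mulrBl normrM normfV (gtr0_norm s0) -[leLHS]mul1r; apply: ler_wpM2r; first by rewrite invr_ge0 ltW.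
have -> : Mval R a - Mval R c = (a : nat)%:Z%:~R - (c : nat)%:Z%:~R by rewrite /Mval; ring.
rewrite -intrB -intr_norm (ler_int _ 1) -gtz0_ge1 normr_gt0 subr_eq0.
by apply: contra ac => /eqP[e]; apply/eqP/val_inj.
Qed.

Lemma gauss_scale (x : R) : expR (- (b / 4 * x ^+ 2)) <= expR (- (q2 / 8 * x) ^+ 2).
Proof.
rewrite ler_expR lerN2 exprMn; apply: ler_wpM2r; first exact: sqr_ge0.
by rewrite exprMn q2_sq; move: Qb; lra.
Qed.

Lemma scale_S_le1 : q2 / (8 * S) <= 1.
Proof.
have s0 := S_gt0 (R := R) n0; have s8 : 0 < 8 * S by lra.
rewrite ler_pdivrMr // mul1r.
have q1 := q2_ge1; have : q2 <= Q by rewrite -q2_sq; nra.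
by move: Qb bS b100; move: (spinS R n) q2 Q => s x y; nra.
Qed.

Lemma gauss_mz_le u : \sum_(a : 'I_n.+1) expR (- (b / 4 * (mz a - u) ^+ 2)) <= 256 * S / q2.
Proof.
have s0 := S_gt0 (R := R) n0; have q20 : 0 < q2 by have := q2_ge1; lra.
apply: le_trans (ler_sum _ (fun a _ => gauss_scale _)) _.
have z0 : 0 < q2 / (8 * S) by rewrite divr_gt0 // mulr_gt0.
apply: le_trans (separated_gauss_sum_le z0 scale_S_le1 _) _.
  move=> a c _ _ ac; rewrite -mulrBr normrM ger0_norm ?divr_ge0 ?(ltW q20) //.
  have -> : mz a - u - (mz c - u) = mz a - mz c by ring.
  rewrite invfM mulrA; apply: ler_wpM2l; first by rewrite divr_ge0 // ltW.
  exact: mz_sep.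
by rewrite invf_div le_eqVlt; apply/orP; left; apply/eqP; ring.
Qed.

(** The squared radii differ by [(m_c - m_a) (m_c + m_a)]; equal signs exclude cancellation in the
    second factor and [|m| > kappa] keeps it away from 0. Near [m = 0] the radius is stationary and
    no such separation holds. *)
Lemma rho_sep a c : intermediate kappa a -> intermediate kappa c -> 0 <= (mz a * mz c : R) -> a != c ->
  2 * kappa / (3 * S) <= `|Num.sqrt (rho2 q a) - Num.sqrt (rho2 q c) : R|.
Proof.
move=> /andP[a1 a2] /andP[c1 c2] ss ac; have s0 := S_gt0 (R := R) n0.
have sep := mz_sep ac.
have ra := sqr_sqrtr (@rho2_ge0 R n q n0 a); have rc := sqr_sqrtr (@rho2_ge0 R n q n0 c).
have pa := sqrtr_ge0 (rho2 q a : R); have pc := sqrtr_ge0 (rho2 q c : R).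
have hm : `|mz a + mz c| = `|mz a| + `|mz c| :> R.
  exact: norm_add_same_sign.
have key : `|Num.sqrt (rho2 q a) - Num.sqrt (rho2 q c)| * (Num.sqrt (rho2 q a) + Num.sqrt (rho2 q c)) =
   `|mz a - mz c| * (`|mz a| + `|mz c|) :> R.
  rewrite -hm -[X in _ * X = _](ger0_norm (_ : 0 <= _)) ?addr_ge0 // -!normrM.
  have -> : (Num.sqrt (rho2 q a) - Num.sqrt (rho2 q c)) * (Num.sqrt (rho2 q a) + Num.sqrt (rho2 q c)) =
     - ((mz a - mz c) * (mz a + mz c)) :> R.
    by rewrite -subr_sqr ra rc -subr_sqr !rho2E; ring.
  by rewrite normrN.
have sl := slack_le.
have up (x : 'I_n.+1) : (rho2 q x : R) <= 9 / 4 by rewrite rho2E; have := sqr_ge0 (mz x : R); lra.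
have r32 (x : 'I_n.+1) : Num.sqrt (rho2 q x) <= 3 / 2 :> R.
  have := up x; have := sqrtr_ge0 (rho2 q x : R); have := sqr_sqrtr (@rho2_ge0 R n q n0 x).
  move: (Num.sqrt (rho2 q x) : R) (rho2 q x : R) => y z e y0 z1; nra.
have ua := r32 a; have uc := r32 c.
have -> : 2 * kappa / (3 * S) = S^-1 * (2 * kappa) / 3 by field; rewrite gt_eqF.
rewrite ler_pdivrMr //.
apply: le_trans (_ : `|mz a - mz c| * (`|mz a| + `|mz c|) <= _).
  by apply: ler_pM; rewrite ?invr_ge0 ?(ltW s0) ?mulr_ge0 ?(ltW k0) //; lra.
rewrite -key; apply: ler_wpM2l => //; lra.
Qed.

Lemma gauss_y_le u (i : 'I_(q ^ 2).+1) :
  \sum_(a : 'I_n.+1 | intermediate kappa a) expR (- (b / 4 * (yatom a (Some i) - u) ^+ 2)) <= 1536 * S / (kappa * q2).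
Proof.
have s0 := S_gt0 (R := R) n0; have q20 : 0 < q2 by have := q2_ge1; lra.
have kk := k0; have k1 := k16.
apply: le_trans (ler_sum _ (fun a _ => gauss_scale _)) _.
pose z := kappa * q2 / (24 * S).
have s8 : 0 < 8 * S by lra.
have s24 : 0 < 24 * S by lra.
have z0 : 0 < z by apply: divr_gt0 => //; exact: mulr_gt0.
have z1 : z <= 1.
  have := scale_S_le1; rewrite /z !ler_pdivrMr // !mul1r; move: (spinS R n) s0 q2 q20 => s s0 y y0; nra.
have x2 : 2^-1 <= expR (- (i%:R ^+ 2 / (2 * Q))).
  apply: le_trans (expR_ge1Dx _).
  have iq : i%:R <= q2 by rewrite ler_nat -ltnS.
  have : i%:R ^+ 2 / (2 * Q) <= 2^-1.
    rewrite invfM mulrCA -[leRHS]mulr1; apply: ler_wpM2l => //.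
    rewrite ler_pdivrMr; last by move: bQ b100; lra.
    by rewrite mul1r -q2_sq; have : 0 <= i%:R :> R by []; move: (i%:R : R) iq => y; nra.
  lra.
have part (P : pred 'I_n.+1) : (forall a c, P a -> P c -> 0 <= mz a * mz c :> R) ->
   \sum_(a : 'I_n.+1 | intermediate kappa a && P a) expR (- (q2 / 8 * (yatom a (Some i) - u)) ^+ 2) <= 32 / z.
  move=> hP; apply: separated_gauss_sum_le => // a c /andP[ha pa] /andP[hc pc] ac.
  rewrite -mulrBr normrM ger0_norm ?divr_ge0 ?(ltW q20) //.
  have -> : (yatom a (Some i) - u - (yatom c (Some i) - u) : R) =
     (Num.sqrt (rho2 q a) - Num.sqrt (rho2 q c)) * expR (- (i%:R ^+ 2 / (2 * Q))) by rewrite /=; ring.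
  rewrite normrM [`|expR _|]ger0_norm ?expR_ge0 //.
  have := rho_sep ha hc (hP _ _ pa pc) ac => h.
  have -> : z = q2 / 8 * (2 * kappa / (3 * S) * 2^-1) by rewrite /z; field; rewrite gt_eqF.
  apply: ler_wpM2l; first by rewrite divr_ge0 // ltW.
  by apply: ler_pM => //; rewrite ?invr_ge0 // divr_ge0 ?mulr_ge0 // ltW.
rewrite (bigID (fun a => 0 <= mz a :> R)) /=.
have h1 := part (fun a => 0 <= mz a :> R) (fun a c ha hc => mulr_ge0 ha hc).
have h2 : \sum_(a : 'I_n.+1 | intermediate kappa a && ~~ (0 <= mz a :> R)) expR (- (q2 / 8 * (yatom a (Some i) - u)) ^+ 2) <= 32 / z.
  by apply: (part (fun a => ~~ (0 <= mz a :> R))) => a c; rewrite -!ltNge => ha hc; rewrite nmulr_lge0 ?ltW.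
apply: le_trans (lerD h1 h2) _.
rewrite /z; move: q2 q20 (spinS R n) s0 => y y0' s' s0'.
by rewrite le_eqVlt; apply/orP; left; apply/eqP; field; rewrite ?gt_eqF.
Qed.

Definition row_pred (r : site N) : site N := edge_inv (false, ~~ odd r.1) r.

Lemma row_predE (r : site N) : (0 < r.1)%N -> (row_pred r).1 = r.1.-1 :> nat.
Proof.
case: r => x y /= x0; rewrite /row_pred /edge_inv /= /nbr.
have -> : (odd x == ~~ odd x) = false by case: odd.
rewrite val_ord_pred; have xN := ltn_ord x.
have -> : ((x + N).-1 = x.-1 + N)%N by case: (x : nat) x0.
by rewrite modnDr modn_small //; apply: leq_ltn_trans xN; exact: leq_pred.
Qed.

Definition label_y (l : label) : R := yatom l.1 l.2.

(** Of the edge penalties only the one towards the predecessor in the first coordinate is kept, an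
    x-edge for odd and a z-edge for even coordinate. Cut open at coordinate 0, each line becomes a
    chain that can be summed out from its end. *)
Definition link (r : site N) (l : {ffun site N -> label}) : R :=
  if (r.1 : nat) == 0%N then 1 else
  if odd r.1 then expR (- (b / 4 * (label_y (l r) - label_y (l (row_pred r))) ^+ 2))
  else expR (- (b / 4 * (mz (l r).1 - mz (l (row_pred r)).1) ^+ 2)).

Lemma exp_neg_sq_le1 (x : R) : 0 <= expR (- (b / 4 * x ^+ 2)) <= 1.
Proof.
by rewrite expR_ge0 -[leRHS]expR0 ler_expR oppr_le0 mulr_ge0 ?sqr_ge0 // divr_ge0 // b_ge0.
Qed.

Lemma link_ge0 r l : 0 <= link r l.
Proof. by rewrite /link; case: ifP => // _; case: ifP => _; exact: expR_ge0. Qed.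

Lemma prod_link_ge (s : cf) (al : {ffun site N -> atom q}) :
  expR (- (b / 4 * \sum_r \sum_(d : bool) edge_cost s al r d)) <=
  \prod_r link r [ffun x => (s x, al x)].
Proof.
rewrite mulr_sumr -sumrN expR_sum; apply: ler_prod => r _; rewrite expR_ge0 /=.
have b4 : 0 <= b / 4 by rewrite divr_ge0 // b_ge0.
have c0 d : 0 <= edge_cost s al r d by rewrite addr_ge0 ?sqr_ge0.
have h : edge_cost s al r false <= \sum_(d : bool) edge_cost s al r d by rewrite big_bool /= lerDr.
rewrite /link; case: ifP => _; first by rewrite -[leRHS]expR0 ler_expR oppr_le0 mulr_ge0 // sumr_ge0.
have m0 := sqr_ge0 (mz (s r) - mz (s (edge_inv (false, true) r)) : R).
have y0 := sqr_ge0 (yconf s al r - yconf s al (edge_inv (false, false) r) : R).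
have yE x : label_y ([ffun x => (s x, al x)] x) = yconf s al x by rewrite ffunE.
have mE x : mz ([ffun x => (s x, al x)] x).1 = mz (s x) :> R by rewrite ffunE.
rewrite !yE !mE /row_pred; case: ifP => o; rewrite ?o ler_expR lerN2; apply: ler_wpM2l => //;
  apply: le_trans h; rewrite /edge_cost ?lerDl ?lerDr //.
Qed.



(** A site gains [1 / q ^ 2] from the radius and [1 / q ^ 2] from its link, together [1 / Q]. The
    [N] sites starting a chain have no link, hence the factor [q2 ^+ N]. The threshold on [C] covers
    the products [256 * 1536] and [256 * 256] of the earlier constants. *)
Theorem all_intermediate_upper (C : R) : 1000 * 1000 <= C -> (0 < N)%N ->
  torus_weight b (fun a _ => intermediate kappa a) None [set: site N] <=
  (expR (b + 3) * (C / kappa ^+ 2 * S / Q)) ^+ (N ^ 2) * q2 ^+ N.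
Proof.
move=> hC N0; have s0 := S_gt0 (R := R) n0; have q1 := q2_ge1; have q20 : 0 < q2 by lra.
have kk := k0; have k1 := k16.
pose h (r : site N) (l : {ffun site N -> label}) : R :=
  (intermediate kappa (l r).1)%:R * (pot (l r) * link r l).
have h0 r l : 0 <= h r l by rewrite !mulr_ge0 ?lweight_ge0 ?expR_ge0 ?link_ge0.
apply: le_trans (_ : \sum_(l : {ffun site N -> label}) \prod_r h r l <= _).
  rewrite /torus_weight /event_weight.
  apply: le_trans (_ : \sum_(s : cf) \sum_(al : {ffun site N -> atom q}) \prod_r h r [ffun x => (s x, al x)] <= _).
    rewrite big_mkcond; apply: ler_sum => s _; case: ifP => [/forall_inP ev|_]; last first.
      by apply: sumr_ge0 => al _; apply: prodr_ge0.
    apply: le_trans (exp_energy_diag_labels s) _; apply: ler_sum => al _.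
    rewrite /h; under [leRHS]eq_bigr => r _.
      have -> : intermediate kappa ([ffun x => (s x, al x)] r).1 by rewrite ffunE; exact: (ev r (in_setT _)).
      rewrite mul1r; over.
    rewrite [leRHS]big_split /=; under [X in _ <= X * _]eq_bigr do rewrite ffunE.
    apply: ler_wpM2l; first by apply: prodr_ge0 => r _; exact: pot_ge0.
    exact: prod_link_ge.
  rewrite (sum_ffun_pair (fun s al => \prod_r h r [ffun x => (s x, al x)])).
  apply: ler_sum => l _; have -> : [ffun x => ([ffun r => (l r).1] x, [ffun r => (l r).2] x)] = l.
    by apply/ffunP => x; rewrite !ffunE; case: (l x).
  exact: lexx.
pose tau (r : site N) : R := expR (b + 3) * (C / kappa ^+ 2 * S / Q) * (if (r.1 : nat) == 0%N then q2 else 1).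
have t00 : 0 <= (C / kappa ^+ 2 * S / Q).
  apply: divr_ge0 => //; apply: mulr_ge0; last exact: ltW.
  have C0 : 0 <= C by lra.
  by apply: divr_ge0 => //; exact: sqr_ge0.
apply: le_trans (sum_prod_eliminate (rk := fun r : site N => r.1 : nat) (tau := tau) _ h0 _ _) _.
- by rewrite card_prod card_ord card_option card_ord.
- move=> r r' l a ne rk; rewrite /h /link relabel_other //.
  case: eqP => // /eqP r'0; rewrite relabel_other //.
  apply/eqP => e; have := row_predE (r := r'); rewrite e lt0n r'0 => /(_ isT) e'.
  move: rk; rewrite e' leqNgt; case: (r'.1 : nat) r'0 => // k _ /=; by rewrite ltnSn.
- move=> r l.
  have split_sum (F : label -> R) : \sum_a (intermediate kappa a.1)%:R * (pot a * F a) =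
     \sum_(a : label | intermediate kappa a.1) pot a * F a.
    by rewrite [RHS]big_mkcond; apply: eq_bigr => a _; case: ifP; rewrite ?mul1r ?mul0r.
  have pr : row_pred r != r by exact: inv_neq.
  rewrite /h /link /tau; under eq_bigr do rewrite relabel_same relabel_other //.
  have Q1 : 1 <= Q by rewrite ler1n expn_gt0 q_gt0.
  have ki : 1 <= kappa^-1 by rewrite invf_ge1 //; lra.
  have QE : Q^-1 = q2^-1 * q2^-1 by rewrite -q2_sq expr2 invfM.
  have sq0 : 0 <= S / Q by rewrite divr_ge0 // ltW.
  have kE : (kappa ^+ 2)^-1 = kappa^-1 * kappa^-1 by rewrite expr2 invfM.
  rewrite -[expR (b + 3) * (C / kappa ^+ 2 * S / Q) * _]mulrA; case: eqP => r0.
    rewrite (split_sum (fun=> 1)).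
    apply: le_trans (sum_pot_le (F := fun _ _ => 1) (G := 4 * S) _ _) _.
    + by move=> a al; rewrite ler01 lexx.
    + move=> i; rewrite sumr_const; apply: le_trans (_ : n.+1%:R <= _).
        by rewrite ler_nat; apply: leq_trans (max_card _) _; rewrite card_ord.
      have : 1 <= 2 * S by rewrite S_double ler1n.
      by have -> : (n.+1%:R : R) = 2 * S + 1; [rewrite S_double natr1|lra].
    apply: ler_wpM2l; first exact: expR_ge0.
    have -> : C / kappa ^+ 2 * S / Q * q2 = (C * (kappa^-1 * kappa^-1)) * (S / q2).
      by rewrite kE QE; move: q2 q20 (spinS R n) => y y0 z; field; rewrite !gt_eqF.
    have -> : 256 / (kappa * q2) * (4 * S) = (1024 * kappa^-1) * (S / q2).
      by move: q2 q20 (spinS R n) => y y0 z; field; rewrite !gt_eqF.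
    have -> : 16 * S / Q = 16 * (S / q2) / q2 by rewrite QE; ring.
    have sq : 0 <= S / q2 by rewrite divr_ge0 // ltW.
    have : 16 * (S / q2) / q2 <= 16 * (S / q2) by rewrite ler_pdivrMr // ler_peMr // mulr_ge0.
    move: (16 * (S / q2) / q2) => w; move: (kappa^-1) ki (S / q2) sq => x x1 y y0 hw.
    have [xy xy'] := mul_sq_ge x1 y0.
    have : 1000 * 1000 * (x * x * y) <= C * (x * x) * y by rewrite -[leRHS]mulrA; apply: ler_wpM2r => //; lra.
    lra.
  rewrite mulr1; case: (odd r.1).
    rewrite (split_sum (fun a => expR (- (b / 4 * (label_y a - label_y (l (row_pred r))) ^+ 2)))).
    apply: le_trans (sum_pot_le (F := fun a al => expR (- (b / 4 * (yatom a al - label_y (l (row_pred r))) ^+ 2))) _ (gauss_y_le _)) _.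
      by move=> a al; exact: exp_neg_sq_le1.
    apply: ler_wpM2l; first exact: expR_ge0.
    have -> : 256 / (kappa * q2) * (1536 * S / (kappa * q2)) = 256 * 1536 * (kappa^-1 * kappa^-1) * (S / Q).
      by rewrite QE; move: q2 q20 (spinS R n) => y y0 z; field; rewrite !gt_eqF.
    have -> : C / kappa ^+ 2 * S / Q = C * (kappa^-1 * kappa^-1 * (S / Q)) by rewrite kE; ring.
    rewrite -[256 * 1536 * _ * _]mulrA -[16 * S / Q]mulrA.
    move: (kappa^-1) ki (S / Q) sq0 => x x1 y y0.
    have [xy xy'] := mul_sq_ge x1 y0.
    have : 1000 * 1000 * (x * x * y) <= C * (x * x * y) by apply: ler_wpM2r => //; lra.
    lra.
  rewrite (split_sum (fun a => expR (- (b / 4 * (mz a.1 - mz (l (row_pred r)).1) ^+ 2)))).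
  apply: le_trans (sum_pot_le (F := fun a _ => expR (- (b / 4 * (mz a - mz (l (row_pred r)).1) ^+ 2))) (G := 256 * S / q2) _ _) _.
  + by move=> a al; exact: exp_neg_sq_le1.
  + move=> i; apply: le_trans (gauss_mz_le (mz (l (row_pred r)).1)).
    by rewrite big_mkcond; apply: ler_sum => a _; case: ifP => // _; exact: expR_ge0.
  apply: ler_wpM2l; first exact: expR_ge0.
  have -> : 256 / (kappa * q2) * (256 * S / q2) = 256 * 256 * kappa^-1 * (S / Q).
    by rewrite QE; move: q2 q20 (spinS R n) => y y0 z; field; rewrite !gt_eqF.
  have -> : C / kappa ^+ 2 * S / Q = C * (kappa^-1 * kappa^-1 * (S / Q)) by rewrite kE; ring.
  rewrite -[256 * 256 * _ * _]mulrA -[16 * S / Q]mulrA.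
  move: (kappa^-1) ki (S / Q) sq0 => x x1 y y0.
  have [xy xy'] := mul_sq_ge x1 y0.
  have : 1000 * 1000 * (x * x * y) <= C * (x * x * y) by apply: ler_wpM2r => //; lra.
  lra.
rewrite big_split /= prodr_const card_prod !card_ord mulnn; apply: ler_wpM2l.
  by rewrite exprn_ge0 // mulr_ge0 // expR_ge0.
rewrite -(pair_bigA _ (fun x y : 'I_N => if (x : nat) == 0%N then q2 else 1)) /=.
under eq_bigr do rewrite prodr_const card_ord.
rewrite (bigD1 (Ordinal N0)) //= big1 ?mulr1 // => x nx.
by rewrite ifN ?expr1n //; apply: contra nx => /eqP e; apply/eqP/val_inj.
Qed.

End Intermediate.

End UpperSums.

(** * Tent-shaped trial functions *)

Section Tent.
Context {R : realType}.

(** Changing by at most 1 per step, the tent nearly coincides with its translate by one, so [S^x] is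
    nearly maximal in a vector supported in a short window. *)
Definition tent (w k : nat) : nat := minn k.+1 (w - k).

Lemma tent_out w k : (w <= k)%N -> tent w k = 0%N.
Proof. by rewrite /tent; lia. Qed.

(** Expand the sum of the squared increments, each at most 1; the translate loses only the first
    term [tent w 0 = 1] of the norm. *)
Lemma tent_overlap w : (0 < w)%N ->
  2 * \sum_(k < w) (tent w k)%:R ^+ 2 - (w%:R + 1) <=
  2 * \sum_(k < w) (tent w k)%:R * (tent w k.+1)%:R :> R.
Proof.
move=> w0.
have sh : \sum_(k < w) (tent w k.+1)%:R ^+ 2 = \sum_(k < w) (tent w k)%:R ^+ 2 - 1 :> R.
  have h1 := big_ord_recl w (fun k : 'I_w.+1 => (tent w k)%:R ^+ 2 : R) (op := +%R) (idx := 0).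
  have h2 := big_ord_recr w (fun k : 'I_w.+1 => (tent w k)%:R ^+ 2 : R) (op := +%R) (idx := 0).
  rewrite /= (tent_out (leqnn w)) expr0n /= addr0 in h2.
  have t0 : tent w 0 = 1%N by rewrite /tent; lia.
  by rewrite -h2 h1 /= t0 expr1n addrAC subrr add0r.
have sq : \sum_(k < w) ((tent w k)%:R - (tent w k.+1)%:R) ^+ 2 <= w%:R :> R.
  rewrite -[X in _ <= X%:R]card_ord -sumr_const; apply: ler_sum => k _.
  have : (tent w k.+1 <= (tent w k).+1)%N && (tent w k <= (tent w k.+1).+1)%N.
    by rewrite /tent; have := ltn_ord k; lia.
  rewrite -!(ler_nat R) -!natr1; move: ((tent w k)%:R : R) ((tent w k.+1)%:R : R) => x y /andP[h1 h2].
  nra.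
have e : \sum_(k < w) ((tent w k)%:R - (tent w k.+1)%:R) ^+ 2 =
   \sum_(k < w) (tent w k)%:R ^+ 2 + \sum_(k < w) (tent w k.+1)%:R ^+ 2 -
   2 * \sum_(k < w) (tent w k)%:R * (tent w k.+1)%:R :> R.
  rewrite -big_split /= mulr_sumr -sumrB; apply: eq_bigr => k _; ring.
move: sq; rewrite e sh; lra.
Qed.

Lemma cube_sum_le m : m%:R ^+ 3 <= 3 * \sum_(k < m) k.+1%:R ^+ 2 :> R.
Proof.
elim: m => [|m IH]; first by rewrite big_ord0 expr0n mulr0.
rewrite big_ord_recr /= mulrDr -[m.+1%:R in leLHS]natr1 -[m.+1%:R]natr1.
move: IH; have : 0 <= m%:R :> R by []; move: (m%:R : R) (\sum_(k < m) _) => x y x0 h; nra.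
Qed.

Lemma tent_norm_ge m : m%:R ^+ 3 <= 3 * \sum_(k < 2 * m) (tent (2 * m) k)%:R ^+ 2 :> R.
Proof.
apply: le_trans (cube_sum_le m) _; apply: ler_wpM2l => //.
have mm : (m <= 2 * m)%N by lia.
rewrite (big_ord_widen _ (fun k => k.+1%:R ^+ 2) mm) [leLHS]big_mkcond; apply: ler_sum => k _.
case: ifP => // km; rewrite ?sqr_ge0 //; suff -> : tent (2 * m) k = k.+1 by [].
by rewrite /tent; lia.
Qed.

(** The squared norm is at least [m ^ 3 / 3] and the loss is of order [m]; at [m = q ^ 2] the
    relative loss is [O(1 / Q)]. *)
Lemma tent_overlap_ge m : (0 < m)%N ->
  (1 - 6 / m%:R ^+ 2) * \sum_(k < 2 * m) (tent (2 * m) k)%:R ^+ 2 <=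
  \sum_(k < 2 * m) (tent (2 * m) k)%:R * (tent (2 * m) k.+1)%:R :> R.
Proof.
move=> m0; have m1 : 1 <= m%:R :> R by rewrite ler1n.
have h1 := @tent_overlap (2 * m) ltac:(lia); have h2 := tent_norm_ge m.
rewrite natrM in h1; move: (\sum_(k < 2 * m) _) (\sum_(k < 2 * m) _) h1 h2 => O T h1 h2.
have h3 : (2 * m%:R + 1) / 2 <= 6 / m%:R ^+ 2 * T.
  rewrite [leRHS]mulrAC ler_pdivlMr ?exprn_gt0 ?ltr0n //; move: (m%:R : R) m1 h2 => x x1 h2; have := sqr_ge0 x; nra.
lra.
Qed.

End Tent.

(** * Product vectors and their energies *)

Section ProductVectors.
Context {R : realType}.
Variables (n : nat) (T : finType).
Notation cf := {ffun T -> 'I_n.+1}.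

Definition prodvec (f : T -> 'I_n.+1 -> R) (s : cf) : R := \prod_r f r (s r).

Lemma prodvec_dot f g : \sum_s prodvec f s * prodvec g s = \prod_r \sum_a f r a * g r a.
Proof.
rewrite bigA_distr_bigA; apply: eq_bigr => s _; by rewrite /prodvec -big_split.
Qed.

Definition act_at (A : 'I_n.+1 -> 'I_n.+1 -> R) r (f : T -> 'I_n.+1 -> R) : T -> 'I_n.+1 -> R :=
  fun x => if x == r then matvec A (f r) else f x.

Lemma matvec_atpoint A r f : matvec (atpoint A r) (prodvec f) = prodvec (act_at A r f).
Proof.
apply/funext => s; have := opmul_atpoint A r (fun t _ => prodvec f t) s s; rewrite /opmul /matvec => ->.
rewrite /prodvec (bigD1 r) //= /act_at eqxx /matvec mulr_suml; apply: eq_bigr => a _.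
rewrite (bigD1 r) //= setat_same mulrA; congr (_ * _); apply: eq_bigr => x xr.
by rewrite setat_other // (negPf xr).
Qed.

Lemma quad_prodvec_pair A B r r' f : r != r' -> (forall x, \sum_a f x a ^+ 2 = 1) ->
  quad (opmul (atpoint A r) (atpoint B r')) (prodvec f) = quad A (f r) * quad B (f r').
Proof.
move=> rr f1; rewrite quad_matvec matvec_mul !matvec_atpoint prodvec_dot.
rewrite (bigD1 r) //= (bigD1 r') /=; last by rewrite eq_sym.
rewrite [X in _ * (_ * X)]big1 ?mulr1; last first.
  move=> x /andP[xr xr'].
  by rewrite /act_at (negPf xr) (negPf xr') -[RHS](f1 x); apply: eq_bigr => a _; rewrite expr2.
by rewrite /act_at eqxx (negPf rr) eq_sym (negPf rr) eqxx !quad_matvec.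
Qed.

Lemma prodvec_unit f : (forall x, \sum_a f x a ^+ 2 = 1) -> \sum_s prodvec f s ^+ 2 = 1.
Proof.
move=> f1; under eq_bigr do rewrite expr2; rewrite prodvec_dot big1 // => x _.
by rewrite -[RHS](f1 x); apply: eq_bigr => a _; rewrite expr2.
Qed.

End ProductVectors.

Lemma uphalf_double_bound m : (m <= 2 * uphalf m <= m.+1)%N.
Proof. by have := uphalf_half m; have := odd_double_half m; lia. Qed.

Lemma divn_double_ge m d : (0 < d)%N -> (0 < m %/ d)%N -> (m <= 2 * (m %/ d) * d)%N.
Proof.
move=> d0 h; have := ltn_ceil m d0; move: (m %/ d)%N h => u u0.
have : (d <= u * d)%N by rewrite leq_pmull.
by rewrite mulSn -mulnA; lia.
Qed.

Lemma window_fits_aux m x y : (0 < y)%N -> (4 * (x + y) <= m)%N -> (uphalf m + x + y <= m)%N.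
Proof. by have := uphalf_double_bound m; lia. Qed.

(** * Plaquettes bounded by z-edges *)

Section Plaquettes.
Variable N : nat.
Hypothesis evN : ~~ odd N.
Hypothesis N0 : (0 < N)%N.

Lemma even_half_gt0 : (0 < N./2)%N.
Proof. by rewrite half_gt0; case: N evN N0 => [|[|k]]. Qed.

(* Both coordinates of the four sites of a plaquette bounded by z-edges have the same [zid]. *)
Definition zid (x : 'I_N) : 'I_(N./2) := Ordinal (ltn_pmod (uphalf x) even_half_gt0).

Lemma zid_nbr x : zid (nbr true x) = zid x.
Proof.
have N2 : N = (N./2).*2 by rewrite even_halfK.
have h0 := even_half_gt0; have xN := ltn_ord x.
apply: val_inj => /=; rewrite /nbr; case: ifP => /eqP ox.
  rewrite val_ordS; have [lt|ge] := ltnP x.+1 N.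
    by rewrite (modn_small lt) !uphalf_half /= uphalf_half ox.
  have e : x.+1 = N by apply/eqP; rewrite eqn_leq ge xN.
  rewrite e modnn /= mod0n uphalf_half ox.
  have -> : (true + x./2 = N./2)%N.
    by have -> : N./2 = x.+1./2; [rewrite e|rewrite /= uphalf_half ox].
  by rewrite modnn.
rewrite val_ord_pred; case ex : (x : nat) => [|y].
  rewrite [RHS](mod0n N./2) add0n (@modn_small N.-1) ?ltn_predL // uphalf_half.
  have -> : (odd N.-1 + N.-1./2 = N./2)%N.
    by rewrite N2; move: h0; case: (N./2) => // k _; rewrite doubleS /= odd_double /= uphalf_double doubleK.
  by rewrite modnn.
have -> : ((y.+1 + N).-1 = y + N)%N by [].
have yN : (y < N)%N by apply: ltn_trans xN; rewrite ex.
rewrite modnDr (modn_small yN); congr (_ %% _)%N.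
have oy : odd y by move: ox; rewrite ex /=; case: (odd y).
by rewrite !uphalf_half /= uphalf_half oy.
Qed.

Definition plaq (r : site N) : 'I_(N./2) * 'I_(N./2) := (zid r.1, zid r.2).

Lemma plaq_edge r d : plaq (edge_inv (d, true) r) = plaq r.
Proof. by case: r => x y; case: d; rewrite /plaq /edge_inv /= zid_nbr. Qed.

Lemma double_ord_lt (i : 'I_(N./2)) : (i.*2 < N)%N.
Proof. by rewrite -[ltnRHS](even_halfK evN) ltn_double. Qed.

Definition plaq_site (p : 'I_(N./2) * 'I_(N./2)) : site N :=
  (Ordinal (double_ord_lt p.1), Ordinal (double_ord_lt p.2)).

Lemma plaq_siteK p : plaq (plaq_site p) = p.
Proof.
case: p => i k; congr (_, _); apply: val_inj => /=; by rewrite uphalf_double modn_small.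
Qed.

End Plaquettes.

(** * Lower bound on the partition function *)

Lemma sq_shift_le (R : realType) (x y z t : R) : 0 <= x -> x <= 1 -> 0 <= z -> z <= t ->
  x - z <= y -> 0 <= y -> x ^+ 2 <= y ^+ 2 + 2 * t.
Proof. by move=> *; case: (lerP x y) => *; nra. Qed.

Section LowerBound.
Context {R : realType}.
Variables (n N q : nat) (b : R).
Hypothesis n0 : (0 < n)%N.
Hypothesis evN : ~~ odd N.
Hypothesis b100 : 100 <= b.
Hypothesis bQ : b <= (q ^ 4)%:R.
Hypothesis Qb : (q ^ 4)%:R <= 16 * b.
Hypothesis bS : 10000 * b ^+ 2 <= spinS R n.
Notation S := (spinS R n).
Notation cf := {ffun site N -> 'I_n.+1}.
Notation Q := ((q ^ 4)%:R : R).

(** Windows of width [2 q ^ 2] are grouped into [q] blocks of [nwin]. Together they fill at most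
    [n / (4 q)] values of [M] from about 0 upwards, so [m] stays below [1 / q] and [m ^ 4] below
    [1 / Q]. *)
Definition nwin : nat := n %/ (8 * q ^ 4).
Notation w := (2 * q ^ 2)%N.

Let q0 : (0 < q)%N := q_gt0 b100 bQ.

Let nE : (n%:R : R) = 2 * S := esym (S_double n).

Lemma nwin_gt0 : (0 < nwin)%N.
Proof.
rewrite divn_gt0 ?muln_gt0 ?expn_gt0 ?q0 // -(ler_nat R) natrM nE.
by move: Qb b100 bS; move: (spinS R n) Q => s z; nra.
Qed.

Lemma nwin_ge : S / (8 * Q) <= nwin%:R.
Proof.
have Q0 : 0 < Q by rewrite ltr0n expn_gt0 q0.
have h : (n <= 2 * nwin * (8 * q ^ 4))%N.
  by apply: divn_double_ge; rewrite ?muln_gt0 ?expn_gt0 ?q0 //; exact: nwin_gt0.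
rewrite ler_pdivrMr ?mulr_gt0 //; move: h; rewrite -(ler_nat R) 3!natrM nE.
by move: (spinS R n) Q (nwin%:R : R) => s z u; lra.
Qed.

Lemma nwin_le : nwin%:R * (4 * Q) <= S.
Proof.
have := leq_trunc_div n (8 * q ^ 4); rewrite -/nwin -(ler_nat R) 2!natrM nE.
by move: (spinS R n) Q (nwin%:R : R) => s z u; lra.
Qed.

Definition wstart (j : nat) : nat := (uphalf n + w * j)%N.
Definition wfun (j a : nat) : nat := if (wstart j <= a)%N then tent w (a - wstart j) else 0%N.

Lemma wfun_supp j a : wfun j a != 0%N -> (wstart j <= a)%N && (a < wstart j + w)%N.
Proof.
rewrite /wfun; case: ifP => // h1; apply: contraNT; rewrite /= -leqNgt => h2.
by rewrite tent_out // leq_subRL.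
Qed.

Lemma wstart_fits j : (j < q * nwin)%N -> (wstart j + w <= n)%N.
Proof.
move=> jq; have h := leq_trunc_div n (8 * q ^ 4); rewrite -/nwin in h.
have h1 : (w * j.+1 <= w * (q * nwin))%N by rewrite leq_mul2l jq orbT.
have e : (nwin * (8 * q ^ 4) = 4 * (w * (q * nwin)) * q)%N by rewrite !expnS expn0; ring.
have h2 : (4 * (w * j.+1) <= n)%N.
  apply: leq_trans h; rewrite e -[leqLHS]muln1; apply: leq_mul => //; rewrite leq_mul2l h1 orbT //.
have e2 : (w * j.+1 = w * j + w)%N by rewrite mulnS addnC.
have w0 : (0 < w)%N by rewrite muln_gt0 expn_gt0 q0.
by rewrite /wstart; apply: window_fits_aux; rewrite // -e2.
Qed.

Lemma window_sum (F : nat -> R) j : (j < q * nwin)%N -> (forall k, (w <= k)%N -> F k = 0) ->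
  \sum_(a < n.+1) (if (wstart j <= a)%N then F (a - wstart j)%N else 0) = \sum_(k < w) F k.
Proof.
move=> jq F0; have h := wstart_fits jq.
rewrite -(big_mkord predT (fun a => if (wstart j <= a)%N then F (a - wstart j)%N else 0)).
rewrite (@big_cat_nat _ _ _ (wstart j)) //=; last by apply: leq_trans (leq_addr _ _) (leqW h).
rewrite big1_seq ?add0r; last first.
  by move=> a /=; rewrite mem_index_iota /= => h'; rewrite leqNgt h'.
rewrite -{1}[wstart j]add0n big_addn big_mkord.
have wn : (w <= n.+1 - wstart j)%N by rewrite leq_subRL; [exact: leqW|exact: leq_trans (leq_addr _ _) (leqW h)].
rewrite [RHS](big_ord_widen _ F wn) [RHS]big_mkcond; apply: eq_bigr => k _.
rewrite leq_addl addnK; case: ifP => // /negbT; rewrite -leqNgt; exact: F0.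
Qed.

Definition wnorm : R := \sum_(k < w) (tent w k)%:R ^+ 2.

Lemma wnorm_gt0 : 0 < wnorm.
Proof.
have := @tent_norm_ge R (q ^ 2); rewrite -/wnorm; have : (0 : R) < (q ^ 2)%:R ^+ 3 by rewrite exprn_gt0 // ltr0n expn_gt0 q0.
lra.
Qed.

Definition wvec (j : nat) (a : 'I_n.+1) : R := (wfun j a)%:R / Num.sqrt wnorm.

Lemma wvec_sq j a : wvec j a ^+ 2 = (wfun j a)%:R ^+ 2 / wnorm.
Proof. by rewrite /wvec exprMn exprVn sqr_sqrtr // ltW // wnorm_gt0. Qed.

Lemma wvec_unit j : (j < q * nwin)%N -> \sum_a wvec j a ^+ 2 = 1.
Proof.
move=> jq; under eq_bigr do rewrite wvec_sq; rewrite -mulr_suml.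
suff -> : \sum_(a < n.+1) (wfun j a)%:R ^+ 2 = wnorm by rewrite divff // gt_eqF // wnorm_gt0.
rewrite /wnorm -(window_sum (F := fun k => (tent w k)%:R ^+ 2) jq); last first.
  by move=> k wk; rewrite tent_out // expr0n.
by apply: eq_bigr => a _; rewrite /wfun; case: ifP => // _; rewrite expr0n.
Qed.

Definition wbase (j : nat) : R := ((wstart j)%:R - S) / S.
Definition wstep : R := w%:R / S.

Lemma wbaseE j : wbase j = wbase 0 + j%:R * wstep.
Proof.
rewrite /wbase /wstep /wstart muln0 addn0 natrD natrM.
by have := S_gt0 (R := R) n0; move: (spinS R n) => s s0; field; rewrite gt_eqF.
Qed.

Lemma wbase0_bound : 0 <= wbase 0 <= 2^-1 / S.
Proof.
have s0 := S_gt0 (R := R) n0; rewrite /wbase /wstart muln0 addn0.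
have := uphalf_double_bound n; rewrite -!(ler_nat R) natrM -[n.+1%:R]natr1 nE => /andP[h1 h2].
rewrite divr_ge0 ?(ltW s0) //=; last by lra.
by apply: ler_wpM2r; [rewrite invr_ge0 ltW|lra].
Qed.

Lemma wstep_ge0 : 0 <= wstep.
Proof. by rewrite divr_ge0 // ltW // S_gt0. Qed.

Lemma wbase_ge0 j : 0 <= wbase j.
Proof.
have /andP[h _] := wbase0_bound; rewrite wbaseE; apply: addr_ge0 => //.
by apply: mulr_ge0 => //; exact: wstep_ge0.
Qed.

Lemma wstep_le : wstep <= Q^-1.
Proof.
have s0 := S_gt0 (R := R) n0; have Q0 : 0 < Q by rewrite ltr0n expn_gt0 q0.
rewrite /wstep ler_pdivrMr // mulrC ler_pdivlMr // natrM.
have q1 := q2_ge1 b100 bQ; have qE := q2_sq (R := R) q.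
have h : (q ^ 2)%:R <= Q by rewrite -qE; nra.
by move: Qb bS b100; move: (spinS R n) Q ((q ^ 2)%:R : R) h q1 => s z y h q1; nra.
Qed.

Lemma wbase_le j : (j < q * nwin)%N -> wbase j + wstep <= q%:R^-1.
Proof.
move=> jq; have s0 := S_gt0 (R := R) n0; rewrite wbaseE; have /andP[_ h0] := wbase0_bound.
have qR : 0 < q%:R :> R by rewrite ltr0n.
have h1 : (j%:R + 1) * wstep <= q%:R * nwin%:R * wstep.
  by apply: ler_wpM2r; [exact: wstep_ge0|]; rewrite -natrM natr1 ler_nat.
have h2 : q%:R * nwin%:R * wstep <= 2^-1 / q%:R.
  rewrite /wstep natrM mulrA ler_pdivrMr // [leRHS]mulrAC ler_pdivlMr //.
  have := nwin_le; rewrite !natrX; move: (q%:R : R) (nwin%:R : R) (spinS R n) => x y s h.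
  have -> : x * y * (2 * x ^+ 2) * x = 2 * y * x ^+ 4 by ring.
  lra.
have h3 : 2^-1 / S <= 2^-1 / q%:R.
  rewrite ler_pM2l ?invr_gt0 // lef_pV2 ?posrE //.
  have := q2_ge1 b100 bQ; have := q2_sq (R := R) q; have : q%:R <= (q ^ 2)%:R :> R by rewrite ler_nat -mulnn leq_pmulr.
  by move: Qb bS b100; move: (spinS R n) Q ((q ^ 2)%:R : R) (q%:R : R) => s z y x; nra.
lra.
Qed.

Lemma mz_window j (a : 'I_n.+1) : wfun j a != 0%N -> wbase j <= mz a <= wbase j + wstep.
Proof.
move=> /wfun_supp/andP[h1 h2]; have s0 := S_gt0 (R := R) n0.
rewrite /mz /wbase /wstep -mulrDl !ler_pM2r ?invr_gt0 // /Mval.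
by move: h1 (ltnW h2); rewrite -!(ler_nat R) natrD => h1 h2'; apply/andP; split; lra.
Qed.

Definition mbar (j : nat) : R := \sum_a wvec j a ^+ 2 * mz a.
Definition xbar (j : nat) : R := quad (Sxloc R n) (wvec j) / S.

Lemma quad_Sz j : quad (Szloc R n) (wvec j) = S * mbar j.
Proof.
have s0 := S_gt0 (R := R) n0; rewrite /quad /mbar mulr_sumr; apply: eq_bigr => a _.
rewrite (bigD1 a) //= big1 ?addr0 => [|c ca].
  by rewrite /Szloc eqxx /mz; move: (spinS R n) s0 => s s0; field; rewrite gt_eqF.
by rewrite /Szloc eq_sym (negPf ca) mulr0 mul0r.
Qed.

Lemma mbar_bounds j : (j < q * nwin)%N -> wbase j <= mbar j <= wbase j + wstep.
Proof.
move=> jq; have u := wvec_unit jq.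
have e c : c = \sum_a wvec j a ^+ 2 * c by rewrite -mulr_suml u mul1r.
rewrite {1}[wbase j]e [wbase j + wstep]e; apply/andP; split; apply: ler_sum => a _;
  (have [z|nz] := eqVneq (wfun j a) 0%N; [by rewrite wvec_sq z expr0n /= !mul0r|]);
  by apply: ler_wpM2l; rewrite ?sqr_ge0 //; case/andP: (mz_window nz).
Qed.

(** A polynomial lower bound of [sqrt (1 - x)] on [[0, 1]], equal to [(1 - x) (1 + x / 2)]. *)
Definition curv (x : R) : R := 1 - x / 2 - x ^+ 2 / 2.

Lemma amplitude_ge j (a : 'I_n.+1) : (j < q * nwin)%N -> wfun j a != 0%N ->
  S * curv ((wbase j + wstep) ^+ 2) <= Num.sqrt ((n%:R - a%:R) * a.+1%:R).
Proof.
move=> jq nz; have s0 := S_gt0 (R := R) n0; have /andP[h1 h2] := mz_window nz.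
have b0 := wbase_ge0 j.
have h3 := wbase_le jq.
have q1 : q%:R^-1 <= 1 :> R by rewrite invf_le1 ?ler1n ?ltr0n.
set M := wbase j + wstep in h2 h3 *.
have M0 : 0 <= M by exact: le_trans (le_trans b0 h1) h2.
have x0 : 0 <= M ^+ 2 by exact: sqr_ge0.
have x1 : M ^+ 2 <= 1 by rewrite -[leRHS](expr1n _ 2); apply: lerXn2r; rewrite ?nnegrE //; exact: le_trans h3 q1.
have mM : mz a ^+ 2 <= M ^+ 2 by apply: lerXn2r; rewrite ?nnegrE //; exact: le_trans b0 h1.
have g0 : 0 <= curv (M ^+ 2) by rewrite /curv; move: (M ^+ 2) x0 x1 => x x0 x1; nra.
have g2 : curv (M ^+ 2) ^+ 2 <= 1 - M ^+ 2.
  rewrite /curv; move: (M ^+ 2) x0 x1 => x x0 x1.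
  have -> : 1 - x / 2 - x ^+ 2 / 2 = (1 - x) * (1 + x / 2) by field.
  rewrite exprMn; have : (1 - x) * (1 + x / 2) ^+ 2 <= 1.
    have -> : (1 - x) * (1 + x / 2) ^+ 2 = 1 - (3 / 4 * x ^+ 2 + x ^+ 3 / 4) by field.
    by rewrite lerBlDr lerDl addr_ge0 // ?divr_ge0 ?mulr_ge0 ?sqr_ge0 ?exprn_ge0.
  by move: ((1 + x / 2) ^+ 2) => y hy; nra.
rewrite -[leLHS]ger0_norm ?(mulr_ge0 (ltW s0)) // -sqrtr_sqr; apply: ler_wsqrtr.
have /andP[_ hM] := @Mval_bound R n a.
have -> : (n%:R - a%:R) * a.+1%:R = S ^+ 2 * (1 - mz a ^+ 2) + (S - Mval R a).
  rewrite /mz -[a.+1%:R]natr1 nE; have -> : (a : nat)%:R = Mval R a + S by rewrite /Mval; ring.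
  by move: (Mval R a) (spinS R n) s0 => m s s0; field; rewrite gt_eqF.
rewrite [leLHS]exprMn -[leLHS]addr0; apply: lerD; last by lra.
apply: ler_wpM2l; first exact: sqr_ge0.
lra.
Qed.

Lemma quad_Sx_wfun j : (j < q * nwin)%N ->
  quad (Sxloc R n) (wvec j) = (\sum_(a < n.+1) (wfun j a)%:R * (wfun j a.+1)%:R *
     Num.sqrt ((n%:R - a%:R) * a.+1%:R)) / wnorm.
Proof.
move=> jq; pose s (a : nat) : R := Num.sqrt ((n%:R - a%:R) * a.+1%:R).
pose u (a : nat) : R := (wfun j a)%:R.
have W0 := wnorm_gt0.
have -> : quad (Sxloc R n) (wvec j) = (\sum_(a < n.+1) \sum_(c < n.+1) u a * Sxloc R n a c * u c) / wnorm.
  rewrite /quad mulr_suml; apply: eq_bigr => a _; rewrite mulr_suml; apply: eq_bigr => c _.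
  rewrite /wvec -/(u a) -/(u c) -[in RHS](sqr_sqrtr (ltW W0)); have : 0 < Num.sqrt wnorm by rewrite sqrtr_gt0.
  by move: (Num.sqrt wnorm) => t t0; field; rewrite gt_eqF.
congr (_ / _).
have -> : \sum_(a < n.+1) \sum_(c < n.+1) u a * Sxloc R n a c * u c =
   \sum_(a < n.+1) \sum_(c < n.+1) (if (a : nat) == c.+1 then u a * u c * s c / 2 else 0) +
   \sum_(a < n.+1) \sum_(c < n.+1) (if (c : nat) == a.+1 then u a * u c * s a / 2 else 0).
  rewrite -big_split; apply: eq_bigr => a _; rewrite -big_split; apply: eq_bigr => c _ /=.
  rewrite SxlocE -/(s a) -/(s c); case: eqP => _; case: eqP => _; ring.
rewrite [X in X + _]exchange_big /= -big_split; apply: eq_bigr => a _ /=.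
have sum1 (G : 'I_n.+1 -> R) : G = (fun c => u a * u c * s a / 2) \/ G = (fun c => u c * u a * s a / 2) ->
   \sum_(c < n.+1) (if (c : nat) == a.+1 then G c else 0) = u a * u a.+1 * s a / 2.
  move=> hG; have [ha|ha] := ltnP a.+1 n.+1.
    rewrite (bigD1 (Ordinal ha)) //= eqxx big1 ?addr0 => [|c nc].
      by case: hG => -> /=; ring.
    by rewrite ifN //; apply: contra nc => /eqP e; apply/eqP/val_inj.
  rewrite big1 => [|c _]; last by rewrite ifN //; apply/eqP => e; have := ltn_ord c; rewrite e ltnNge ha.
  have -> : u a.+1 = 0.
    rewrite /u; suff -> : wfun j a.+1 = 0%N by [].
    apply/eqP; apply: contraT => /wfun_supp/andP[_ h]; have := leq_trans h (wstart_fits jq).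
    by rewrite ltnNge (ltnW ha).
  by rewrite mulr0 !mul0r.
rewrite (sum1 (fun c => u a * u c * s a / 2)) ?(sum1 (fun c => u c * u a * s a / 2)); try by [left|right].
by rewrite -/(u a) -/(u a.+1) -/(s a); field.
Qed.

(** Three errors of order [1 / Q] add up: the tent overlap, the quartic term of [curv], and the
    variation of [m] inside a window. *)
Lemma xbar_ge j : (j < q * nwin)%N -> 1 - mbar j ^+ 2 / 2 - 8 / Q <= xbar j.
Proof.
move=> jq; have s0 := S_gt0 (R := R) n0; have W0 := wnorm_gt0.
have b0 := wbase_ge0 j.
have h3 := wbase_le jq; have /andP[m1 m2] := mbar_bounds jq.
have q1 : 1 <= q%:R :> R by rewrite ler1n.
have q1' : q%:R^-1 <= 1 :> R by rewrite invf_le1 ?ler1n ?ltr0n.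
set M := wbase j + wstep in h3 m2 *.
have M0 : 0 <= M by rewrite addr_ge0 ?wstep_ge0.
have st := wstep_le; have st0 := wstep_ge0.
have M4 : (M ^+ 2) ^+ 2 <= Q^-1.
  have -> : Q^-1 = ((q%:R^-1) ^+ 2) ^+ 2 by rewrite -exprM natrX exprVn.
  by apply: lerXn2r; rewrite ?nnegrE ?sqr_ge0 //; apply: lerXn2r; rewrite ?nnegrE ?invr_ge0.
have M1 : M <= 1 by exact: le_trans h3 q1'.
have Mm : M ^+ 2 <= mbar j ^+ 2 + 2 / Q.
  have e : M - wstep <= mbar j by rewrite /M addrK.
  have e0 : 0 <= mbar j by exact: le_trans b0 m1.
  exact: (sq_shift_le M0 M1 st0 st e e0).
have low : S * curv (M ^+ 2) * (1 - 6 / Q) <= quad (Sxloc R n) (wvec j).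
  rewrite quad_Sx_wfun // ler_pdivlMr //.
  apply: le_trans (_ : \sum_(a < n.+1) (S * curv (M ^+ 2)) * ((wfun j a)%:R * (wfun j a.+1)%:R) <= _); last first.
    apply: ler_sum => a _; have [->|nz] := eqVneq (wfun j a) 0%N; first by rewrite !mul0r mulr0.
    by rewrite mulrC; apply: ler_wpM2l; [rewrite mulr_ge0|exact: amplitude_ge].
  rewrite -mulr_sumr -[leLHS]mulrA; apply: ler_wpM2l.
    apply: mulr_ge0; first exact: ltW.
    have : M ^+ 2 <= 1 by rewrite -[leRHS](expr1n _ 2); apply: lerXn2r; rewrite ?nnegrE.
    by rewrite /curv; have := sqr_ge0 M; move: (M ^+ 2) => x x0 x1; nra.
  have q20 : (0 < q ^ 2)%N by rewrite expn_gt0 q0.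
  have := @tent_overlap_ge R _ q20; rewrite (q2_sq (R := R) q) -/wnorm; move=> h; apply: le_trans h _.
  rewrite -(window_sum (F := fun k => (tent w k)%:R * (tent w k.+1)%:R) jq); last first.
    by move=> k wk; rewrite tent_out // mul0r.
  apply: ler_sum => a _; rewrite /wfun; case: ifP => h; last by rewrite mulr_ge0.
  by rewrite leqW // subSn.
have Qi : Q^-1 <= 1 by rewrite invf_le1 ?ler1n ?ltr0n ?expn_gt0 ?q0.
have Qi0 : 0 <= Q^-1 by rewrite invr_ge0.
rewrite /xbar ler_pdivlMr // [leLHS]mulrC; apply: le_trans low; rewrite -[leRHS]mulrA; apply: ler_wpM2l; first exact: ltW.
rewrite /curv; have := sqr_ge0 M; have := sqr_ge0 (M ^+ 2).
by move: (mbar j ^+ 2) (M ^+ 2) ((M ^+ 2) ^+ 2) Q^-1 M4 Mm Qi Qi0 => x y z t; nra.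
Qed.

Lemma quad_energy_prodvec (jr : site N -> nat) : (forall r, (jr r < q * nwin)%N) ->
  quad (energy (n := n) (N := N) b) (prodvec (fun r => wvec (jr r))) =
  b / 2 * \sum_r \sum_(d : bool) (mbar (jr r) * mbar (jr (edge_inv (d, true) r)) +
                                  xbar (jr r) * xbar (jr (edge_inv (d, false) r))).
Proof.
move=> jq; have s0 := S_gt0 (R := R) n0; set V := prodvec _.
have u r : \sum_a wvec (jr r) a ^+ 2 = 1 by exact: wvec_unit.
have lin (I : finType) (A : I -> cf -> cf -> R) : quad (fun s t => \sum_i A i s t) V = \sum_i quad (A i) V.
  rewrite /quad; under eq_bigr => x _ do (under eq_bigr => y _ do rewrite mulr_sumr mulr_suml; rewrite exchange_big).
  by rewrite exchange_big.
have sc (k : R) (A : cf -> cf -> R) : quad (fun s t => k * A s t) V = k * quad A V.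
  rewrite /quad mulr_sumr; apply: eq_bigr => x _; rewrite mulr_sumr; apply: eq_bigr => y _; ring.
rewrite /energy /pair_energy sc lin.
have -> : b / 2 * \sum_r \sum_(d : bool) (mbar (jr r) * mbar (jr (edge_inv (d, true) r)) +
                                  xbar (jr r) * xbar (jr (edge_inv (d, false) r))) =
   b / (2 * S ^+ 2) * \sum_r \sum_(d : bool) (S * mbar (jr r) * (S * mbar (jr (edge_inv (d, true) r))) +
                                  S * xbar (jr r) * (S * xbar (jr (edge_inv (d, false) r)))).
  have -> : \sum_r \sum_(d : bool) (S * mbar (jr r) * (S * mbar (jr (edge_inv (d, true) r))) +
                                  S * xbar (jr r) * (S * xbar (jr (edge_inv (d, false) r)))) =
    S ^+ 2 * \sum_r \sum_(d : bool) (mbar (jr r) * mbar (jr (edge_inv (d, true) r)) +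
                                  xbar (jr r) * xbar (jr (edge_inv (d, false) r))).
    rewrite [RHS]mulr_sumr; apply: eq_bigr => r _; rewrite [RHS]mulr_sumr; apply: eq_bigr => d _; ring.
  by move: (\sum_r _) (spinS R n) s0 => z s s0; field; rewrite gt_eqF.
congr (_ * _); apply: eq_bigr => r _; rewrite lin.
rewrite -(pair_bigA _ (fun d p : bool => quad (opmul (atpoint (spinloc (d, p)) r) (atpoint (spinloc (d, p)) (edge_inv (d, p) r))) V)) /=.
apply: eq_bigr => d _; rewrite big_bool /=.
have ne i : r != edge_inv i r by rewrite eq_sym inv_neq.
rewrite (quad_prodvec_pair _ _ (ne (d, true)) u) (quad_prodvec_pair _ _ (ne (d, false)) u).
rewrite /spinloc /= !quad_Sz; congr (_ + _).
have xE j : S * xbar j = quad (Sxloc R n) (wvec j) by rewrite /xbar mulrC divfK // gt_eqF.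
by rewrite !xE.
Qed.

(** The terms [m ^ 2 / 2] lost on x-edges are recovered on z-edges after summation over the sites:
    this is the classical degeneracy, and it leaves [mbar] free to vary across x-edges. The
    remaining [17 / Q] per summand costs at most 17 per site because [b <= Q]. *)
Lemma quad_energy_ge (jr : site N -> nat) : (forall r, (jr r < q * nwin)%N) ->
  (forall r d, `|mbar (jr r) - mbar (jr (edge_inv (d, true) r))| <= ((q ^ 2)%:R)^-1) ->
  (b - 17) * (N ^ 2)%:R <= quad (energy (n := n) (N := N) b) (prodvec (fun r => wvec (jr r))).
Proof.
move=> jq close; rewrite quad_energy_prodvec //.
have b0 := b_ge0 b100; have Q0 : 0 < Q by rewrite ltr0n expn_gt0 q0.
have bi : b / Q <= 1 by rewrite ler_pdivrMr // mul1r.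
pose m r := mbar (jr r).
have term r (d : bool) : (m r ^+ 2 + m (edge_inv (d, true) r) ^+ 2) / 2 - (m r ^+ 2 + m (edge_inv (d, false) r) ^+ 2) / 2 + (1 - 17 / Q) <=
   mbar (jr r) * mbar (jr (edge_inv (d, true) r)) + xbar (jr r) * xbar (jr (edge_inv (d, false) r)).
  have c2 : (m r - m (edge_inv (d, true) r)) ^+ 2 <= Q^-1.
    rewrite -[leLHS]real_normK ?num_real // -(q2_sq (R := R) q) -exprVn.
    by apply: lerXn2r; rewrite ?nnegrE ?invr_ge0 //; exact: close.
  have h1 := xbar_ge (jq r); have h2 := xbar_ge (jq (edge_inv (d, false) r)).
  rewrite -/(m r) -/(m _) in h1 h2 *.
  have h : 1 - m r ^+ 2 / 2 - m (edge_inv (d, false) r) ^+ 2 / 2 - 16 / Q <= xbar (jr r) * xbar (jr (edge_inv (d, false) r)).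
    have le1 (j : nat) : (j < q * nwin)%N -> mbar j ^+ 2 <= 1 / 16.
      move=> hj; have /andP[l1 l2] := mbar_bounds hj; have l3 := wbase_le hj.
      have l0 : 0 <= mbar j by exact: le_trans (wbase_ge0 j) l1.
      have q4 : q%:R^-1 <= 4^-1 :> R.
        rewrite lef_pV2 ?posrE ?ltr0n //; rewrite (ler_nat R 4).
        rewrite leqNgt; apply/negP => q3; have : (q ^ 4 <= 3 ^ 4)%N by rewrite leq_exp2r // -ltnS.
        rewrite -(ler_nat R); move: bQ b100; rewrite (_ : (3 ^ 4)%N = 81%N) //; lra.
      by have : mbar j <= 4^-1; [lra|nra].
    have l1 := le1 _ (jq r); have l2 := le1 _ (jq (edge_inv (d, false) r)).
    have Q100 : Q^-1 <= 100^-1 by rewrite lef_pV2 ?posrE //; move: bQ b100; lra.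
    have Qi0 : 0 <= Q^-1 by rewrite invr_ge0 ltW.
    set m' := m (edge_inv (d, false) r) in h2 *; rewrite -/(m r) -/(m _) -/m' in l1 l2.
    have s1 := sqr_ge0 (m r); have s2 := sqr_ge0 m'.
    move: (m r ^+ 2) (m' ^+ 2) Q^-1 (xbar _) (xbar _) l1 l2 s1 s2 Q100 Qi0 h1 h2 => x y t u v l1 l2 s1 s2 t1 t0 h1 h2.
    apply: le_trans (_ : (1 - x / 2 - 8 * t) * (1 - y / 2 - 8 * t) <= _); first by nra.
    by apply: ler_pM => //; lra.
  have e : m r * m (edge_inv (d, true) r) = (m r ^+ 2 + m (edge_inv (d, true) r) ^+ 2) / 2 - (m r - m (edge_inv (d, true) r)) ^+ 2 / 2 by field.
  rewrite e; move: ((m r - _) ^+ 2) c2 => z c2.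
  have Qi0 : 0 <= Q^-1 by rewrite invr_ge0 ltW.
  move: Q^-1 h c2 Qi0 => t h c2 t0; lra.
apply: le_trans (_ : b / 2 * \sum_r \sum_(d : bool) ((m r ^+ 2 + m (edge_inv (d, true) r) ^+ 2) / 2 - (m r ^+ 2 + m (edge_inv (d, false) r) ^+ 2) / 2 + (1 - 17 / Q)) <= _); last first.
  apply: ler_wpM2l; first by rewrite divr_ge0.
  by apply: ler_sum => r _; apply: ler_sum => d _; exact: term.
have eS (p d : bool) : \sum_r m (edge_inv (d, p) r) ^+ 2 = \sum_r m r ^+ 2.
  by rewrite [RHS](reindex_inj (inv_inj (invK evN (d, p)))).
have -> : \sum_r \sum_(d : bool) ((m r ^+ 2 + m (edge_inv (d, true) r) ^+ 2) / 2 - (m r ^+ 2 + m (edge_inv (d, false) r) ^+ 2) / 2 + (1 - 17 / Q)) =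
   2 * (1 - 17 / Q) * (N ^ 2)%:R.
  rewrite exchange_big /= (eq_bigr (fun=> (1 - 17 / Q) * (N ^ 2)%:R)) => [|d _].
    by rewrite sumr_const card_bool -mulr_natl; ring.
  move: (1 - 17 / Q) => c.
  rewrite big_split sumrB -!mulr_suml !big_split /= !eS subrr add0r sumr_const.
  by rewrite card_prod !card_ord mulnn mulr_natr.
have N2 : 0 <= (N ^ 2)%:R :> R by [].
have -> : b / 2 * (2 * (1 - 17 / Q) * (N ^ 2)%:R) = (b - 17 * (b / Q)) * (N ^ 2)%:R.
  by move: ((N ^ 2)%:R : R) Q Q0 => x y y0; field; rewrite gt_eqF.
apply: ler_wpM2r => //; lra.
Qed.

Lemma nwin_step_le : nwin%:R * wstep <= ((q ^ 2)%:R)^-1.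
Proof.
have s0 := S_gt0 (R := R) n0; have q20 : 0 < (q ^ 2)%:R :> R by rewrite ltr0n expn_gt0 q0.
rewrite /wstep mulrA ler_pdivrMr // [leRHS]mulrC ler_pdivlMr // natrM.
have := nwin_le; rewrite -(q2_sq (R := R) q).
by have : 0 <= nwin%:R :> R by []; move: ((q ^ 2)%:R : R) (nwin%:R : R) (spinS R n) => x y s; nra.
Qed.

Lemma mbar_close j j' : (j < q * nwin)%N -> (j' < q * nwin)%N -> (j %/ nwin = j' %/ nwin)%N ->
  `|mbar j - mbar j'| <= ((q ^ 2)%:R)^-1.
Proof.
move=> jq jq' e; apply: le_trans nwin_step_le.
have /andP[h1 h2] := mbar_bounds jq; have /andP[h1' h2'] := mbar_bounds jq'.
have e1 := wbaseE j; have e2 := wbaseE j'; have st := wstep_ge0.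
have near i k : (i %/ nwin = k %/ nwin)%N -> (i%:R + 1) * wstep <= k%:R * wstep + nwin%:R * wstep.
  move=> eik; rewrite -mulrDl; apply: ler_wpM2r => //; rewrite natr1 -natrD ler_nat.
  rewrite (divn_eq i nwin) (divn_eq k nwin) eik -addnS -addnA leq_add2l.
  by apply: leq_trans (leq_addl _ _); rewrite ltn_mod nwin_gt0.
have := near j j' e; have := near j' j (esym e); rewrite ler_norml => n1 n2.
by apply/andP; split; lra.
Qed.

Section WindowFamilies.
Hypothesis N0 : (0 < N)%N.
Notation hd := (N./2).

(** One block per plaquette and, independently, one window of that block per site. All z-edges lie
    inside plaquettes, so the closeness asked by [quad_energy_ge] never relates different blocks. *)
Definition family : finType := ({ffun 'I_hd * 'I_hd -> 'I_q} * {ffun site N -> 'I_nwin})%type.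
Definition jidx (i : family) (r : site N) : nat := (i.1 (plaq evN N0 r) * nwin + i.2 r)%N.

Lemma jidx_lt i r : (jidx i r < q * nwin)%N.
Proof.
have h1 := ltn_ord (i.1 (plaq evN N0 r)); have h2 := ltn_ord (i.2 r).
apply: leq_trans (_ : ((i.1 (plaq evN N0 r)).+1 * nwin <= _)%N); last by rewrite leq_mul2r h1 orbT.
by rewrite /jidx mulSn [ltnRHS]addnC ltn_add2l.
Qed.

Lemma jidx_div i r : (jidx i r %/ nwin = i.1 (plaq evN N0 r))%N.
Proof. by rewrite divnMDl ?nwin_gt0 // divn_small // addn0. Qed.

Lemma jidx_mod i r : (jidx i r %% nwin = i.2 r)%N.
Proof. by rewrite modnMDl modn_small. Qed.

Definition jof (a : nat) : nat := ((a - uphalf n) %/ w)%N.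

Lemma jof_window j a : wfun j a != 0%N -> jof a = j.
Proof.
move=> /wfun_supp; rewrite /wstart /jof => /andP[h1 h2].
have w0 : (0 < w)%N by rewrite muln_gt0 expn_gt0 q0.
have -> : a = (uphalf n + (j * w + (a - (uphalf n + j * w))))%N by rewrite addnA subnKC // mulnC.
rewrite addKn divnMDl // divn_small ?addn0 // ltn_subLR; first by rewrite [(j * w)%N]mulnC.
by rewrite mulnC.
Qed.

(** Windows have disjoint supports, so a configuration charged by a product vector determines its
    family; the remainders only serve to make the indices total. *)
Definition lab (s : cf) : option family := Some
  ([ffun p => Ordinal (ltn_pmod (jof (s (plaq_site evN p)) %/ nwin) q0)],
   [ffun r => Ordinal (ltn_pmod (jof (s r)) nwin_gt0)]).

Lemma lab_correct (i : family) (s : cf) :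
  prodvec (fun r => wvec (jidx i r)) s != 0 -> lab s = Some i.
Proof.
move=> nz.
have hj r : jof (s r) = jidx i r.
  apply: jof_window; apply: contraNneq nz => z.
  by rewrite /prodvec (bigD1 r) //= /wvec z mul0r mul0r.
case: i hj {nz} => be o hj; congr (Some (_, _)).
  apply/ffunP => p; rewrite ffunE; apply: val_inj => /=.
  by rewrite hj jidx_div plaq_siteK /= modn_small.
by apply/ffunP => r; rewrite ffunE; apply: val_inj => /=; rewrite hj jidx_mod.
Qed.

(** There are [nwin] windows per site and [q] blocks per plaquette; the factor from the [hd ^ 2]
    plaquettes is the entropy that the intermediate pattern lacks. *)
Theorem partition_lower :
  (expR (b - 17) * (S / (8 * Q))) ^+ (N ^ 2) * q%:R ^+ (hd ^ 2) <= optr (opexp (energy (n := n) (N := N) b)).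
Proof.
have Q0 : 0 < Q by rewrite ltr0n expn_gt0 q0.
have s0 := S_gt0 (R := R) n0.
apply: le_trans (trace_exp_ge (V := fun i : family => prodvec (fun r => wvec (jidx i r))) (lab := lab) _ _ _).
- apply: le_trans (_ : \sum_(i : family) expR ((b - 17) * (N ^ 2)%:R) <= _); last first.
    apply: ler_sum => i _; rewrite ler_expR; apply: quad_energy_ge => [r|r d]; first exact: jidx_lt.
    by apply: mbar_close; rewrite ?jidx_lt // !jidx_div plaq_edge.
  have cardE (X : R) : \sum_(i : family) X = X * (nwin%:R ^+ (N ^ 2) * q%:R ^+ (hd ^ 2)).
    by rewrite sumr_const card_prod !card_ffun !card_prod !card_ord !mulnn -[X *+ _]mulr_natr natrM !natrX; ring.
  rewrite cardE [(_ * (S / _)) ^+ _]exprMn -[expR _ ^+ _]expRM_natr -[leLHS]mulrA.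
  apply: ler_wpM2l; first exact: expR_ge0.
  apply: ler_wpM2r; first by rewrite exprn_ge0.
  apply: lerXn2r; rewrite ?nnegrE ?nwin_ge //.
  by apply: divr_ge0; [exact: ltW|rewrite mulr_ge0 // ltW].
- exact: energy_sym.
- by move=> i; apply: prodvec_unit => r; apply: wvec_unit; exact: jidx_lt.
- by move=> i s; exact: lab_correct.
Qed.

End WindowFamilies.

End LowerBound.

(** * Contours in a square grid *)

Section GridContours.
Variables (d : nat) (sg : nat -> nat -> bool).

(* [(false, (i, j))] is the edge from [(i, j)] to [(i + 1, j)], [(true, (i, j))] the edge from
   [(i, j)] to [(i, j + 1)]. *)
Notation gedge := (bool * (nat * nat))%type.

Definition cell (i j : nat) : seq gedge :=
  [:: (false, (i, j)); (false, (i, j.+1)); (true, (i, j)); (true, (i.+1, j))].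

(** Edges sharing a cell with [e], which is itself included; at most 8 entries, the branching number
    of contours. *)
Definition nbh (e : gedge) : seq gedge :=
  let: (v, (i, j)) := e in
  cell i j ++ (if v then (if i is i'.+1 then cell i' j else [::])
               else (if j is j'.+1 then cell i j' else [::])).

Definition flipped (e : gedge) : bool :=
  let: (v, (i, j)) := e in
  if v then [&& (i <= d)%N, (j < d)%N & sg i j != sg i j.+1]
  else [&& (i < d)%N, (j <= d)%N & sg i j != sg i.+1 j].

Definition exits (e : gedge) : bool :=
  let: (v, (i, j)) := e in if v then (i == 0%N) || (i == d) else j == d.

Definition gstep (e f : gedge) : bool := (f \in nbh e) && flipped f.

Lemma cell_nbh i j e f : e \in cell i j -> f \in cell i j -> f \in nbh e.
Proof.
move=> he hf; move: he; rewrite /cell !inE => /or4P[]/eqP->; by rewrite /nbh mem_cat hf ?orbT.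
Qed.

Definition exitable (e : gedge) : bool := `[< exists p, path gstep e p /\ exits (last e p) >].

Lemma exitable_cell i j e f : e \in cell i j -> f \in cell i j -> flipped f ->
  exitable f -> exitable e.
Proof.
move=> he hf ff /asboolP[p [hp hl]]; apply/asboolP; exists (f :: p); split=> //=.
by rewrite /gstep (cell_nbh he hf) ff hp.
Qed.

(** Parity argument: every cell has an even number of flipped edges. Delete the edges from which the
    left, right or top side can be reached; a cell loses all of its flipped edges or none, so
    evenness survives. Summed row by row, the number of edges kept on the bottom side has the parity
    of that on the top side, where none is kept. If nothing on the bottom side had an exit, this
    would contradict the different corners. *)
Lemma exists_exit_path : sg 0 0 != sg d 0 ->
  exists k p, [/\ (k < d)%N, flipped (false, (k, 0%N)), path gstep (false, (k, 0%N)) p &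
    exits (last (false, (k, 0%N)) p)].
Proof.
move=> ends; apply: contrapT => none.
have noexit k : (k < d)%N -> flipped (false, (k, 0%N)) -> exitable (false, (k, 0%N)) = false.
  by move=> kd fk; apply/asboolP => -[p [hp hl]]; apply: none; exists k, p.
pose keep e := flipped e && ~~ exitable e.
have par i j : (i < d)%N -> (j < d)%N ->
   keep (false, (i, j)) (+) keep (false, (i, j.+1)) (+) keep (true, (i, j)) (+) keep (true, (i.+1, j)) = false.
  move=> id jd; have [/hasP[f hf /andP[ff uf]]|/hasPn hn] := boolP (has (fun e => flipped e && exitable e) (cell i j)).
    have k0 e : e \in cell i j -> keep e = false.
      move=> he; rewrite /keep; case fe: (flipped e) => //=.
      by rewrite (exitable_cell he hf ff uf).
    by rewrite !k0 // /cell !inE eqxx ?orbT.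
  have k1 e : e \in cell i j -> keep e = flipped e.
    by move=> he; rewrite /keep; have := hn e he; case: (flipped e) => //= ->.
  rewrite !k1 /cell ?inE ?eqxx ?orbT // /flipped id jd (ltnW id) (ltnW jd) /=.
  by case: (sg i j); case: (sg i.+1 j); case: (sg i j.+1); case: (sg i.+1 j.+1).
pose row j i := \big[addb/false]_(k < i) keep (false, (nat_of_ord k, j)).
have rowS j i : (j < d)%N -> (i <= d)%N -> row j i (+) row j.+1 i = keep (true, (0%N, j)) (+) keep (true, (i, j)).
  move=> jd; elim: i => [|i IH] id.
    by rewrite /row !big_ord0; case: (keep _).
  have := par i j id jd; have := IH (ltnW id); rewrite /row !big_ord_recr /= -!/(row _ _).
  case: (row j i); case: (row j.+1 i); case: (keep (true, (0%N, j))); case: (keep (true, (i, j)));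
  case: (keep (false, (i, j))); case: (keep (false, (i, j.+1))); by case: (keep (true, (i.+1, j))).
have side j i : (j < d)%N -> exits (true, (i, j)) -> keep (true, (i, j)) = false.
  move=> jd hx; rewrite /keep; case: (flipped _) => //=; apply/negbTE; rewrite negbK.
  by apply/asboolP; exists [::].
have rowE j : (j < d)%N -> row j d = row j.+1 d.
  move=> jd; have := rowS j d jd (leqnn d); rewrite !side //= ?eqxx ?orbT //.
  by case: (row j d); case: (row j.+1 d).
have row0 j : (j <= d)%N -> row 0%N d = row j d.
  elim: j => [//|j IH] jd; rewrite (IH (ltnW jd)); exact: rowE.
have top : row d d = false.
  rewrite /row big1 // => k _; rewrite /keep; case: (flipped _) => //=; apply/negbTE; rewrite negbK.
  by apply/asboolP; exists [::]; split => //=; rewrite eqxx.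
have bottom i : (i <= d)%N -> row 0%N i = (sg 0 0 != sg i 0).
  elim: i => [|i IH] id; first by rewrite /row big_ord0 eqxx.
  rewrite /row big_ord_recr /= -/(row _ _) IH ?(ltnW id) //.
  have -> : keep (false, (i, 0%N)) = flipped (false, (i, 0%N)).
    by rewrite /keep; case fk : (flipped _) => //=; rewrite noexit.
  by rewrite /flipped id leq0n /=; case: (sg 0 0); case: (sg i 0); case: (sg i.+1 0).
by have := bottom d (leqnn d); rewrite (row0 d) // top ends.
Qed.

(** Twice the abscissa of the midpoint of the edge. A contour step moves it by at most 2, which
    bounds lengths from below. *)
Definition xpos (e : gedge) : nat := let: (v, (i, j)) := e in (i.*2 + ~~ v)%N.
Definition ypos (e : gedge) : nat := let: (v, (i, j)) := e in (j.*2 + v)%N.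

Lemma nbh_pos e f : f \in nbh e ->
  [/\ (xpos f <= xpos e + 2)%N, (xpos e <= xpos f + 2)%N & (ypos f <= ypos e + 2)%N].
Proof.
move: e f => [v [i j]] [v' [i' j']].
have cells x y : (v', (i', j')) \in cell x y -> [/\ (x <= i' <= x.+1)%N, (y <= j' <= y.+1)%N,
     ~~ v' -> i' = x & v' -> j' = y].
  by rewrite !inE => /or4P[]/eqP[-> -> ->]; split => //; lia.
rewrite /nbh mem_cat => /orP[/cells[h1 h2 h3 h4]|].
  by rewrite /xpos /ypos; case: v; case: v' {cells} h3 h4 => /= h3 h4; split; lia.
case: v; [case: i => [//|i]|case: j => [//|j]] => /cells[h1 h2 h3 h4];
  by rewrite /xpos /ypos; case: v' {cells} h3 h4 => /= h3 h4; split; lia.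
Qed.

Lemma path_pos e p : path gstep e p ->
  [/\ (xpos (last e p) <= xpos e + (size p).*2)%N, (xpos e <= xpos (last e p) + (size p).*2)%N &
   (ypos (last e p) <= ypos e + (size p).*2)%N].
Proof.
elim: p e => [|f p IH] e /=; first by rewrite !addn0.
case/andP=> /andP[/nbh_pos[h1 h2 h3] _] /IH[h4 h5 h6]; split; lia.
Qed.

(** A contour coded by its first edge and a choice among 8 at each step. An index out of range
    repeats [e], which the uniqueness of the edges excludes later. *)
Fixpoint gwalk (e : gedge) (cs : seq 'I_8) : seq gedge :=
  if cs is c :: cs' then let f := nth e (nbh e) c in f :: gwalk f cs' else [::].

Lemma size_gwalk e cs : size (gwalk e cs) = size cs.
Proof. by elim: cs e => //= c cs IH e; rewrite IH. Qed.

Lemma gwalk_path e p : path gstep e p -> exists cs, gwalk e cs = p /\ size cs = size p.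
Proof.
elim: p e => [|f p IH] e /=; first by exists [::].
case/andP=> /andP[hf _] /IH[cs [hcs szc]].
have sz : (size (nbh e) <= 8)%N by move: e {hf hcs} => [[] [[|i] [|j]]].
have hi : (index f (nbh e) < 8)%N by apply: leq_trans sz; rewrite index_mem.
by exists (Ordinal hi :: cs); rewrite /= nth_index // hcs szc.
Qed.

(** A contour from the bottom edge [k] has to reach a side, hence makes at least
    [min (k, d - 1 - k)] steps. It is truncated to exactly that many, so that contours are counted
    by tuples. *)
Theorem exists_contour : sg 0 0 != sg d 0 ->
  exists2 k, (k < d)%N & exists cs : (minn k (d.-1 - k)).-tuple 'I_8,
    let l := (false, (k, 0%N)) :: gwalk (false, (k, 0%N)) cs in uniq l && all flipped l.
Proof.
move=> /exists_exit_path[k [p [kd fk hp hl]]]; exists k => //.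
case/shortenP: hp hl => p' hp' up' _ hl.
have [h1 h2 h3] := path_pos hp'.
set m := minn k (d.-1 - k).
have mp : (m <= size p')%N.
  move: hl h1 h2 h3; case: (last _ p') => [[] [i j]] /=; rewrite /m.
    case/orP => /eqP ->; lia.
  by move=> /eqP ->; lia.
have tp : path gstep (false, (k, 0%N)) (take m p') by exact: take_path.
have [cs [hcs szc]] := gwalk_path tp.
have sz : size cs == m by rewrite szc size_take; case: ltngtP mp => // ->.
exists (Tuple sz); rewrite [tval _]/= hcs; apply/andP; split; last first.
  rewrite /= -/(flipped (false, (k, 0%N))) fk /=.
  by elim: (take m p') (false, (k, 0%N)) tp => //= f s IH e /andP[/andP[_ ->]] /IH.
rewrite /=.
have -> : (false, (k, 0%N)) \notin take m p'.
  by move: up' => /= /andP[h _]; apply: contra h; exact: mem_take.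
by rewrite take_uniq //; move: up' => /= /andP[].
Qed.

End GridContours.

(** * The Peierls argument *)

Lemma far_dichotomy (R : realType) (kappa x y : R) : kappa <= 16^-1 ->
  (x <= kappa) || (1 - kappa <= x) -> (y <= kappa) || (1 - kappa <= y) -> (x < 2^-1) != (y < 2^-1) ->
  (x <= kappa) && (1 - kappa <= y) || (y <= kappa) && (1 - kappa <= x).
Proof.
move=> kk hx hy; case: (ltrP x (2^-1)) => x2; case: (ltrP y (2^-1)) => y2 // _.
  case/orP: hx => hx; last by exfalso; lra.
  case/orP: hy => hy; first by exfalso; lra.
  by rewrite hx hy.
case/orP: hx => hx; first by exfalso; lra.
case/orP: hy => hy; last by exfalso; lra.
by rewrite hx hy orbT.
Qed.

Lemma pigeonhole8 (t L : nat) : (L <= t)%N -> (8 + 8 * t <= 8 * L)%N -> false.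
Proof. by lia. Qed.

Section Peierls.
Context {R : realType}.
Variables (n N : nat) (b kappa eta : R).
Hypothesis evN : ~~ odd N.
Hypothesis b0 : 0 <= b.
Hypothesis k16 : kappa <= 16^-1.
Hypothesis eta0 : 0 < eta.
Hypothesis eta32 : 32 * eta <= 1.
Notation cf := {ffun site N -> 'I_n.+1}.
Notation Z := (optr (opexp (energy (n := n) (N := N) b))).
Hypothesis rare_intermediate : forall J : {set site N},
  torus_weight b (fun (a : 'I_n.+1) _ => intermediate kappa a) None J <= (eta ^+ 8) ^+ #|J| * Z.
Hypothesis rare_split : forall i (J : {set site N}),
  torus_weight b (split_pair (n := n) kappa) (Some i) J <= (eta ^+ 8) ^+ #|J| * Z.

Definition weight (ev : pred cf) : R := \sum_(s | ev s) opexp (energy (n := n) (N := N) b) s s.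

Lemma weight_union (I : finType) (F : I -> pred cf) (ev : pred cf) :
  (forall s, ev s -> exists i, F i s) -> weight ev <= \sum_i weight (F i).
Proof.
move=> h; rewrite /weight big_mkcond /= (eq_bigr (fun i => \sum_s (if F i s then opexp (energy (n := n) (N := N) b) s s else 0))); last first.
  by move=> i _; rewrite big_mkcond.
rewrite exchange_big /=; apply: ler_sum => s _.
have w0 : 0 <= opexp (energy (n := n) (N := N) b) s s by apply: ltW; exact: exp_energy_gt0.
have t0 i : 0 <= (if F i s then opexp (energy (n := n) (N := N) b) s s else 0) by case: ifP.
case: ifP => [/h[i Fi]|_]; last exact: sumr_ge0.
by rewrite (bigD1 i) //= Fi lerDl sumr_ge0.
Qed.

Lemma weight_eq (e e' : pred cf) : (forall s, e s = e' s) -> weight e = weight e'.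
Proof. by move=> h; apply: eq_bigl. Qed.

Lemma Z_gt0 : 0 < Z.
Proof. by rewrite -(@torus_weight0 R n N b (fun _ _ => true) None); exact: torus_weight0_gt0. Qed.

Lemma eta_le1 : eta <= 1.
Proof. by move: eta32 eta0; lra. Qed.

Definition small (s : cf) (r : site N) : bool := `|mz (s r) : R| < 2^-1.

Section Line.
Variables (D : bool) (a c : 'I_N) (d : nat).
Hypothesis dN : (d < N)%N.

Definition emb (i j : nat) : site N := mk D (omod a (a + i)) (omod a (c + j)).

Lemma emb_inj i j i' j' : (i < N)%N -> (j < N)%N -> (i' < N)%N -> (j' < N)%N ->
  emb i j = emb i' j' -> i = i' /\ j = j'.
Proof.
move=> hi hj hi' hj' /mk_inj[/(congr1 val)/= e1 /(congr1 val)/= e2].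
move/eqP: e1; rewrite eqn_modDl !modn_small // => /eqP ->.
by move/eqP: e2; rewrite eqn_modDl !modn_small // => /eqP ->.
Qed.

Notation gedge := (bool * (nat * nat))%type.

Definition base (e : gedge) : site N := emb e.2.1 e.2.2.
Definition other (e : gedge) : site N := if e.1 then emb e.2.1 e.2.2.+1 else emb e.2.1.+1 e.2.2.

Lemma other_edge e : exists p, other e = edge_inv (D (+) e.1, p) (base e).
Proof.
case: e => v [i j]; rewrite /other /base /=; case: v.
  exists (odd (c + j)); rewrite addbT /edge_inv /emb /= cdN_mk negbK cd_mk nbr_omod // eqxx addnS.
  by case: (D).
by exists (odd (a + i)); rewrite addbF /edge_inv /emb /= cd_mk cdN_mk nbr_omod // eqxx addnS.
Qed.

Notation cls := (bool * option (option bool))%type.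

(** A flipped edge has an intermediate first end, an intermediate second end, or is a split pair of
    type [p]; with the orientation this makes 8 classes. Inside a class distinct edges have distinct
    sites, so that events can be counted by sites. *)
Definition class_site (k : cls) (e : gedge) : site N := if k.2 is Some None then other e else base e.

Definition class_cond (k : cls) (s : cf) (e : gedge) : bool :=
  (e.1 == k.1) && match k.2 with
  | None => intermediate kappa (s (base e))
  | Some None => intermediate kappa (s (other e))
  | Some (Some p) => (other e == edge_inv (D (+) e.1, p) (base e)) && split_pair kappa (s (base e)) (s (other e))
  end.

Definition class_event (k : cls) (J : {set site N}) : pred cf :=
  if k.2 is Some (Some p) then pair_event (tau_of (Some (D (+) k.1, p))) (split_pair kappa) J
  else pair_event (tau_of None) (fun a _ => intermediate kappa a) J.

Lemma class_event_weight k J : weight (class_event k J) <= (eta ^+ 8) ^+ #|J| * Z.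
Proof.
case: k => v [[p|]|]; rewrite /class_event /=; [exact: rare_split|exact: rare_intermediate|exact: rare_intermediate].
Qed.

Notation flip s := (flipped d (fun i j => small s (emb i j))).

Lemma flip_class s e : flip s e -> exists k, class_cond k s e.
Proof.
move=> he; have sm : small s (base e) != small s (other e).
  by move: he; case: e => [[] [i j]] /= /and3P[_ _].
have [p hp] := other_edge e.
have [h1|h1] := boolP (intermediate kappa (s (base e))); first by exists (e.1, None); rewrite /class_cond eqxx.
have [h2|h2] := boolP (intermediate kappa (s (other e))); first by exists (e.1, Some None); rewrite /class_cond eqxx.
exists (e.1, Some (Some p)); rewrite /class_cond eqxx /= -hp eqxx /=.
move: h1 h2 sm; rewrite /intermediate /small /split_pair /far_apart !negb_and -!leNgt.
exact: far_dichotomy.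
Qed.

Lemma class_site_inj k s : {in [pred e | flip s e && class_cond k s e] &, injective (class_site k)}.
Proof.
move=> [v [i j]] [v' [i' j']]; rewrite !inE /class_cond /= => /andP[f1 /andP[/eqP v1 _]] /andP[f2 /andP[/eqP v2 _]].
have {v2} e : v' = v by rewrite v1 v2. 
move=> h; subst v'; suff [-> ->] : i = i' /\ j = j' by [].
have lt : forall x, (x <= d)%N -> (x < N)%N by move=> x; move/leq_ltn_trans; exact.
move: f1 f2 h; rewrite /class_site /base /other /=; case: (v) => /and3P[a1 a2 _] /and3P[a3 a4 _];
  case: k.2 => [[p|]|] /= /emb_inj; rewrite ?lt ?(ltnW a2) ?(ltnW a4) ?(ltnW a1) ?(ltnW a3) // => /(_ isT isT isT isT) [e1 e2]; split => //;
  by apply: succn_inj.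
Qed.

(** Some class holds at least [L / 8] of the edges. The class costs a factor 8 and the choice of its
    sites [2 ^ L], while [(eta ^ 8) ^ (L / 8)] leaves [eta ^ L]: hence the power 8 in the
    hypotheses. *)
Lemma flipped_list_weight (l : seq gedge) : uniq l ->
  weight (fun s => all (flip s) l) <= 8 * (2 * eta) ^+ size l * Z.
Proof.
move=> ul; set L := size l.
have cls8 : #|{: cls}| = 8 by rewrite card_prod card_bool !card_option card_bool.
pose A (k : cls) : {set site N} := [set x in map (class_site k) l].
have cA k : (#|A k| <= L)%N by rewrite /A cardsE; apply: leq_trans (card_size _) _; rewrite size_map.
pose F (k : cls) (s : cf) := [exists J : {set site N}, [&& J \subset A k, (L <= 8 * #|J|)%N & class_event k J s]].
have step s : all (flip s) l -> exists k, F k s.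
  move=> fl; pose lk (k : cls) := [seq e <- l | class_cond k s e].
  pose J (k : cls) : {set site N} := [set x in map (class_site k) (lk k)].
  have cJ k : #|J k| = count (class_cond k s) l.
    rewrite cardsE (card_uniqP _) ?size_map ?size_filter // map_inj_in_uniq ?filter_uniq //.
    move=> e e'; rewrite !mem_filter => /andP[c1 l1] /andP[c2 l2]; apply: (@class_site_inj k s);
      by rewrite inE (allP fl) // ?c1 ?c2.
  have tot : (L <= \sum_(k : cls) #|J k|)%N.
    rewrite (eq_bigr (fun k => count (class_cond k s) l)) => [|k _]; last exact: cJ.
    rewrite /L; elim: (l) fl => [|e l' IH] /=; first by rewrite big1.
    case/andP=> fe /IH h; rewrite big_split /= -add1n; apply: leq_add => //.
    by have [k hk] := flip_class fe; rewrite (bigD1 k) //= hk.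
  have [k hk] : exists k, (L <= 8 * #|J k|)%N.
    apply/existsP; apply: contraT => /existsPn hk.
    have : (\sum_(k : cls) (8 * #|J k|).+1 <= \sum_(k : cls) L)%N.
      by apply: leq_sum => k _; have := hk k; rewrite -ltnNge.
    rewrite sum_nat_const cls8 (eq_bigr (fun k => 1 + 8 * #|J k|)%N) // big_split /= -big_distrr /=.
    by rewrite sum1_card cls8 => /(pigeonhole8 tot).
  exists k; apply/existsP; exists (J k); rewrite hk /=; apply/andP; split.
    apply/fintype.subsetP => x; rewrite !inE => /mapP[e]; rewrite mem_filter => /andP[_ el] ->.
    exact: map_f.
  have inJ x : x \in J k -> exists2 e, class_cond k s e & x = class_site k e.
    by rewrite inE => /mapP[e]; rewrite mem_filter => /andP[ce _] ->; exists e.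
  move: k {hk} inJ => [v [[p|]|]] inJ; rewrite /class_event /=; apply/forall_inP => x /inJ[e];
    rewrite /class_cond /class_site /= => /andP[/eqP ev ce] ->; rewrite /tau_of //.
  by case/andP: ce => /eqP eo; rewrite -ev -eo.
have e1 := eta_le1; have z0 := Z_gt0.
apply: le_trans (weight_union step) _.
apply: le_trans (_ : \sum_(k : cls) (2 * eta) ^+ L * Z <= _); last first.
  by rewrite -[8 * _ * Z]mulrA; move: (_ ^+ L * Z) => X; rewrite sumr_const cls8 [leRHS]mulr_natl.
apply: ler_sum => k _.
apply: le_trans (weight_union (F := fun (J : {set site N}) s => [&& J \subset A k, (L <= 8 * #|J|)%N & class_event k J s]) _) _.
  by move=> s /existsP.
apply: le_trans (_ : \sum_(J : {set site N} | J \subset A k) eta ^+ L * Z <= _); last first.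
  have X0 : 0 <= eta ^+ L * Z by rewrite mulr_ge0 ?exprn_ge0 ?(ltW eta0) // ltW.
  rewrite [(2 * eta) ^+ L]exprMn -[2 ^+ L * _ * Z]mulrA; move: (eta ^+ L * Z) X0 => X X0.
  rewrite sumr_const -[X *+ _]mulr_natl; apply: ler_wpM2r => //.
  rewrite -natrX ler_nat; apply: leq_trans (_ : 2 ^ #|A k| <= _)%N; last by rewrite leq_exp2l.
  by rewrite -card_powerset subset_leq_card //; apply/fintype.subsetP => J; rewrite powersetE.
rewrite [leRHS]big_mkcond /=; apply: ler_sum => J _; case: ifP => JA /=; last first.
  by rewrite /weight big_pred0.
case LJ : (L <= 8 * #|J|)%N => /=; last by rewrite /weight big_pred0 // mulr_ge0 ?exprn_ge0 ?(ltW eta0) // ltW.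
apply: le_trans (class_event_weight k J) _; apply: ler_wpM2r; first exact: ltW.
by rewrite -exprM; apply: ler_wiXn2l => //; exact: ltW.
Qed.

(** Contours from the edge [k] have [m k + 1] edges and [8 ^ m k] codes, so they contribute at most
    [16 eta (16 eta) ^ m k]. The two geometric series, from both ends of the segment, sum to at most
    4. *)
Lemma line_disagree_weight : weight (fun s => small s (emb 0 0) != small s (emb d 0)) <= 64 * eta * Z.
Proof.
have z0 := Z_gt0; have e0 := eta0; have e32 := eta32.
pose m (k : nat) := minn k (d.-1 - k).
pose l (k : nat) (cs : seq 'I_8) : seq gedge := (false, (k, 0%N)) :: gwalk (false, (k, 0%N)) cs.
pose F (k : 'I_d) (s : cf) := [exists cs : (m k).-tuple 'I_8, uniq (l k cs) && all (flip s) (l k cs)].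
apply: le_trans (weight_union (F := F) _) _.
  move=> s h; have [k kd [cs hcs]] := @exists_contour d (fun i j => small s (emb i j)) h; exists (Ordinal kd); apply/existsP; by exists cs.
apply: le_trans (_ : \sum_(k < d) 16 * eta * Z * ((16 * eta) ^+ k + (16 * eta) ^+ (d.-1 - k)) <= _); last first.
  rewrite -mulr_sumr big_split /=.
  have x0 : 0 <= 16 * eta by lra.
  have x1 : 16 * eta < 1 by lra.
  have g1 : \sum_(k < d) (16 * eta) ^+ k <= 2.
    apply: le_trans (geometric_sum_le d x0 x1) _; rewrite -[leRHS]invrK lef_pV2 ?posrE; lra.
  have g2 : \sum_(k < d) (16 * eta) ^+ (d.-1 - k) <= 2.
    rewrite (reindex_inj rev_ord_inj) /=; apply: le_trans g1; apply: ler_sum => k _.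
    by have -> : (d.-1 - (d - k.+1) = k)%N by have := ltn_ord k; lia.
  have -> : 64 * eta * Z = 16 * eta * Z * (2 + 2) by ring.
  apply: ler_wpM2l; first by rewrite mulr_ge0 // ltW.
  exact: lerD.
apply: ler_sum => k _.
apply: le_trans (weight_union (F := fun (cs : (m k).-tuple 'I_8) s => uniq (l k cs) && all (flip s) (l k cs)) _) _.
  by move=> s /existsP.
apply: le_trans (_ : \sum_(cs : (m k).-tuple 'I_8) 8 * (2 * eta) ^+ (m k).+1 * Z <= _).
  apply: ler_sum => cs _; case ul : (uniq (l k cs)).
    have -> : (m k).+1 = size (l k cs) by rewrite -[size _]/(size (gwalk _ _)).+1 size_gwalk size_tuple.
    exact: flipped_list_weight ul.
  rewrite /weight big_pred0 //.
  by apply: mulr_ge0; [apply: mulr_ge0 => //; apply: exprn_ge0; lra|exact: ltW].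
set X := 8 * (2 * eta) ^+ (m k).+1 * Z.
have -> : \sum_(cs : (m k).-tuple 'I_8) X = 8 ^+ m k * X.
  by rewrite sumr_const card_tuple card_ord -natrX [RHS]mulr_natl.
rewrite /X exprS.
have -> : 8 ^+ m k * (8 * (2 * eta * (2 * eta) ^+ m k) * Z) = 16 * eta * Z * (16 * eta) ^+ m k.
  have -> : 16 * eta = 8 * (2 * eta) by ring.
  by rewrite [(8 * (2 * eta)) ^+ m k]exprMn; ring.
apply: ler_wpM2l; first by rewrite !mulr_ge0 // ltW.
have x0 : 0 <= 16 * eta by lra.
rewrite /m /minn; case: ifP => _; rewrite ?lerDl ?lerDr exprn_ge0 //.
Qed.

End Line.

Lemma weight_disagree_triangle r1 r2 r3 : weight (fun s => small s r1 != small s r3) <=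
  weight (fun s => small s r1 != small s r2) + weight (fun s => small s r2 != small s r3).
Proof.
apply: le_trans (weight_union (F := fun (i : bool) s => if i then small s r1 != small s r2 else small s r2 != small s r3) _) _.
  move=> s h; have [e|ne] := eqVneq (small s r1) (small s r2); last by exists true.
  by exists false; rewrite -e.
by rewrite big_bool.
Qed.

Lemma weight_disagree_sym r1 r2 : weight (fun s => small s r1 != small s r2) = weight (fun s => small s r2 != small s r1).
Proof. by apply: weight_eq => s; rewrite eq_sym. Qed.

Lemma line_disagree (D : bool) (x x' y : 'I_N) :
  weight (fun s => small s (mk D x y) != small s (mk D x' y)) <= 64 * eta * Z.
Proof.
wlog lt : x x' / (x <= x')%N.
  by move=> h; case: (leqP x x') => [|/ltnW] /h //; rewrite weight_disagree_sym.
have dN : (x' - x < N)%N by apply: leq_ltn_trans (leq_subr _ _) (ltn_ord x').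
have := line_disagree_weight D x y dN.
have -> : emb D x y 0 0 = mk D x y.
  by congr (mk _ _ _); apply: val_inj; rewrite /= addn0 modn_small.
have -> // : emb D x y (x' - x) 0 = mk D x' y.
by congr (mk _ _ _); apply: val_inj; rewrite /= ?addn0 ?subnKC // modn_small.
Qed.

Theorem disagree_weight r r' : weight (fun s => small s r != small s r') <= 128 * eta * Z.
Proof.
case: r r' => x y [x' y'].
apply: le_trans (weight_disagree_triangle _ (x', y) _) _.
have h1 := line_disagree false x x' y; have h2 := line_disagree true y y' x'.
by rewrite /= in h1 h2; apply: le_trans (lerD h1 h2) _; lra.
Qed.

End Peierls.

(** * Choice of the parameters *)

Section ParameterChoice.
Context {R : realType}.

Lemma exists_fourth_root (b : R) : 1 <= b -> exists q : nat, b <= (q ^ 4)%:R <= 16 * b.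
Proof.
move=> b1; have ex : exists q : nat, b <= (q ^ 4)%:R.
  have b0 : 0 <= b by lra.
  have := archi_boundP b0; set k := Num.bound b => hk.
  have k0 : (0 < k)%N by rewrite lt0n; apply/eqP => e; move: hk; rewrite e; lra.
  by exists k; apply: le_trans (ltW hk) _; rewrite ler_nat -{1}(expn1 k) leq_pexp2l.
have [q hq qmin] := ex_minnP ex; exists q; rewrite hq /=.
case: q hq qmin => [|[|q]] hq qmin.
- by move: hq; rewrite exp0n //; lra.
- by rewrite exp1n; lra.
have h : (q.+1 ^ 4)%:R <= b.
  by rewrite leNgt; apply/negP => /ltW /qmin; rewrite ltnn.
apply: le_trans (_ : (16 * q.+1 ^ 4)%:R <= _); last by rewrite natrM; lra.
rewrite ler_nat -[16%N]/(2 ^ 4)%N -expnMn leq_exp2r //; lia.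
Qed.

Lemma exp_beats_linear (M t : R) : 0 <= M -> 0 < t ->
  exists B, forall b, B <= b -> 0 < b -> M * b * expR (- (b * t)) <= 1.
Proof.
move=> M0 t0; exists (4 * M / t ^+ 2) => b hb b0.
have e0 := expR_gt0 (b * t).
rewrite expRN ler_pdivrMr // mul1r.
have h1 : (b * t / 2) ^+ 2 <= expR (b * t).
  have -> : b * t = (b * t / 2) * 2 by field.
  rewrite expRM_natr; have h := expR_ge1Dx (b * t / 2).
  have z0 : 0 <= b * t / 2 by rewrite divr_ge0 // mulr_ge0 // ltW.
  by rewrite mulfK //; apply: lerXn2r; rewrite ?nnegrE ?expR_ge0 //; lra.
apply: le_trans h1; move: hb; rewrite ler_pdivrMr ?exprn_gt0 // => hb.
have -> : (b * t / 2) ^+ 2 = b * (b * t ^+ 2) / 4 by field.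
by have := ler_wpM2l (ltW b0) hb; lra.
Qed.

Lemma parity_block_exponent (h : nat) : (8 <= h)%N -> (4 * h ^ 2 <= 8 * (h ^ 2 - 4 * h))%N.
Proof. by move=> h8; have : (8 * h <= h ^ 2)%N; [rewrite -mulnn leq_mul2r h8 orbT|lia]. Qed.

(** Here [h] is [N / 2]: the entropy [x ^ (h ^ 2)] of the plaquettes must pay for a constant [D] per
    site and for the boundary factor [x ^ (4 h)]. *)
Lemma pow_balance (D x : R) (h : nat) : 1 <= D -> D ^+ 8 <= x -> (8 <= h)%N ->
  D ^+ (4 * h ^ 2) * x ^+ (4 * h) <= x ^+ (h ^ 2).
Proof.
move=> D1 Dx h8; have D0 : 0 <= D by lra.
have D80 : 0 <= D ^+ 8 by exact: exprn_ge0.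
have x0 : 0 <= x by exact: le_trans Dx.
have hh : (4 * h <= h ^ 2)%N by rewrite -mulnn leq_mul2r; apply/orP; right; lia.
have -> : x ^+ (h ^ 2) = x ^+ (h ^ 2 - 4 * h) * x ^+ (4 * h) by rewrite -exprD subnK.
apply: ler_wpM2r; first exact: exprn_ge0.
apply: le_trans (_ : D ^+ (8 * (h ^ 2 - 4 * h)) <= _).
  by apply: ler_weXn2l => //; exact: parity_block_exponent.
by rewrite exprM; apply: lerXn2r; rewrite ?nnegrE.
Qed.

End ParameterChoice.

Lemma even_quadruple_half m : ~~ odd m -> (2 * m = 4 * m./2)%N.
Proof. by move=> e; have := even_halfK e; lia. Qed.

(** * Defects are rare *)

Section RareDefects.
Context {R : realType}.

(* The auxiliary integer [q] of the previous estimates is taken to be about [b^(1/4)]. *)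
Theorem rare_defects (kappa eps : R) : 0 < kappa -> kappa <= 16^-1 -> 0 < eps -> eps <= 1 ->
  exists2 b1 : R, 100 <= b1 & forall (b : R) (n N : nat), b1 <= b -> (0 < n)%N ->
   10000 * b ^+ 2 <= spinS R n -> ~~ odd N -> (16 <= N)%N ->
   let Z := optr (opexp (energy (n := n) (N := N) b)) in
   [/\ forall J : {set site N}, torus_weight b (fun (a : 'I_n.+1) _ => intermediate kappa a) None J <= eps ^+ #|J| * Z,
       forall i (J : {set site N}), torus_weight b (split_pair (n := n) kappa) (Some i) J <= eps ^+ #|J| * Z &
       (expR (b - 17) * (spinS R n / (128 * b))) ^+ (N ^ 2) <= Z].
Proof.
move=> k0 k16 e0 e1.
have [C C1 hC] : exists2 C : R, 1 <= C & 1000 * 1000 <= C.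
  by exists (1000 * 1000); [lra|exact: lexx].
have C0 : 0 <= C by exact: le_trans ler01 C1.
(* [A] bounds, per site, the intermediate pattern by [T]: [expR 20] bridges [b + 3] and [b - 17],
   and the 8 comes from the number of windows. *)
pose A := expR 20 * 8 * (C / kappa ^+ 2).
have A1 : 1 <= A.
  have h1 : 1 <= expR 20 :> R by rewrite -[leLHS]expR0 ler_expR.
  have h2 : 1 <= C / kappa ^+ 2.
    rewrite ler_pdivlMr ?exprn_gt0 // mul1r; apply: le_trans C1.
    by clear -k0 k16; nra.
  by rewrite /A; move: (expR 20 : R) (C / _) h1 h2 => x y h1 h2; clear -h1 h2; nra.
pose D := A / eps.
have D1 : 1 <= D by rewrite /D ler_pdivlMr // mul1r; exact: le_trans A1.
have [K K0 hK] : exists2 K : R, 0 <= K & inhabited (expR 20 * (36 * 8) <= K).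
  exists (expR 20 * (36 * 8)); last by apply: inhabits; exact: lexx.
  by apply: mulr_ge0; [exact: expR_ge0|lra].
have M0 : 0 <= K * 16 by lra.
have t0 : 0 < (50 * 6)^-1 :> R by rewrite invr_gt0; lra.
have [B hB] := exp_beats_linear M0 t0.
have e6 : 0 < 50 * 6 / eps by apply: divr_gt0 => //; lra.
(* [D ^ 32 <= b] gives [D ^ 8 <= q], [300 / eps <= b] gives [exp (- b / 300) <= eps], and [B] makes
   this exponential beat the linear prefactor [K * 16 * b] of split pairs. *)
have [b1 b1100 [b1D b1e b1B]] : exists2 b1, 100 <= b1 & [/\ (D ^+ 8) ^+ 4 <= b1, 50 * 6 / eps <= b1 & B <= b1].
  have D32 : 0 <= (D ^+ 8) ^+ 4 by rewrite !exprn_ge0 //; lra.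
  have B1 := normr_ge0 B; have B2 := ler_norm B.
  exists (100 + (D ^+ 8) ^+ 4 + 50 * 6 / eps + `|B|); [|split];
    move: ((D ^+ 8) ^+ 4) (50 * 6 / eps) `|B| D32 e6 B1 B2 => x y z x0 y0 z0 z1; clear -x0 y0 z0 z1; lra.
exists b1 => // b n N hb n0 bS evN N16 Z.
have b100 := le_trans b1100 hb; have bD := le_trans b1D hb; have be := le_trans b1e hb.
have bB := le_trans b1B hb.
have b0 := b_ge0 b100.
have bp : 0 < b by apply: lt_le_trans b100.
have [|q /andP[bQ Qb]] := exists_fourth_root (b := b); first by apply: le_trans b100; rewrite ler1n.
have N0 : (0 < N)%N by apply: leq_trans N16.
have q0 := q_gt0 b100 bQ.
have s0 := S_gt0 (R := R) n0.
have Q0 : 0 < (q ^ 4)%:R :> R by rewrite ltr0n expn_gt0 q0.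
have low := partition_lower n0 evN b100 bQ Qb bS N0.
have up1 := all_intermediate_upper n0 evN b100 bQ Qb bS k0 k16 hC N0.
have up2 i J := split_pairs_upper n0 evN b100 bQ Qb bS i J (ltW k0) k16.
move=> {bS hC}.
set T := expR (b - 17) * (spinS R n / (8 * (q ^ 4)%:R)) in low.
have T0 : 0 < T by rewrite mulr_gt0 ?expR_gt0 // divr_gt0 // mulr_gt0.
have qR : 1 <= q%:R :> R by rewrite ler1n.
have e20 : expR (b + 3) = expR (b - 17) * expR 20 by rewrite -expRD; congr expR; lra.
have W0 (E : rel 'I_n.+1) o : torus_weight (N := N) b E o set0 = Z by exact: torus_weight0.
have lowT : T ^+ (N ^ 2) <= Z.
  apply: le_trans low; rewrite -[leLHS]mulr1; apply: ler_wpM2l; first by rewrite exprn_ge0 // ltW.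
  exact: exprn_ege1.
split.
- rewrite -(W0 (fun (a : 'I_n.+1) _ => intermediate kappa a) None); apply: chessboard_site => //; rewrite W0.
  apply: le_trans up1 _.
  apply: le_trans (ler_wpM2l _ low); last by rewrite exprn_ge0 // ltW.
  have -> : expR (b + 3) * (C / kappa ^+ 2 * spinS R n / (q ^ 4)%:R) = eps * D * T.
    rewrite e20 /T /D /A; move: (expR (b - 17)) (expR 20) ((q ^ 4)%:R : R) Q0 (spinS R n) => x y z z0 s.
    by field; rewrite !gt_eqF.
  have -> : ((q ^ 2)%:R : R) ^+ N = q%:R ^+ (4 * N./2).
    by rewrite natrX -exprM; congr (_ ^+ _); exact: even_quadruple_half.
  have NE : (N ^ 2 = 4 * (N./2) ^ 2)%N by rewrite -[in LHS](even_halfK evN) -mul2n expnMn.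
  have hb8 : (8 <= N./2)%N by have := half_leq N16.
  have Dq : D ^+ 8 <= q%:R.
    rewrite -(@ler_pXn2r _ 4) ?nnegrE ?exprn_ge0 //; last by lra.
    by apply: le_trans bD _; rewrite -natrX.
  have := pow_balance D1 Dq hb8; rewrite -NE => pb.
  rewrite [(eps * D * T) ^+ _]exprMn [(eps * D) ^+ _]exprMn.
  have -> : eps ^+ (N ^ 2) * D ^+ (N ^ 2) * T ^+ (N ^ 2) * q%:R ^+ (4 * N./2) =
    (eps ^+ (N ^ 2) * T ^+ (N ^ 2)) * (D ^+ (N ^ 2) * q%:R ^+ (4 * N./2)) by ring.
  rewrite [leRHS]mulrA; apply: ler_wpM2l => //.
  by rewrite mulr_ge0 // exprn_ge0 // ltW.
- move=> i J; pose ep := expR (- (b / (50 * 6))).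
  have ep0 : 0 < ep by exact: expR_gt0.
  have ep1 : ep <= 1 by rewrite -[leRHS]expR0 ler_expR oppr_le0 divr_ge0.
  have epe : ep <= eps.
    rewrite /ep expRN -[leRHS]invrK lef_pV2 ?posrE ?expR_gt0 ?invr_gt0 //.
    apply: le_trans (expR_ge1Dx _); move: be; rewrite ler_pdivrMr // => be.
    by rewrite -[leLHS]mul1r ler_pdivrMr //; nra.
  pose D2 : R := expR 20 * (36 * 8) * (q ^ 4)%:R.
  have c0 : 0 <= expR 20 * (36 * 8) :> R by apply: mulr_ge0; [exact: expR_ge0|lra].
  have D20 : 0 <= D2 by apply: mulr_ge0.
  have De : D2 * ep <= 1.
    apply: le_trans (hB b bB bp); rewrite -/ep; apply: ler_wpM2r; first exact: ltW.
    rewrite /D2 -[leRHS]mulrA; by apply: ler_pM => //; case: hK.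
  apply: le_trans (_ : ep ^+ #|J| * Z <= _); last first.
    apply: ler_wpM2r; first by apply: le_trans lowT; rewrite exprn_ge0 // ltW.
    by apply: lerXn2r => //; rewrite nnegrE; exact: ltW.
  rewrite -(W0 (split_pair kappa) (Some i)); have N4 : (4 <= N)%N by apply: leq_trans N16.
  apply: (chessboard_pair evN N4 b0 (@split_pair_sym R n kappa) ep0 ep1 D20 De).
  move=> J'; rewrite W0; apply: le_trans (up2 i J') _.
  have -> : ep ^+ (6 * #|J'|) = expR (- (b / 50)) ^+ #|J'|.
    by rewrite exprM; congr (_ ^+ _); rewrite /ep -expRM_natr; congr expR; field.
  rewrite mulrAC; apply: ler_wpM2r; first by rewrite exprn_ge0 // expR_ge0.
  apply: le_trans (ler_wpM2l _ lowT); last by rewrite exprn_ge0.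
  rewrite -exprMn; apply: lerXn2r; rewrite ?nnegrE.
  + by rewrite !mulr_ge0 ?expR_ge0 // ltW.
  + by apply: mulr_ge0 => //; exact: ltW.
  rewrite e20 /T /D2 le_eqVlt; apply/orP; left; apply/eqP.
  move: (expR (b - 17)) (expR 20) ((q ^ 4)%:R : R) Q0 (spinS R n) => x y z z0 s.
  by field; rewrite gt_eqF.
- apply: le_trans lowT; apply: lerXn2r; rewrite ?nnegrE ?(ltW T0) //.
    by rewrite mulr_ge0 ?expR_ge0 // divr_ge0 ?(ltW s0) // mulr_ge0.
  apply: ler_wpM2l; first exact: expR_ge0.
  apply: ler_wpM2l; first exact: ltW.
  by rewrite lef_pV2 ?posrE ?mulr_gt0 //; lra.
Qed.

End RareDefects.

(** * The intertwiner of [S^x] and [S^z] *)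

Section Krawtchouk.
Context {R : realType}.
Variable n : nat.
Notation X := (Sxloc R n).
Notation Z := (Szloc R n).

(* In the realization of spin [n / 2] on polynomials of degree [n], the basis vector [a] being
   [sqrt (binomial n a) X^a], the polynomials [krawpoly c] are the eigenvectors of [S^x]. *)
Definition krawpoly (c : nat) : {poly R} := (1 + 'X) ^+ c * ('X - 1) ^+ (n - c).
Definition bweight (a : nat) : R := Num.sqrt 'C(n, a)%:R.
Definition kraw (a c : 'I_n.+1) : R := bweight c / bweight a * (krawpoly c)`_a.

Lemma krawpoly_deriv c : (c <= n)%N -> ('X ^+ 2 - 1) * (krawpoly c)^`() =
  (c%:R * ('X - 1) + (n - c)%:R * ('X + 1)) * krawpoly c.
Proof.
move=> cn; rewrite /krawpoly derivM !deriv_exp.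
have -> : (1 + 'X : {poly R})^`() = 1 by rewrite derivD derivX -polyC1 derivC add0r.
have -> : ('X - 1 : {poly R})^`() = 1 by rewrite derivB derivX -polyC1 derivC subr0.
have e (p : {poly R}) k : p * (1 * p ^+ k.-1 *+ k) = k%:R * p ^+ k.
  case: k => [|k]; first by rewrite mulr0n mulr0 mul0r.
  by rewrite /= mul1r mulrnAr -exprS mulr_natl.
have -> : 'X ^+ 2 - 1 = (1 + 'X) * ('X - 1) :> {poly R} by ring.
rewrite mulrDr mulrACA [X in _ + X]mulrACA !e.
set x : {poly R} := (1 + 'X) ^+ c; set y : {poly R} := ('X - 1) ^+ (n - c); move: x y => x y; ring.
Qed.

(** The left side is [2 S^x] acting as a differential operator on polynomials of degree at most
    [n]. *)
Lemma krawpoly_eigen c : (c <= n)%N ->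
  n%:R * 'X * krawpoly c - ('X ^+ 2 - 1) * (krawpoly c)^`() = (2 * c%:R - n%:R) * krawpoly c.
Proof. by move=> cn; rewrite krawpoly_deriv // natrB //; ring. Qed.

(** The dual relation: [2 S^z], that is [2 X d/dX - n], acts on the index [c] by a three-term
    recurrence. Both sides are multiplied by [X ^ 2 - 1] to reach the formula for the derivative. *)
Lemma krawpoly_step c : (c <= n)%N ->
  (n - c)%:R * krawpoly c.+1 + c%:R * krawpoly c.-1 = 2 * 'X * (krawpoly c)^`() - n%:R * krawpoly c.
Proof.
move=> cn.
have nz : ('X ^+ 2 - 1 : {poly R}) != 0.
  apply/eqP => e; have := congr1 (fun p : {poly R} => p`_2) e.
  by rewrite coefB coefXn coefC coef0 /= subr0 => /eqP; rewrite oner_eq0.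
apply: (mulfI nz).
have -> : ('X ^+ 2 - 1) * (2 * 'X * (krawpoly c)^`() - n%:R * krawpoly c) =
  2 * 'X * (('X ^+ 2 - 1) * (krawpoly c)^`()) - n%:R * ('X ^+ 2 - 1) * krawpoly c :> {poly R} by ring.
rewrite krawpoly_deriv //.
have up : (n - c)%:R * (('X - 1) * krawpoly c.+1) = (n - c)%:R * ((1 + 'X) * krawpoly c) :> {poly R}.
  have [->|] := posnP (n - c); first by rewrite !mul0r.
  rewrite subn_gt0 => lt; congr (_ * _); rewrite /krawpoly exprS -[in RHS](subnSK lt) exprS; ring.
have down : c%:R * ((1 + 'X) * krawpoly c.-1) = c%:R * (('X - 1) * krawpoly c) :> {poly R}.
  case: c cn {up} => [|c] cn; first by rewrite !mul0r.
  congr (_ * _); rewrite /= /krawpoly exprS -(subnSK cn) exprS; ring.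
have -> : ('X ^+ 2 - 1) * ((n - c)%:R * krawpoly c.+1 + c%:R * krawpoly c.-1) =
  (1 + 'X) * ((n - c)%:R * (('X - 1) * krawpoly c.+1)) + ('X - 1) * (c%:R * ((1 + 'X) * krawpoly c.-1)) :> {poly R} by ring.
rewrite up down natrB //; ring.
Qed.

Lemma krawpoly_eigen_coef c a : (c <= n)%N -> (a <= n)%N ->
  (2 * c%:R - n%:R) * (krawpoly c)`_a =
  (if a is a'.+1 then (n - a')%:R * (krawpoly c)`_a' else 0) + a.+1%:R * (krawpoly c)`_a.+1.
Proof.
move=> cn an; have := congr1 (fun p : {poly R} => p`_a) (krawpoly_eigen cn).
have -> : n%:R * 'X * krawpoly c - ('X ^+ 2 - 1) * (krawpoly c)^`() =
  (n%:R *: (krawpoly c * 'X)) - (krawpoly c)^`() * 'X^2 + (krawpoly c)^`() :> {poly R}.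
  by rewrite -mul_polyC polyC_natr; ring.
have -> : (2 * c%:R - n%:R) * krawpoly c = (2 * c%:R - n%:R) *: krawpoly c :> {poly R}.
  by rewrite -mul_polyC polyCB polyCM !polyC_natr.
rewrite coefD coefB !coefZ coefMX coefMXn !coef_deriv => <-.
case: a an => [|[|a]] an /=; rewrite ?mulr0 ?sub0r ?oppr0 ?add0r ?mulr_natl //.
  by rewrite addr0 subn0.
by rewrite subn2 /= -mulrnBr ?(ltnW an).
Qed.

Lemma krawpoly_step_coef c a : (c <= n)%N ->
  (n - c)%:R * (krawpoly c.+1)`_a + c%:R * (krawpoly c.-1)`_a = (2 * a%:R - n%:R) * (krawpoly c)`_a.
Proof.
move=> cn; have := congr1 (fun p : {poly R} => p`_a) (krawpoly_step cn).
have -> : (n - c)%:R * krawpoly c.+1 + c%:R * krawpoly c.-1 =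
   (n - c)%:R *: krawpoly c.+1 + c%:R *: krawpoly c.-1 :> {poly R}.
  by rewrite -!mul_polyC !polyC_natr.
have -> : 2 * 'X * (krawpoly c)^`() - n%:R * krawpoly c =
   2 *: ((krawpoly c)^`() * 'X) - n%:R *: krawpoly c :> {poly R}.
  by rewrite -!mul_polyC !polyC_natr; ring.
rewrite coefD coefB !coefZ coefMX coef_deriv => ->.
case: a => [|a]; first by rewrite eqxx; move: (_`_0) => x; ring.
rewrite /= -[(krawpoly c)`_a.+1 *+ a.+1]mulr_natl; move: ((krawpoly c)`_a.+1) (a.+1%:R : R) => x y; ring.
Qed.

Lemma bweight_gt0 a : (a <= n)%N -> 0 < bweight a.
Proof. by move=> an; rewrite sqrtr_gt0 ltr0n bin_gt0. Qed.

Lemma bweight_up a : (a < n)%N ->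
  Num.sqrt ((n%:R - a%:R) * a.+1%:R) * bweight a.+1 = (n - a)%:R * bweight a.
Proof.
move=> an; rewrite /bweight -sqrtrM; last by rewrite mulr_ge0 // subr_ge0 ler_nat ltnW.
rewrite -[(n - a)%:R]ger0_norm // -sqrtr_sqr -sqrtrM ?sqr_ge0 //; congr Num.sqrt.
have := mul_bin_left n a => e.
have := congr1 (fun k => k%:R : R) e; rewrite !natrM => e'.
by rewrite -natrB ?(ltnW an) // -mulrA e'; ring.
Qed.

Lemma bweight_down a : (a < n)%N ->
  Num.sqrt ((n%:R - a%:R) * a.+1%:R) * bweight a = a.+1%:R * bweight a.+1.
Proof.
move=> an; have w1 := bweight_gt0 (ltnW an); have w2 := bweight_gt0 an.
have u := bweight_up an.
have sq : Num.sqrt ((n%:R - a%:R) * a.+1%:R) ^+ 2 = (n - a)%:R * a.+1%:R :> R.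
  by rewrite sqr_sqrtr ?natrB ?(ltnW an) // mulr_ge0 // subr_ge0 ler_nat ltnW.
have na : (n - a)%:R != 0 :> R by rewrite pnatr_eq0 subn_eq0 -ltnNge.
apply: (mulfI na).
have -> : (n - a)%:R * (Num.sqrt ((n%:R - a%:R) * a.+1%:R) * bweight a) =
   Num.sqrt ((n%:R - a%:R) * a.+1%:R) * ((n - a)%:R * bweight a) :> R by ring.
by rewrite -u mulrA -expr2 sq; ring.
Qed.

Definition samp (a : nat) : R := Num.sqrt ((n%:R - a%:R) * a.+1%:R) / 2.

Lemma sum_Sx_row (F : nat -> R) (a : 'I_n.+1) : \sum_d X a d * F d =
  (if (a : nat) is a'.+1 then samp a' * F a' else 0) + (if (a < n)%N then samp a * F a.+1 else 0).
Proof.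
under eq_bigr do rewrite SxlocE -/(samp _) mulrDl; rewrite big_split /=; congr (_ + _).
  case ea : (a : nat) => [|a']; first by rewrite big1 // => d _; rewrite mul0r.
  have ha : (a' < n.+1)%N by have := ltn_ord a; rewrite ea; exact: ltnW.
  rewrite (bigD1 (Ordinal ha)) //= eqxx big1 ?addr0 // => d nd.
  by case: eqP => [[e]|_]; rewrite ?mul0r //; case/eqP: nd; apply: val_inj.
case: ifP => an.
  rewrite (bigD1 (Ordinal (an : (a.+1 < n.+1)%N))) //= eqxx big1 ?addr0 // => d nd.
  by case: eqP => [e|_]; rewrite ?mul0r //; case/eqP: nd; apply: val_inj.
rewrite big1 // => d _; case: eqP => [e|_]; rewrite ?mul0r //.
by have := ltn_ord d; rewrite e ltnS an.
Qed.

Lemma krawpolyE c : krawpoly c = ('X - (-1)%:P) ^+ c * ('X - 1%:P) ^+ (n - c).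
Proof. by rewrite /krawpoly polyCN opprK polyC1 addrC. Qed.

Lemma krawpoly_monic c : krawpoly c \is monic.
Proof. by rewrite krawpolyE rpredM ?rpredX ?monicXsubC. Qed.

Lemma size_krawpoly c : (c <= n)%N -> size (krawpoly c) = n.+1.
Proof.
move=> cn; rewrite krawpolyE size_Mmonic ?rpredX ?monicXsubC //; last first.
  by rewrite expf_neq0 // polyXsubC_eq0.
by rewrite !size_exp_XsubC addSn addnS /= subnKC.
Qed.

(** [krawpoly_eigen] read on coefficients and rescaled by [bweight]: the columns are eigenvectors of
    [S^x]. *)
Lemma kraw_Sz : opmul kraw Z = opmul X kraw.
Proof.
apply/funext => a; apply/funext => c; rewrite /opmul.
have an : (a <= n)%N by rewrite -ltnS.
have cn : (c <= n)%N by rewrite -ltnS.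
have wa := bweight_gt0 an.
rewrite (bigD1 c) //= big1 ?addr0 => [|d dc]; last by rewrite /Szloc (negPf dc) mulr0.
rewrite (sum_Sx_row (fun d => bweight c / bweight d * (krawpoly c)`_d)) /Szloc eqxx /kraw.
have e := krawpoly_eigen_coef cn an.
have -> : bweight c / bweight a * (krawpoly c)`_a * Mval R c =
   bweight c / (2 * bweight a) * ((2 * c%:R - n%:R) * (krawpoly c)`_a).
  by rewrite /Mval /spinS; field; rewrite gt_eqF.
rewrite e mulrDr; congr (_ + _).
  case ea : (a : nat) => [|a']; first by rewrite mulr0.
  have a'n : (a' < n)%N by rewrite -ea.
  have wa' := bweight_gt0 (ltnW a'n); have u := bweight_up a'n; rewrite ea in wa *.
  have -> : (n - a')%:R = 2 * samp a' * bweight a'.+1 / bweight a'.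
    by rewrite /samp [2 * _]mulrC divfK // u mulfK // gt_eqF.
  by field; rewrite !gt_eqF.
case: ltnP => an'; last first.
  rewrite [X in _ * (_ * X)](_ : _ = 0) ?mulr0 // nth_default //.
  by rewrite size_krawpoly.
have wa' := bweight_gt0 an'; have u := bweight_down an'.
have -> : a.+1%:R = 2 * samp a * bweight a / bweight a.+1.
  by rewrite /samp [2 * _]mulrC divfK // u mulfK // gt_eqF.
by field; rewrite !gt_eqF.
Qed.

(** [krawpoly_step] read on coefficients: the self-duality of Krawtchouk polynomials makes the same
    matrix an intertwiner in the other direction. *)
Lemma kraw_Sx : opmul kraw X = opmul Z kraw.
Proof.
apply/funext => a; apply/funext => c; rewrite /opmul.
have an : (a <= n)%N by rewrite -ltnS.
have cn : (c <= n)%N by rewrite -ltnS.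
have wa := bweight_gt0 an; have wc := bweight_gt0 cn.
rewrite [RHS](bigD1 a) //= [X in _ = _ + X]big1 ?addr0 => [|d da]; last first.
  by rewrite /Szloc eq_sym (negPf da) mul0r.
have -> : \sum_z kraw a z * X z c = \sum_z X c z * (bweight z / bweight a * (krawpoly z)`_a).
  by apply: eq_bigr => z _; rewrite mulrC -[X in X * _]/(optrans X c z) Sxloc_sym.
rewrite (sum_Sx_row (fun z => bweight z / bweight a * (krawpoly z)`_a)) /Szloc eqxx /kraw.
have e := krawpoly_step_coef a cn.
have -> : Mval R a * (bweight c / bweight a * (krawpoly c)`_a) =
   bweight c / (2 * bweight a) * ((2 * a%:R - n%:R) * (krawpoly c)`_a).
  by rewrite /Mval /spinS; field; rewrite gt_eqF.
rewrite -e mulrDr addrC; congr (_ + _).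
  case: ltnP => cn'; last first.
    have e0 : (n - c = 0)%N by apply/eqP; rewrite subn_eq0.
    by rewrite e0 mul0r mulr0.
  have wc' := bweight_gt0 cn'; have u := bweight_up cn'.
  have -> : (n - c)%:R = 2 * samp c * bweight c.+1 / bweight c.
    by rewrite /samp [2 * _]mulrC divfK // u mulfK // gt_eqF.
  by field; rewrite !gt_eqF.
case ec : (c : nat) => [|c']; first by rewrite mul0r mulr0.
have c'n : (c' < n)%N by rewrite -ec.
have wc' := bweight_gt0 (ltnW c'n); have u := bweight_down c'n; rewrite ec in wc *.
have -> : c'.+1%:R = 2 * samp c' * bweight c' / bweight c'.+1.
  by rewrite /samp [2 * _]mulrC divfK // u mulfK // gt_eqF.
by rewrite /=; field; rewrite !gt_eqF.
Qed.

(* [kraw^2] commutes with [S^z] and [S^x], hence is a scalar. *)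
Lemma kraw_sq : exists2 k : R, k != 0 & opmul kraw kraw = opscale k opid.
Proof.
set M := opmul kraw kraw.
have MZ : opmul M Z = opmul Z M by rewrite /M -opmulA kraw_Sz opmulA kraw_Sx -opmulA.
have MX : opmul M X = opmul X M by rewrite /M -opmulA kraw_Sx opmulA kraw_Sz -opmulA.
have off a c : a != c -> M a c = 0.
  move=> ac; have := congr1 (fun f => f a c) MZ; rewrite /opmul.
  rewrite (bigD1 c) //= big1 ?addr0 => [|d dc]; last by rewrite /Szloc (negPf dc) mulr0.
  rewrite (bigD1 a) //= big1 ?addr0 => [|d da]; last by rewrite /Szloc eq_sym (negPf da) mul0r.
  rewrite /Szloc !eqxx mulrC => /eqP; rewrite -subr_eq0 -mulrBl mulf_eq0 => /orP[|/eqP //].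
  rewrite /Mval (_ : _ - _ = c%:R - a%:R); last by ring.
  by rewrite subr_eq0 eqr_nat => /eqP e; case/eqP: ac; apply: val_inj.
have diag j (a : 'I_n.+1) : (a : nat) = (n - j)%N -> M a a = M ord_max ord_max.
  elim: j a => [|j IH] a ea; first by have -> : a = ord_max by apply: val_inj; rewrite /= ea subn0.
  have [jn|nj] := ltnP j n; last first.
    by apply: IH; rewrite ea; apply/eqP; rewrite eqn_leq leq_sub2l //= (eqP (_ : n - j == 0)%N) // subn_eq0.
  have e1 : a.+1 = (n - j)%N by rewrite ea subnSK.
  have an : (a < n)%N by rewrite e1 leq_subr.
  have hc : (a.+1 < n.+1)%N by [].
  rewrite -(IH (Ordinal hc) e1); have := congr1 (fun f => f a (Ordinal hc)) MX; rewrite /opmul.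
  rewrite (bigD1 a) //= big1 ?addr0 => [|d da]; last by rewrite (off _ _ _) ?mul0r // eq_sym.
  rewrite (bigD1 (Ordinal hc)) //= big1 ?addr0 => [|d da]; last by rewrite (off _ _ da) mulr0.
  rewrite mulrC; apply: mulfI; rewrite SxlocE /= eqxx ifN ?add0r; last by rewrite neq_ltn ltnS leqnSn.
  rewrite gt_eqF // divr_gt0 // sqrtr_gt0 mulr_gt0 // subr_gt0 ltr_nat //.
exists (M ord_max ord_max).
  (* This corner entry is a sum of non-negative terms, since every [krawpoly c] is monic and
     [krawpoly n] is a power of [1 + X]. *)
  rewrite gt_eqF // /M /opmul.
  apply: lt_le_trans (_ : kraw ord_max ord_max * kraw ord_max ord_max <= _).
    rewrite /kraw /= divff ?gt_eqF ?bweight_gt0 // !mul1r.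
    by have /monicP := krawpoly_monic n; rewrite lead_coefE size_krawpoly // => ->; rewrite mulr1 ltr01.
  rewrite [leRHS](bigD1 ord_max) //= lerDl; apply: sumr_ge0 => c _.
  have cn : (c <= n)%N by rewrite -ltnS.
  have w0 := bweight_gt0 cn; have w1 := bweight_gt0 (leqnn n).
  have -> : kraw ord_max c = bweight c / bweight n.
    rewrite /kraw /=; have /monicP := krawpoly_monic c; rewrite lead_coefE size_krawpoly // => ->.
    by rewrite mulr1.
  rewrite mulr_ge0 //; first by rewrite divr_ge0 // ltW.
  rewrite /kraw mulr_ge0 //; first by rewrite divr_ge0 // ltW.
  rewrite /krawpoly /= subnn expr0 mulr1 exprDn coef_sum sumr_ge0 // => i _.
  by rewrite expr1n mul1r coefMn coefXn mulrn_wge0.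
apply/funext => a; apply/funext => c; rewrite /opscale /opid; have [->|ac] := eqVneq a c; last by rewrite off // mulr0.
by rewrite mulr1; apply: (diag (n - c)%N); rewrite subKn // -ltnS.
Qed.

End Krawtchouk.

(** * Lattice symmetries and homogeneity of the state *)

Section Symmetries.
Context {R : realType}.
Variables (n N : nat).
Hypothesis evN : ~~ odd N.
Notation cf := {ffun site N -> 'I_n.+1}.
Implicit Types (A B : cf -> cf -> R) (b : R).

Definition pullback (tau : site N -> site N) (s : cf) : cf := [ffun r => s (tau r)].

Lemma pullback_bij tau : bijective tau -> bijective (pullback tau).
Proof.
case=> tau' k1 k2; exists (pullback tau') => s; apply/ffunP => r; by rewrite !ffunE ?k1 ?k2.
Qed.

Lemma atpoint_pullback tau (C : 'I_n.+1 -> 'I_n.+1 -> R) r s t : bijective tau ->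
  atpoint C r (pullback tau s) (pullback tau t) = atpoint C (tau r) s t.
Proof.
case=> tau' k1 k2; rewrite /atpoint !ffunE; congr (_ * _%:R); congr nat_of_bool.
apply/forallP/forallP => h q.
  have := h (tau' q); rewrite !ffunE k2; case: (eqVneq (tau' q) r) => [<-|ne] /=; first by rewrite k2 eqxx.
  by move=> ->; rewrite implybT.
have := h (tau q); rewrite !ffunE (inj_eq (can_inj k1)).
by [].
Qed.

Lemma opmul_pullback tau A B A' B' : bijective tau ->
  (forall s t, A (pullback tau s) (pullback tau t) = A' s t) ->
  (forall s t, B (pullback tau s) (pullback tau t) = B' s t) ->
  forall s t, opmul A B (pullback tau s) (pullback tau t) = opmul A' B' s t.
Proof.
move=> bt hA hB s t; rewrite /opmul (reindex (pullback tau)) /=; last exact/onW_bij/pullback_bij.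
by apply: eq_bigr => z _; rewrite hA hB.
Qed.

Lemma optr_pullback tau A A' : bijective tau ->
  (forall s t, A (pullback tau s) (pullback tau t) = A' s t) -> optr A = optr A'.
Proof.
move=> bt hA; rewrite /optr (reindex (pullback tau)) /=; last exact/onW_bij/pullback_bij.
by apply: eq_bigr => z _; rewrite hA.
Qed.

Lemma state_pullback tau A B A' B' : bijective tau ->
  (forall s t, A (pullback tau s) (pullback tau t) = A' s t) ->
  (forall s t, B (pullback tau s) (pullback tau t) = B' s t) ->
  optr (opmul B (opexp A)) = optr (opmul B' (opexp A')).
Proof.
move=> bt hA hB; apply: (optr_pullback bt); apply: opmul_pullback => // s t.
rewrite -opexp_reindex; last exact: pullback_bij.
by have -> : (fun s t => A (pullback tau s) (pullback tau t)) = A' by apply/funext => u; apply/funext => v.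
Qed.

(** [f] permutes the edge types: the identity for reflections, the exchange of x and z for the
    diagonal translation. *)
Lemma pair_energy_pullback tau (loc loc' : bool * bool -> 'I_n.+1 -> 'I_n.+1 -> R) (f : bool * bool -> bool * bool) (k : R) :
  bijective tau -> involutive f -> (forall i, loc i = loc' (f i)) ->
  (forall i r, tau (edge_inv i r) = edge_inv (f i) (tau r)) ->
  forall s t, pair_energy loc (@edge_inv N) k (pullback tau s) (pullback tau t) =
    pair_energy loc' (@edge_inv N) k s t.
Proof.
move=> bt ff hloc hedge s t; rewrite /pair_energy; congr (_ * _).
rewrite [RHS](reindex tau) /=; last exact: onW_bij.
apply: eq_bigr => r _; rewrite [RHS](reindex_inj (inv_inj ff)); apply: eq_bigr => i _.
rewrite (opmul_pullback (A' := atpoint (loc i) (tau r)) (B' := atpoint (loc i) (tau (edge_inv i r))) bt).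
- by rewrite hedge hloc.
- by move=> u v; exact: atpoint_pullback.
- by move=> u v; exact: atpoint_pullback.
Qed.

Definition refl (k : nat) (x : 'I_N) : 'I_N := omod x (k + N - x).

Lemma reflK k : (k < 2 * N)%N -> involutive (refl k).
Proof.
move=> kN x; apply: val_inj => /=; have xN := ltn_ord x; set y := (k + N - x)%N.
have N0 : (0 < N)%N by apply: leq_ltn_trans xN.
have yE : (y + x = k + N)%N by rewrite subnK //; apply: leq_trans (ltnW xN) (leq_addl _ _).
have h : (y %% N + (k + N - y %% N) = k + N)%N.
  by rewrite subnKC //; apply: leq_trans (ltnW (ltn_pmod _ N0)) (leq_addl _ _).
by apply/eqP; rewrite -[X in _ == X](modn_small xN) -(eqn_modDl (y %% N)) h modnDml yE.
Qed.

Lemma nbr_refl p k x : odd k -> nbr p (refl k x) = refl k (nbr p x).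
Proof.
move=> ok; have xN := ltn_ord x; have N0 : (0 < N)%N by apply: leq_ltn_trans xN.
have ox : odd (k + N - x) = ~~ odd x.
  by rewrite oddB ?oddD ?ok ?(negPf evN) //; apply: leq_trans (ltnW xN) (leq_addl _ _).
rewrite {1}/refl nbr_omod // ox /refl /nbr; apply: val_inj => /=.
have [e|ne] := eqVneq (odd x) p.
  have -> : (~~ odd x == p) = false by rewrite e; case: p {e}.
  have zE : (k + N - x + N.-1 + ordS x = k + N %[mod N])%N.
    rewrite val_ordS modnDmr -[X in (X %% _)%N]addnA addnS -addSn prednK // [(N + x)%N]addnC addnA subnK ?modnDr //.
    by apply: leq_trans (ltnW xN) (leq_addl _ _).
  have wE : (k + N - ordS x + ordS x = k + N)%N.
    by rewrite subnK //; apply: leq_trans (ltnW (ltn_ord _)) (leq_addl _ _).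
  by apply/eqP; rewrite -(eqn_modDr (ordS x)) zE wE.
have -> : (~~ odd x == p) = true by move: ne; case: (odd x); case: p.
have wE : (k + N - ord_pred x + ord_pred x = k + N)%N.
  by rewrite subnK //; apply: leq_trans (ltnW (ltn_ord _)) (leq_addl _ _).
apply/eqP; rewrite -(eqn_modDr (ord_pred x)) wE val_ord_pred modnDmr.
rewrite addSn -addnS prednK ?addn_gt0 ?N0 ?orbT // addnA subnK ?modnDr //.
by apply: leq_trans (ltnW xN) (leq_addl _ _).
Qed.

Definition site_refl (d : bool) (k : nat) (r : site N) : site N := mk d (refl k (cd d r)) (cd (~~ d) r).

Lemma site_refl_bij d k : (k < 2 * N)%N -> bijective (site_refl d k).
Proof.
move=> kN; exists (site_refl d k) => r; by rewrite /site_refl cd_mk cdN_mk reflK // mk_cd.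
Qed.

Lemma site_refl_edge d k i r : odd k -> site_refl d k (edge_inv i r) = edge_inv i (site_refl d k r).
Proof.
move=> ok; case: i => d' p; rewrite /site_refl /edge_inv /=.
have [->|nd] := eqVneq d' d; first by rewrite !cd_mk !cdN_mk nbr_refl.
have -> : d' = ~~ d by move: nd; case: d; case: d'.
by rewrite negbK; case: (d).
Qed.

Definition state b B : R := optr (opmul B (opexp (energy (n := n) (N := N) b))).

Lemma state_refl b d k (C : 'I_n.+1 -> 'I_n.+1 -> R) r : (k < 2 * N)%N -> odd k ->
  state b (atpoint C (site_refl d k r)) = state b (atpoint C r).
Proof.
move=> kN ok; have bt := site_refl_bij d kN.
apply/esym; apply: (state_pullback bt) => s t; last exact: atpoint_pullback.
apply: (pair_energy_pullback (f := id)) => // i x; exact: site_refl_edge.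
Qed.

(** Unit translations change edge types, so homogeneity comes from the reflections [x] to [k - x]
    with [k] odd: coordinates of opposite parity are exchanged by [k = x + x'], equal parities go
    through a third coordinate. *)
Lemma state_line b (C : 'I_n.+1 -> 'I_n.+1 -> R) d x x' y :
  state b (atpoint C (mk d x y)) = state b (atpoint C (mk d x' y)).
Proof.
have N0 : (0 < N)%N by exact: leq_ltn_trans (leq0n _) (ltn_ord x).
have diff (u v : 'I_N) : odd u != odd v -> state b (atpoint C (mk d u y)) = state b (atpoint C (mk d v y)).
  move=> uv; have ok : odd (u + v) by rewrite oddD; move: uv; case: (odd u); case: (odd v).
  have kN : (u + v < 2 * N)%N by rewrite mul2n -addnn; apply: leq_trans (_ : u.+1 + v <= _)%N; [rewrite addSn|apply: leq_add => //; exact: ltnW].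
  rewrite -(state_refl b d C (mk d u y) kN ok) /site_refl cd_mk cdN_mk; congr (state b (atpoint C (mk d _ y))).
  apply: val_inj => /=; have -> : (u + v + N - u = v + N)%N by rewrite -addnA addKn.
  by rewrite modnDr modn_small.
have [e|ne] := eqVneq (odd x) (odd x'); last exact: diff.
rewrite (diff x (ordS x)); first rewrite (diff (ordS x) x') //.
  by rewrite val_ordS odd_modN //= e; case: odd.
by rewrite val_ordS odd_modN //=; case: odd.
Qed.

Theorem state_homogeneous b (C : 'I_n.+1 -> 'I_n.+1 -> R) r r' :
  state b (atpoint C r) = state b (atpoint C r').
Proof.
case: r r' => x y [x' y']; rewrite (state_line b C false x x' y : state b (atpoint C (x, y)) = state b (atpoint C (x', y))).
exact: (state_line b C true y y' x').
Qed.

End Symmetries.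

(** * Exchange of the x and z components *)

Section Exchange.
Context {R : realType}.
Variables (n N : nat).
Hypothesis evN : ~~ odd N.
Notation cf := {ffun site N -> 'I_n.+1}.
Notation K := (@kraw R n).
Implicit Types (A B : cf -> cf -> R) (b : R) (C D : 'I_n.+1 -> 'I_n.+1 -> R).

Definition kraw_all : cf -> cf -> R := fun s t => \prod_r K (s r) (t r).

Lemma kraw_all_atpoint C C' r : opmul K C = opmul C' K ->
  opmul kraw_all (atpoint C r) = opmul (atpoint C' r) kraw_all.
Proof.
move=> h; apply/funext => s; apply/funext => t; rewrite opmul_atpoint.
pose P := \prod_(x | x != r) K (s x) (t x) : R.
have -> : \sum_a C' (s r) a * kraw_all (setat s r a) t = opmul C' K (s r) (t r) * P.
  rewrite /opmul mulr_suml; apply: eq_bigr => a _; rewrite -mulrA; congr (_ * _).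
  rewrite /kraw_all (bigD1 r) //= setat_same; congr (_ * _); apply: eq_bigr => x xr.
  by rewrite setat_other.
have -> : opmul kraw_all (atpoint C r) s t = opmul (atpoint (optrans C) r) (optrans kraw_all) t s.
  by rewrite -atpoint_trans -optransM.
rewrite opmul_atpoint -h /opmul mulr_suml; apply: eq_bigr => a _; rewrite /optrans mulrC.
rewrite /kraw_all (bigD1 r) //= setat_same mulrAC; congr (_ * _); apply: eq_bigr => x xr.
by rewrite setat_other.
Qed.

Lemma kraw_all_sq : exists2 k : R, k != 0 & opmul kraw_all kraw_all = opscale k opid.
Proof.
have [k k0 hk] := kraw_sq (R := R) n; exists (k ^+ #|site N|); first by rewrite expf_neq0.
apply/funext => s; apply/funext => t; rewrite /opmul /kraw_all /opscale /opid.
under eq_bigr do rewrite -big_split /=.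
rewrite -(bigA_distr_bigA (fun r z => K (s r) z * K z (t r))).
have e r : \sum_z K (s r) z * K z (t r) = k * (s r == t r)%:R.
  by have := congr1 (fun f => f (s r) (t r)) hk.
rewrite (eq_bigr _ (fun r _ => e r)) big_split /= prodr_const; congr (_ * _).
have [->|ne] := eqVneq s t; first by rewrite big1 // => r _; rewrite eqxx.
have [r nr] : exists r, s r != t r.
  apply/existsP; apply: contraNT ne => /existsPn h; apply/eqP/ffunP => r.
  by have := h r; rewrite negbK => /eqP.
by rewrite (bigD1 r) //= (negPf nr) mul0r.
Qed.

Definition swap (i : bool * bool) : bool * bool := (i.1, ~~ i.2).

Lemma swapK : involutive swap.
Proof. by case=> d p; rewrite /swap /= negbK. Qed.

Definition energy_swapped b : cf -> cf -> R :=
  pair_energy (fun i => spinloc (R := R) (n := n) (swap i)) (@edge_inv N) (b / (2 * spinS R n ^+ 2)).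

Lemma kraw_spinloc i : opmul K (spinloc i) = opmul (spinloc (swap i)) K :> (_ -> _ -> R).
Proof. by case: i => d []; rewrite /spinloc /swap /= ?(kraw_Sz n) ?(kraw_Sx n). Qed.

Lemma kraw_all_energy b : opmul (energy_swapped b) kraw_all = opmul kraw_all (energy (n := n) (N := N) b).
Proof.
set k := b / (2 * spinS R n ^+ 2).
have -> : energy_swapped b = opscale k (fun s t => \sum_r \sum_i
   opmul (atpoint (spinloc (swap i)) r) (atpoint (spinloc (swap i)) (edge_inv i r)) s t) by [].
have -> : energy (n := n) (N := N) b = opscale k (fun s t => \sum_r \sum_i
   opmul (atpoint (spinloc i) r) (atpoint (spinloc i) (edge_inv i r)) s t) by [].
rewrite opmulZl opmulZr; congr (opscale _ _).
rewrite opmul_suml opmul_sumr; apply/funext => s; apply/funext => t; apply: eq_bigr => r _.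
rewrite opmul_suml opmul_sumr; apply: eq_bigr => i _.
have h x := kraw_all_atpoint x (kraw_spinloc i).
by rewrite -opmulA -(h (edge_inv i r)) opmulA -(h r) -opmulA.
Qed.

(** [kraw_all] is not normalized: its square, a nonzero scalar, is inserted under the trace and
    moved by the intertwining relations, in place of an inverse. *)
Lemma state_exchange b B B' : opmul kraw_all B = opmul B' kraw_all ->
  state b B = optr (opmul B' (opexp (energy_swapped b))).
Proof.
move=> hB; have [k k0 hk] := kraw_all_sq; apply: (mulfI k0).
have hE := opexp_commute (kraw_all_energy b).
have tr1 A : k * optr A = optr (opmul A (opmul kraw_all kraw_all)).
  by rewrite hk opmulZr opmul1r /optr /opscale mulr_sumr.
rewrite /state !tr1 opmulA optr_mulC !opmulA hB.
by rewrite -[opmul (opmul B' kraw_all) _]opmulA -hE !opmulA.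
Qed.

(** The translation turns every x-edge into a z-edge and conversely, which undoes the exchange made
    in [energy_swapped]. *)
Definition shift (r : site N) : site N := (ordS r.1, ordS r.2).

Lemma shift_bij : bijective shift.
Proof.
exists (fun r => (ord_pred r.1, ord_pred r.2)) => -[x y]; by rewrite /shift /= ?ordSK ?ord_predK.
Qed.

Lemma nbr_ordS p (x : 'I_N) : nbr (~~ p) (ordS x) = ordS (nbr p x).
Proof.
rewrite /nbr val_ordS odd_modN //=.
have -> : (~~ odd x == ~~ p) = (odd x == p) by case: odd; case: p.
by case: ifP => _ //; rewrite ordSK ord_predK.
Qed.

Lemma shift_edge i r : shift (edge_inv i r) = edge_inv (swap i) (shift r).
Proof. by case: i r => [[] p] [x y]; rewrite /shift /edge_inv /= nbr_ordS. Qed.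

Theorem state_xz b C C' D D' r r' : opmul K C = opmul C' K -> opmul K D = opmul D' K ->
  state b (opmul (atpoint C r) (atpoint D r')) = state b (opmul (atpoint C' (shift r)) (atpoint D' (shift r'))).
Proof.
move=> hC hD; rewrite (@state_exchange b _ (opmul (atpoint C' r) (atpoint D' r'))); last first.
  by rewrite opmulA (kraw_all_atpoint r hC) -opmulA (kraw_all_atpoint r' hD) opmulA.
apply: (state_pullback shift_bij) => s t.
  apply: (pair_energy_pullback (f := swap)) => //; first exact: shift_bij.
    exact: swapK.
  exact: shift_edge.
apply: (opmul_pullback shift_bij) => u v; apply: atpoint_pullback; exact: shift_bij.
Qed.

End Exchange.

(** * The Casimir identity *)

Section Casimir.
Context {R : realType}.
Variable n : nat.
Notation S := (spinS R n).
Notation X := (Sxloc R n).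
Notation Z := (Szloc R n).
Notation T := (iSyloc R n).
Notation P := (Splusloc R n).
Notation M := (Sminusloc R n).
Notation I := 'I_n.+1.
Notation K := (@kraw R n).

Lemma PM_mul (a c : I) : opmul P M a c = (S * (S + 1) - Mval R a * (Mval R a - 1)) * (a == c)%:R.
Proof.
rewrite /opmul /Splusloc /Sminusloc; case ea : (a : nat) => [|a'].
  rewrite big1 => [|d _]; last by rewrite mul0r.
  have -> : S * (S + 1) - Mval R a * (Mval R a - 1) = 0 by rewrite /Mval ea; ring.
  by rewrite mul0r.
have ha : (a' < n.+1)%N by have := ltn_ord a; rewrite ea; exact: ltnW.
rewrite (bigD1 (Ordinal ha)) //= eqxx big1 ?addr0 => [|d nd]; last first.
  by rewrite ifN ?mul0r // eqSS eq_sym; apply: contra nd => /eqP e; apply/eqP/val_inj.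
have [<-|ne] := eqVneq a c; last first.
  by rewrite ifN ?mulr0 //; apply: contra ne => /eqP e; apply/eqP/val_inj; rewrite /= ea e.
rewrite ea eqxx mulr1.
have e1 : Mval R (Ordinal ha) = Mval R a - 1 by rewrite /Mval /= ea -[a'.+1%:R]natr1; ring.
have -> : S * (S + 1) - Mval R (Ordinal ha) * (Mval R (Ordinal ha) + 1) = S * (S + 1) - Mval R a * (Mval R a - 1).
  by rewrite e1; ring.
rewrite -expr2 sqr_sqrtr //.
have -> : S * (S + 1) - Mval R a * (Mval R a - 1) = (S + Mval R a) * (S - Mval R a + 1) by ring.
have /andP[h1 h2] := @Mval_bound R n a.
by rewrite mulr_ge0 //; lra.
Qed.

Lemma MP_mul (a c : I) : opmul M P a c = (S * (S + 1) - Mval R a * (Mval R a + 1)) * (a == c)%:R.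
Proof.
rewrite /opmul /Splusloc /Sminusloc; have [an|na] := ltnP a.+1 n.+1; last first.
  rewrite big1 => [|d _]; last by rewrite ifN ?mul0r //; apply/eqP => e; have := ltn_ord d; rewrite e ltnNge na.
  have -> : S * (S + 1) - Mval R a * (Mval R a + 1) = 0.
    have ea : (a : nat) = n by apply/eqP; rewrite eqn_leq -ltnS ltn_ord -ltnS na.
    by rewrite /Mval ea -S_double; ring.
  by rewrite mul0r.
rewrite (bigD1 (Ordinal an)) //= eqxx big1 ?addr0 => [|d nd]; last first.
  by rewrite ifN ?mul0r //; apply: contra nd => /eqP e; apply/eqP/val_inj.
have [<-|ne] := eqVneq a c; last first.
  by rewrite ifN ?mulr0 // eqSS; apply: contra ne => /eqP e; apply/eqP/val_inj.
rewrite eqxx mulr1.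
have e1 : Mval R (Ordinal an) = Mval R a + 1 by rewrite /Mval /= -[a.+1%:R]natr1; ring.
have -> : S * (S + 1) - Mval R (Ordinal an) * (Mval R (Ordinal an) - 1) = S * (S + 1) - Mval R a * (Mval R a + 1).
  by rewrite e1; ring.
rewrite -expr2 sqr_sqrtr //.
have -> : S * (S + 1) - Mval R a * (Mval R a + 1) = (S - Mval R a) * (S + Mval R a + 1) by ring.
have /andP[h1 h2] := @Mval_bound R n a.
by rewrite mulr_ge0 //; lra.
Qed.

Definition X2 : I -> I -> R := opmul X X.
Definition Z2 : I -> I -> R := opmul Z Z.
Definition Y2 : I -> I -> R := opscale (-1) (opmul T T).

Lemma Z2E (a c : I) : Z2 a c = Mval R a ^+ 2 * (a == c)%:R.
Proof.
rewrite /Z2 /opmul (bigD1 a) //= big1 ?addr0 => [|d da]; last by rewrite /Szloc eq_sym (negPf da) mul0r.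
by rewrite /Szloc eqxx; case: eqP => [->|_]; rewrite ?mulr1 ?mulr0 // expr2.
Qed.

Lemma casimir : opadd X2 (opadd Y2 Z2) = opscale (S * (S + 1)) opid.
Proof.
apply/funext => a; apply/funext => c; rewrite /opadd.
have -> : X2 a c + (Y2 a c + Z2 a c) = 2^-1 * (opmul P M a c + opmul M P a c) + Z2 a c.
  rewrite /X2 /Y2 /opscale /opmul addrA; congr (_ + _); rewrite mulrDr !mulr_sumr -!big_split.
  apply: eq_bigr => d _ /=; rewrite /Sxloc /iSyloc /opscale /opadd; by field.
rewrite PM_mul MP_mul Z2E /opscale /opid; by field.
Qed.

Lemma iSyloc_skew : optrans T = opscale (-1) T.
Proof.
apply/funext => a; apply/funext => c; rewrite /optrans /iSyloc /opscale /opadd.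
have -> : Splusloc R n c a = M a c.
  rewrite /Splusloc /Sminusloc; case: eqP => // e; congr Num.sqrt; rewrite /Mval e -natr1; ring.
have -> : Sminusloc R n c a = P a c.
  rewrite /Splusloc /Sminusloc; case: eqP => // e; congr Num.sqrt; rewrite /Mval e -natr1; ring.
ring.
Qed.

Lemma Z2_sym : optrans Z2 = Z2. Proof. by rewrite /Z2 optransM Szloc_sym. Qed.
Lemma Y2_gram : Y2 = opmul (optrans T) T.
Proof. by rewrite iSyloc_skew opmulZl. Qed.
Lemma Y2_sym : optrans Y2 = Y2.
Proof. by rewrite Y2_gram optransM; congr (opmul _ _); apply/funext => a; apply/funext => c. Qed.

Lemma kraw_X2 : opmul K X2 = opmul Z2 K.
Proof. by rewrite /X2 /Z2 opmulA (kraw_Sx n) -opmulA (kraw_Sx n) opmulA. Qed.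

(** The Gram operators on the left have non-negative Gibbs means, so the fourth moment of [S^y] is
    controlled by the second. *)
Lemma Y4_gram : opadd (opmul (optrans (opmul X T)) (opmul X T)) (opmul (optrans (opmul Z T)) (opmul Z T)) =
  opadd (opscale (S * (S + 1)) Y2) (opscale (-1) (opmul Y2 Y2)).
Proof.
have e (B : I -> I -> R) : optrans B = B -> opmul (optrans (opmul B T)) (opmul B T) = opmul (optrans T) (opmul (opmul B B) T).
  by move=> sB; rewrite optransM sB -!opmulA.
rewrite (e _ (Sxloc_sym n)) (e _ (Szloc_sym n)) -opmulDr -opmulDl.
have -> : opadd (opmul X X) (opmul Z Z) = opadd (opscale (S * (S + 1)) opid) (opscale (-1) Y2).
  rewrite -casimir; apply/funext => a; apply/funext => c; rewrite /opadd /opscale -/X2 -/Z2; ring.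
have f (U V W : I -> I -> R) k : opmul U (opmul (opadd (opscale k opid) (opscale (-1) V)) W) =
    opadd (opscale k (opmul U W)) (opscale (-1) (opmul U (opmul V W))).
  by rewrite opmulDl opmulDr !opmulZl !opmulZr opmul1l.
rewrite f -Y2_gram; congr (opadd _ (opscale _ _)).
have g (U V : I -> I -> R) : opmul U (opmul (opscale (-1) (opmul V V)) V) = opmul (opmul U V) (opscale (-1) (opmul V V)).
  by rewrite opmulZl !opmulZr -!opmulA.
by rewrite {2}Y2_gram; exact: g.
Qed.

End Casimir.

(** * Estimates in the Gibbs state *)

Section GibbsState.
Context {R : realType}.
Variables (n N : nat) (b : R) (r0 : site N).
Hypothesis evN : ~~ odd N.
Hypothesis n0 : (0 < n)%N.
Notation cf := {ffun site N -> 'I_n.+1}.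
Notation S := (spinS R n).
Notation Z := (optr (opexp (energy (n := n) (N := N) b))).
Notation x2 := (atpoint (@X2 R n)).
Notation y2 := (atpoint (@Y2 R n)).
Notation z2 := (atpoint (@Z2 R n)).
Implicit Types (A B C : cf -> cf -> R) (D : 'I_n.+1 -> 'I_n.+1 -> R).

Definition mean B : R := state b B / Z.

Lemma partition_gt0 : 0 < Z.
Proof. exact: (optr_exp_gt0 [ffun=> ord0]) (energy_sym n evN b). Qed.

Lemma meanD A B : mean (opadd A B) = mean A + mean B.
Proof. by rewrite /mean /state opmulDl -mulrDl /optr /opadd big_split. Qed.

Lemma meanZ a A : mean (opscale a A) = a * mean A.
Proof. by rewrite /mean /state opmulZl mulrA /optr /opscale -mulr_sumr. Qed.

Lemma mean1 : mean opid = 1.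
Proof. by rewrite /mean /state opmul1l divff // gt_eqF // partition_gt0. Qed.

Lemma mean_sum (I : finType) (F : I -> cf -> cf -> R) :
  mean (fun s t => \sum_i F i s t) = \sum_i mean (F i).
Proof.
by rewrite /mean /state opmul_suml /optr exchange_big /= mulr_suml.
Qed.

Lemma mean_gram_ge0 B : 0 <= mean (opmul (optrans B) B).
Proof.
by rewrite /mean /state divr_ge0 ?(weight_gram_ge0 _ (energy_sym n evN b)) // ltW // partition_gt0.
Qed.

Lemma mean_cs B C : mean (opmul (optrans B) C) ^+ 2 <= mean (opmul (optrans B) B) * mean (opmul (optrans C) C).
Proof.
rewrite /mean /state mulrACA -expr2 exprMn.
by rewrite ler_wpM2r ?sqr_ge0 // weight_cs // energy_sym.
Qed.

Lemma mean_homogeneous D r r' : mean (atpoint D r) = mean (atpoint D r').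
Proof. exact: (congr1 (fun x => x / Z) (state_homogeneous evN b D r r')). Qed.

Lemma mean_exchange D D' r r' : opmul (@kraw R n) D = opmul D' (@kraw R n) ->
  mean (atpoint D r) = mean (atpoint D' r').
Proof.
move=> h; have := state_xz evN b r r h (etrans (opmul1r _) (esym (opmul1l _))).
rewrite !atpoint_id !opmul1r => e; rewrite -(mean_homogeneous D' (shift r) r').
exact: (congr1 (fun x => x / Z) e).
Qed.

Lemma mean_X2 r r' : mean (x2 r) = mean (z2 r').
Proof. exact: mean_exchange (kraw_X2 n). Qed.

Lemma mean_X2X2 r r' : mean (opmul (x2 r) (x2 r')) =
  mean (opmul (z2 (shift r)) (z2 (shift r'))).
Proof. exact: (congr1 (fun x => x / Z) (state_xz evN b r r' (kraw_X2 n) (kraw_X2 n))). Qed.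

Lemma atpoint_Z2 r (s t : cf) : z2 r s t = Mval R (s r) ^+ 2 * (s == t)%:R.
Proof.
rewrite /Z2 -atpoint_mul /opmul (bigD1 s) //= big1 ?addr0 => [|u us].
  by rewrite !atpoint_Sz eqxx mulr1 mulrA expr2.
by rewrite !atpoint_Sz eq_sym (negPf us) mulr0 mul0r.
Qed.

Lemma state_diag (f : cf -> R) B : (forall s t, B s t = f s * (s == t)%:R) ->
  state b B = \sum_s f s * opexp (energy b) s s.
Proof.
move=> h; rewrite /state /optr; apply: eq_bigr => s _; rewrite /opmul (bigD1 s) //= big1 ?addr0 => [|u us].
  by rewrite h eqxx mulr1.
by rewrite h eq_sym (negPf us) mulr0 mul0r.
Qed.

Lemma Mval_mz a : Mval R (n := n) a = S * mz a.
Proof. by rewrite /mz mulrC divfK // gt_eqF // S_gt0. Qed.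

Lemma mean_Z2E r : mean (z2 r) = S ^+ 2 * ((\sum_(s : cf) mz (s r) ^+ 2 * opexp (energy b) s s) / Z).
Proof.
rewrite /mean (state_diag (atpoint_Z2 r)) mulrA mulr_sumr; congr (_ / _); apply: eq_bigr => s _.
by rewrite Mval_mz exprMn mulrA.
Qed.

Lemma mean_Z2Z2E r r' : mean (opmul (z2 r) (z2 r')) =
  S ^+ 4 * ((\sum_(s : cf) mz (s r) ^+ 2 * mz (s r') ^+ 2 * opexp (energy b) s s) / Z).
Proof.
have h s t : opmul (z2 r) (z2 r') s t = Mval R (s r) ^+ 2 * Mval R (s r') ^+ 2 * (s == t)%:R.
  rewrite /opmul (bigD1 s) //= big1 ?addr0 => [|u us]; first by rewrite !atpoint_Z2 eqxx mulr1 mulrA.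
  by rewrite !atpoint_Z2 eq_sym (negPf us) mulr0 mul0r.
rewrite /mean (state_diag h) mulrA mulr_sumr; congr (_ / _); apply: eq_bigr => s _.
by rewrite !Mval_mz; ring.
Qed.

Lemma spinloc_sq i : opmul (spinloc i) (spinloc i) = if i.2 then @Z2 R n else @X2 R n.
Proof. by rewrite /spinloc; case: i.2. Qed.

Notation pz := (mean (z2 r0)).
Notation py := (mean (y2 r0)).

Lemma mean_casimir : 2 * pz + py = S * (S + 1).
Proof.
have := mean_X2 r0 r0; have := casimir (R := R) n; move: (@X2 R n) (@Y2 R n) (@Z2 R n) => C E D h e.
have := congr1 (fun F => mean (atpoint F r0)) h.
by rewrite !atpointD atpointZ atpoint_id meanZ mean1 !meanD e mulr1 => <-; ring.
Qed.

Lemma mean_site_gram_ge0 D r : 0 <= mean (atpoint (opmul (optrans D) D) r).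
Proof. by rewrite -atpoint_mul -atpoint_trans mean_gram_ge0. Qed.

Lemma mean_Y2_ge0 : 0 <= py.
Proof.
have := Y2_gram (R := R) n; move: (@Y2 R n) (iSyloc R n) => E D ->; exact: mean_site_gram_ge0.
Qed.

Lemma mean_Y4_le r : mean (opmul (y2 r) (y2 r)) <= S * (S + 1) * py.
Proof.
have := Y4_gram (R := R) n; move: (@Y2 R n) (opmul _ (iSyloc R n)) (opmul _ (iSyloc R n)) => E D D' h.
have := congr1 (fun F => mean (atpoint F r)) h.
rewrite !atpointD !atpointZ !meanD !meanZ -(mean_homogeneous E r0 r) atpoint_mul => e.
by have := addr_ge0 (mean_site_gram_ge0 D' r) (mean_site_gram_ge0 D r); rewrite e mulN1r subr_ge0.
Qed.

Lemma mean_mul_le A B : optrans A = A -> optrans B = B -> opmul A B = opmul B A ->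
  2 * mean (opmul A B) <= mean (opmul A A) + mean (opmul B B).
Proof.
move=> sA sB AB; have := mean_gram_ge0 (opadd A (opscale (-1) B)).
have -> : optrans (opadd A (opscale (-1) B)) = opadd A (opscale (-1) B) by rewrite -[in RHS]sA -[in RHS]sB.
rewrite opmulDl !opmulDr !opmulZl !opmulZr -AB.
by rewrite !meanD !meanZ; lra.
Qed.

Lemma mean_pair_le D r r' : optrans D = D -> r != r' ->
  2 * mean (opmul (atpoint D r) (atpoint D r')) <= mean (atpoint (opmul D D) r) + mean (atpoint (opmul D D) r').
Proof.
move=> sD rr'; rewrite -!atpoint_mul; apply: mean_mul_le; last exact: atpoint_comm.
- by rewrite atpoint_trans sD.
- by rewrite atpoint_trans sD.
Qed.

(** Each edge term is at most the average of two squared components, all of mean [pz] by homogeneity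
    and exchange; the Casimir identity rewrites [2 pz]. *)
Lemma mean_energy_le : 0 <= b -> mean (energy b) <= b * (S * (S + 1) - py) / S ^+ 2 * (N ^ 2)%:R.
Proof.
move=> b0; have s0 := S_gt0 (R := R) n0.
have -> : energy (n := n) (N := N) b = opscale (b / (2 * S ^+ 2)) (fun s t => \sum_r (fun s t => \sum_i
   opmul (atpoint (spinloc i) r) (atpoint (spinloc i) (edge_inv i r)) s t) s t) by [].
rewrite meanZ mean_sum.
have h r : mean (fun s t => \sum_i opmul (atpoint (spinloc i) r) (atpoint (spinloc i) (edge_inv i r)) s t) <= pz *+ 4.
  rewrite (mean_sum (fun i => opmul (atpoint (spinloc i) r) (atpoint (spinloc i) (edge_inv i r)))).
  have -> : pz *+ 4 = \sum_(i : bool * bool) pz by rewrite sumr_const card_prod card_bool.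
  apply: ler_sum => i _.
  have sp : optrans (spinloc (R := R) (n := n) i) = spinloc i.
    by rewrite /spinloc; case: i.2; rewrite ?(Sxloc_sym n) ?(Szloc_sym n).
  have rr : r != edge_inv i r by rewrite eq_sym inv_neq.
  have sq q : mean (atpoint (opmul (spinloc i) (spinloc i)) q) = pz.
    by rewrite spinloc_sq; case: i.2; [exact: mean_homogeneous | exact: mean_X2].
  have := mean_pair_le sp rr; rewrite [X in _ <= X + _]sq [X in _ <= _ + X]sq.
  move: (mean _) pz => x y; lra.
apply: le_trans (_ : b / (2 * S ^+ 2) * \sum_(r : site N) (pz *+ 4) <= _).
  by rewrite ler_wpM2l ?ler_sum // divr_ge0 // mulr_ge0 // sqr_ge0.
rewrite sumr_const card_prod card_ord -mean_casimir addrK mulnn -[X in _ * X <= _]mulr_natr -[pz *+ 4]mulr_natr.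
move: (N ^ 2)%N pz => k p; rewrite le_eqVlt; apply/orP; left; apply/eqP.
by move: (k%:R : R) => x; field; rewrite gt_eqF.
Qed.

(** The lower and the entropy bound are both powers [N ^ 2]. After taking roots [S] and [exp b]
    cancel; [n + 1 <= 4 S] gives the 4 and [b / S <= 1] turns 17 into 18. *)
Lemma mean_Y2_exp_le : 100 <= b -> b <= S ->
  (expR (b - 17) * (S / (128 * b))) ^+ (N ^ 2) <= Z -> expR (b * (py / S ^+ 2)) <= 4 * 128 * b * expR 18.
Proof.
move=> b100 bS low; have s0 := S_gt0 (R := R) n0; have b0 : 0 < b by lra.
have N0 : (0 < N ^ 2)%N by rewrite expn_gt0 (leq_ltn_trans (leq0n _) (ltn_ord r0.1)).
have c0 : (0 < #|conf n N|)%N by apply/card_gt0P; exists [ffun=> ord0].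
have := trace_exp_le (energy_sym n evN b) c0.
rewrite -[optr (opmul _ _) / _]/(mean (energy b)) => up.
have cE : #|conf n N| = (n.+1 ^ (N ^ 2))%N by rewrite card_ffun card_ord card_prod card_ord mulnn.
set e := b * (S * (S + 1) - py) / S ^+ 2.
have : (expR (b - 17) * (S / (128 * b))) ^+ (N ^ 2) <= (n.+1%:R * expR e) ^+ (N ^ 2).
  apply: le_trans low (le_trans up _); rewrite exprMn cE natrX ler_wpM2l ?exprn_ge0 //.
  rewrite -expRM_natr ler_expR; exact: mean_energy_le (ltW b0).
have L0 : 0 <= expR (b - 17) * (S / (128 * b)).
  by rewrite mulr_ge0 ?expR_ge0 // divr_ge0 ?(ltW s0) // mulr_ge0 // ltW.
have E0 : 0 <= n.+1%:R * expR e by rewrite mulr_ge0 ?expR_ge0.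
rewrite ler_pXn2r ?nnegrE // => key.
have n1 : n.+1%:R <= 4 * S.
  rewrite -natr1; have := S_double (R := R) n; have : 1 <= n%:R :> R by rewrite ler1n.
  lra.
have eE : e = b + b / S - b * (py / S ^+ 2) by rewrite /e; field; rewrite gt_eqF.
have bS1 : b / S <= 1 by rewrite ler_pdivrMr // mul1r.
have key2 : expR (b - 17) * (S / (128 * b)) <= 4 * S * (expR (b + 1) * expR (- (b * (py / S ^+ 2)))).
  apply: le_trans key _; apply: ler_pM; [exact: ler0n | exact: expR_ge0 | exact: n1 |].
  by rewrite -expRD ler_expR eE; lra.
have -> : expR (b * (py / S ^+ 2)) = (4 * 128 * b / S) * expR (- (b + 1) + 18) * expR (b * (py / S ^+ 2)) * (expR (b - 17) * (S / (128 * b))) / 4.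
  have : expR (- (b + 1) + 18) * expR (b - 17) = 1 by rewrite -expRD (_ : _ + _ = 0) ?expR0 //; ring.
  move: (expR (- (b + 1) + 18)) (expR (b - 17)) (expR (b * (py / S ^+ 2))) => x y z xy.
  have -> : 4 * 128 * b / S * x * z * (y * (S / (128 * b))) / 4 = x * y * z by field; rewrite !gt_eqF.
  by rewrite xy mul1r.
apply: le_trans (_ : (4 * 128 * b / S) * expR (- (b + 1) + 18) * expR (b * (py / S ^+ 2)) *
   (4 * S * (expR (b + 1) * expR (- (b * (py / S ^+ 2))))) / 4 <= _).
  rewrite ler_wpM2r ?invr_ge0 //; apply: ler_wpM2l => //.
  by rewrite !mulr_ge0 ?expR_ge0 ?invr_ge0 ?(ltW s0) ?(ltW b0).
rewrite [expR (- (b + 1) + 18)]expRD !expRN; move: (expR_gt0 (b + 1)) (expR_gt0 (b * (py / S ^+ 2))).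
move: (expR (b + 1)) (expR (b * _)) (expR 18) (4 * 128 : R) => x y z w x0 y0.
by rewrite le_eqVlt; apply/orP; left; apply/eqP; field; rewrite !gt_eqF.
Qed.

Lemma mean_Z2_le r : mean (z2 r) <= S ^+ 2.
Proof.
rewrite mean_Z2E ler_piMr ?sqr_ge0 // ler_pdivrMr ?partition_gt0 // mul1r; apply: ler_sum => s _.
by rewrite ler_piMl ?mz_sq_le1 // ltW // exp_energy_gt0.
Qed.

Lemma mean_Z2_ge0 r : 0 <= mean (z2 r).
Proof.
rewrite mean_Z2E mulr_ge0 ?sqr_ge0 // divr_ge0 ?(ltW partition_gt0) // sumr_ge0 // => s _.
by rewrite mulr_ge0 ?sqr_ge0 // ltW // exp_energy_gt0.
Qed.

Lemma mean_Z2Z2_le r r' : mean (opmul (z2 r) (z2 r')) <= S ^+ 2 * pz.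
Proof.
rewrite (mean_homogeneous _ r0 r) mean_Z2E mean_Z2Z2E [leRHS]mulrA -exprD ler_wpM2l //.
  by rewrite exprn_ge0 // ltW // S_gt0.
rewrite ler_wpM2r ?invr_ge0 ?(ltW partition_gt0) //; apply: ler_sum => s _.
rewrite ler_wpM2r ?(ltW (exp_energy_gt0 _ _ _)) //.
by rewrite ler_piMr ?sqr_ge0 ?mz_sq_le1.
Qed.

(** Outside three exceptional events both [|m|] are near 0 or both near 1: in the first case
    [m_a ^ 2] itself is small, in the second [m_c ^ 2 >= 1 - 2 kappa]. *)
Lemma sq_sq_ge (kappa : R) (a c : 'I_n.+1) : 0 < kappa -> kappa <= 16^-1 ->
  mz a ^+ 2 - 2 * kappa - (intermediate kappa a)%:R - (intermediate kappa c)%:R -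
    ((`|mz a : R| < 2^-1) != (`|mz c : R| < 2^-1))%:R <= mz a ^+ 2 * mz c ^+ 2.
Proof.
move=> k0 k16; rewrite -[mz a ^+ 2]real_normK ?num_real // -[mz c ^+ 2]real_normK ?num_real //.
have h (d : 'I_n.+1) : `|mz d : R| ^+ 2 <= 1 by rewrite real_normK ?num_real // mz_sq_le1.
have := h a; have := h c; rewrite /intermediate.
move: (normr_ge0 (mz a : R)) (normr_ge0 (mz c : R)); move: `|mz a| `|mz c| => x y x0 y0 y1 x1.
have P : 0 <= x ^+ 2 * y ^+ 2 by rewrite mulr_ge0 ?sqr_ge0.
have [ia|] := boolP (kappa < x < 1 - kappa).
  have := ler0n R (nat_of_bool (kappa < y < 1 - kappa)%R); have := ler0n R (nat_of_bool ((x < 2^-1) != (y < 2^-1))%R); rewrite /=; lra.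
rewrite negb_and -!leNgt /= => hx.
have [ic|] := boolP (kappa < y < 1 - kappa).
  have := ler0n R (nat_of_bool ((x < 2^-1) != (y < 2^-1))%R); rewrite /=; lra.
rewrite negb_and -!leNgt /= => hy.
case: (ltP x 2^-1) => xs; case: (ltP y 2^-1) => ys /=; try lra.
  have {}hx : x <= kappa by case/orP: hx => // hx; lra.
  have : x ^+ 2 <= kappa ^+ 2 by rewrite lerXn2r ?nnegrE // ltW.
  have : kappa ^+ 2 <= kappa by rewrite expr2 ler_piMl ?(ltW k0) //; lra.
  lra.
have {}hy : 1 - kappa <= y by case/orP: hy => // hy; lra.
have y2 : (1 - kappa) ^+ 2 <= y ^+ 2 by rewrite lerXn2r ?nnegrE //; lra.
have y3 : 1 - 2 * kappa <= (1 - kappa) ^+ 2 by have := sqr_ge0 kappa; rewrite sqrrB expr1n mul1r -mulr_natl; lra.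
have : x ^+ 2 * (1 - 2 * kappa) <= x ^+ 2 * y ^+ 2 by rewrite ler_wpM2l ?sqr_ge0 //; lra.
have : x ^+ 2 * kappa <= kappa by rewrite ler_piMl // ltW.
lra.
Qed.

Lemma mean_Z2Z2_ge (kappa p e : R) r r' : 0 < kappa -> kappa <= 16^-1 ->
  (forall q, weight b (fun s : cf => intermediate kappa (s q)) <= p * Z) ->
  weight b (fun s : cf => small (R := R) s r != small (R := R) s r') <= e * Z ->
  S ^+ 2 * pz - S ^+ 4 * (2 * kappa + 2 * p + e) <= mean (opmul (z2 r) (z2 r')).
Proof.
move=> k0 k16 hp he; have Z0 := partition_gt0.
rewrite (mean_homogeneous _ r0 r) mean_Z2E mean_Z2Z2E mulrA -exprD -mulrBr ler_wpM2l //.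
  by rewrite exprn_ge0 // ltW // S_gt0.
rewrite ler_pdivlMr // mulrBl divfK ?gt_eqF //.
pose W (s : cf) : R := opexp (energy b) s s.
have wE (ev : pred cf) : \sum_s (ev s)%:R * W s = weight b ev.
  rewrite /weight [RHS]big_mkcond; apply: eq_bigr => s _; by case: ifP; rewrite ?mul1r ?mul0r.
have ZE : \sum_s W s = Z by [].
have key : \sum_(s : cf) mz (s r) ^+ 2 * W s - (2 * kappa) * \sum_s W s -
   weight b (fun s : cf => intermediate kappa (s r)) - weight b (fun s : cf => intermediate kappa (s r'))
   - weight b (fun s : cf => small (R := R) s r != small (R := R) s r') <= \sum_(s : cf) mz (s r) ^+ 2 * mz (s r') ^+ 2 * W s.
  rewrite -!wE mulr_sumr -!sumrB; apply: ler_sum => s _; rewrite -!mulrBl ler_wpM2r //.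
    exact: ltW (exp_energy_gt0 _ _ _).
  exact: sq_sq_ge.
apply: le_trans key; rewrite ZE; move: (hp r) (hp r') he; rewrite -/(W _); lra.
Qed.

Lemma mean_Y2Y2_le r r' : mean (opmul (y2 r) (y2 r')) <= S * (S + 1) * py.
Proof.
have Y0 : 0 <= S * (S + 1) * py.
  have s0 := S_gt0 (R := R) n0; apply: mulr_ge0 mean_Y2_ge0; apply: mulr_ge0; lra.
have sY q : optrans (y2 q) = y2 q :> (cf -> cf -> R) by rewrite atpoint_trans Y2_sym.
have g q : 0 <= mean (opmul (y2 q) (y2 q)) by have := mean_gram_ge0 (y2 q); rewrite sY.
have := mean_cs (y2 r) (y2 r'); rewrite sY sY => cs.
have {}cs := le_trans cs (ler_pM (g r) (g r') (mean_Y4_le r) (mean_Y4_le r')).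
move: cs Y0; move: (mean (opmul _ _)) (S * (S + 1) * py) => x y; rewrite -expr2 => cs y0.
by rewrite leNgt; apply/negP => lt; move: cs; apply/negP; rewrite -ltNge ltrXn2r ?nnegrE // ltW // (le_lt_trans y0).
Qed.

Lemma mean_Y2Z2_sq_le r r' : mean (opmul (y2 r) (z2 r')) ^+ 2 <= S * (S + 1) * py * S ^+ 4.
Proof.
have sY q : optrans (y2 q) = y2 q :> (cf -> cf -> R) by rewrite atpoint_trans Y2_sym.
have sZ q : optrans (z2 q) = z2 q :> (cf -> cf -> R) by rewrite atpoint_trans Z2_sym.
have := mean_cs (y2 r) (z2 r'); rewrite sY sZ => cs.
apply: le_trans cs _; apply: ler_pM.
- by have := mean_gram_ge0 (y2 r); rewrite sY.
- by have := mean_gram_ge0 (z2 r'); rewrite sZ.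
- exact: mean_Y4_le.
apply: le_trans (mean_Z2Z2_le r' r') _.
by rewrite (_ : S ^+ 4 = S ^+ 2 * S ^+ 2) ?ler_wpM2l ?sqr_ge0 ?mean_Z2_le // -exprD.
Qed.

(** The Casimir identity at [r] expresses the mixed correlation by quantities already controlled; it
    also covers [r = r'], where the factors do not commute. *)
Lemma mean_X2Z2E r r' : mean (opmul (x2 r) (z2 r')) =
  S * (S + 1) * pz - mean (opmul (y2 r) (z2 r')) - mean (opmul (z2 r) (z2 r')).
Proof.
have := congr1 (fun D => mean (opmul (atpoint D r) (z2 r'))) (casimir n).
rewrite !atpointD atpointZ atpoint_id opmulZl opmul1l !opmulDl meanZ !meanD -(mean_homogeneous _ r0 r') => <-.
ring.
Qed.

End GibbsState.

(** * Final numerical estimates *)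

Section Estimates.
Context {R : realType}.

(* The energy of the Gibbs state is at most [b (1 + 1 / S - y)] per site, [y] being the mean of
   [(S^y / S)^2]; comparing the entropy bound for the partition function with its lower bound
   gives [exp (b y) = O(b)]. *)
Lemma mean_Y2_small (d : R) : 0 < d -> exists B : R, forall (b : R) n N (r : site N),
  B <= b -> 100 <= b -> ~~ odd N -> (0 < n)%N -> b <= spinS R n ->
  (expR (b - 17) * (spinS R n / (128 * b))) ^+ (N ^ 2) <= optr (opexp (energy (n := n) (N := N) b)) ->
  mean b (atpoint (@Y2 R n) r) <= d * spinS R n ^+ 2.
Proof.
move=> d0; have M0 : 0 <= 2 * (4 * 128 * expR 18) :> R.
  by apply: mulr_ge0 => //; apply: mulr_ge0 (expR_ge0 _); apply: mulr_ge0.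
have [B hB] := exp_beats_linear M0 d0.
exists B => b n N r bB b100 evN n0 bS low; have b0 : 0 < b by lra.
have s0 := S_gt0 (R := R) n0.
rewrite -ler_pdivrMr ?exprn_gt0 // leNgt; apply/negP => lt.
have h1 := mean_Y2_exp_le r evN n0 b100 bS low.
have h2 := hB b bB b0; move: h1 h2 lt.
move: (_ / spinS R n ^+ 2) => y h1 h2 lt.
have h3 : expR (b * d) <= 4 * 128 * b * expR 18.
  by apply: le_trans h1; rewrite ler_expR ler_wpM2l ?(ltW b0) // ltW.
have e0 := expR_gt0 (b * d).
have : 2 * (4 * 128 * expR 18) * b <= expR (b * d).
  by rewrite -[leRHS]mul1r -ler_pdivrMr // -expRN.
have : 0 < 4 * 128 * b * expR 18 by rewrite !mulr_gt0 ?expR_gt0.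
rewrite (_ : 2 * (4 * 128 * expR 18) * b = 2 * (4 * 128 * b * expR 18)); last by ring.
by move: h3; move: (4 * 128 * b * expR 18) (expR (b * d)) => w z; lra.
Qed.

(* In units [S = 1]: [p], [y] are the means of [(S^z)^2], [(S^y)^2], [i] is [1 / S], and [w], [v], [g]
   are the two-point functions of [zz], [yy], [yz]. *)
Lemma correlation_bounds (delta p y i e w v g : R) : 0 < delta -> 0 <= i -> i <= delta / 4 -> i <= 1 ->
  0 <= y -> y <= delta / 8 -> y <= delta ^+ 2 / 32 ->
  2 * p + y = 1 + i -> 0 <= p -> p <= 1 -> e <= delta / 4 -> p - e <= w -> w <= p -> v <= (1 + i) * y ->
  g ^+ 2 <= (1 + i) * y ->
  [/\ 1 / 2 - delta <= w, v < delta & `|(1 + i) * p - g - w| < delta].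
Proof.
move=> d0 i0 id i1 y0 y8 y32 py p0 p1 e4 we wp v1 g2.
have iy : (1 + i) * y <= 2 * y by rewrite ler_wpM2r //; lra.
split; [lra | lra |].
have : `|g| <= delta / 4.
  rewrite -(@ler_pXn2r _ 2) ?nnegrE ?divr_ge0 ?(ltW d0) // real_normK ?num_real //.
  by apply: le_trans g2 _; apply: le_trans iy _; rewrite expr_div_n; lra.
rewrite ler_norml => /andP[g1 g3].
have ip : i * p <= i by rewrite ler_piMr.
have ip0 : 0 <= i * p by rewrite mulr_ge0.
by rewrite ltr_norml mulrDl mul1r; apply/andP; split; lra.
Qed.

End Estimates.

(** * Translation into the notions of the statement and conclusion *)

Section SquaredSpins.
Context {R : realType}.
Variables (n N : nat).

Lemma Sx2E (r : site N) : Sx2 R n r = atpoint (@X2 R n) r.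
Proof. exact: (atpoint_mul (Sxloc R n) (Sxloc R n) r). Qed.

Lemma Sz2E (r : site N) : Sz2 R n r = atpoint (@Z2 R n) r.
Proof. exact: (atpoint_mul (Szloc R n) (Szloc R n) r). Qed.

Lemma Sy2E (r : site N) : Sy2 R n r = atpoint (@Y2 R n) r.
Proof.
rewrite /Y2 atpointZ -atpoint_mul; exact: erefl.
Qed.

Lemma gibbsE (J beta : R) A : ~~ odd N -> gibbs J J beta A = mean (n := n) (N := N) (beta * J) A.
Proof. by move=> evN; rewrite /gibbs hamiltonianE. Qed.

Lemma intermediate_weight (b kappa : R) (q : site N) :
  weight b (fun s : {ffun site N -> 'I_n.+1} => intermediate kappa (s q)) =
  torus_weight b (fun (a : 'I_n.+1) _ => intermediate kappa a) None [set q]%SET.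
Proof.
apply: eq_bigl => s; apply/idP/forallP => [h q'|/(_ q)]; last by rewrite in_set1 eqxx.
by apply/implyP; rewrite in_set1 => /eqP ->.
Qed.

End SquaredSpins.

Theorem theorem2p5 (R : realType) (J : R) (hJ : 0 < J) :
  forall delta : R, 0 < delta ->
  exists c : R, 0 < c /\
  exists beta0 : R,
  forall beta : R, beta0 <= beta ->
  forall n : nat, (0 < n)%N -> c * beta ^+ 2 <= spinS R n ->
  exists N0 : nat, forall N : nat, (N0 <= N)%N -> ~~ odd N ->
  forall r r' : site N,
    [/\ 1 / 2 - delta <= spinS R n ^- 4 *
          gibbs J J beta (opmul (Sx2 R n r) (Sx2 R n r')),
        1 / 2 - delta <= spinS R n ^- 4 *
          gibbs J J beta (opmul (Sz2 R n r) (Sz2 R n r')),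
        spinS R n ^- 4 * gibbs J J beta (opmul (Sy2 R n r) (Sy2 R n r')) < delta
      & spinS R n ^- 4 * `| gibbs J J beta (opmul (Sx2 R n r) (Sz2 R n r')) | < delta].
Proof.
move=> delta d0; pose d' := delta / 16; have d'0 : 0 < d' by rewrite divr_gt0.
(* The disagreement error [2 kappa + 2 eta ^ 8 + 128 eta] is to be at most [3 d'], below
   [delta / 4]; the caps are the conditions of the Peierls argument. *)
pose kappa := Num.min 16^-1 (d' / 2).
pose eta := Num.min 32^-1 (d' / 128).
(* In [correlation_bounds], [delta ^ 2 / 32] serves the yz correlation, bounded only through its
   square; [delta / 8] serves the others. *)
pose d := Num.min (delta / 8) (delta ^+ 2 / 32).
have k0 : 0 < kappa by rewrite lt_min invr_gt0 divr_gt0 ?andbT.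
have k16 : kappa <= 16^-1 by rewrite ge_min lexx.
have k2 : kappa <= d' / 2 by rewrite ge_min lexx orbT.
have eta0 : 0 < eta by rewrite lt_min invr_gt0 divr_gt0 ?andbT.
have eta32 : eta <= 32^-1 by rewrite ge_min lexx.
have etad : eta <= d' / 128 by rewrite ge_min lexx orbT.
have eta1 : eta <= 1 by lra.
have dd0 : 0 < d by rewrite lt_min !divr_gt0 ?exprn_gt0.
have dd1 : d <= delta / 8 by rewrite ge_min lexx.
have dd2 : d <= delta ^+ 2 / 32 by rewrite ge_min lexx orbT.
have eps1 : eta ^+ 8 <= 1 by rewrite exprn_ile1 // ltW.
have [b1 b1_100 rare] := rare_defects k0 k16 (exprn_gt0 8 eta0) eps1.
have [B hB] := mean_Y2_small dd0.
have e8 : eta ^+ 8 <= eta by rewrite exprS ler_piMr ?(ltW eta0) // exprn_ile1 // ltW.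
have c0 : 0 < 10000 :> R by rewrite ltr0n.
move: c0 rare; move: (10000 : R) => c c0 rare.
(* With [b = beta * J] the first term yields [10000 b ^ 2 <= S], the second [b ^ 2 <= S] and so
   [b <= S]. *)
exists (c * J ^+ 2 + J ^+ 2); split; first by rewrite addr_gt0 ?mulr_gt0 ?exprn_gt0.
(* [4 / delta <= b] makes the Casimir excess [1 / S] at most [delta / 4]. *)
pose b2 := Num.max b1 (Num.max B (4 / delta)).
exists (b2 / J) => beta hbeta n n0 hS; exists 16%N => N N16 evN r r'.
pose b := beta * J.
have bb2 : b2 <= b by rewrite -ler_pdivrMr.
have bb1 : b1 <= b by apply: le_trans bb2; rewrite le_max lexx.
have bB : B <= b by apply: le_trans bb2; rewrite !le_max lexx orbT.
have bd : 4 / delta <= b by apply: le_trans bb2; rewrite !le_max lexx !orbT.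
have b100 : 100 <= b by exact: le_trans bb1.
have b0 : 0 < b by lra.
have s0 := S_gt0 (R := R) n0.
have hS' : c * b ^+ 2 + b ^+ 2 <= spinS R n.
  by apply: le_trans hS; rewrite le_eqVlt; apply/orP; left; apply/eqP; rewrite /b; ring.
have cS : c * b ^+ 2 <= spinS R n by apply: le_trans hS'; rewrite lerDl sqr_ge0.
have bS : b <= spinS R n.
  apply: le_trans (_ : b ^+ 2 <= _); first by rewrite expr2 ler_peMr ?(ltW b0) //; lra.
  by apply: le_trans hS'; rewrite lerDr mulr_ge0 ?(ltW c0) // sqr_ge0.
have [ri rs low] := rare b n N bb1 n0 cS evN N16.
have eta32' : 32 * eta <= 1 by lra.
have dis := disagree_weight evN (ltW b0) k16 eta0 eta32' ri rs.
have inter q : weight b (fun s : {ffun site N -> 'I_n.+1} => intermediate kappa (s q)) <=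
    eta ^+ 8 * optr (opexp (energy (n := n) (N := N) b)).
  by have := ri [set q]%SET; rewrite cards1 expr1 -intermediate_weight.
have hy := hB b n N r bB b100 evN n0 bS low.
set S := spinS R n in s0 hS' cS bS hy *.
have i0 : 0 <= S^-1 by rewrite invr_ge0 ltW.
have ib : S^-1 <= b^-1 by rewrite lef_pV2 ?posrE.
have id4 : S^-1 <= delta / 4.
  by apply: le_trans ib _; rewrite -[leRHS]invrK invf_div lef_pV2 ?posrE ?divr_gt0.
have i1 : S^-1 <= 1 by rewrite invf_le1 //; lra.
have e4 : 2 * kappa + 2 * eta ^+ 8 + 128 * eta <= delta / 4.
  have : 128 * eta <= d' by rewrite mulrC -ler_pdivlMr.
  move: k2 e8 etad; rewrite /d'; move: (eta ^+ 8) => z; lra.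
have S0 : S != 0 by rewrite gt_eqF.
have main (q q' : site N) : [/\ 1 / 2 - delta <= S ^- 4 * mean b (opmul (atpoint (@Z2 R n) q) (atpoint (@Z2 R n) q')),
    S ^- 4 * mean b (opmul (atpoint (@Y2 R n) q) (atpoint (@Y2 R n) q')) < delta &
    S ^- 4 * `|mean b (opmul (atpoint (@X2 R n) q) (atpoint (@Z2 R n) q'))| < delta].
  have cas := mean_casimir n b r evN; have y0 := mean_Y2_ge0 n b r evN.
  have z0 := mean_Z2_ge0 b evN n0 r; have z1 := mean_Z2_le b evN n0 r.
  have zz1 := mean_Z2Z2_le b r evN n0 q q'.
  have zz2 := mean_Z2Z2_ge r evN n0 k0 k16 inter (dis q q').
  have yy := mean_Y2Y2_le b r evN n0 q q'; have yz := mean_Y2Z2_sq_le b r evN n0 q q'.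
  rewrite (mean_X2Z2E n b r evN q q').
  move: hy cas y0 z0 z1 zz1 zz2 yy yz; rewrite -/S.
  move: (mean b (opmul (atpoint (@Z2 R n) q) (atpoint (@Z2 R n) q'))) => w.
  move: (mean b (opmul (atpoint (@Y2 R n) q) (atpoint (@Y2 R n) q'))) => v.
  move: (mean b (opmul (atpoint (@Y2 R n) q) (atpoint (@Z2 R n) q'))) => g.
  move: (mean b (atpoint (@Z2 R n) r)) (mean b (atpoint (@Y2 R n) r)) => p y.
  move=> hy cas y0 z0 z1 zz1 zz2 yy yz.
  have S4 : 0 < S ^+ 4 by exact: exprn_gt0.
  have S2 : 0 < S ^+ 2 by exact: exprn_gt0.
  rewrite -[X in X * `|_|]gtr0_norm ?invr_gt0 // -normrM.
  have -> : S ^- 4 * (S * (S + 1) * p - g - w) = (1 + S^-1) * (p / S ^+ 2) - S ^- 4 * g - S ^- 4 * w by field.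
  have hd : y / S ^+ 2 <= d by rewrite ler_pdivrMr.
  apply: (@correlation_bounds R delta (p / S ^+ 2) (y / S ^+ 2) S^-1 (2 * kappa + 2 * eta ^+ 8 + 128 * eta)) => //.
  - by rewrite divr_ge0 // ltW.
  - exact: le_trans hd dd1.
  - exact: le_trans hd dd2.
  - by rewrite mulrA -mulrDl cas; field.
  - by rewrite divr_ge0 // ltW.
  - by rewrite ler_pdivrMr // mul1r.
  - rewrite [leRHS]mulrC ler_pdivlMr //; apply: le_trans zz2; rewrite le_eqVlt; apply/orP; left; apply/eqP.
    by move: (_ + 128 * eta) => u; field.
  - rewrite mulrC ler_pdivrMr //; apply: le_trans zz1 _; rewrite le_eqVlt; apply/orP; left; apply/eqP; field.
    by [].
  - rewrite mulrC ler_pdivrMr //; apply: le_trans yy _; rewrite le_eqVlt; apply/orP; left; apply/eqP; field.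
    by [].
  - rewrite mulrC expr_div_n ler_pdivrMr ?exprn_gt0 //; apply: le_trans yz _; rewrite le_eqVlt; apply/orP; left; apply/eqP; field.
    by [].
(* The xx correlation at [r], [r'] is the zz correlation at the translated sites, hence the second
   use of [main]. *)
have [zz yy xz] := main r r'; have [zz' _ _] := main (shift r) (shift r').
rewrite !gibbsE // -/b !Sx2E !Sz2E !Sy2E (mean_X2X2 n b evN r r').
exact: And4 zz' zz yy xz.
Qed.
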